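(* (1) The cardinality of the set of conjugacy classes of Cartan subalgebras of $\mathfrak{gl}_\infty$ or $\mathfrak{sl}_\infty$ with given standard invariants is $0$, $1$, $2$, or continuum. One conjugacy class occurs precisely for standard invariants $(0,0,0,0,0)$. Two conjugacy classes occur precisely for standard invariants $(0,0,0,1,0)$, $(0,0,0,0,1)$, $(0,1,0,0,1)$, and $(0,0,1,1,0)$. (2) The cardinality of the set of conjugacy classes of Cartan subalgebras of $\mathfrak{so}_\infty$ with given standard invariants is $0$, $1$, or continuum. One conjugacy class occurs precisely for standard invariants $(0,0,0)$ and $(1,1,0)$. (3) The cardinality of the set of conjugacy classes of Cartan subalgebras of $\mathfrak{sp}_\infty$ with given standard invariants is $0$, $1$, or continuum. One conjugacy class occurs precisely for standard invariants $(0,0,0)$.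
   Context: Everything is over $\mathbb{C}$. $V,V_*$ are countably infinite-dimensional with a nondegenerate pairing $\langle\cdot,\cdot\rangle:V\times V_*\to\mathbb{C}$. $\mathfrak{gl}_\infty=\mathfrak{gl}(V,V_* )$ is the Lie algebra of the associative algebra $V\otimes V_*$, $(v\otimes w)(v'\otimes w')=\langle v',w\rangle v\otimes w'$; $\mathfrak{sl}_\infty=\mathfrak{sl}(V,V_* )$ is its derived algebra. For a nondegenerate symmetric (resp. antisymmetric) form on $V=V_*$, $\mathfrak{so}_\infty=\mathfrak{so}(V)=\bigwedge^2V$ (resp. $\mathfrak{sp}_\infty=\mathfrak{sp}(V)=\mathrm{Sym}^2(V)$) in $V\otimes V$ with the commutator bracket. Write $a\wedge b=a\otimes b-b\otimes a$, $a\,\&\,b=a\otimes b+b\otimes a$. Conjugacy is under the group $G$, where $G=\mathrm{GL}(V,V_* )$ (the subgroup of $\mathrm{GL}(V)$ preserving $V_*\subseteq V^*$) for $\mathfrak{gl}_\infty$ and $\mathfrak{sl}_\infty$, and $G$ is the subgroup of $\mathrm{GL}(V,V)$ preserving the form for $\mathfrak{so}_\infty$ and $\mathfrak{sp}_\infty$. These Lie algebras are unions of nested finite-dimensional reductive subalgebras $\mathfrak{g}_i$ with $\mathfrak{g}_i$ reductive in $\mathfrak{g}_{i+1}$, from which Jordan decompositions $x=x_{ss}+x_{nil}$ are inherited. For a subalgebra $\mathfrak{h}$, $\mathfrak{h}_{ss}=\{h_{ss}:h\in\mathfrak{h}\}$; $\mathfrak{h}$ is a Cartan subalgebra if it is locally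 nilpotent (every finite subset lies in a nilpotent subalgebra) and equals the centralizer of $\mathfrak{h}_{ss}$; then $\mathfrak{h}_{ss}$ is a maximal toral subalgebra (toral: all elements semisimple). A dual system for $\mathfrak{gl}_\infty$ or $\mathfrak{sl}_\infty$ is a set of lines $L_i\subseteq V$, $L^i\subseteq V_*$ ($i\in\mathbb{Z}_{>0}$) with $\langle L_i,L^j\rangle=\delta_{ij}\mathbb{C}$; a self-dual system for $\mathfrak{so}_\infty$ or $\mathfrak{sp}_\infty$ is a set of lines $L_i\subseteq V$ ($i\in\mathbb{Z}_{\ne0}$) with $\langle L_i,L_j\rangle=\delta_{i,-j}\mathbb{C}$. For every Cartan subalgebra $\mathfrak{h}$ there is a unique (maximal) such system, up to re-indexing, with $\mathfrak{h}_{ss}=\bigoplus_iL_i\otimes L^i$ ($\mathfrak{gl}_\infty$), $\mathfrak{sl}_\infty\cap\bigoplus_iL_i\otimes L^i$ ($\mathfrak{sl}_\infty$), $\bigoplus_{i>0}L_i\wedge L_{-i}$ ($\mathfrak{so}_\infty$), $\bigoplus_{i>0}L_i\,\&\,L_{-i}$ ($\mathfrak{sp}_\infty$). Standard invariants of $\mathfrak{h}$ (values in $\mathbb{Z}_{\ge0}\cup\{\aleph_0\}$): for $\mathfrak{gl}_\infty,\mathfrak{sl}_\infty$, with $S=\bigoplus_iL_i$, $T=\bigoplus_iL^i$, they are $(\operatorname{rank}\langle\cdot,\cdot\rangle|_{T^\perp\times S^\perp},\ \dim T^\perp,\ \dim S^\perp,\ \operatorname{codim}(T^\perp\oplus S),\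 \operatorname{codim}(S^\perp\oplus T))$, where $T^\perp\subseteq V$, $S^\perp\subseteq V_*$ and the codimensions are in $V$ and $V_*$ respectively; for $\mathfrak{so}_\infty,\mathfrak{sp}_\infty$, with $S=\bigoplus_iL_i$, they are $(\operatorname{rank}\langle\cdot,\cdot\rangle|_{S^\perp\times S^\perp},\ \dim S^\perp,\ \operatorname{codim}(S^\perp\oplus S))$, the codimension being in $V$. *)

(* Defs.v *)
From HB Require Import structures.
From mathcomp Require Import all_boot all_order all_algebra.
From mathcomp Require Import boolp classical_sets functions cardinality reals.
From mathcomp Require Import complex.
Set Implicit Arguments.
Unset Strict Implicit.
Unset Printing Implicit Defensive.
Import GRing.Theory.
Local Open Scope classical_set_scope.
Local Open Scope ring_scope.

(* Dimensions of spaces of countable dimension. *)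
Inductive dimension := Fin of nat | Aleph0.

Definition below (d : dimension) (i : nat) : bool :=
  if d is Fin n then (i < n)%N else true.

Section Subspaces.
Variables (K : fieldType) (V : lmodType K).
Implicit Types (A B S U : set V) (d : dimension).

Definition is_subspace U :=
  U 0 /\ forall (a : K) u v, U u -> U v -> U (a *: u + v).

Definition lspan S : set V := smallest is_subspace S.

Definition sum_space A B : set V := [set a + b | a in A & b in B].

Definition line U := exists2 v, v != 0 & U = [set a *: v | a in [set: K]].

(* dim_quot A B d: the quotient A / (A `&` B) has dimension d; the images of
   the e i with [below d i] form a basis of it. *)
Definition dim_quot A B d := exists e : nat -> V,
  [/\ forall i, below d i -> A (e i),
      forall v, A v -> exists (N : nat) (c : nat -> K),
        B (v - \sum_(i < N | below d i) c i *: e i)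
    & forall (N : nat) (c : nat -> K),
        B (\sum_(i < N | below d i) c i *: e i) ->
        forall i : nat, (i < N)%N -> below d i -> c i = 0].

Definition has_dim A d := dim_quot A [set 0] d.
Definition has_codim B d := dim_quot [set: V] B d.

End Subspaces.

Section LieAlgebra.
Variables (K : fieldType) (L : lmodType K) (br : L -> L -> L).
Implicit Types (g h k U : set L) (x s n : L).

Definition subalgebra h :=
  is_subspace h /\ forall x y, h x -> h y -> h (br x y).

Definition derived h : set L := lspan [set br x y | x in h & y in h].

Fixpoint lower_central h (m : nat) : set L :=
  if m is m'.+1 then lspan [set br x y | x in h & y in lower_central h m']
  else h.

Definition nilpotent_alg h := exists m, lower_central h m = [set 0].

Definition locally_nilpotent h := forall F : set L,
  finite_set F -> F `<=` h ->
  exists m : set L,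
    [/\ subalgebra m, nilpotent_alg m, F `<=` m & m `<=` h].

Definition ad_stable k U := forall x u, k x -> U u -> U (br x u).

(* The adjoint action of k on g is completely reducible.  [reductive_in k k]
   says that k is reductive. *)
Definition reductive_in k g := forall U,
  is_subspace U -> U `<=` g -> ad_stable k U ->
  exists U', [/\ is_subspace U', ad_stable k U', U `&` U' = [set 0]
                & sum_space U U' = g].

(* ad s is diagonalizable on k *)
Definition ad_semisimple k s :=
  k `<=` lspan [set y | k y /\ exists c : K, br s y = c *: y].

Definition ad_nilpotent k n :=
  exists m, forall y, k y -> iter m (br n) y = 0.

(* Jordan decomposition in a finite-dimensional reductive Lie algebra k, with
   central elements being semisimple: hence the condition that the nilpotent
   part lies in [k, k]. *)
Definition reductive_jordan k x s n :=
  [/\ k s, derived k n, x = s + n, br s n = 0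
    & ad_semisimple k s /\ ad_nilpotent k n].

Definition reductive_exhaustion g (k : nat -> set L) :=
  (forall i, [/\ subalgebra (k i), exists d : nat, has_dim (k i) (Fin d),
                reductive_in (k i) (k i), k i `<=` k i.+1
              & reductive_in (k i) (k i.+1)])
  /\ \bigcup_i k i = g.

Definition jordan g x s n := exists (k : nat -> set L) (i : nat),
  [/\ reductive_exhaustion g k, k i x & reductive_jordan (k i) x s n].

Definition ss_parts g h : set L :=
  [set s | exists x n, h x /\ jordan g x s n].

Definition centralizer g U : set L :=
  [set y | g y /\ forall z, U z -> br z y = 0].

Definition is_cartan g h :=
  [/\ subalgebra h, h `<=` g, locally_nilpotent h
    & h = centralizer g (ss_parts g h)].

End LieAlgebra.

Definition nondegenerate_pairing (K : fieldType) (V W : lmodType K)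
    (pair : V -> W -> K) :=
  (forall v, (forall w, pair v w = 0) -> v = 0) /\
  (forall w, (forall v, pair v w = 0) -> w = 0).

(* The associative algebra V (x) W attached to a pairing of V and W.  The
   underlying space is given with the universal property of the tensor
   product. *)
Record tensor_alg (K : fieldType) (V W : lmodType K) (pair : V -> W -> K) :=
  TensorAlg {
    tspace :> lmodType K;
    tens : {bilinear V -> W -> tspace};
    tens_lift : forall (U : lmodType K) (f : {bilinear V -> W -> U}),
      exists F : {linear tspace -> U}, forall v w, F (tens v w) = f v w;
    tens_ext : forall (U : lmodType K) (F F' : {linear tspace -> U}),
      (forall v w, F (tens v w) = F' (tens v w)) -> F =1 F';
    tmul : {bilinear tspace -> tspace -> tspace};
    tmulE : forall v w v' w',
      tmul (tens v w) (tens v' w') = pair v' w *: tens v w'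
  }.

Section DualPair.
Variables (K : fieldType) (V W : lmodType K).
Variable pair : {bilinear V -> W -> K | *%R & *%R}.
Variable A : tensor_alg pair.
Implicit Types (g h : set A).

Definition bracket (x y : A) : A := tmul A x y - tmul A y x.

Definition gl : set A := [set: A].
Definition sl : set A := derived bracket gl.

Definition perpV (T : set W) : set V :=
  [set v | forall w, T w -> pair v w = 0].
Definition perpW (S : set V) : set W :=
  [set w | forall v, S v -> pair v w = 0].

(* rank of the restriction of the pairing to P x Q, i.e. the dimension of P
   modulo its left kernel *)
Definition rank_on (P : set V) (Q : set W) (d : dimension) :=
  dim_quot P (perpV Q) d.

(* W seen inside the algebraic dual of V *)
Definition restricted_dual : set (V -> K) :=
  [set phi | exists w, phi = (fun v => pair v w)].

Definition GL : set {linear V -> V} :=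
  [set f : {linear V -> V} | bijective f /\
    [set (fun v => phi (f v)) | phi in restricted_dual] = restricted_dual].

(* F is the action of f on V (x) W; f' is the contragredient of f *)
Definition induced (f : {linear V -> V}) (F : {linear A -> A}) :=
  exists f' : W -> W,
    (forall v w, pair (f v) (f' w) = pair v w) /\
    (forall v w, F (tens A v w) = tens A (f v) (f' w)).

Definition conjugate_under (G : set {linear V -> V}) h h' :=
  exists (f : {linear V -> V}) (F : {linear A -> A}),
    [/\ G f, induced f F & h' = F @` h].

Definition conj_class (G : set {linear V -> V}) h : set (set A) :=
  [set h' | conjugate_under G h h'].

Definition dual_system (L : nat -> set V) (L' : nat -> set W) :=
  [/\ forall i, line (L i), forall i, line (L' i)
    & forall i j, [set pair v w | v in L i & w in L' j] =
                  if i == j then [set: K] else [set 0]].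

(* The dual system belongs to h; g is gl or sl. *)
Definition dual_system_of g h (L : nat -> set V) (L' : nat -> set W) :=
  dual_system L L' /\
  ss_parts bracket g h =
    g `&` lspan (\bigcup_i [set tens A v w | v in L i & w in L' i]).

Definition gl_invariants g h
    (p : dimension * dimension * dimension * dimension * dimension) :=
  let: (r, d1, d2, c1, c2) := p in
  exists (L : nat -> set V) (L' : nat -> set W),
    dual_system_of g h L L' /\
    let S := lspan (\bigcup_i L i) in
    let T := lspan (\bigcup_i L' i) in
    [/\ rank_on (perpV T) (perpW S) r,
        has_dim (perpV T) d1,
        has_dim (perpW S) d2,
        has_codim (sum_space (perpV T) S) c1
      & has_codim (sum_space (perpW S) T) c2].

Definition gl_classes g p : set (set (set A)) :=
  [set conj_class GL h | h in
    [set h | is_cartan bracket g h /\ gl_invariants g h p]].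

End DualPair.

Arguments bracket {K V W pair} A x y.
Arguments gl {K V W pair} A _.
Arguments sl {K V W pair} A _.

Section SelfDual.
Variables (K : fieldType) (V : lmodType K).
Variable form : {bilinear V -> V -> K | *%R & *%R}.
Variable A : tensor_alg form.
Implicit Types (g h : set A).

Definition wedge (a b : V) : A := tens A a b - tens A b a.
Definition symp (a b : V) : A := tens A a b + tens A b a.

Definition so : set A := lspan [set wedge a b | a in [set: V] & b in [set: V]].
Definition sp : set A := lspan [set symp a b | a in [set: V] & b in [set: V]].

Definition isometries : set {linear V -> V} :=
  [set f : {linear V -> V} | GL form f /\ forall u v, form (f u) (f v) = form u v].

(* L 0 is irrelevant *)
Definition self_dual_system (L : int -> set V) :=
  (forall i, i != 0 -> line (L i)) /\
  (forall i j, i != 0 -> j != 0 ->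
     [set form v w | v in L i & w in L j] =
     if i == - j then [set: K] else [set 0]).

(* op is wedge for so and symp for sp *)
Definition self_dual_system_of (op : V -> V -> A) g h (L : int -> set V) :=
  self_dual_system L /\
  ss_parts (bracket A) g h =
    lspan (\bigcup_(i in [set i : int | 0 < i])
            [set op a b | a in L i & b in L (- i)]).

Definition self_dual_invariants (op : V -> V -> A) g h
    (p : dimension * dimension * dimension) :=
  let: (r, d, c) := p in
  exists L : int -> set V,
    self_dual_system_of op g h L /\
    let S := lspan (\bigcup_(i in [set i : int | i != 0]) L i) in
    [/\ rank_on form (perpW form S) (perpW form S) r,
        has_dim (perpW form S) d
      & has_codim (sum_space (perpW form S) S) c].

Definition self_dual_classes (op : V -> V -> A) g p : set (set (set A)) :=
  [set conj_class isometries h | h in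
    [set h | is_cartan (bracket A) g h /\
             self_dual_invariants op g h p]].

Definition so_classes := self_dual_classes wedge so.
Definition sp_classes := self_dual_classes symp sp.

End SelfDual.

Arguments so {K V form} A _.
Arguments sp {K V form} A _.
Arguments so_classes {K V form} A p _.
Arguments sp_classes {K V form} A p _.

(* Main.v *)
Require Import Defs.
From HB Require Import structures.
From mathcomp Require Import all_boot all_order all_algebra.
From mathcomp Require Import boolp classical_sets functions cardinality reals.
From mathcomp Require Import complex zify ring lra.
Set Implicit Arguments.
Unset Strict Implicit.
Unset Printing Implicit Defensive.
Import Order.TTheory GRing.Theory Num.Theory.
Local Open Scope classical_set_scope.
Local Open Scope card_scope.
Local Open Scope ring_scope.

(* The semisimple parts of the elements of a Cartan subalgebra h of g act diagonalizably
   on V and W.  They form the intersection of g with the span of the [e_i (x) f_i], for a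
   dual family (e, f) spanning the given lines, and h is the centralizer of this torus.
   Conversely the centralizer of the torus of a dual family is a Cartan subalgebra with this toral part exactly when the pairing vanishes on
   [T^perp x S^perp] (for so, when its rank there is at most 1).  Conjugacy classes are
   therefore dual families up to automorphisms of the pairing, permutation and rescaling.

   A dual family is governed by the sequences [(<p_k, f_i>)_i], where the p_k span a
   complement of [T^perp + S], considered up to finite modifications.  All sequences that
   are independent modulo finite ones occur, because a nondegenerate pairing of spaces of
   countable dimension is unique up to isomorphism.  Without any sequence the family is
   unique.  A single sequence can be rescaled to take the values 0 and 1 only, and the
   sole invariant is whether it vanishes infinitely often: two classes.  Two sequences
   attach to each i a point of the projective line, and the cross ratio of four points
   occurring infinitely often is an invariant.  One sequence on each side gives the
   invariant values [<p, f_i> <e_i, q>]; for a form, the values [<p, e_i> <p, e_-i>] play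
   the same role, up to sign. *)

(** * Spans and bases *)

(** [jordan] lets the reductive exhaustion vary, so a decomposition x = s + n must be recognized
    independently of it. This is done on V: complete reducibility spreads the diagonalizability of
    [ad s] along the exhaustion to all of g and from there to V; n lies in a derived algebra, so its
    traces on stable subspaces vanish and n is nilpotent on V; and such a decomposition of an
    operator is unique. In the other direction only semisimple elements need an explicit exhaustion.
    The pairing must vanish on T^perp x S^perp because vectors x, y there with <x, y> = 1 would make
    x (x) y semisimple and centralizing the torus without lying in it. For so the corresponding
    element is the wedge of a hyperbolic pair, which a form of rank one does not contain. Given the
    vanishing, T^perp embeds in the dual of W / (S^perp + T): this is the origin of the conditions
    [dle d1 c2] and [dle d2 c1]. The parameter of the invariants runs over the interval ]0, 1/2[,
    where it is determined by an unordered cross ratio and by a pair of values 1, z up to scale. *)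

Definition lin (K : fieldType) (U V : lmodType K) (f : U -> V) :=
  forall a u v, f (a *: u + v) = a *: f u + f v.

Lemma lin_pack (K : fieldType) (U V : lmodType K) (f : U -> V) :
  lin f -> exists F : {linear U -> V}, F =1 f.
Proof.
move=> Hf.
pose L := GRing.isLinear.Build K U V *:%R f Hf.
pose F : {linear U -> V} := HB.pack f L.
by exists F.
Qed.

Section LinFun.
Variables (K : fieldType) (U V : lmodType K) (f : U -> V).
Hypothesis Hf : lin f.

Lemma lin0 : f 0 = 0.
Proof. by have [F HF] := lin_pack Hf; rewrite -HF linear0. Qed.
Lemma linD u v : f (u + v) = f u + f v.
Proof. by have [F HF] := lin_pack Hf; rewrite -!HF linearD. Qed.
Lemma linZ a u : f (a *: u) = a *: f u.
Proof. by have [F HF] := lin_pack Hf; rewrite -!HF linearZ. Qed.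
Lemma linN u : f (- u) = - f u.
Proof. by have [F HF] := lin_pack Hf; rewrite -!HF linearN. Qed.
Lemma linB u v : f (u - v) = f u - f v.
Proof. by rewrite linD linN. Qed.
Lemma lin_sum (I : Type) (r : seq I) (P : pred I) (E : I -> U) :
  f (\sum_(i <- r | P i) E i) = \sum_(i <- r | P i) f (E i).
Proof.
have [F HF] := lin_pack Hf; rewrite -HF linear_sum.
by apply: eq_bigr => i _; rewrite HF.
Qed.
End LinFun.

Lemma linear_lin (K : fieldType) (U V : lmodType K) (f : {linear U -> V}) : lin f.
Proof. by move=> a u v; rewrite linearP. Qed.

Section Span.
Variables (K : fieldType) (V : lmodType K).
Implicit Types (S U : set V).

Lemma lspan_subspace S : is_subspace (lspan S).
Proof.
split; first by move=> U [[]].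
move=> a u v Hu Hv U HU; case: (HU) => -[_ Uc] _.
by apply: Uc; [exact: Hu | exact: Hv].
Qed.

Lemma sub_lspan S : S `<=` lspan S.
Proof. by move=> v Sv U [_]; apply. Qed.

Lemma lspan_min S U : is_subspace U -> S `<=` U -> lspan S `<=` U.
Proof. by move=> HU SU v; apply. Qed.

Lemma lspan_mono S U : S `<=` U -> lspan S `<=` lspan U.
Proof.
move=> SU; apply: lspan_min; first exact: lspan_subspace.
by move=> v /SU; apply: sub_lspan.
Qed.

Section Closure.
Variable U : set V.
Hypothesis HU : is_subspace U.

Lemma subspace0 : U 0. Proof. by case: HU. Qed.
Lemma subspaceZ a u : U u -> U (a *: u).
Proof. by move=> Uu; rewrite -[_ *: _]addr0; apply HU.2 => //; apply HU.1. Qed.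
Lemma subspaceD u v : U u -> U v -> U (u + v).
Proof. by move=> Uu Uv; rewrite -[u]scale1r; apply HU.2. Qed.
Lemma subspaceN u : U u -> U (- u).
Proof. by rewrite -scaleN1r; exact: subspaceZ. Qed.
Lemma subspaceB u v : U u -> U v -> U (u - v).
Proof. by move=> Uu Uv; apply: subspaceD => //; apply: subspaceN. Qed.
Lemma subspace_sum (I : Type) (r : seq I) (P : pred I) (E : I -> V) :
  (forall i, P i -> U (E i)) -> U (\sum_(i <- r | P i) E i).
Proof. by move=> UE; elim/big_ind: _ => //; [exact: subspace0 | exact: subspaceD]. Qed.
Lemma subspaceZ_inv a u : a != 0 -> U (a *: u) -> U u.
Proof. by move=> a0 /(subspaceZ a^-1); rewrite scalerA mulVf// scale1r. Qed.
End Closure.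

Lemma set0_subspace : is_subspace [set (0 : V)].
Proof. by split=> // a u v -> ->; rewrite scaler0 addr0. Qed.

Lemma setI_subspace S U : is_subspace S -> is_subspace U -> is_subspace (S `&` U).
Proof.
move=> HS HU; split; first by split; apply: subspace0.
by move=> a u v [Su Uu] [Sv Uv]; split; [apply HS.2 | apply HU.2].
Qed.

Lemma sum_space_subspace S U :
  is_subspace S -> is_subspace U -> is_subspace (sum_space S U).
Proof.
move=> HS HU; split.
  by exists 0; [exact: subspace0 | exists 0; [exact: subspace0 | rewrite addr0]].
move=> a _ _ [u Su [v Uv <-]] [u' Su' [v' Uv' <-]].
exists (a *: u + u'); first by apply HS.2.
exists (a *: v + v'); first by apply HU.2.
by rewrite scalerDr addrACA.
Qed.

End Span.

Lemma lspan_lin (K : fieldType) (V W : lmodType K) (f : V -> W) S (U : set W) :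
  lin f -> is_subspace U -> (forall v, S v -> U (f v)) -> forall v, lspan S v -> U (f v).
Proof.
move=> Hf HU SU; apply: (@lspan_min _ _ S (fun v => U (f v))) => //; split.
  by rewrite (lin0 Hf); exact: (subspace0 HU).
by move=> a u v Uu Uv; rewrite Hf; apply HU.2.
Qed.


Lemma sum_widen (I : eqType) (M : nmodType) (s t : seq I) (F : I -> M) :
  uniq s -> uniq t -> {subset s <= t} -> (forall i, i \in t -> i \notin s -> F i = 0) ->
  \sum_(i <- s) F i = \sum_(i <- t) F i.
Proof.
move=> us ut st F0; rewrite [RHS](bigID (mem s))/= [X in _ + X]big1_seq ?addr0; last first.
  by move=> i /andP[ins it]; apply: F0.
rewrite -[RHS]big_filter; apply: perm_big; apply: uniq_perm => //.
  exact: filter_uniq.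
by move=> i; rewrite mem_filter; apply/idP/andP => [Hi|[]//]; split=> //; apply: st.
Qed.

Section Families.
Variables (K : fieldType) (V : lmodType K) (I : eqType).
Implicit Types (D : pred I) (a : I -> V) (s : seq I) (c : I -> K).

Definition span_on D a : set V := lspan [set a i | i in [set i | D i]].

(** The coefficients form a total function vanishing off the support [s], so that two
    representations of a vector can be compared pointwise even when their supports differ. *)
Definition rep D a s c v :=
  [/\ uniq s, {subset s <= D}, forall i, i \notin s -> c i = 0
    & v = \sum_(i <- s) c i *: a i].

Definition free_on D a := forall s c, uniq s -> {subset s <= D} ->
  \sum_(i <- s) c i *: a i = 0 -> forall i, i \in s -> c i = 0.

Definition basis_on D a := free_on D a /\ forall v, span_on D a v.

Lemma span_on_subspace D a : is_subspace (span_on D a).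
Proof. exact: lspan_subspace. Qed.

Lemma span_on_in D a i : D i -> span_on D a (a i).
Proof. by move=> Di; apply: sub_lspan; exists i. Qed.

Lemma span_on_sum D a s c : {subset s <= D} -> span_on D a (\sum_(i <- s) c i *: a i).
Proof.
move=> sD; rewrite big_seq; apply: (subspace_sum (span_on_subspace D a)).
move=> i /sD Di; apply: (subspaceZ (span_on_subspace D a)).
exact: span_on_in.
Qed.

Lemma rep_widen D a s c v t : rep D a s c v -> uniq t -> {subset s <= t} ->
  {subset t <= D} -> rep D a t c v.
Proof.
move=> [us sD c0 ->] ut st tD; split=> //.
  by move=> i it; apply: c0; apply: contra it; apply: st.
apply: sum_widen => // i _ /c0 ->; exact: scale0r.
Qed.

Lemma rep_comb D a s c v s' c' v' (k : K) :
  rep D a s c v -> rep D a s' c' v' ->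
  rep D a (undup (s ++ s')) (fun i => k * c i + c' i) (k *: v + v').
Proof.
move=> H H'; set t := undup _.
have ut : uniq t by exact: undup_uniq.
have tD : {subset t <= D}.
  case: H H' => _ sD _ _ [_ sD' _ _] i; rewrite mem_undup mem_cat.
  by case/orP; [exact: sD | exact: sD'].
have {}H : rep D a t c v.
  by apply: (rep_widen H) => // i; rewrite mem_undup mem_cat => ->.
have {}H' : rep D a t c' v'.
  by apply: (rep_widen H') => // i; rewrite mem_undup mem_cat => ->; rewrite orbT.
case: H H' => _ _ c0 -> [_ _ c0' ->]; split=> //.
  by move=> i it; rewrite c0// c0'// mulr0 addr0.
rewrite scaler_sumr -big_split/=; apply: eq_bigr => i _.
by rewrite scalerDl scalerA.
Qed.

Lemma span_rep D a v : span_on D a v -> exists s c, rep D a s c v.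
Proof.
move: v; apply: lspan_min; first split.
- by exists [::], (fun=> 0); split=> //; rewrite big_nil.
- move=> k u v [s [c H]] [s' [c' H']].
  by eexists; eexists; exact: rep_comb H H'.
- move=> _ [i Di <-]; exists [:: i], (fun j => (j == i)%:R); split=> //.
  + by move=> j; rewrite inE => /eqP ->.
  + by move=> j; rewrite inE => /negbTE ->.
  + by rewrite big_seq1 eqxx scale1r.
Qed.

Lemma rep_uniq D a s c s' c' v : free_on D a -> rep D a s c v -> rep D a s' c' v -> c =1 c'.
Proof.
move=> Hf H H' i.
have := rep_comb (-1) H H'; rewrite scaleN1r addNr => -[ut tD c0 E].
case: (boolP (i \in undup (s ++ s'))) => [it|/c0/eqP].
  have /eqP := Hf _ _ ut tD (esym E) i it.
  by rewrite mulN1r addrC subr_eq0 => /eqP.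
by rewrite mulN1r addrC subr_eq0 => /eqP.
Qed.

Lemma free_coord D a : free_on D a ->
  exists (cf : I -> V -> K) (sp : V -> seq I),
    [/\ forall i k u v, span_on D a u -> span_on D a v -> cf i (k *: u + v) = k * cf i u + cf i v,
        forall v, span_on D a v -> rep D a (sp v) (cf^~ v) v
      & forall i j, D j -> cf i (a j) = (i == j)%:R].
Proof.
move=> Hf.
have /choice[g Hg] : forall v, exists p : seq I * (I -> K),
    span_on D a v -> rep D a p.1 p.2 v.
  move=> v; have [/span_rep[s [c H]]|n] := pselect (span_on D a v).
    by exists (s, c).
  (* A default outside the span; linearity of the coordinates is claimed on the span only. *)
  by exists ([::], fun=> 0).
exists (fun i v => (g v).2 i), (fun v => (g v).1); split.
- move=> i k u v Hu Hv.
  have Huv : span_on D a (k *: u + v) by apply (lspan_subspace _).2.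
  exact: (rep_uniq Hf (Hg _ Huv) (rep_comb k (Hg _ Hu) (Hg _ Hv))).
- by move=> v /Hg.
- move=> i j Dj; have H := Hg _ (@span_on_in D a _ Dj).
  have H' : rep D a [:: j] (fun i => (i == j)%:R) (a j).
    split=> //.
    + by move=> k; rewrite inE => /eqP ->.
    + by move=> k; rewrite inE => /negbTE ->.
    + by rewrite big_seq1 eqxx scale1r.
  exact: (rep_uniq Hf H H').
Qed.

Lemma basis_coord D a : basis_on D a ->
  exists (cf : I -> V -> K) (sp : V -> seq I),
    [/\ forall i k u v, cf i (k *: u + v) = k * cf i u + cf i v,
        forall v, rep D a (sp v) (cf^~ v) v
      & forall i j, D j -> cf i (a j) = (i == j)%:R].
Proof.
move=> [Hf Hs]; have [cf [sp [H1 H2 H3]]] := free_coord Hf.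
by exists cf, sp; split=> // *; [apply: H1 | apply: H2].
Qed.

Lemma basis_ext D a (U : lmodType K) (g : I -> U) : basis_on D a ->
  exists F : {linear V -> U}, forall i, D i -> F (a i) = g i.
Proof.
move=> /basis_coord[cf [sp [H1 H2 H3]]].
pose f v := \sum_(i <- sp v) cf i v *: g i.
have fE v t : uniq t -> {subset sp v <= t} -> f v = \sum_(i <- t) cf i v *: g i.
  move=> ut st; apply: sum_widen => //; first by case: (H2 v).
  by move=> i _; case: (H2 v) => _ _ /(_ i) c0 _ /c0 ->; rewrite scale0r.
have Hf : lin f.
  move=> k u v; pose t := undup (sp (k *: u + v) ++ sp u ++ sp v).
  have ut : uniq t by exact: undup_uniq.
  rewrite !(fE _ t)//; last first.
  - by move=> i Hi; rewrite mem_undup !mem_cat Hi.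
  - by move=> i Hi; rewrite mem_undup !mem_cat Hi orbT.
  - by move=> i Hi; rewrite mem_undup !mem_cat Hi !orbT.
  rewrite scaler_sumr -big_split; apply: eq_bigr => i _.
  by rewrite H1 scalerDl scalerA.
have [F HF] := lin_pack Hf; exists F => j Dj; rewrite HF.
pose t := undup (j :: sp (a j)).
have jt : j \in t by rewrite mem_undup inE eqxx.
rewrite (fE _ t) ?undup_uniq//; last by move=> i Hi; rewrite mem_undup inE Hi orbT.
rewrite (bigD1_seq j)//= ?undup_uniq// H3// eqxx scale1r big1 ?addr0// => i /negbTE ij.
by rewrite H3// ij scale0r.
Qed.


End Families.

(** * Finite-dimensional spaces and eigenvectors *)

Notation upto n := (below (Fin n)).

Section FiniteDim.
Variables (K : fieldType) (V : lmodType K).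
Implicit Types (U A B : set V) (e u : nat -> V).

(** Duplicate-free lists replace the sums over all indices below a bound, which is the shape in
    which [rep] and [free_on] deliver coefficients. *)
Lemma dim_quotP A B d : dim_quot A B d <-> exists e : nat -> V,
  [/\ forall i, below d i -> A (e i),
      forall v, A v -> exists (s : seq nat) (c : nat -> K),
        [/\ uniq s, {subset s <= below d} & B (v - \sum_(i <- s) c i *: e i)]
    & forall (s : seq nat) (c : nat -> K), uniq s -> {subset s <= below d} ->
        B (\sum_(i <- s) c i *: e i) -> forall i, i \in s -> c i = 0].
Proof.
have flt N (c : nat -> K) e : \sum_(i < N | below d i) c i *: e i =
    \sum_(i <- [seq i <- iota 0 N | below d i]) c i *: e i.
  by rewrite -(big_mkord (below d) (fun i => c i *: e i)) big_filter /index_iota subn0.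
split=> -[e [He Hs Hf]]; exists e; split=> //.
- move=> v /Hs[N [c Hc]]; exists [seq i <- iota 0 N | below d i], c; split.
  + by rewrite filter_uniq// iota_uniq.
  + by move=> i; rewrite mem_filter => /andP[].
  + by rewrite -flt.
- move=> s c us sd Hc i si.
  pose c' j := if j \in s then c j else 0.
  have sN j : j \in s -> (j < (\max_(j <- s) j).+1)%N.
    by move=> js; rewrite ltnS; exact: leq_bigmax_seq.
  have := Hf (\max_(j <- s) j).+1 c'; rewrite flt.
  rewrite -(@sum_widen _ _ s) => //; first last.
  + by move=> j _ /negbTE js; rewrite /c' js scale0r.
  + by move=> j js; rewrite mem_filter mem_iota add0n sN//= andbT; apply: sd.
  + by rewrite filter_uniq// iota_uniq.
  have -> : \sum_(j <- s) c' j *: e j = \sum_(j <- s) c j *: e j.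
    by apply: eq_big_seq => j js; rewrite /c' js.
  by move=> /(_ Hc i (sN _ si) (sd _ si)); rewrite /c' si.
- move=> v /Hs[s [c [us sd Hc]]].
  pose c' j := if j \in s then c j else 0.
  exists (\max_(j <- s) j).+1, c'.
  rewrite flt -(@sum_widen _ _ s) => //; first last.
  + by move=> j _ /negbTE js; rewrite /c' js scale0r.
  + move=> j js; rewrite mem_filter mem_iota add0n ltnS leq_bigmax_seq//= andbT.
    exact: sd.
  + by rewrite filter_uniq// iota_uniq.
  by rewrite (eq_big_seq (fun j => c j *: e j))// => j js; rewrite /c' js.
- move=> N c; rewrite flt => Hc i iN di; apply: (Hf _ c _ _ Hc).
  + by rewrite filter_uniq// iota_uniq.
  + by move=> j; rewrite mem_filter => /andP[].
  + by rewrite mem_filter di mem_iota.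
Qed.

Lemma span_upto n e v : span_on (upto n) e v ->
  exists c : nat -> K, v = \sum_(i < n) c i *: e i.
Proof.
move=> /span_rep[s [c H]]; exists c.
have : rep (upto n) e (iota 0 n) c v.
  apply: (rep_widen H); rewrite ?iota_uniq//.
    by case: H => _ sn _ _ i /sn; rewrite mem_iota.
  by move=> i; rewrite mem_iota.
by case=> _ _ _ ->; rewrite -(big_mkord predT (fun i => c i *: e i)) /index_iota subn0.
Qed.

Lemma free_upto n e : free_on (upto n) e <->
  forall c : nat -> K, \sum_(i < n) c i *: e i = 0 -> forall i, (i < n)%N -> c i = 0.
Proof.
have E (c : nat -> K) : \sum_(i < n) c i *: e i = \sum_(i <- iota 0 n) c i *: e i.
  by rewrite -(big_mkord predT (fun i => c i *: e i)) /index_iota subn0.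
split=> H.
  move=> c; rewrite E => /H; rewrite iota_uniq => Hc i ni.
  apply: Hc => //; last by rewrite mem_iota.
  by move=> j; rewrite mem_iota.
move=> s c us sn Hc i si.
pose c' j := if j \in s then c j else 0.
have := H c'; rewrite E.
rewrite -(@sum_widen _ _ s) ?iota_uniq//; first last.
+ by move=> j _ /negbTE js; rewrite /c' js scale0r.
+ by move=> j /sn; rewrite mem_iota.
rewrite (eq_big_seq (fun j => c j *: e j)); last by move=> j js; rewrite /c' js.
by move=> /(_ Hc i (sn _ si)); rewrite /c' si.
Qed.

(** A dependence among the [u i] is a vector in the left kernel of their coefficient matrix, and
    this kernel is nonzero as soon as there are more rows than columns. *)
Lemma free_le m n u e : free_on (upto m) u ->
  (forall i, (i < m)%N -> span_on (upto n) e (u i)) -> (m <= n)%N.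
Proof.
move=> /free_upto Hf Hu; rewrite leqNgt; apply/negP => nm.
have /choice[M HM] : forall i, exists c : nat -> K,
    (i < m)%N -> u i = \sum_(j < n) c j *: e j.
  move=> i; case: (boolP (i < m)%N) => [/Hu/span_upto[c Hc]|_]; first by exists c.
  by exists (fun=> 0).
pose A : 'M[K]_(m, n) := \matrix_(i, j) M i j.
have /rowV0Pn[v /sub_kermxP vA v0] : kermx A != 0.
  by rewrite -mxrank_eq0 mxrank_ker -lt0n subn_gt0 (leq_ltn_trans (rank_leq_col A)).
case/eqP: v0; apply/rowP => i; rewrite mxE.
pose c j := oapp (v 0) 0 (insub j).
have cE (j : 'I_m) : c j = v 0 j by rewrite /c valK.
rewrite -cE; apply: Hf => //.
rewrite (eq_bigr (fun j : 'I_m => \sum_(l < n) (v 0 j * A j l) *: e l)); last first.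
  move=> j _; rewrite cE HM// scaler_sumr; apply: eq_bigr => l _.
  by rewrite mxE scalerA.
rewrite exchange_big/= big1// => l _; rewrite -scaler_suml.
by have := congr1 (fun X : 'rV_n => X 0 l) vA; rewrite !mxE => ->; rewrite scale0r.
Qed.

Definition findim U := exists n e, U `<=` span_on (upto n) e.

Lemma has_dim_findim U n : has_dim U (Fin n) -> findim U.
Proof.
move=> /dim_quotP[e [He Hs _]]; exists n, e => v /Hs[s [c [us sn /eqP]]].
by rewrite subr_eq0 => /eqP ->; apply: span_on_sum.
Qed.

(** A free family of maximal length inside [U] works: [free_le] bounds the length by the size of the
    ambient spanning family, whose members may lie outside [U]. *)
Lemma findim_basis U : is_subspace U -> findim U ->
  exists n e, [/\ free_on (upto n) e, forall i, (i < n)%N -> U (e i)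
                & U `<=` span_on (upto n) e].
Proof.
move=> HU [n [e Ue]].
pose P m := `[< exists u, free_on (upto m) u /\ forall i, (i < m)%N -> U (u i) >].
have exP : exists m, P m.
  by exists 0%N; apply/asboolP; exists (fun=> 0); split=> // s c _ s0 _ i /s0.
have ubP m : P m -> (m <= n)%N.
  move=> /asboolP[u [Hf Hu]]; apply: (free_le Hf (e := e)) => i im.
  by apply: Ue; apply: Hu.
case: (ex_maxnP exP ubP) => m /asboolP[u [Hf Hu]] mmax.
exists m, u; split=> // v Uv.
apply: contrapT => nv.
pose u' i := if i == m then v else u i.
suff /mmax : P m.+1 by rewrite ltnn.
apply/asboolP; exists u'; split; last first.
  by move=> i; rewrite /u' ltnS leq_eqVlt; case: eqP => //= _ /Hu.
apply/free_upto => c; rewrite big_ord_recr/= /u' eqxx => E.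
have E' : \sum_(i < m) c i *: u i + c m *: v = 0.
  rewrite -[RHS]E; congr (_ + _); apply: eq_bigr => i _.
  by rewrite ltn_eqF.
have cm : c m = 0.
  apply: contrapT => /eqP cm; apply: nv.
  have -> : v = (- (c m)^-1) *: \sum_(i < m) c i *: u i.
    move/eqP: E'; rewrite addr_eq0 => /eqP ->.
    by rewrite scalerN scaleNr opprK scalerA mulVf// scale1r.
  apply: (subspaceZ (span_on_subspace _ _)).
  rewrite -(big_mkord predT (fun i => c i *: u i)) /index_iota subn0.
  by apply: span_on_sum => i; rewrite mem_iota.
move: E'; rewrite cm scale0r addr0 => E'.
move=> i; rewrite ltnS leq_eqVlt => /orP[/eqP -> //|im].
exact: ((free_upto _ _).1 Hf c E').
Qed.

Lemma findim_has_dim U : is_subspace U -> findim U -> exists n, has_dim U (Fin n).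
Proof.
move=> HU /(findim_basis HU)[n [e [Hf Ue eU]]]; exists n; apply/dim_quotP.
exists e; split=> //.
by move=> v /eU /span_rep[s [c [us sn _ ->]]]; exists s, c; split=> //; rewrite subrr.
Qed.

Lemma findim_sub A B : A `<=` B -> findim B -> findim A.
Proof. by move=> AB [n [e H]]; exists n, e => v /AB; apply: H. Qed.

Lemma findim_seq (I : eqType) (a : I -> V) (s : seq I) :
  findim (span_on (mem s) a).
Proof.
pose e i := nth 0 (map a s) i.
exists (size s), e; apply: lspan_min; first exact: span_on_subspace.
move=> _ [i si <-].
have -> : a i = e (index i s) by rewrite /e (nth_map i) ?index_mem// nth_index.
by apply: span_on_in; rewrite /= index_mem.
Qed.

End FiniteDim.

Section Eigen.
Variables (K : numClosedFieldType) (V : lmodType K).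
Implicit Types (T S N : V -> V) (U : set V) (p : {poly K}) (u v y : V).

Definition stable T U := forall v, U v -> U (T v).

Definition eigen T : set V := [set y | exists c, T y = c *: y].

Definition diagonalizable T := forall v, lspan (eigen T) v.

Definition loc_nilpotent T := forall v, exists n, iter n T v = 0.

(** The vector p(T) u, kept as a plain sum because [V] is infinite-dimensional and [T] has no
    matrix. *)
Definition pev p T u := \sum_(i < size p) p`_i *: iter i T u.

Lemma iter_lin T n : lin T -> lin (fun v => iter n T v).
Proof. by move=> HT; elim: n => [|n IHn] a u v //=; rewrite IHn HT. Qed.

Lemma iter_eigen T n c y : lin T -> T y = c *: y -> iter n T y = c ^+ n *: y.
Proof.
move=> HT Hy; elim: n => [|n IHn] /=; first by rewrite expr0 scale1r.
by rewrite IHn linZ// Hy scalerA -exprSr.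
Qed.

Lemma pevE p T u n : (size p <= n)%N -> pev p T u = \sum_(i < n) p`_i *: iter i T u.
Proof.
move=> pn; rewrite /pev (big_ord_widen n (fun i => p`_i *: iter i T u))//.
rewrite [RHS](bigID (fun i : 'I_n => (i < size p)%N))/= [X in _ + X]big1 ?addr0//.
by move=> i; rewrite -leqNgt => /(nth_default 0) ->; rewrite scale0r.
Qed.

Lemma pev_lin p T : lin T -> lin (pev p T).
Proof.
move=> HT a u v; rewrite /pev scaler_sumr -big_split; apply: eq_bigr => i _ /=.
by rewrite (iter_lin i HT) scalerDr !scalerA mulrC.
Qed.

Lemma pev_eigen p T c y : lin T -> T y = c *: y -> pev p T y = p.[c] *: y.
Proof.
move=> HT Hy; rewrite /pev horner_coef scaler_suml; apply: eq_bigr => i _.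
by rewrite (iter_eigen i HT Hy) scalerA.
Qed.

Lemma pev_mulXsubC p T u z : lin T -> pev (p * ('X - z%:P)) T u = pev p T (T u - z *: u).
Proof.
move=> HT.
rewrite (@pevE _ _ _ (size p).+1); last first.
  have [->|p0] := eqVneq p 0; first by rewrite mul0r size_poly0.
  by rewrite size_Mmonic ?monicXsubC// size_XsubC addn2.
rewrite (linB (pev_lin p HT)) (linZ (pev_lin p HT)).
rewrite (@pevE p T u (size p).+1) // /pev big_ord_recl/= mulrBr.
rewrite coefB coefMX/= add0r coefMC.
rewrite [in RHS]big_ord_recl/=.
rewrite (eq_bigr (fun i : 'I_(size p) => p`_i *: iter i T (T u) - z *: (p`_(bump 0 i) *: iter (bump 0 i) T u))).
  rewrite sumrB -scaler_sumr scalerDr scalerA [z * _]mulrC scaleNr opprD.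
  by rewrite addrCA.
move=> i _; rewrite /bump/= add1n add0n coefB coefMX/= coefMC scalerBl -iterSr.
by rewrite scalerA mulrC.
Qed.

Lemma stable_iter T U n v : stable T U -> U v -> U (iter n T v).
Proof. by move=> HT Uv; elim: n => //= n; apply: HT. Qed.

Lemma stable_pev p T U v : is_subspace U -> stable T U -> U v -> U (pev p T v).
Proof.
move=> HU HT Uv; apply: (subspace_sum HU) => i _; apply: (subspaceZ HU).
exact: stable_iter.
Qed.

Definition pr T (rs : seq K) u := foldl (fun y z => T y - z *: y) u rs.

Lemma pev_pr T rs u : lin T -> pev (\prod_(z <- rs) ('X - z%:P)) T u = pr T rs u.
Proof.
move=> HT; elim: rs u => [|z rs IHrs] u.
  by rewrite big_nil /pev size_poly1 big_ord1 coef1 /= scale1r.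
by rewrite big_cons mulrC pev_mulXsubC// IHrs.
Qed.

(** The first n + 1 iterates of [u] are dependent in a space spanned by n vectors, and the resulting
    polynomial splits because [K] is algebraically closed. *)
Lemma findim_annihilated T U u : lin T -> is_subspace U -> stable T U -> findim U ->
  U u -> exists rs, pr T rs u = 0.
Proof.
move=> HT HU TU [n [e Ue]] Uu.
have : ~ free_on (upto n.+1) (fun i => iter i T u).
  move=> Hf; have := free_le Hf (e := e) (n := n); rewrite ltnn => H.
  suff : false by [].
  by apply: H => i _; apply: Ue; apply: stable_iter.
move=> /(contra_not (free_upto _ _).2).
move=> /existsNP[c /not_implyP[Hc /existsNP[i /not_implyP[ni /eqP ci]]]].
pose p := \poly_(i < n.+1) c i.
have pE : pev p T u = 0.
  rewrite (@pevE _ _ _ n.+1) ?size_poly//; rewrite -[RHS]Hc; apply: eq_bigr => j _.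
  by rewrite coef_poly ltn_ord.
have p0 : p != 0.
  by apply: contraNneq ci => p0; have := coef_poly n.+1 c i; rewrite ni -/p p0 coef0 => <-.
have [rs Ep] := closed_field_poly_normal p.
exists rs; rewrite -pev_pr//.
have lp : lead_coef p != 0 by rewrite lead_coef_eq0.
have : lead_coef p *: pev (\prod_(z <- rs) ('X - z%:P)) T u = 0.
  rewrite -[RHS]pE [in RHS]Ep (@pevE (_ *: _) _ _ (size (\prod_(z <- rs) ('X - z%:P)))) ?size_scale//.
  by rewrite /pev scaler_sumr; apply: eq_bigr => j _; rewrite coefZ scalerA.
by move=> /eqP; rewrite scaler_eq0 (negbTE lp)/= => /eqP.
Qed.

(** The last nonzero vector met while the factors are applied one by one is an eigenvector. *)
Lemma annihilated_eigen T U rs u : lin T -> is_subspace U -> stable T U ->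
  U u -> u != 0 -> pr T rs u = 0 -> exists y c, [/\ U y, y != 0 & T y = c *: y].
Proof.
move=> HT HU TU; elim: rs u => [|z rs IHrs] u Uu u0 /=; first by move/eqP; rewrite (negbTE u0).
have [/eqP|y0] := eqVneq (T u - z *: u) 0.
  by rewrite subr_eq0 => /eqP Tu _; exists u, z.
apply: IHrs => //; apply: (subspaceB HU); [exact: TU|exact: subspaceZ].
Qed.

Lemma findim_eigen T U u : lin T -> is_subspace U -> stable T U -> findim U ->
  U u -> u != 0 -> exists y c, [/\ U y, y != 0 & T y = c *: y].
Proof.
move=> HT HU TU fU Uu u0; have [rs] := findim_annihilated HT HU TU fU Uu.
exact: annihilated_eigen.
Qed.

(** Factors T - z with z nonzero are injective here and can be cancelled; only powers of [T]
    remain. *)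
Lemma annihilated_nilpotent T rs u : lin T ->
  (forall z y, z != 0 -> T y = z *: y -> y = 0) -> pr T rs u = 0 ->
  exists n, iter n T u = 0.
Proof.
move=> HT H0; elim: rs u => [|z rs IHrs] u /=; first by exists 0.
move=> /IHrs[n]; have [->|z0] := eqVneq z 0.
  by rewrite scale0r subr0 -iterSr; exists n.+1.
have -> : iter n T (T u - z *: u) = T (iter n T u) - z *: iter n T u.
  by rewrite (linB (iter_lin n HT)) (linZ (iter_lin n HT)) -iterSr.
by move=> /eqP; rewrite subr_eq0 => /eqP /H0 E; exists n; apply: E.
Qed.

Lemma eigen_decomp T v : lin T -> lspan (eigen T) v ->
  exists (rs : seq K) (y : K -> V), [/\ uniq rs, forall c, T (y c) = c *: y c,
    forall c, c \notin rs -> y c = 0 & v = \sum_(c <- rs) y c].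
Proof.
move=> HT; move: v; apply: lspan_min; first split.
- by exists [::], (fun=> 0); split=> // [c|]; rewrite ?big_nil// scaler0 lin0.
- move=> a u v [rs [y [us Ty y0 ->]]] [rs' [y' [us' Ty' y0' ->]]].
  exists (undup (rs ++ rs')), (fun c => a *: y c + y' c); split.
  + exact: undup_uniq.
  + by move=> c; rewrite HT Ty Ty' scalerDr !scalerA mulrC.
  + move=> c; rewrite mem_undup mem_cat negb_or => /andP[/y0 -> /y0' ->].
    by rewrite scaler0 addr0.
  + rewrite scaler_sumr big_split/=; congr (_ + _).
      apply: sum_widen => [||c Hc|c _ /y0 ->]; rewrite ?undup_uniq ?scaler0//.
      by rewrite mem_undup mem_cat Hc.
    apply: sum_widen => [||c Hc|c _ /y0' ->]; rewrite ?undup_uniq//.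
    by rewrite mem_undup mem_cat Hc orbT.
- move=> y [c Tc]; exists [:: c], (fun c' => if c' == c then y else 0); split=> //.
  + by move=> c'; case: eqP => [->//|_]; rewrite scaler0 lin0.
  + by move=> c'; rewrite inE => /negbTE ->.
  + by rewrite big_seq1 eqxx.
Qed.

(** The component of [v] for an eigenvalue c is, up to a nonzero scalar, the image of [v] under the
    product of the T - z over the other eigenvalues z, hence it stays in [U]. *)
Lemma eigen_stable T U v : lin T -> is_subspace U -> stable T U -> U v ->
  lspan (eigen T) v -> lspan (U `&` eigen T) v.
Proof.
move=> HT HU TU Uv /(eigen_decomp HT)[rs [y [us Ty y0 vE]]].
rewrite vE big_seq; apply: (subspace_sum (lspan_subspace _)) => c crs.
apply: sub_lspan; split; last by exists c.
pose p := \prod_(z <- rs | z != c) ('X - z%:P).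
have pc : p.[c] != 0.
  rewrite horner_prod prodf_seq_neq0; apply/allP => z _; apply/implyP => zc.
  by rewrite hornerXsubC subr_eq0 eq_sym.
have := stable_pev p HU TU Uv; rewrite [in pev _ _ _]vE.
rewrite (lin_sum (pev_lin p HT)).
rewrite (bigD1_seq c)//= [X in _ + X]big1_seq ?addr0.
  by rewrite (pev_eigen p HT (Ty c)); apply: subspaceZ_inv.
move=> z /andP[zc zrs]; rewrite (pev_eigen p HT (Ty z)) /p horner_prod.
by rewrite (big_rem z)//= zc hornerXsubC subrr mul0r scale0r.
Qed.

End Eigen.

(** * Uniqueness of the Jordan decomposition of an operator *)

Section JordanUniqueness.
Variables (K : numClosedFieldType) (V : lmodType K).
Implicit Types (T S N : V -> V).

Lemma lin_sub_scale T c : lin T -> lin (fun v => T v - c *: v).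
Proof.
move=> HT a u v; rewrite HT scalerBr [a *: u + v]addrC scalerDr opprD [- (c *: v) - _]addrC.
by rewrite addrACA !scalerA [c * a]mulrC.
Qed.

Definition gen_eigen T c : set V :=
  [set v | exists m, iter m (fun y => T y - c *: y) v = 0].

Lemma iter0_le T m n v : lin T -> (m <= n)%N -> iter m T v = 0 -> iter n T v = 0.
Proof.
move=> HT /subnK <- H; rewrite iterD H.
by elim: (n - m)%N => //= k ->; rewrite lin0.
Qed.

Lemma gen_eigen_subspace T c : lin T -> is_subspace (gen_eigen T c).
Proof.
move=> /(lin_sub_scale c) HT; split; first by exists 0%N.
move=> a u v [m Hm] [n Hn]; exists (maxn m n).
rewrite (iter_lin (maxn m n) HT) (iter0_le HT (leq_maxl _ _) Hm).
by rewrite (iter0_le HT (leq_maxr _ _) Hn) scaler0 addr0.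
Qed.

Lemma gen_eigen_stable T S c : lin T -> lin S -> (forall v, S (T v) = T (S v)) ->
  stable S (gen_eigen T c).
Proof.
move=> HT HS ST v [m Hm]; exists m.
have E n u : iter n (fun y => T y - c *: y) (S u) = S (iter n (fun y => T y - c *: y) u).
  by elim: n => //= n ->; rewrite (linB HS) (linZ HS) ST.
by rewrite E Hm lin0.
Qed.

(** By induction on the height, (T - c) v already vanishes; then [v] is an eigenvector on which T -
    d acts by the nonzero scalar c - d, and no power of that kills it. *)
Lemma gen_eigen_disjoint T c d v : lin T -> c != d ->
  gen_eigen T c v -> gen_eigen T d v -> v = 0.
Proof.
move=> HT cd [m]; elim: m v => [|m IHm] v //.
rewrite iterSr => Hm vd.
have E : T v - c *: v = 0.
  apply: IHm => //; apply: (subspaceB (gen_eigen_subspace d HT)).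
    exact: gen_eigen_stable vd.
  exact: (subspaceZ (gen_eigen_subspace d HT)).
case: vd => n.
have Tv : (fun y => T y - d *: y) v = (c - d) *: v.
  by move/eqP: E; rewrite subr_eq0 => /eqP ->; rewrite scalerBl.
rewrite (iter_eigen n (lin_sub_scale d HT) Tv) => /eqP.
by rewrite scaler_eq0 expf_eq0 subr_eq0 (negbTE cd) andbF/= => /eqP.
Qed.

Lemma eigen_gen_eigen S N c v : lin S -> lin N -> (forall v, S (N v) = N (S v)) ->
  loc_nilpotent N -> S v = c *: v -> gen_eigen (fun y => S y + N y) c v.
Proof.
move=> HS HN SN Nnil Sv; have [m Hm] := Nnil v; exists m.
suff [-> //] : iter m (fun y => S y + N y - c *: y) v = iter m N v /\
  S (iter m N v) = c *: iter m N v.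
elim: m {Hm} => //= m [-> E].
by rewrite SN E (linZ HN); split=> //; rewrite addrAC subrr add0r.
Qed.

(** An eigenvector of [S'] lies in a generalized eigenspace of the common sum T. That space is
    stable under [S], and an eigenvector of [S] inside it has the same eigenvalue because distinct
    generalized eigenspaces of T meet in 0. *)
Lemma jordan_unique S N S' N' : lin S -> lin N -> lin S' -> lin N' ->
  (forall v, S (N v) = N (S v)) -> (forall v, S' (N' v) = N' (S' v)) ->
  diagonalizable S -> diagonalizable S' -> loc_nilpotent N -> loc_nilpotent N' ->
  (forall v, S v + N v = S' v + N' v) -> S =1 S'.
Proof.
move=> HS HN HS' HN' SN SN' dS dS' nN nN' E v.
pose T y := S y + N y.
have HT : lin T by move=> a x y; rewrite /T HS HN scalerDr addrACA.
have ST y : S (T y) = T (S y) by rewrite /T (linD HS) SN.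
apply: (@lspan_min _ _ (eigen S') [set u | S u = S' u]); last exact: dS'.
  by split=> [|a x y /= Ex Ey]; rewrite /= ?lin0// HS HS' Ex Ey.
move=> u [c S'u] /=; rewrite S'u.
have uc : gen_eigen T c u.
  have -> : T = fun y => S' y + N' y by apply/funext.
  exact: eigen_gen_eigen.
have HG := gen_eigen_subspace c HT.
have := eigen_stable HS HG (gen_eigen_stable (c := c) HT HS ST) uc (dS u).
apply: (@lspan_min _ _ _ [set w | S w = c *: w]).
  split=> [|a x y /= Ex Ey]; rewrite /= ?scaler0 ?lin0//.
  by rewrite HS Ex Ey scalerDr !scalerA mulrC.
move=> y [yc [d Sy]] /=; rewrite Sy.
have [-> //|cd] := eqVneq c d.
by rewrite (gen_eigen_disjoint HT cd yc) ?scaler0//; exact: eigen_gen_eigen.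
Qed.

End JordanUniqueness.

(** * Traces of elements of derived algebras *)

Section TraceZero.
Variables (K : numClosedFieldType) (V L : lmodType K).
Variables (act : L -> V -> V) (br : L -> L -> L).
Hypothesis act_linl : forall v, lin (act^~ v).
Hypothesis act_linr : forall x, lin (act x).
Hypothesis act_br : forall x y v, act (br x y) v = act x (act y v) - act y (act x v).

Lemma act0l v : act 0 v = 0.
Proof. exact: (lin0 (act_linl v)). Qed.

Lemma nilpotent_trace0 n (A : 'M[K]_n) :
  (forall a, eigenvalue A a -> a = 0) -> \tr A = 0.
Proof.
case: n A => [A _|n A H]; first by rewrite /mxtrace big_ord0.
have [rs E] := closed_field_poly_normal (char_poly A).
have := char_poly_monic A; rewrite monicE => /eqP lc; rewrite lc scale1r in E.
have rs0 : {in rs, forall z, z = 0}.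
  move=> z zrs; apply: H; rewrite eigenvalue_root_char E.
  by rewrite root_prod_XsubC.
have srs : size rs = n.+1.
  by have := size_char_poly A; rewrite E size_prod_XsubC => -[].
have {}E : char_poly A = 'X^(n.+1).
  rewrite E (eq_big_seq (fun=> 'X)); last by move=> z /rs0 ->; rewrite subr0.
  by rewrite big_const_seq count_predT srs iter_mulr_1.
have := char_poly_trace A (ltn0Sn n); rewrite E /= coefXn.
by rewrite ltn_eqF// => /esym/eqP; rewrite oppr_eq0 => /eqP.
Qed.

(** Commutators have trace zero on the finite-dimensional stable space [M], while n - lam is
    nilpotent there, so the trace of n is lam times dim M. In characteristic 0 this forces dim M =
    0. *)
Lemma derived_gen_eigen0 (k : set L) (M : set V) (n : L) (lam : K) :
  is_subspace M -> findim M -> (forall x, k x -> stable (act x) M) ->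
  derived br k n -> M `<=` gen_eigen (act n) lam -> lam != 0 -> M `<=` [set 0].
Proof.
move=> HM fM kM dn Mn lam0 v Mv.
have [d [e [fe Me Msp]]] := findim_basis HM fM.
have [cf [sp [cf_lin cf_rep _]]] := free_coord fe.
have cfE u : M u -> u = \sum_(j < d) cf j u *: e j.
  move=> /Msp/cf_rep Hr.
  have : rep (upto d) e (iota 0 d) (cf^~ u) u.
    apply: (rep_widen Hr); rewrite ?iota_uniq//.
      by case: Hr => _ sn _ _ i /sn; rewrite mem_iota.
    by move=> i; rewrite mem_iota.
  case=> _ _ _ {1}->.
  by rewrite -(big_mkord predT (fun i => cf i u *: e i)) /index_iota subn0.
have cfP a u w i : M u -> M w -> cf i (a *: u + w) = a * cf i u + cf i w.
  by move=> /Msp Mu /Msp Mw; apply: cf_lin.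
have cf0 i : cf i 0 = 0.
  have := cfP 0 0 0 i; rewrite scaler0 addr0 mul0r add0r.
  by have := cfP (-1) 0 0 i; rewrite scaler0 addr0 mulN1r addNr => ->; have [] := HM.
have cf_sum i (I : finType) (c : I -> K) (w : I -> V) :
    (forall j, M (w j)) -> cf i (\sum_j c j *: w j) = \sum_j c j * cf i (w j).
  move=> Mw; have : M (\sum_j c j *: w j) /\ cf i (\sum_j c j *: w j) = \sum_j c j * cf i (w j).
    rewrite [in X in _ /\ X]unlock [in X in X /\ _]unlock /reducebig.
    elim: (index_enum I) => [|j r [M1 M2]] /=; first by split; [case: HM|].
    by split; [apply HM.2 | rewrite cfP// M2].
  by case.
(* Row i holds the coordinates of the image of [e i]; hence [rho] reverses products, which is
   harmless for traces. *)
pose rho x : 'M[K]_d := \matrix_(i, j) cf j (act x (e i)).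
have rho_br x y : stable (act x) M -> stable (act y) M ->
    rho (br x y) = rho y *m rho x - rho x *m rho y.
  move=> sx sy; apply/matrixP => i j; rewrite !mxE act_br.
  have Mei : M (e i) by exact: Me.
  have -> : act x (act y (e i)) - act y (act x (e i)) =
      (-1) *: act y (act x (e i)) + act x (act y (e i)) by rewrite scaleN1r addrC.
  rewrite cfP; [|by apply: sy; apply: sx|by apply: sx; apply: sy].
  rewrite mulN1r addrC.
  have mulE x' y' : stable (act x') M -> stable (act y') M ->
      cf j (act x' (act y' (e i))) = \sum_l rho y' i l * rho x' l j.
    move=> sx' sy'; rewrite {1}[act y' _]cfE; last exact: sy'.
    rewrite (lin_sum (act_linr x')).
    under eq_bigr do rewrite (linZ (act_linr x')).
    rewrite cf_sum; last by move=> l; apply: sx'; exact: Me.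
    by apply: eq_bigr => l _; rewrite !mxE.
  by rewrite !mulE.
have [_ trn] : stable (act n) M /\ \tr (rho n) = 0.
  move: n dn {Mn}; apply: lspan_min; first split.
  - split; first by move=> u Mu; rewrite act0l; exact: (subspace0 HM).
    by apply: big1 => i _; rewrite mxE act0l cf0.
  - move=> a x y [sx tx] [sy ty].
    have sxy : stable (act (a *: x + y)) M.
      by move=> u Mu; rewrite act_linl; apply HM.2; [exact: sx | exact: sy].
    split=> //.
    have -> : rho (a *: x + y) = a *: rho x + rho y.
      apply/matrixP => i j; rewrite !mxE act_linl cfP//.
        by apply: sx; exact: Me.
      by apply: sy; exact: Me.
    by rewrite linearP/= tx ty mulr0 addr0.
  - move=> _ [x kx [y ky <-]]; split.
      move=> u Mu; rewrite act_br; apply: (subspaceB HM).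
        by apply: (kM _ kx); apply: (kM _ ky).
      by apply: (kM _ ky); apply: (kM _ kx).
    rewrite rho_br; [|exact: kM|exact: kM].
    by rewrite linearB/= mxtrace_mulC subrr.
have stn : stable (act n) M.
  move: n dn {Mn trn}; apply: lspan_min; first split.
  - by move=> u Mu; rewrite act0l; exact: (subspace0 HM).
  - by move=> a x y sx sy u Mu; rewrite act_linl; apply HM.2; [exact: sx | exact: sy].
  - move=> _ [x kx [y ky <-]] u Mu; rewrite act_br; apply: (subspaceB HM).
      by apply: (kM _ kx); apply: (kM _ ky).
    by apply: (kM _ ky); apply: (kM _ kx).
have : \tr (rho n - lam%:M) = 0.
  apply: nilpotent_trace0 => a /eigenvalueP[w wE w0].
  pose u := \sum_(i < d) w 0 i *: e i.
  have Mu : M u.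
    by apply: (subspace_sum HM) => i _; apply: (subspaceZ HM); exact: Me.
  have u0 : u != 0.
    apply: contraNneq w0 => u0; apply/eqP/rowP => i; rewrite mxE.
    pose c j := oapp (w 0) 0 (insub j).
    have cE (j : 'I_d) : c j = w 0 j by rewrite /c valK.
    rewrite -cE; apply: ((free_upto _ _).1 fe c) => //.
    by rewrite -[RHS]u0; apply: eq_bigr => j _; rewrite cE.
  have nu : act n u - lam *: u = a *: u.
    rewrite [act n u]cfE; last exact: stn.
    rewrite /u !scaler_sumr -sumrB; apply: eq_bigr => j _.
    rewrite !scalerA -scalerBl; congr (_ *: _).
    rewrite (lin_sum (act_linr n)).
    under eq_bigr do rewrite (linZ (act_linr n)).
    rewrite cf_sum; last by move=> l; apply: stn; exact: Me.
    have := congr1 (fun X : 'rV_d => X 0 j) wE; rewrite mulmxBr mul_mx_scalar !mxE => <-.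
    congr (_ - _); apply: eq_bigr => l _; by rewrite !mxE.
  have [N] := Mn _ Mu.
  rewrite (iter_eigen N (lin_sub_scale lam (act_linr n)) nu) => /eqP.
  by rewrite scaler_eq0 (negbTE u0) orbF expf_eq0 => /andP[_ /eqP].
rewrite linearB/= trn sub0r mxtrace_scalar => /eqP.
rewrite oppr_eq0 mulrn_eq0 (negbTE lam0) orbF => /eqP d0.
by rewrite [v]cfE// d0 big_ord0.
Qed.

End TraceZero.

(** * Operators of the tensor algebra *)

Definition bil (K : fieldType) (V W : lmodType K) (b : V -> W -> K) :=
  (forall w a u v, b (a *: u + v) w = a * b u w + b v w) /\
  (forall v a w w', b v (a *: w + w') = a * b v w + b v w').

Section Bil.
Variables (K : fieldType) (V W : lmodType K) (b : V -> W -> K).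
Hypothesis Hb : bil b.

Lemma bil_swap : bil (fun w v => b v w).
Proof. by case: Hb => H1 H2; split. Qed.

Lemma bil_linl w : lin (fun v => b v w : K^o).
Proof. by move=> a u v; rewrite Hb.1. Qed.
Lemma bil_linr v : lin (fun w => b v w : K^o).
Proof. by move=> a u w; rewrite Hb.2. Qed.

Lemma bil0l w : b 0 w = 0. Proof. exact: (lin0 (bil_linl w)). Qed.
Lemma bil0r v : b v 0 = 0. Proof. exact: (lin0 (bil_linr v)). Qed.
Lemma bilDl u v w : b (u + v) w = b u w + b v w. Proof. exact: (linD (bil_linl w)). Qed.
Lemma bilDr v w w' : b v (w + w') = b v w + b v w'. Proof. exact: (linD (bil_linr v)). Qed.
Lemma bilZl a u w : b (a *: u) w = a * b u w. Proof. exact: (linZ (bil_linl w)). Qed.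
Lemma bilZr a v w : b v (a *: w) = a * b v w. Proof. exact: (linZ (bil_linr v)). Qed.
Lemma bilBl u v w : b (u - v) w = b u w - b v w. Proof. exact: (linB (bil_linl w)). Qed.
Lemma bilBr v w w' : b v (w - w') = b v w - b v w'. Proof. exact: (linB (bil_linr v)). Qed.
Lemma bil_suml (I : Type) (r : seq I) (P : pred I) (E : I -> V) w :
  b (\sum_(i <- r | P i) E i) w = \sum_(i <- r | P i) b (E i) w.
Proof. exact: (lin_sum (bil_linl w)). Qed.
Lemma bil_sumr (I : Type) (r : seq I) (P : pred I) (E : I -> W) v :
  b v (\sum_(i <- r | P i) E i) = \sum_(i <- r | P i) b v (E i).
Proof. exact: (lin_sum (bil_linr v)). Qed.
End Bil.

Lemma bilinear_bil (K : fieldType) (V W : lmodType K)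
  (b : {bilinear V -> W -> K | *%R & *%R}) : bil b.
Proof. by split=> *; rewrite (linearPl, linearPr). Qed.

Definition freeO (K : fieldType) (V : lmodType K) n (a : 'I_n -> V) :=
  forall c : 'I_n -> K, \sum_i c i *: a i = 0 -> forall i, c i = 0.

Definition infdim (K : fieldType) (V : lmodType K) := ~ findim [set: V].

Section Tensor.
Variables (K : fieldType) (V W : lmodType K).
Variable pair : {bilinear V -> W -> K | *%R & *%R}.
Variable A : tensor_alg pair.
Implicit Types (x y z : A) (v a : V) (w b : W).
Local Notation tens := (tens A).
Local Notation tmul := (tmul A).

Lemma tens_linl w : lin (tens^~ w). Proof. by move=> k u v; rewrite linearPl. Qed.
Lemma tens_linr v : lin (tens v). Proof. by move=> k u w; rewrite linearPr. Qed.
Lemma tmul_linl y : lin (tmul^~ y). Proof. by move=> k u v; rewrite linearPl. Qed.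
Lemma tmul_linr x : lin (tmul x). Proof. by move=> k u w; rewrite linearPr. Qed.

Lemma lift_tens (U : lmodType K) (f : V -> W -> U) :
  (forall w, lin (f^~ w)) -> (forall v, lin (f v)) ->
  exists F : {linear A -> U}, forall v w, F (tens v w) = f v w.
Proof.
move=> Hl Hr.
have Hf : bilinear_for *:%R *:%R f by split=> ? ? ? ?; [exact: Hl | exact: Hr].
pose B := bilinear_isBilinear.Build K V W U *:%R *:%R f Hf.
pose F : {bilinear V -> W -> U} := HB.pack f B.
exact: (tens_lift A F).
Qed.

Definition pure : set A := [set tens v w | v in [set: V] & w in [set: W]].

Section PureSpan.
Let S : {pred A} := [pred x : A | `[< lspan pure x >]].
Fact pure_closed : submod_closed S.
Proof.
have [H0 H1] := lspan_subspace pure.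
split; first by rewrite inE.
by move=> a u v; rewrite !inE => Hu Hv; apply: H1.
Qed.
HB.instance Definition _ := GRing.isSubmodClosed.Build K A S pure_closed.
Record pure_sub := PureSub { pure_val : A; _ : pure_val \in S }.
HB.instance Definition _ := [isSub for pure_val].
HB.instance Definition _ := [Choice of pure_sub by <:].
HB.instance Definition _ := [SubChoice_isSubLmodule of pure_sub by <:].

(** The universal map into the subspace spanned by the pure tensors, followed by the inclusion,
    agrees with the identity on pure tensors and is therefore the identity. *)
Lemma pure_span x : lspan pure x.
Proof.
have pS v w : tens v w \in S.
  by rewrite inE; apply: sub_lspan; exists v => //; exists w.
pose f v w : pure_sub := PureSub (pS v w).
have [|v|F HF] := @lift_tens pure_sub f.
- by move=> w a u v; apply/val_inj; rewrite /= linearPl.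
- by move=> a u w; apply/val_inj; rewrite /= linearPr.
have vlin : lin (fun x => val (F x)) by move=> a u v; rewrite linearP.
have [G HG] := lin_pack vlin.
have E := @tens_ext _ _ _ _ A A G idfun.
rewrite -[x](E _ x) => [|v w]; rewrite HG; last by rewrite HF.
by have := valP (F x); rewrite inE.
Qed.
End PureSpan.

Lemma tens_ind (P : set A) : is_subspace P -> (forall v w, P (tens v w)) -> forall x, P x.
Proof.
move=> HP Ht x; apply: (lspan_min HP _ (pure_span x)).
by move=> _ [v _ [w _ <-]].
Qed.

Lemma lin_eq_tens (U : lmodType K) (F G : A -> U) : lin F -> lin G ->
  (forall v w, F (tens v w) = G (tens v w)) -> F =1 G.
Proof.
move=> HF HG; apply: (@tens_ind [set x | F x = G x]); split=> [|a u v /= Eu Ev].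
  by rewrite /= !lin0.
by rewrite /= HF HG Eu Ev.
Qed.

Let Hb : bil pair. Proof. exact: bilinear_bil. Qed.

(** [A] is known only through its universal property, so the action on [V] is specified by its
    values on pure tensors and then chosen; [opVP] shows that such an action exists. *)
Definition opV_spec (f : A -> V -> V) := (forall v, lin (f^~ v)) /\
  forall a b v, f (tens a b) v = pair v b *: a.
Definition opV : A -> V -> V := xget (fun _ _ => 0) opV_spec.
(** The transpose of the action on [V], without the sign of the contragredient: it reverses
    products, and [op_adj] moves one action to the other across the pairing. *)
Definition opW_spec (f : A -> W -> W) := (forall w, lin (f^~ w)) /\
  forall a b w, f (tens a b) w = pair a w *: b.
Definition opW : A -> W -> W := xget (fun _ _ => 0) opW_spec.

Lemma opVP : opV_spec opV.
Proof.
rewrite /opV; case: xgetP => [f _ //|H]; exfalso.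
have /choice[f Hf] : forall v, exists F : {linear A -> V}, forall a b, F (tens a b) = pair v b *: a.
  move=> v; apply: (lift_tens (f := fun a b => pair v b *: a)).
    by move=> w k u u'; rewrite scalerDr !scalerA mulrC.
  by move=> u k w w'; rewrite Hb.2 scalerDl scalerA.
apply: (H (fun x v => f v x)); split; last by move=> a b v; rewrite Hf.
by move=> v; exact: linear_lin.
Qed.

Lemma opWP : opW_spec opW.
Proof.
rewrite /opW; case: xgetP => [f _ //|H]; exfalso.
have /choice[f Hf] : forall w, exists F : {linear A -> W}, forall a b, F (tens a b) = pair a w *: b.
  move=> w; apply: (lift_tens (f := fun a b => pair a w *: b)).
    by move=> u k v v'; rewrite Hb.1 scalerDl scalerA.
  by move=> u k v v'; rewrite scalerDr !scalerA mulrC.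
apply: (H (fun x w => f w x)); split; last by move=> a b w; rewrite Hf.
by move=> w; exact: linear_lin.
Qed.

Lemma opV_linl v : lin (opV^~ v). Proof. exact: opVP.1. Qed.
Lemma opW_linl w : lin (opW^~ w). Proof. exact: opWP.1. Qed.
Lemma opV_tens a b v : opV (tens a b) v = pair v b *: a. Proof. exact: opVP.2. Qed.
Lemma opW_tens a b w : opW (tens a b) w = pair a w *: b. Proof. exact: opWP.2. Qed.

Lemma opV_linr x : lin (opV x).
Proof.
move=> k u v; move: x; apply: (@lin_eq_tens _ (opV^~ (k *: u + v))
  (fun x => k *: opV x u + opV x v)); first exact: opV_linl.
  move=> c x y; rewrite !opV_linl !scalerDr !scalerA [k * c]mulrC.
  by rewrite -!addrA; congr (_ + _); rewrite addrCA.
by move=> a b; rewrite !opV_tens Hb.1 scalerDl scalerA.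
Qed.

Lemma opW_linr x : lin (opW x).
Proof.
move=> k u v; move: x; apply: (@lin_eq_tens _ (opW^~ (k *: u + v))
  (fun x => k *: opW x u + opW x v)); first exact: opW_linl.
  move=> c x y; rewrite !opW_linl !scalerDr !scalerA [k * c]mulrC.
  by rewrite -!addrA; congr (_ + _); rewrite addrCA.
by move=> a b; rewrite !opW_tens Hb.2 scalerDl scalerA.
Qed.

Lemma op_adj x v w : pair (opV x v) w = pair v (opW x w).
Proof.
move: x; apply: (@lin_eq_tens K^o (fun x => pair (opV x v) w) (fun x => pair v (opW x w))).
- by move=> k x y; rewrite opV_linl Hb.1.
- by move=> k x y; rewrite opW_linl Hb.2.
- by move=> a b; rewrite opV_tens opW_tens (bilZl Hb) (bilZr Hb) mulrC.
Qed.

Lemma opV_mul x y v : opV (tmul x y) v = opV x (opV y v).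
Proof.
move: x; apply: (@lin_eq_tens V (fun x => opV (tmul x y) v) (fun x => opV x (opV y v))).
- by move=> k x x'; rewrite tmul_linl opV_linl.
- by move=> k x x'; rewrite opV_linl.
move=> a b; move: y; apply: (@lin_eq_tens V (fun y => opV (tmul (tens a b) y) v)
    (fun y => opV (tens a b) (opV y v))).
- by move=> k x x'; rewrite tmul_linr opV_linl.
- by move=> k x x'; rewrite opV_linl opV_linr.
move=> a' b'; rewrite tmulE (linZ (opV_linl v)) !opV_tens (bilZl Hb).
by rewrite scalerA mulrC.
Qed.

Lemma opW_mul x y w : opW (tmul x y) w = opW y (opW x w).
Proof.
move: x; apply: (@lin_eq_tens W (fun x => opW (tmul x y) w) (fun x => opW y (opW x w))).
- by move=> k x x'; rewrite tmul_linl opW_linl.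
- by move=> k x x'; rewrite opW_linl opW_linr.
move=> a b; move: y; apply: (@lin_eq_tens W (fun y => opW (tmul (tens a b) y) w)
    (fun y => opW y (opW (tens a b) w))).
- by move=> k x x'; rewrite tmul_linr opW_linl.
- by move=> k x x'; rewrite opW_linl.
move=> a' b'; rewrite tmulE (linZ (opW_linl w)) !opW_tens (bilZr Hb).
by rewrite scalerA mulrC.
Qed.

Lemma tens_rep x : exists n (a : 'I_n -> V) (b : 'I_n -> W),
  x = \sum_i tens (a i) (b i).
Proof.
move: x; apply: tens_ind; last first.
  by move=> v w; exists 1%N, (fun=> v), (fun=> w); rewrite big_ord1.
split; first by exists 0%N, (fun=> 0), (fun=> 0); rewrite big_ord0.
move=> k x y [n [a [b ->]]] [m [a' [b' ->]]].
exists (n + m)%N, (fun i : 'I_(n + m) => match fintype.split i with inl j => k *: a j | inr j => a' j end),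
  (fun i : 'I_(n + m) => match fintype.split i with inl j => b j | inr j => b' j end).
rewrite big_split_ord/=; congr (_ + _).
  rewrite scaler_sumr; apply: eq_bigr => i _.
  by rewrite (unsplitK (inl i)) (linZ (tens_linl _)).
by apply: eq_bigr => i _; rewrite (unsplitK (inr i)).
Qed.

(** In an expression with the least number of terms both families are free, since a linear relation
    in either of them would allow one term to be absorbed into the others. *)
Lemma tens_free_rep x : exists n (a : 'I_n -> V) (b : 'I_n -> W),
  [/\ x = \sum_i tens (a i) (b i), freeO a & freeO b].
Proof.
pose P n := `[< exists (a : 'I_n -> V) (b : 'I_n -> W), x = \sum_i tens (a i) (b i) >].
have exP : exists n, P n.
  by have [n [a [b E]]] := tens_rep x; exists n; apply/asboolP; exists a, b.
case: (ex_minnP exP) => n /asboolP[a [b E]] nmin; exists n, a, b.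
case: n a b E nmin => [|n] a b E nmin.
  by split=> // c _ [].
have lt_n : ~ P n by move=> /nmin; rewrite ltnn.
split=> //; apply: contrapT => /existsNP[c /not_implyP[Hc /existsNP[i0 /eqP ci0]]];
  apply: lt_n; apply/asboolP.
- exists (fun j => a (lift i0 j)), (fun j => b (lift i0 j) - (c (lift i0 j) / c i0) *: b i0).
  rewrite E (bigD1_ord i0)//=.
  have -> : a i0 = - \sum_j (c (lift i0 j) / c i0) *: a (lift i0 j).
    move: Hc; rewrite (bigD1_ord i0)//= => /eqP; rewrite addr_eq0 => /eqP Hc.
    rewrite -[LHS](scalerK ci0) Hc scalerN; congr (- _); rewrite scaler_sumr.
    by apply: eq_bigr => j _; rewrite scalerA mulrC.
  rewrite (linN (tens_linl _)) (lin_sum (tens_linl _)) -sumrN -big_split.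
  apply: eq_bigr => j _ /=; rewrite (linZ (tens_linl _)) (linB (tens_linr _)).
  by rewrite (linZ (tens_linr _)) addrC.
- exists (fun j => a (lift i0 j) - (c (lift i0 j) / c i0) *: a i0), (fun j => b (lift i0 j)).
  rewrite E (bigD1_ord i0)//=.
  have -> : b i0 = - \sum_j (c (lift i0 j) / c i0) *: b (lift i0 j).
    move: Hc; rewrite (bigD1_ord i0)//= => /eqP; rewrite addr_eq0 => /eqP Hc.
    rewrite -[LHS](scalerK ci0) Hc scalerN; congr (- _); rewrite scaler_sumr.
    by apply: eq_bigr => j _; rewrite scalerA mulrC.
  rewrite (linN (tens_linr _)) (lin_sum (tens_linr _)) -sumrN -big_split.
  apply: eq_bigr => j _ /=; rewrite (linZ (tens_linr _)) (linB (tens_linl _)).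
  by rewrite (linZ (tens_linl _)) addrC.
Qed.

Lemma opV_sum n (a : 'I_n -> V) (b : 'I_n -> W) v :
  opV (\sum_i tens (a i) (b i)) v = \sum_i pair v (b i) *: a i.
Proof. by rewrite (lin_sum (opV_linl v)); apply: eq_bigr => i _; rewrite opV_tens. Qed.

Lemma opW_sum n (a : 'I_n -> V) (b : 'I_n -> W) w :
  opW (\sum_i tens (a i) (b i)) w = \sum_i pair (a i) w *: b i.
Proof. by rewrite (lin_sum (opW_linl w)); apply: eq_bigr => i _; rewrite opW_tens. Qed.

Hypothesis Hnd : nondegenerate_pairing pair.

(** Faithfulness of the action on [V]. Through [opV_inj] identities in [A] are checked on
    operators. *)
Lemma opV_eq0 x : (forall v, opV x v = 0) -> x = 0.
Proof.
have [n [a [b [-> fa fb]]]] := tens_free_rep x => H.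
apply: big1 => i _; suff -> : b i = 0 by exact: (lin0 (tens_linr _)).
by apply: Hnd.2 => v; apply: (fa (fun j => pair v (b j))); rewrite -opV_sum.
Qed.

Lemma opV_inj x y : opV x =1 opV y -> x = y.
Proof.
move=> E; apply/eqP; rewrite -subr_eq0; apply/eqP; apply: opV_eq0 => v.
by rewrite (linB (opV_linl v)) E subrr.
Qed.

Lemma tmulA x y z : tmul x (tmul y z) = tmul (tmul x y) z.
Proof. by apply: opV_inj => v; rewrite !opV_mul. Qed.

Lemma range_opV_findim x : exists U, [/\ is_subspace U, findim U & forall v, U (opV x v)].
Proof.
have [n [a [b ->]]] := tens_rep x.
exists (span_on (mem (enum 'I_n)) a); split.
- exact: span_on_subspace.
- exact: findim_seq.
- move=> v; rewrite opV_sum.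
  apply: (subspace_sum (span_on_subspace _ _)) => i _.
  apply: (subspaceZ (span_on_subspace _ _)); apply: span_on_in.
  by rewrite /= mem_enum.
Qed.

Local Notation br := (bracket A).

Lemma opV_br x y v : opV (br x y) v = opV x (opV y v) - opV y (opV x v).
Proof. by rewrite /bracket (linB (opV_linl v)) !opV_mul. Qed.

Lemma opW_br x y w : opW (br x y) w = opW y (opW x w) - opW x (opW y w).
Proof. by rewrite /bracket (linB (opW_linl w)) !opW_mul. Qed.

Lemma br_linl y : lin (br^~ y).
Proof.
move=> k x x'; rewrite /bracket tmul_linl tmul_linr scalerBr opprD addrACA.
by [].
Qed.

Lemma br_linr x : lin (br x).
Proof.
move=> k y y'; rewrite /bracket tmul_linl tmul_linr scalerBr opprD addrACA.
by [].
Qed.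

Lemma br_skew x y : br x y = - br y x. Proof. by rewrite /bracket opprB. Qed.

Lemma jacobi x y z : br x (br y z) = br (br x y) z + br y (br x z).
Proof.
rewrite /bracket !(linB (tmul_linr _)) !(linB (tmul_linl _)) !tmulA.
set a := tmul (tmul x y) z; set b := tmul (tmul x z) y; set c := tmul (tmul y z) x.
set d := tmul (tmul z y) x; set e := tmul (tmul y x) z; set f := tmul (tmul z x) y.
rewrite !opprB.
rewrite [RHS](_ : _ = (a - e) + (d - f) + ((e - c) + (f - b))) //.
rewrite [RHS](AC ((2*2)*(2*2)) ((1*8)*(3*6)*((5*2)*(7*4)))).
by rewrite /= !subrr !addr0.
Qed.

End Tensor.

(** * Jordan decompositions *)

Section JordanElim.
Variables (K : numClosedFieldType) (V W : lmodType K).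
Variable pair : {bilinear V -> W -> K | *%R & *%R}.
Variable A : tensor_alg pair.
Hypothesis Hnd : nondegenerate_pairing pair.
Implicit Types (x y s n : A) (g k : set A).
Local Notation br := (bracket A).

(** [ad s] sees only differences of eigenvalues of s. A vector u of eigenvalue 0 turns the
    eigenvalues of [ad s] into those of s itself. *)
Definition kernel_transitive g := forall x v, exists y u,
  [/\ g y, opV x u = 0 & opV y u = v].

Lemma eigen_br_stable s x y c d : br s x = c *: x -> br s y = d *: y ->
  br s (br x y) = (c + d) *: br x y.
Proof.
move=> sx sy; rewrite jacobi// sx sy (linZ (br_linl _)) (linZ (br_linr _)).
by rewrite -scalerDl.
Qed.

(* The span U of the eigenvectors of [ad s] in k' is k-stable; if U were not k', a
   k-stable complement of U would contain an eigenvector of [ad s]. *)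
Lemma ad_semisimple_step k k' s : subalgebra br k' -> findim k' -> k `<=` k' ->
  reductive_in br k k' -> k s -> ad_semisimple br k s -> ad_semisimple br k' s.
Proof.
move=> [Sk' Bk'] fk' kk' red ks sk.
pose E : set A := k' `&` eigen (br s).
have subE : lspan E `<=` k' by apply: lspan_min => // y [].
have stE : ad_stable br k (lspan E).
  move=> x u /sk Hx Hu; have LE := lspan_subspace E.
  apply: (lspan_lin (f := br^~ u) (br_linl u) LE _ Hx) => y [ky [c sy]].
  apply: (lspan_lin (f := br y) (br_linr y) LE _ Hu) => z [kz [d sz]].
  apply: sub_lspan; split; first by apply: Bk' => //; apply: kk'.
  by exists (c + d); apply: eigen_br_stable.
have [U' [SU' stU' capU sumU]] := red _ (lspan_subspace E) subE stE.
have U'k : U' `<=` k'.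
  move=> u Uu; rewrite -sumU; exists 0; first exact: (subspace0 (lspan_subspace E)).
  by exists u => //; rewrite add0r.
have U'0 u : U' u -> u = 0.
  move=> Uu; apply: contrapT => /eqP u0.
  have [y [c [Uy y0 sy]]] := findim_eigen (br_linr s) SU' (fun v => stU' s v ks)
    (findim_sub U'k fk') Uu u0.
  suff : (lspan E `&` U') y by rewrite capU => /eqP; rewrite (negbTE y0).
  by split=> //; apply: sub_lspan; split; [exact: U'k | exists c].
move=> x kx; have : sum_space (lspan E) U' x by rewrite sumU.
move=> [a Ea [b /U'0 -> <-]]; rewrite addr0.
exact: Ea.
Qed.

Lemma exhaustion_mono g (k : nat -> set A) i j : reductive_exhaustion br g k -> (i <= j)%N -> k i `<=` k j.
Proof.
move=> [H _] /subnK <-; elim: (j - i)%N => [|m IHm] //=.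
by apply: (subset_trans IHm); case: (H (m + i)%N).
Qed.

(** Diagonalizability of [ad s] climbs the exhaustion step by step from the algebra in which s was
    found to be semisimple. *)
Lemma exhaustion_ad_semisimple g (k : nat -> set A) i s : reductive_exhaustion br g k -> k i s ->
  ad_semisimple br (k i) s -> g `<=` lspan (eigen (br s)).
Proof.
move=> Hk ks ss x gx; have [H gE] := Hk; move: gx; rewrite -gE => -[j _ kx].
have step m : ad_semisimple br (k (m + i)%N) s.
  elim: m => // m IHm.
  have [_ _ _ kk red] := H (m + i)%N; have [Sk [d fk] _ _ _] := H (m.+1 + i)%N.
  apply: (ad_semisimple_step Sk (has_dim_findim fk) kk red _ IHm).
  exact: (exhaustion_mono Hk (leq_addl _ _) ks).
apply: (lspan_mono (S := k (j + i)%N `&` eigen (br s))); first by move=> y [].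
by apply: step; exact: (exhaustion_mono Hk (leq_addr _ _) kx).
Qed.

(* If [s u = 0] and [y u = v], the components of y for [ad s] send u to eigenvectors
   of s whose sum is v. *)
Lemma diagonalizable_of_ad g s : kernel_transitive g -> g `<=` lspan (eigen (br s)) ->
  diagonalizable (opV s).
Proof.
move=> Hg gs v; have [y [u [gy su <-]]] := Hg s v.
apply: (lspan_lin (f := fun y => opV y u) (opV_linl u) (lspan_subspace _) _ (gs _ gy)).
move=> z [c sz]; apply: sub_lspan; exists c.
have := opV_br s z u; rewrite sz su (lin0 (opV_linr z)) subr0 => <-.
by rewrite (linZ (opV_linl u)).
Qed.

(** From (n - lam) y v = y (n - lam) v + [n, y] v, by induction on the nilpotency order of [ad n] at
    [y] and on the height of [v]. *)
Lemma ad_nilpotent_gen_eigen n lam m y v : iter m (br n) y = 0 ->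
  gen_eigen (opV n) lam v -> gen_eigen (opV n) lam (opV y v).
Proof.
have HG := gen_eigen_subspace lam (opV_linr n).
elim: m y v => [|m IHm] y v /=.
  by move=> -> _; rewrite (lin0 (opV_linl v)); exact: (subspace0 HG).
rewrite -iterS iterSr => ny [N]; elim: N v => [|N IHN] v.
  by move=> /= ->; rewrite (lin0 (opV_linr y)) => *; exact: (subspace0 HG).
rewrite iterSr => Hv.
have vG : gen_eigen (opV n) lam v by exists N.+1; rewrite iterSr.
have E : opV n (opV y v) - lam *: opV y v =
    opV y (opV n v - lam *: v) + opV (br n y) v.
  rewrite (linB (opV_linr y)) (linZ (opV_linr y)) opV_br.
  by rewrite [RHS]addrC addrA subrK.
have [M HM] : gen_eigen (opV n) lam (opV n (opV y v) - lam *: opV y v).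
  by rewrite E; apply: (subspaceD HG); [exact: IHN | exact: IHm].
by exists M.+1; rewrite iterSr.
Qed.

(** The generalized eigenspaces of [n] for nonzero eigenvalues are finite-dimensional and stable
    under [k], so the trace argument kills them; an annihilating polynomial on the range of [n] then
    reduces to a power of [n]. *)
Lemma derived_loc_nilpotent k n : subalgebra br k -> derived br k n ->
  ad_nilpotent br k n -> loc_nilpotent (opV n).
Proof.
move=> [Sk Bk] dn [m nm] v.
have [U [SU fU HU]] := range_opV_findim n.
have noeig z (y : V) : z != 0 -> opV n y = z *: y -> y = 0.
  move=> z0 ny.
  have HG := gen_eigen_subspace z (opV_linr n).
  (* Since z is nonzero, a generalized eigenvector u is recovered from n u and (n - z) u, and both
     lie in the finite-dimensional [U] that contains the range. *)
  have GU : gen_eigen (opV n) z `<=` U.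
    move=> u [N]; elim: N u => [|N IHN] u; first by move=> /= ->; exact: (subspace0 SU).
    rewrite iterSr => /IHN Hu; apply: (subspaceZ_inv SU z0).
    by rewrite -[_ *: _](subKr (opV n u)); apply: (subspaceB SU).
  have kG x : k x -> stable (opV x) (gen_eigen (opV n) z).
    by move=> kx w; apply: (ad_nilpotent_gen_eigen (m := m)); exact: nm.
  have G0 := derived_gen_eigen0 (@opV_linl _ _ _ _ A) (@opV_linr _ _ _ _ A)
    (@opV_br _ _ _ _ A) HG (findim_sub GU fU) kG dn (@subset_refl _ _) z0.
  by apply: G0; exists 1%N; rewrite /= ny subrr.
have [rs Hrs] := findim_annihilated (opV_linr n) SU (fun u _ => HU u) fU (HU v).
have [N HN] := annihilated_nilpotent (opV_linr n) noeig Hrs.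
by exists N.+1; rewrite iterSr.
Qed.

Lemma jordan_elim g x s n : kernel_transitive g -> jordan br g x s n ->
  [/\ diagonalizable (opV s), loc_nilpotent (opV n), x = s + n
    & forall v, opV s (opV n v) = opV n (opV s v)].
Proof.
move=> Hg [k [i [Hk kx [ks dn xE sn [ss nn]]]]]; split=> //.
- by apply: (diagonalizable_of_ad Hg); exact: exhaustion_ad_semisimple Hk ks ss.
- by have [/(_ i)[Sk _ _ _ _] _] := Hk; exact: derived_loc_nilpotent Sk dn nn.
- move=> v; apply/eqP; rewrite -subr_eq0 -opV_br sn.
  by rewrite (lin0 (opV_linl v)).
Qed.

End JordanElim.

(** * Hermitian forms and an explicit reductive exhaustion *)

Section HermitianProjection.
Variables (K : numClosedFieldType) (L : lmodType K) (H : L -> L -> K).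
Hypothesis H_linl : forall a x y z, H (a *: x + y) z = a * H x z + H y z.
Hypothesis H_linr : forall a x y z, H x (a *: y + z) = a^* * H x y + H x z.

Lemma H_orth_subspace x : is_subspace [set z | H x z = 0].
Proof.
have H0 : H x 0 = 0.
  have := H_linr 0 x 0 0; rewrite scaler0 addr0 => E.
  have := H_linr (-1) x 0 0; rewrite scaler0 addr0 rmorphN rmorph1 mulN1r addNr.
  by [].
split=> // a y z /= Hy Hz; by rewrite H_linr Hy Hz mulr0 addr0.
Qed.

(** Gram-Schmidt: [q] is the component of the last vector orthogonal to the previous ones, and
    anisotropy on the span allows division by [H q q] unless [q] is zero. *)
Lemma H_projection n (e : nat -> L) :
  (forall y, span_on (upto n) e y -> H y y = 0 -> y = 0) ->
  forall x, exists2 u, span_on (upto n) e u &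
    forall z, span_on (upto n) e z -> H (x - u) z = 0.
Proof.
have HB x y z a : H (x - a *: y) z = H x z - a * H y z.
  by rewrite addrC -scaleNr H_linl mulNr addrC.
have mono m : span_on (upto m) e `<=` span_on (upto m.+1) e.
  by apply: lspan_mono => _ [i /= im <-]; exists i => //=; rewrite ltnS ltnW.
elim: n => [|n IHn] pos x.
  exists 0; first exact: (subspace0 (span_on_subspace _ _)).
  move=> z /span_upto[c ->]; rewrite big_ord0.
  exact: (subspace0 (H_orth_subspace _)).
have {}IHn := IHn (fun y Hy => pos y (mono _ _ Hy)).
have [p pn Hp] := IHn (e n); have [u un Hu] := IHn x.
have S1 := span_on_subspace (upto n.+1) e.
have en : span_on (upto n.+1) e (e n) by apply: span_on_in => /=.
set q := e n - p.
have qn : span_on (upto n.+1) e q by apply: (subspaceB S1) => //; exact: mono.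
pose t := H (x - u) q / H q q.
have tq : H (x - u - t *: q) q = 0.
  rewrite HB /t; have [q0|q0] := eqVneq (H q q) 0; last by rewrite mulfVK// subrr.
  rewrite q0 mulr0 subr0 (pos _ qn q0).
  exact: (subspace0 (H_orth_subspace _)).
exists (u + t *: q).
  by apply: (subspaceD S1); [exact: mono | exact: (subspaceZ S1)].
rewrite opprD addrA => z.
apply: (lspan_min (H_orth_subspace _)) => _ [i /= iN <-].
have small z' : span_on (upto n) e z' -> H (x - u - t *: q) z' = 0.
  by move=> Hz; rewrite HB Hu// Hp// mulr0 subr0.
move: iN; rewrite ltnS leq_eqVlt => /orP[/eqP ->|iN]; last first.
  by apply: small; exact: span_on_in.
have -> : e n = 1 *: q + p by rewrite scale1r subrK.
by rewrite H_linr tq small// mulr0 addr0.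
Qed.

End HermitianProjection.

Section Exhaustion.
Variables (K : numClosedFieldType) (V W : lmodType K).
Variable pair : {bilinear V -> W -> K | *%R & *%R}.
Variable A : tensor_alg pair.
Hypothesis Hnd : nondegenerate_pairing pair.
Variables (v : nat -> V) (w : nat -> W).
Hypothesis vw : forall i j, pair (v i) (w j) = (i == j)%:R.
Hypothesis v_span : forall u, span_on predT v u.
Hypothesis w_span : forall u, span_on predT w u.
Implicit Types (x y s : A) (g : set A).
Local Notation br := (bracket A).
Let Hb : bil pair. Proof. exact: bilinear_bil. Qed.

Lemma br_tens x a b : br x (tens A a b) = tens A (opV x a) b - tens A a (opW x b).
Proof.
apply: opV_inj => // u; rewrite opV_br (linB (opV_linl u)) !opV_tens.
by rewrite (linZ (opV_linr x)) op_adj.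
Qed.

Definition cf x i j := pair (opV x (v j)) (w i).

Lemma cf_lin a x y i j : cf (a *: x + y) i j = a * cf x i j + cf y i j.
Proof. by rewrite /cf opV_linl Hb.1. Qed.

Lemma cf_tens a b i j : cf (tens A a b) i j = pair a (w i) * pair (v j) b.
Proof. by rewrite /cf opV_tens (bilZl Hb) mulrC. Qed.

Lemma w_ext u u' : (forall i, pair u (w i) = pair u' (w i)) -> u = u'.
Proof.
move=> E; apply/eqP; rewrite -subr_eq0; apply/eqP; apply: Hnd.1 => z.
apply: (lspan_lin (bil_linr Hb (u - u')) (set0_subspace _) _ (w_span z)).
by move=> _ [i _ <-]; rewrite /= (bilBl Hb) E subrr.
Qed.

Lemma cf_ext x y : (forall i j, cf x i j = cf y i j) -> x = y.
Proof.
move=> E; apply: opV_inj => // u; apply/eqP; rewrite -subr_eq0; apply/eqP.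
have HL : lin (fun u => opV x u - opV y u).
  by move=> a u1 u2; rewrite !opV_linr scalerBr opprD addrACA.
apply: (lspan_lin HL (set0_subspace _) _ (v_span u)).
move=> _ [j _ <-] /=; apply/eqP; rewrite subr_eq0; apply/eqP.
by apply: w_ext => i; exact: E.
Qed.

(** A copy of gl_m inside [A]; these corners exhaust [A]. *)
Definition glm m : set A := [set x | forall i j, ~~ ((i < m) && (j < m))%N -> cf x i j = 0].

Lemma glm_subspace m : is_subspace (glm m).
Proof.
have cf0 i j : cf 0 i j = 0 by rewrite /cf (lin0 (opV_linl _)) (bil0l Hb).
split=> [i j _|a x y Hx Hy i j Hij]; first exact: cf0.
by rewrite cf_lin Hx// Hy// mulr0 addr0.
Qed.

Lemma glm_mono m n : (m <= n)%N -> glm m `<=` glm n.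
Proof.
move=> mn x Hx i j ij; apply: Hx; apply: contra ij => /andP[im jm].
by rewrite !(leq_trans _ mn).
Qed.

Lemma v_bound u : exists n, forall i, (n <= i)%N -> pair u (w i) = 0.
Proof.
have [s [c [us _ c0 ->]]] := span_rep (v_span u).
exists (\max_(i <- s) i).+1 => i ni; rewrite (bil_suml Hb) big1_seq// => j /andP[_ js].
rewrite (bilZl Hb) vw; case: eqP => [ji|_]; last by rewrite mulr0.
by move: ni; rewrite -ji ltnNge => /negP[]; exact: leq_bigmax_seq.
Qed.

Lemma w_bound u : exists n, forall i, (n <= i)%N -> pair (v i) u = 0.
Proof.
have [s [c [us _ c0 ->]]] := span_rep (w_span u).
exists (\max_(i <- s) i).+1 => i ni; rewrite (bil_sumr Hb) big1_seq// => j /andP[_ js].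
rewrite (bilZr Hb) vw; case: eqP => [ji|_]; last by rewrite mulr0.
by move: ni; rewrite ji ltnNge => /negP[]; exact: leq_bigmax_seq.
Qed.

Lemma glm_exhaust x : exists m, glm m x.
Proof.
move: x; apply: tens_ind.
  split; first by exists 0%N; exact: (subspace0 (glm_subspace _)).
  move=> a x y [m Hm] [n Hn]; exists (maxn m n).
  by apply (glm_subspace _).2; [exact: (glm_mono (leq_maxl m n) Hm) | exact: (glm_mono (leq_maxr m n) Hn)].
move=> a b; have [m Hm] := v_bound a; have [n Hn] := w_bound b.
exists (maxn m n) => i j; rewrite negb_and -!leqNgt => ij.
rewrite cf_tens; case/orP: ij => [/(leq_trans (leq_maxl _ _))/Hm ->|/(leq_trans (leq_maxr _ _))/Hn ->].
  by rewrite mul0r.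
by rewrite mulr0.
Qed.

Lemma opV_glm m x j : glm m x -> opV x (v j) = \sum_(l < m) cf x l j *: v l.
Proof.
move=> Hx; apply: w_ext => i; rewrite (bil_suml Hb) -/(cf x i j).
under eq_bigr do rewrite (bilZl Hb) vw.
case: (ltnP i m) => im.
  rewrite (bigD1 (Ordinal im))//= eqxx mulr1 big1 ?addr0// => l /negbTE li.
  by rewrite -[_ == i]/(l == Ordinal im) li mulr0.
rewrite big1 => [|l _]; last by rewrite ltn_eqF ?mulr0// (leq_trans _ im).
by apply: Hx; rewrite ltnNge im.
Qed.

Lemma cf_mul m x y i j : glm m y -> cf (tmul A x y) i j = \sum_(l < m) cf x i l * cf y l j.
Proof.
move=> Hy; rewrite {1}/cf opV_mul (opV_glm j Hy) (lin_sum (opV_linr x)) (bil_suml Hb).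
by apply: eq_bigr => l _; rewrite (linZ (opV_linr x)) (bilZl Hb) mulrC.
Qed.

Lemma glm_mul m x y : glm m x -> glm m y -> glm m (tmul A x y).
Proof.
move=> Hx Hy i j ij; rewrite (cf_mul _ _ _ Hy) big1// => l _.
move: ij; rewrite negb_and => /orP[im|jm].
  by rewrite Hx ?mul0r// negb_and im.
by rewrite (Hy l j) ?mulr0// negb_and jm orbT.
Qed.

Lemma glm_br m x y : glm m x -> glm m y -> glm m (br x y).
Proof. by move=> Hx Hy; apply: (subspaceB (glm_subspace m)); exact: glm_mul. Qed.

Lemma glm_findim m : findim (glm m).
Proof.
pose t (p : nat * nat) := tens A (v p.1) (w p.2).
pose s := [seq (i, j) | i <- iota 0 m, j <- iota 0 m].
apply: (findim_sub (B := span_on (mem s) t)); last exact: findim_seq.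
move=> x Hx.
have -> : x = \sum_(i < m) \sum_(j < m) cf x i j *: t (val i, val j).
  apply: cf_ext => i j.
  have Hc : lin (fun x => cf x i j : K^o) by move=> a y z; rewrite cf_lin.
  rewrite (lin_sum Hc).
  under eq_bigr do rewrite (lin_sum Hc).
  under eq_bigr do under eq_bigr do rewrite (linZ Hc) cf_tens !vw.
  case: (boolP ((i < m) && (j < m))%N) => [/andP[im jm]|ij]; last first.
    rewrite Hx// big1// => i' _; rewrite big1// => j' _.
    case: eqP => [ii|_]; last by rewrite mul0r scaler0.
    case: eqP => [jj|_]; last by rewrite mulr0 scaler0.
    by move: ij; rewrite -ii jj !ltn_ord.
  rewrite (bigD1 (Ordinal im))//= [X in _ = _ + X]big1 ?addr0; last first.
    move=> i' /negbTE ii; rewrite big1// => j' _.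
    by rewrite -[_ == i]/(i' == Ordinal im) ii mul0r scaler0.
  rewrite (bigD1 (Ordinal jm))//= [X in _ = _ + X]big1 ?addr0; last first.
    move=> j' /negbTE jj.
    by rewrite (eq_sym j) -[_ == j]/(j' == Ordinal jm) jj mulr0 scaler0.
  by rewrite !eqxx mulr1 [RHS]mulr1.
apply: (subspace_sum (span_on_subspace _ _)) => i _.
apply: (subspace_sum (span_on_subspace _ _)) => j _.
apply: (subspaceZ (span_on_subspace _ _)); apply: span_on_in => /=.
by apply/allpairsP; exists (val i, val j); split=> //=; rewrite mem_iota/=.
Qed.

Definition mxm m x : 'M[K]_m := \matrix_(i, j) cf x i j.

Lemma mxm_lin m a x y : mxm m (a *: x + y) = a *: mxm m x + mxm m y.
Proof. by apply/matrixP => i j; rewrite !mxE cf_lin. Qed.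

Lemma mxm_mul m x y : glm m y -> mxm m (tmul A x y) = mxm m x *m mxm m y.
Proof.
move=> Hy; apply/matrixP => i j; rewrite !mxE (cf_mul _ _ _ Hy).
by apply: eq_bigr => l _; rewrite !mxE.
Qed.

(** The Frobenius hermitian form of the m by m corners. By [hform_br] the adjoint of [ad a] for it
    is [ad] of the conjugate transpose of [a]. *)
Definition hform m x y := \tr (mxm m x *m (map_mx Num.conj (mxm m y))^T).

Lemma hform_linl m a x y z : hform m (a *: x + y) z = a * hform m x z + hform m y z.
Proof. by rewrite /hform mxm_lin mulmxDl -scalemxAl linearP. Qed.

Lemma hform_linr m a x y z : hform m x (a *: y + z) = a^* * hform m x y + hform m x z.
Proof.
rewrite /hform mxm_lin map_mxD map_mxZ linearP/= mulmxDr -scalemxAr linearP.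
by [].
Qed.

Lemma hform_eq0 m x : glm m x -> hform m x x = 0 -> x = 0.
Proof.
move=> Hx; rewrite /hform /mxtrace => H0.
have {}H0 : forall i, true -> (mxm m x *m (map_mx Num.conj (mxm m x))^T) i i = 0.
  apply/psumr_eq0P => // i _; rewrite mxE sumr_ge0// => j _.
  by rewrite !mxE mul_conjC_ge0.
apply: cf_ext => i j.
have -> : cf 0 i j = 0 by rewrite /cf (lin0 (opV_linl _)) (bil0l Hb).
case: (boolP ((i < m) && (j < m))%N) => [/andP[im jm]|]; last exact: Hx.
have := H0 (Ordinal im) isT; rewrite mxE => /psumr_eq0P => /(_ _ (Ordinal jm) isT).
rewrite !mxE /= => H1; apply/eqP; rewrite -mul_conjC_eq0; apply/eqP; apply: H1.
by move=> l _; rewrite !mxE mul_conjC_ge0.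
Qed.

(** Closure under conjugate transposition in the bases [v], [w]; it makes orthogonal complements of
    stable subspaces stable. *)
Definition star_closed g := forall x, g x -> exists2 y, g y &
  forall i j, cf y i j = (cf x j i)^*.

Lemma hform_br m a a' x y : glm m a -> glm m a' -> glm m x -> glm m y ->
  (forall i j, cf a' i j = (cf a j i)^*) -> hform m (br a x) y = hform m x (br a' y).
Proof.
move=> Ha Ha' Hx Hy aa.
have mB u z : mxm m (u - z) = mxm m u - mxm m z.
  by rewrite addrC -scaleN1r mxm_lin scaleN1r addrC.
have aE : mxm m a' = (map_mx Num.conj (mxm m a))^T.
  by apply/matrixP => i j; rewrite !mxE aa.
have cE (B : 'M[K]_m) : map_mx Num.conj (map_mx Num.conj B)^T = B^T.
  by apply/matrixP => i j; rewrite !mxE conjCK.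
rewrite /hform /bracket !mB !mxm_mul// aE.
move: (mxm m a) (mxm m x) (mxm m y) => B X Y {aE}.
rewrite map_mxB !map_mxM linearB/= !trmx_mul cE trmxK mulmxBl mulmxBr !linearB/=.
congr (_ - _); last by rewrite mulmxA.
by rewrite mxtrace_mulC mulmxA mxtrace_mulC.
Qed.

Section WithG.
Variable g : set A.
Hypothesis Sg : is_subspace g.
Hypothesis Bg : forall x y, g x -> g y -> g (br x y).
Hypothesis g_star : star_closed g.

Let k m := g `&` glm m.

Lemma k_subspace m : is_subspace (k m).
Proof. exact: (setI_subspace Sg (glm_subspace m)). Qed.

Lemma k_findim m : findim (k m).
Proof. by apply: (findim_sub _ (glm_findim m)) => x []. Qed.

Lemma k_reductive m n : (m <= n)%N -> reductive_in br (k m) (k n).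
Proof.
move=> mn U SU Uk stU.
pose U' : set A := k n `&` [set x | forall u, U u -> hform n x u = 0].
have U0 u : U u -> U' u -> u = 0.
  by move=> Uu [[_ gu] /(_ u Uu)]; exact: hform_eq0.
exists U'; split.
- split.
    split; first exact: (subspace0 (k_subspace n)).
    move=> u _; have := hform_linl n (-1) 0 0 u.
    by rewrite scaler0 addr0 mulN1r addNr.
  move=> a x y [kx Hx] [ky Hy]; split; first by apply (k_subspace n).2.
  by move=> u Uu; rewrite hform_linl Hx// Hy// mulr0 addr0.
- move=> a x [ga Ha] [[gx Hx] xU]; have Ha' := glm_mono mn Ha.
  split; first by split; [exact: Bg | exact: glm_br].
  move=> u Uu; have [a' ga' aa'] := g_star ga.
  have Hma' : glm m a'.
    by move=> i j ij; rewrite aa' Ha ?conjC0// andbC.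
  have [_ Hu] := Uk _ Uu.
  (* The operator [ad a] passes to the other argument as [ad a'], and [a'] lies in [k m] again, so
     [U] is stable under it. *)
  rewrite (hform_br Ha' (glm_mono mn Hma') Hx Hu aa'); apply: xU.
  by apply: stU => //.
- apply/seteqP; split=> [u [Uu U'u]|_ ->]; first exact: U0.
  split; first exact: (subspace0 SU).
  split; first exact: (subspace0 (k_subspace n)).
  move=> u _; have := hform_linl n (-1) 0 0 u.
  by rewrite scaler0 addr0 mulN1r addNr.
- have [d [e [fe Ue Usp]]] := findim_basis SU (findim_sub Uk (k_findim n)).
  have spU : span_on (upto d) e `<=` U.
    by apply: lspan_min => // _ [i id <-]; exact: Ue.
  apply/seteqP; split=> [_ [u /Uk ku [y [ky _] <-]]|x kx].
    exact: (subspaceD (k_subspace n)).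
  have pos y : span_on (upto d) e y -> hform n y y = 0 -> y = 0.
    by move=> /spU/Uk[_ Hy]; exact: hform_eq0.
  have [u /spU Uu Hu] := H_projection (hform_linl n) (hform_linr n) pos x.
  exists u => //; exists (x - u); last by rewrite addrC subrK.
  split; first by apply: (subspaceB (k_subspace n)) => //; exact: Uk.
  by move=> z /Usp; exact: Hu.
Qed.

Lemma k_exhaustion : reductive_exhaustion br g k.
Proof.
split=> [i|].
  split.
  - split; first exact: k_subspace.
    by move=> x y [gx Hx] [gy Hy]; split; [exact: Bg | exact: glm_br].
  - exact: (findim_has_dim (k_subspace i) (k_findim i)).
  - exact: k_reductive.
  - by move=> x [gx Hx]; split=> //; exact: glm_mono Hx.
  - exact: k_reductive.
apply/seteqP; split=> [x [i _ []]//|x gx].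
by have [m Hm] := glm_exhaust x; exists m.
Qed.

(* The exhaustion by the matrices of bounded size in the dual bases v, w is reductive:
   the conjugate transpose gives an invariant hermitian form, whence complements. *)
Lemma jordan_intro x : g x -> diagonalizable (opV x) -> diagonalizable (opW x) ->
  jordan br g x x 0.
Proof.
move=> gx dV dW; have [m Hm] := glm_exhaust x.
exists k, m; split; [exact: k_exhaustion | by [] |].
have Sd := lspan_subspace [set br x y | x in k m & y in k m].
split; [by [] | exact: (subspace0 Sd) | by rewrite addr0 | exact: (lin0 (br_linr x)) |].
split; last by exists 1%N => y _; exact: (lin0 (br_linl y)).
(* Tensors of eigenvectors with eigenvalues c on [V] and d on [W] are eigenvectors of [ad x] for c -
   d, and they span [A]; the restriction to [k m] is by stability. *)
have allA : forall y, lspan (eigen (br x)) y.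
  have LS := lspan_subspace (eigen (br x)).
  apply: tens_ind => // a b.
  apply: (lspan_lin (f := tens A ^~ b) (tens_linl A b) LS _ (dV a)) => a' [c xa].
  apply: (lspan_lin (f := tens A a') (tens_linr A a') LS _ (dW b)) => b' [d xb].
  apply: sub_lspan; exists (c - d); rewrite br_tens xa xb.
  by rewrite (linZ (tens_linl A _)) (linZ (tens_linr A _)) scalerBl.
move=> y ky; apply: (eigen_stable (br_linr x) (k_subspace m) _ ky (allA y)).
by move=> z [gz Hz]; split; [exact: Bg | exact: glm_br].
Qed.

End WithG.
End Exhaustion.

(** * Tori and their centralizers *)

Section Torus.
Variables (K : numClosedFieldType) (V W : lmodType K).
Variable pair : {bilinear V -> W -> K | *%R & *%R}.
Variable A : tensor_alg pair.
Hypothesis Hnd : nondegenerate_pairing pair.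
Variables (I : eqType) (e : I -> V) (f : I -> W).
Hypothesis ef : forall i j, pair (e i) (f j) = (i == j)%:R.
Implicit Types (x y t d : A) (g : set A).
Local Notation br := (bracket A).
Local Notation tens := (tens A).
Local Notation tmul := (tmul A).
Let Hb : bil pair. Proof. exact: bilinear_bil. Qed.

Definition torus : set A := span_on predT (fun i => tens (e i) (f i)).
(** With T the span of [f] and S that of [e], this is T^perp (x) S^perp: in a free representation of
    such an element the left factors are orthogonal to [f] and the right ones to [e]. *)
Definition null_part : set A :=
  [set y | (forall i, opV y (e i) = 0) /\ (forall i, opW y (f i) = 0)].
Definition tc x i := pair (opV x (e i)) (f i).

Lemma tmul_tensr x a b : tmul x (tens a b) = tens (opV x a) b.
Proof.
apply: opV_inj => // u; rewrite opV_mul !opV_tens.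
by rewrite (linZ (opV_linr x)).
Qed.

Lemma tmul_tensl x a b : tmul (tens a b) x = tens a (opW x b).
Proof. by apply: opV_inj => // u; rewrite opV_mul !opV_tens op_adj. Qed.

Lemma tc_lin k x y i : tc (k *: x + y) i = k * tc x i + tc y i.
Proof. by rewrite /tc opV_linl Hb.1. Qed.

Lemma torus_subspace : is_subspace torus. Proof. exact: span_on_subspace. Qed.

Lemma torus_in i : torus (tens (e i) (f i)).
Proof. exact: (@span_on_in _ _ _ predT (fun i => tens (e i) (f i)) i isT). Qed.

Lemma tc_tens i j : tc (tens (e i) (f i)) j = (i == j)%:R.
Proof.
rewrite /tc opV_tens (bilZl Hb) !ef (eq_sym j); case: eqP => _; by rewrite ?mulr1 ?mulr0.
Qed.

Lemma torus_ind (P : set A) : is_subspace P -> (forall i, P (tens (e i) (f i))) -> torus `<=` P.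
Proof. by move=> HP H; apply: lspan_min => // _ [i _ <-]. Qed.

Lemma torus_e d i : torus d -> opV d (e i) = tc d i *: e i.
Proof.
move: d; apply: torus_ind.
  split=> [|k x y /= Hx Hy]; first by rewrite /tc /= !(lin0 (opV_linl _)) (bil0l Hb) scale0r.
  by rewrite /= tc_lin opV_linl Hx Hy scalerDl scalerA.
move=> j /=; rewrite tc_tens opV_tens ef (eq_sym i).
by case: eqP => [->|_]; rewrite ?scale0r.
Qed.

Lemma torus_f d i : torus d -> opW d (f i) = tc d i *: f i.
Proof.
move: d; apply: torus_ind.
  split=> [|k x y /= Hx Hy].
    by rewrite /= /tc (lin0 (opV_linl _)) (lin0 (opW_linl _)) (bil0l Hb) scale0r.
  by rewrite /= tc_lin opW_linl Hx Hy scalerDl scalerA.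
move=> j /=; rewrite tc_tens opW_tens ef.
by case: eqP => [->|_]; rewrite ?scale0r.
Qed.

Lemma torus_range d v : torus d -> span_on predT e (opV d v).
Proof.
move=> Hd; apply: (lspan_lin (f := fun d => opV d v) (opV_linl v) (span_on_subspace _ _) _ Hd).
move=> _ [i _ <-]; rewrite opV_tens; apply: (subspaceZ (span_on_subspace _ _)).
exact: span_on_in.
Qed.

Lemma torus_rep d : torus d -> exists2 s, uniq s & d = \sum_(i <- s) tc d i *: tens (e i) (f i).
Proof.
move=> /span_rep[s [c [us _ _ dE]]]; exists s => //.
rewrite {1}dE; apply: eq_big_seq => i si; congr (_ *: _).
have Ht : lin (fun x => tc x i : K^o) by move=> k x y; rewrite tc_lin.
rewrite dE (lin_sum Ht) (bigD1_seq i)//= (linZ Ht) tc_tens eqxx big1.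
  by rewrite addr0; symmetry; apply: mulr1.
by move=> j /negbTE ji; rewrite (linZ Ht) tc_tens ji; apply: mulr0.
Qed.

Lemma torus_diagV d : torus d -> diagonalizable (opV d).
Proof.
move=> Hd v; have [s us dE] := torus_rep Hd.
have LS := lspan_subspace (eigen (opV d)).
have eigE i : eigen (opV d) (e i) by exists (tc d i); exact: torus_e.
(* The vector is split into components along the finitely many [e i] occurring in [d] and a
   remainder that [d] kills. *)
rewrite -(subrK (\sum_(i <- s) pair v (f i) *: e i) v); apply: (subspaceD LS); last first.
  by apply: (subspace_sum LS) => i _; apply: (subspaceZ LS); exact: sub_lspan.
apply: sub_lspan; exists 0; rewrite scale0r {1}dE (lin_sum (opV_linl _)).
apply: big1_seq => i /andP[_ si]; rewrite (linZ (opV_linl _)) opV_tens (bilBl Hb) (bil_suml Hb).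
rewrite (bigD1_seq i)//= (bilZl Hb) ef eqxx mulr1 big1 ?addr0 ?subrr ?scale0r ?scaler0//.
by move=> j /negbTE ji; rewrite (bilZl Hb) ef ji mulr0.
Qed.

Lemma torus_diagW d : torus d -> diagonalizable (opW d).
Proof.
move=> Hd v; have [s us dE] := torus_rep Hd.
have LS := lspan_subspace (eigen (opW d)).
have eigE i : eigen (opW d) (f i) by exists (tc d i); exact: torus_f.
rewrite -(subrK (\sum_(i <- s) pair (e i) v *: f i) v); apply: (subspaceD LS); last first.
  by apply: (subspace_sum LS) => i _; apply: (subspaceZ LS); exact: sub_lspan.
apply: sub_lspan; exists 0; rewrite scale0r {1}dE (lin_sum (opW_linl _)).
apply: big1_seq => i /andP[_ si]; rewrite (linZ (opW_linl _)) opW_tens (bilBr Hb) (bil_sumr Hb).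
rewrite (bigD1_seq i)//= (bilZr Hb) ef eqxx mulr1 big1 ?addr0 ?subrr ?scale0r ?scaler0//.
by move=> j /negbTE ji; rewrite (bilZr Hb) ef eq_sym ji mulr0.
Qed.

Lemma torus_comm d d' : torus d -> torus d' -> br d d' = 0.
Proof.
move=> Hd Hd'; apply: (lspan_lin (f := br d) (br_linr d) (set0_subspace _) _ Hd').
move=> _ [i _ <-] /=; rewrite br_tens// torus_e// torus_f//.
by rewrite (linZ (tens_linl _ _)) (linZ (tens_linr _ _)) subrr.
Qed.

Lemma torus_null_mul d y : torus d -> null_part y -> tmul d y = 0 /\ tmul y d = 0.
Proof.
move=> Hd [Hy1 Hy2]; split.
  apply: (lspan_lin (f := tmul^~ y) (tmul_linl y) (set0_subspace _) _ Hd).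
  by move=> _ [i _ <-] /=; rewrite tmul_tensl Hy2 (lin0 (tens_linr _ _)).
apply: (lspan_lin (f := tmul y) (tmul_linr y) (set0_subspace _) _ Hd).
by move=> _ [i _ <-] /=; rewrite tmul_tensr Hy1 (lin0 (tens_linl _ _)).
Qed.

Lemma torus_null_br d y : torus d -> null_part y -> br d y = 0.
Proof. by move=> Hd /(torus_null_mul Hd)[E1 E2]; rewrite /bracket E1 E2 subrr. Qed.

Lemma null_subspace : is_subspace null_part.
Proof.
split; first by split=> i; [exact: (lin0 (opV_linl _)) | exact: (lin0 (opW_linl _))].
move=> k x y [Hx Hx'] [Hy Hy']; split=> i.
  by rewrite opV_linl Hx Hy scaler0 addr0.
by rewrite opW_linl Hx' Hy' scaler0 addr0.
Qed.

Lemma e_ext u : span_on predT e u -> (forall i, pair u (f i) = 0) -> u = 0.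
Proof.
move=> /span_rep[s [c [us _ _ ->]]] H; apply: big1_seq => i /andP[_ si].
have := H i; rewrite (bil_suml Hb) (bigD1_seq i)//= (bilZl Hb) ef eqxx mulr1.
rewrite big1 ?addr0 => [->|j /negbTE ji]; first by rewrite scale0r.
by rewrite (bilZl Hb) ef ji mulr0.
Qed.

Lemma f_ext u : span_on predT f u -> (forall i, pair (e i) u = 0) -> u = 0.
Proof.
move=> /span_rep[s [c [us _ _ ->]]] H; apply: big1_seq => i /andP[_ si].
have := H i; rewrite (bil_sumr Hb) (bigD1_seq i)//= (bilZr Hb) ef eqxx mulr1.
rewrite big1 ?addr0 => [->|j /negbTE ji]; first by rewrite scale0r.
by rewrite (bilZr Hb) ef eq_sym ji mulr0.
Qed.

(** Elements of [A] have finite rank, and the [e i] are independent. The finiteness puts the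
    diagonal part of a centralizing element into the torus, which contains finite sums only. *)
Lemma diag_scalars_finite x (l : I -> K) : (forall i, opV x (e i) = l i *: e i) ->
  exists s : seq I, forall i, i \notin s -> l i = 0.
Proof.
move=> Hl; apply: contrapT => Hs.
have {}Hs (s : seq I) : exists i, i \notin s /\ l i != 0.
  apply: contrapT => H; apply: Hs; exists s => i si; apply/eqP; apply/negP => li.
  by apply: H; exists i; split=> //; apply/negP.
have long n : exists s : seq I, [/\ uniq s, size s = n & {in s, forall i, l i != 0}].
  elim: n => [|n [s [us ss ls]]]; first by exists [::].
  have [i [si li]] := Hs s; exists (i :: s); split; rewrite /= ?si ?ss//.
  by move=> j; rewrite inE => /orP[/eqP ->|/ls].
have [U [SU [n [b Ub]] HU]] := range_opV_findim x.
have [s [us ss ls]] := long n.+1.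
case: s us ss ls => [//|i0 s0] us ss ls; set s := i0 :: s0 in us ss ls *.
have : (n.+1 <= n)%N.
  apply: (@free_le _ _ _ _ (fun k => e (nth i0 s k)) b).
    apply/free_upto => c Hc k kn.
    have := congr1 (fun u => pair u (f (nth i0 s k))) Hc; rewrite /= (bil0l Hb) (bil_suml Hb).
    rewrite (bigD1 (Ordinal kn))//= (bilZl Hb) ef eqxx mulr1 big1 ?addr0// => j jk.
    rewrite (bilZl Hb) ef nth_uniq ?ss//.
    by rewrite -[_ == k]/(j == Ordinal kn) (negbTE jk) mulr0.
  move=> k kn; apply: Ub; apply: (subspaceZ_inv SU (a := l (nth i0 s k))).
    by apply: ls; rewrite mem_nth// ss.
  by rewrite -Hl; exact: HU.
by rewrite ltnn.
Qed.

Section Centralizer.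
Variable g : set A.
Hypothesis Sg : is_subspace g.
Hypothesis Bg : forall x y, g x -> g y -> g (br x y).
Hypothesis g_kt : kernel_transitive g.
Hypothesis g_ji : forall x, g x -> diagonalizable (opV x) -> diagonalizable (opW x) ->
  jordan br g x x 0.

Local Notation h := (centralizer br g (g `&` torus)).

(** A Cartan subalgebra is the whole centralizer of its toral part, so it contains [z], and a
    semisimple [z] is its own semisimple part. This is the source of all obstructions to a torus
    being toral part of a Cartan subalgebra. *)
Lemma diag_in_torus h' z : is_cartan br g h' -> ss_parts br g h' = g `&` torus ->
  h z -> diagonalizable (opV z) -> diagonalizable (opW z) -> torus z.
Proof.
move=> [_ _ _ hE] ssE hz dV dW.
suff : (g `&` torus) z by case.
rewrite -ssE; exists z, 0; split; first by rewrite hE ssE.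
by apply: g_ji => //; case: hz.
Qed.

(** In sl and so a single e_i (x) f_i does not belong to the algebra; what is used instead is that
    the weights of the smaller torus are nonzero and pairwise distinct. *)
Hypothesis sep1 : forall i, exists t, [/\ g t, torus t & tc t i != 0].
Hypothesis sep2 : forall i j, i != j -> exists t, [/\ g t, torus t & tc t i != tc t j].

(** Applying a torus element of nonzero weight shows that [v] lies in the span of [e]; its pairing
    with [f j] vanishes for j different from i because some torus element has different weights at i
    and j. *)
Lemma weightV i v : (forall t, g t -> torus t -> opV t v = tc t i *: v) ->
  v = pair v (f i) *: e i.
Proof.
move=> Hv; have [t [gt tt ti]] := sep1 i.
apply/eqP; rewrite -subr_eq0; apply/eqP; apply: e_ext.
  apply: (subspaceB (span_on_subspace _ _)).
    by apply: (subspaceZ_inv (span_on_subspace _ _) ti); rewrite -Hv//; exact: torus_range.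
  by apply: (subspaceZ (span_on_subspace _ _)); exact: span_on_in.
move=> j; rewrite (bilBl Hb) (bilZl Hb) ef; have [->|ij] := eqVneq i j.
  by rewrite mulr1 subrr.
rewrite mulr0 subr0; have [t' [gt' tt' tij]] := sep2 ij.
have := op_adj t' v (f j); rewrite Hv// torus_f// (bilZl Hb) (bilZr Hb) => /eqP.
by rewrite -subr_eq0 -mulrBl mulf_eq0 subr_eq0 (negbTE tij)/= => /eqP.
Qed.

Lemma torus_rangeW d v : torus d -> span_on predT f (opW d v).
Proof.
move=> Hd; apply: (lspan_lin (f := fun d => opW d v) (opW_linl v) (span_on_subspace _ _) _ Hd).
move=> _ [i _ <-]; rewrite opW_tens; apply: (subspaceZ (span_on_subspace _ _)).
exact: span_on_in.
Qed.

Lemma weightW i v : (forall t, g t -> torus t -> opW t v = tc t i *: v) ->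
  v = pair (e i) v *: f i.
Proof.
move=> Hv; have [t [gt tt ti]] := sep1 i.
apply/eqP; rewrite -subr_eq0; apply/eqP; apply: f_ext.
  apply: (subspaceB (span_on_subspace _ _)).
    by apply: (subspaceZ_inv (span_on_subspace _ _) ti); rewrite -Hv//; exact: torus_rangeW.
  by apply: (subspaceZ (span_on_subspace _ _)); exact: span_on_in.
move=> j; rewrite (bilBr Hb) (bilZr Hb) ef (eq_sym j); have [->|ij] := eqVneq i j.
  by rewrite mulr1 subrr.
rewrite mulr0 subr0; have [t' [gt' tt' tij]] := sep2 ij.
have := op_adj t' (e j) v; rewrite Hv// torus_e// (bilZl Hb) (bilZr Hb) => /eqP.
by rewrite eq_sym -subr_eq0 -mulrBl mulf_eq0 subr_eq0 (negbTE tij)/= => /eqP.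
Qed.

(** Commuting with the torus, [x] preserves every weight line; subtracting the finite diagonal
    element with the same scalars leaves an element that kills both families. *)
Lemma centralizer_decomp x : (forall t, g t -> torus t -> br t x = 0) ->
  exists d y, [/\ torus d, null_part y & x = d + y].
Proof.
move=> Hx.
have comm t v : g t -> torus t -> opV t (opV x v) = opV x (opV t v).
  move=> gt tt; apply/eqP; rewrite -subr_eq0 -opV_br Hx//.
  by rewrite (lin0 (opV_linl _)).
have commW t v : g t -> torus t -> opW t (opW x v) = opW x (opW t v).
  move=> gt tt; apply/eqP; rewrite eq_sym -subr_eq0 -opW_br Hx//.
  by rewrite (lin0 (opW_linl _)).
have xe i : opV x (e i) = tc x i *: e i.
  by apply: weightV => t gt tt; rewrite comm// torus_e// (linZ (opV_linr x)).
have xf i : opW x (f i) = tc x i *: f i.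
  rewrite /tc op_adj.
  by apply: weightW => t gt tt; rewrite commW// torus_f// (linZ (opW_linr x)).
have [s Hs] := diag_scalars_finite xe.
pose s' := undup s; pose d := \sum_(i <- s') tc x i *: tens (e i) (f i).
have td : torus d.
  apply: (subspace_sum torus_subspace) => i _; apply: (subspaceZ torus_subspace).
  exact: torus_in.
have dc j : tc d j = tc x j.
  have Ht : lin (fun x => tc x j : K^o) by move=> k a b; rewrite tc_lin.
  rewrite /d (lin_sum Ht); case: (boolP (j \in s')) => js.
    rewrite (bigD1_seq j)//= ?undup_uniq// (linZ Ht) tc_tens eqxx big1 => [|i /negbTE ij].
      by rewrite addr0; apply: mulr1.
    by rewrite (linZ Ht) tc_tens ij; apply: mulr0.
  rewrite (Hs j); last by move: js; rewrite mem_undup.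
  rewrite big1_seq// => i /andP[_ si].
  rewrite (linZ Ht) tc_tens; case: eqP => [ij|_]; last by apply: mulr0.
  by rewrite -ij si in js.
exists d, (x - d); split=> //; last by rewrite addrC subrK.
split=> i; first by rewrite (linB (opV_linl _)) xe torus_e// dc subrr.
by rewrite (linB (opW_linl _)) xf torus_f// dc subrr.
Qed.

(** [g_split] keeps both parts of a centralizing element inside [g]. In [g_nil] three factors are
    taken because, for so with a form of rank one on T^perp, a product of two null elements can be
    nonzero. *)
Hypothesis g_split : forall d y, torus d -> null_part y -> g (d + y) -> g d.
Hypothesis g_nil : forall y1 y2 y3, g y1 -> g y2 -> g y3 ->
  null_part y1 -> null_part y2 -> null_part y3 -> tmul y1 (tmul y2 y3) = 0.

Lemma hP x : h x <-> exists d y, [/\ torus d, g d, null_part y, g y & x = d + y].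
Proof.
split.
  move=> [gx Hx]; have [|d [y [td ny xE]]] := @centralizer_decomp x.
    by move=> t gt tt; apply: Hx.
  have gd : g d by apply: (g_split td ny); rewrite -xE.
  exists d, y; split=> //; have -> : y = x - d by rewrite xE addrC addKr.
  exact: (subspaceB Sg).
move=> [d [y [td gd ny gy ->]]]; split; first exact: (subspaceD Sg).
by move=> t [gt tt]; rewrite (linD (br_linr t)) torus_comm// torus_null_br// addr0.
Qed.

Lemma null_loc_nilpotent y : g y -> null_part y -> loc_nilpotent (opV y).
Proof.
move=> gy ny v; exists 3%N => /=.
have := congr1 (fun z => opV z v) (g_nil gy gy gy ny ny ny).
by rewrite !opV_mul (lin0 (opV_linl _)).
Qed.

Lemma torus_null_opV d y v : torus d -> null_part y -> opV d (opV y v) = opV y (opV d v).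
Proof.
move=> td ny; have [E1 E2] := torus_null_mul td ny.
by rewrite -!opV_mul E1 E2.
Qed.

(** x + 0 and d + y are two decompositions of the same operator into commuting diagonalizable and
    locally nilpotent parts, so uniqueness gives x = d. *)
Lemma diag_h x : h x -> diagonalizable (opV x) -> torus x.
Proof.
move=> /hP[d [y [td gd ny gy xE]]] dx.
suff -> : x = d by [].
have L0 : lin (fun _ : V => 0 : V) by move=> *; rewrite scaler0 addr0.
have n0 : loc_nilpotent (fun _ : V => 0 : V) by move=> v; exists 1%N.
have E := jordan_unique (opV_linr x) L0 (opV_linr d) (opV_linr y).
apply: opV_inj => //; apply: E => //.
- by move=> v; rewrite (lin0 (opV_linr x)).
- by move=> v; exact: torus_null_opV.
- exact: torus_diagV.
- exact: null_loc_nilpotent.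
- by move=> v; rewrite addr0 xE (linD (opV_linl v)).
Qed.

Lemma ss_parts_h : ss_parts br g h = g `&` torus.
Proof.
apply/seteqP; split=> [s [x [n [/hP[d [y [td gd ny gy xE]]] /(jordan_elim Hnd g_kt)[ds nn xE' sn]]]]|d [gd td]].
  suff -> : s = d by [].
  apply: opV_inj => //.
  apply: (jordan_unique (opV_linr s) (opV_linr n) (opV_linr d) (opV_linr y)) => //.
  - by move=> v; exact: torus_null_opV.
  - exact: torus_diagV.
  - exact: null_loc_nilpotent.
  - by move=> v; rewrite -!(linD (opV_linl v)) -xE -xE'.
exists d, 0; split.
  apply/hP; exists d, 0; split=> //; last by rewrite addr0.
    exact: (subspace0 null_subspace).
  exact: (subspace0 Sg).
by apply: g_ji => //; [exact: torus_diagV | exact: torus_diagW].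
Qed.

Lemma h_subalgebra : subalgebra br h.
Proof.
split.
  split; first by split; [exact: (subspace0 Sg) | move=> z _; exact: (lin0 (br_linr z))].
  move=> k x y [gx Hx] [gy Hy]; split; first by apply Sg.2.
  by move=> z Hz; rewrite br_linr Hx// Hy// scaler0 addr0.
move=> x y [gx Hx] [gy Hy]; split; first exact: Bg.
move=> z Hz; rewrite jacobi// (Hx _ Hz) (Hy _ Hz) (lin0 (br_linl y)) (lin0 (br_linr x)).
by rewrite addr0.
Qed.

(** The torus parts are central, so a double bracket involves null parts only and expands into
    triple products, which vanish by [g_nil]. *)
Lemma h_lower_central : lower_central br h 2 = [set 0].
Proof.
apply/seteqP; split; last by move=> _ ->; exact: (subspace0 (lspan_subspace _)).
rewrite /=; apply: lspan_min; first exact: set0_subspace.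
move=> _ [x hx [z Hz <-]] /=.
apply: (lspan_lin (f := br x) (br_linr x) (set0_subspace _) _ Hz).
move=> _ [x1 hx1 [x2 hx2 <-]] /=.
move: hx hx1 hx2 => /hP[d [y [td gd ny gy ->]]] /hP[d1 [y1 [td1 gd1 ny1 gy1 ->]]]
  /hP[d2 [y2 [td2 gd2 ny2 gy2 ->]]].
have E0 d' y' : torus d' -> null_part y' -> br y' d' = 0.
  by move=> Hd Hy; rewrite br_skew torus_null_br// oppr0.
rewrite [br (d1 + y1) _](_ : _ = br y1 y2); last first.
  rewrite (linD (br_linr _)) (linD (br_linl d2)) (linD (br_linl y2)).
  by rewrite (torus_comm td1 td2) (torus_null_br td1 ny2) (E0 _ _ td2 ny1) !add0r.
rewrite (linD (br_linl _)) [br d _](_ : _ = 0) ?add0r; last first.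
  rewrite jacobi// (torus_null_br td ny1) (torus_null_br td ny2).
  by rewrite (lin0 (br_linl _)) (lin0 (br_linr _)) addr0.
rewrite /bracket (linB (tmul_linr _)) (linB (tmul_linl _)) -!tmulA//.
by rewrite !g_nil// !subrr.
Qed.

Lemma h_cartan : is_cartan br g h.
Proof.
split; first exact: h_subalgebra.
- by move=> x [].
- move=> F _ Fh; exists h; split=> //; first exact: h_subalgebra.
  by exists 2%N; exact: h_lower_central.
- by rewrite ss_parts_h.
Qed.

End Centralizer.
End Torus.

(** * Conjugacy *)

Section LinBij.
Variables (K : fieldType) (V : lmodType K).

Lemma inj_surj_bij (I : Type) (p : I -> I) : injective p -> (forall j, exists i, p i = j) -> bijective p.
Proof.
move=> pi /choice[q pq]; exists q => // i.
by apply: pi; rewrite pq.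
Qed.

Lemma linear_inverse (phi : {linear V -> V}) : bijective phi ->
  exists phi' : {linear V -> V}, cancel phi phi' /\ cancel phi' phi.
Proof.
move=> [g gK Kg].
have Hg : lin g by move=> a u v; apply: (can_inj gK); rewrite linearP !Kg.
by have [G HG] := lin_pack Hg; exists G; split=> v; rewrite HG.
Qed.
End LinBij.

Section FamilyEquiv.
Variables (K : fieldType) (V W : lmodType K) (pair : V -> W -> K).

Definition pair_aut (phi : {linear V -> V}) (psi : {linear W -> W}) :=
  [/\ bijective phi, bijective psi & forall v w, pair (phi v) (psi w) = pair v w].

(* [Q] restricts the conjugating group: no condition for [GL(V, W)], and
   [phi = psi] for the isometry group of a form on [V = W]. *)
Definition fam_equiv (Q : (V -> V) -> (W -> W) -> Prop) (I : eqType)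
    (e : I -> V) (f : I -> W) (e' : I -> V) (f' : I -> W) :=
  exists (phi : {linear V -> V}) (psi : {linear W -> W}) (p : I -> I) (l m : I -> K),
  [/\ pair_aut phi psi, Q phi psi, bijective p
    & forall i, [/\ l i != 0, m i != 0, phi (e i) = l i *: e' (p i) & psi (f i) = m i *: f' (p i)]].
End FamilyEquiv.

Section Conjugation.
Variables (K : numClosedFieldType) (V W : lmodType K).
Variable pair : {bilinear V -> W -> K | *%R & *%R}.
Variable A : tensor_alg pair.
Hypothesis Hnd : nondegenerate_pairing pair.
Implicit Types (x y t d : A) (g : set A).
Implicit Types (phi : {linear V -> V}) (psi : {linear W -> W}) (F : {linear A -> A}).
Local Notation br := (bracket A).
Local Notation tens := (tens A).
Local Notation tmul := (tmul A).
Let Hb : bil pair. Proof. exact: bilinear_bil. Qed.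

Local Notation autpair := (pair_aut pair).

Definition tens_map phi psi F := forall v w, F (tens v w) = tens (phi v) (psi w).

Lemma tens_map_exists phi psi : exists F, tens_map phi psi F.
Proof.
apply: (lift_tens A (f := fun v w => tens (phi v) (psi w))).
  by move=> w a u v; rewrite linearP tens_linl.
by move=> v a u w; rewrite linearP tens_linr.
Qed.

Lemma autpair_inv phi psi phi' psi' : autpair phi psi ->
  cancel phi phi' -> cancel phi' phi -> cancel psi psi' -> cancel psi' psi -> autpair phi' psi'.
Proof.
move=> [_ _ H] c1 c2 c3 c4; split; [by exists phi | by exists psi |].
by move=> v w; rewrite -H c2 c4.
Qed.

(** [induced] provides the contragredient as a bare function. Nondegeneracy and the surjectivity of
    [f] make it linear, and it is onto because [f] preserves the restricted dual. *)
Lemma GL_autpair f F : GL pair f -> induced f F ->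
  exists psi, autpair f psi /\ tens_map f psi F.
Proof.
move=> [bf fW] [f' [Hf' HF]].
have Hsurj : forall v, exists u, f u = v by case: bf => g _ Kg v; exists (g v).
have f'_lin : lin f'.
  move=> a u v; apply/eqP; rewrite -subr_eq0; apply/eqP; apply: Hnd.2 => y.
  have [z <-] := Hsurj y.
  by rewrite (bilBr Hb) Hf' !Hb.2 !Hf' subrr.
have [psi Hpsi] := lin_pack f'_lin; exists psi.
have pE v w : pair (f v) (psi w) = pair v w by rewrite Hpsi.
split; last by move=> v w; rewrite HF Hpsi.
split=> //; apply: inj_surj_bij.
  move=> u v E; apply/eqP; rewrite -subr_eq0; apply/eqP; apply: Hnd.2 => y.
  by rewrite (bilBr Hb) -(pE y u) -(pE y v) E subrr.
move=> w.
have : restricted_dual pair (fun v => pair (f v) w).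
  rewrite -fW; exists (fun v => pair v w) => //; by exists w.
move=> [w' E]; exists w'; apply/eqP; rewrite -subr_eq0; apply/eqP; apply: Hnd.2 => y.
have [z <-] := Hsurj y; rewrite (bilBr Hb) pE.
by rewrite -(congr1 (fun h => h z) E) subrr.
Qed.

Lemma autpair_GL f psi F : autpair f psi -> tens_map f psi F -> GL pair f /\ induced f F.
Proof.
move=> [bf bpsi H] HF; split; last by exists psi.
split=> //; have [psi' [c1 c2]] := linear_inverse bpsi.
apply/seteqP; split=> [_ [_ [w ->] <-]|_ [w ->]].
  by exists (psi' w); apply/funext => v; rewrite -[RHS]H c2.
exists (fun v => pair v (psi w)); first by exists (psi w).
by apply/funext => v; rewrite H.
Qed.

Section OneMap.
Variables (phi : {linear V -> V}) (psi : {linear W -> W}) (F : {linear A -> A}).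
Hypothesis HA : autpair phi psi.
Hypothesis HF : tens_map phi psi F.

Lemma tmap_opV x v : opV (F x) (phi v) = phi (opV x v).
Proof.
move: x; apply: (@lin_eq_tens _ _ _ _ A V (fun x => opV (F x) (phi v)) (fun x => phi (opV x v))).
- by move=> k x y; rewrite linearP opV_linl.
- by move=> k x y; rewrite opV_linl linearP.
- by move=> a b; rewrite HF !opV_tens linearZ/=; case: HA => _ _ ->.
Qed.

Lemma tmap_opW x w : opW (F x) (psi w) = psi (opW x w).
Proof.
move: x; apply: (@lin_eq_tens _ _ _ _ A W (fun x => opW (F x) (psi w)) (fun x => psi (opW x w))).
- by move=> k x y; rewrite linearP opW_linl.
- by move=> k x y; rewrite opW_linl linearP.
- by move=> a b; rewrite HF !opW_tens linearZ/=; case: HA => _ _ ->.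
Qed.

Lemma tmap_mul x y : F (tmul x y) = tmul (F x) (F y).
Proof.
apply: opV_inj => // u; have [[phi' c1 c2] _ _] := HA.
by rewrite -(c2 u) opV_mul !tmap_opV opV_mul.
Qed.

Lemma tmap_br x y : F (br x y) = br (F x) (F y).
Proof. by rewrite /bracket linearB/= !tmap_mul. Qed.

Lemma tmap_diag x : diagonalizable (opV x) -> diagonalizable (opV (F x)).
Proof.
move=> dx v; have [[phi' c1 c2] _ _] := HA.
rewrite -(c2 v); apply: (lspan_lin (linear_lin phi) (lspan_subspace _) _ (dx (phi' v))).
move=> u [c xu]; apply: sub_lspan; exists c.
by rewrite tmap_opV xu linearZ.
Qed.

End OneMap.

Lemma tmap_cancel phi psi F phi' psi' F' : tens_map phi psi F -> tens_map phi' psi' F' ->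
  cancel phi phi' -> cancel psi psi' -> cancel F F'.
Proof.
move=> HF HF' c1 c2; apply: (@lin_eq_tens _ _ _ _ A A (fun x => F' (F x)) id).
- by move=> k x y; rewrite !linearP.
- by move=> k x y.
- by move=> a b; rewrite HF HF' c1 c2.
Qed.

Variable Q : (V -> V) -> (W -> W) -> Prop.
Hypothesis Q_id : Q id id.
Hypothesis Q_inv : forall phi psi phi' psi', Q phi psi ->
  cancel phi phi' -> cancel phi' phi -> cancel psi psi' -> cancel psi' psi -> Q phi' psi'.
Hypothesis Q_comp : forall phi psi phi' psi', Q phi psi -> Q phi' psi' ->
  Q (phi' \o phi) (psi' \o psi).

(** Recording the map together with its contragredient makes inverses and composites immediate and
    treats all the groups at once through [Q]. *)
Definition conjP (h h' : set A) := exists phi psi F,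
  [/\ autpair phi psi, Q phi psi, tens_map phi psi F & h' = F @` h].

Lemma conjP_refl h : conjP h h.
Proof.
exists idfun, idfun, idfun; split=> //; last by rewrite image_id.
Qed.

Lemma conjP_sym h h' : conjP h h' -> conjP h' h.
Proof.
move=> [phi [psi [F [Ha HQ HF ->]]]]; have [b1 b2 _] := Ha.
have [phi' [c1 c2]] := linear_inverse b1; have [psi' [c3 c4]] := linear_inverse b2.
have [F' HF'] := tens_map_exists phi' psi'.
exists phi', psi', F'; split=> //.
- exact: autpair_inv Ha c1 c2 c3 c4.
- exact: Q_inv HQ c1 c2 c3 c4.
- have FK := tmap_cancel HF HF' c1 c3.
  apply/seteqP; split=> [x hx|_ [_ [x hx <-] <-]]; last by rewrite FK.
  by exists (F x); [exists x | rewrite FK].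
Qed.

Lemma conjP_trans h1 h2 h3 : conjP h1 h2 -> conjP h2 h3 -> conjP h1 h3.
Proof.
move=> [phi [psi [F [Ha HQ HF ->]]]] [phi' [psi' [F' [Ha' HQ' HF' ->]]]].
case: Ha Ha' => b1 b2 b3 [b1' b2' b3'].
exists (phi' \o phi), (psi' \o psi), (F' \o F); split.
- split; [exact: bij_comp | exact: bij_comp | by move=> v w /=; rewrite b3' b3].
- exact: Q_comp.
- by move=> v w /=; rewrite HF HF'.
- by rewrite image_comp.
Qed.

Variable G : set {linear V -> V}.
Hypothesis GP : forall h h', conjugate_under G h h' <-> conjP h h'.

Lemma conj_classP h h' : conj_class G h = conj_class G h' <-> conjP h h'.
Proof.
split=> [E|H].
  have : conj_class G h' h' by apply/GP; exact: conjP_refl.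
  by rewrite -E => /GP.
apply/seteqP; split=> k /GP Hk; apply/GP.
  by apply: conjP_trans Hk; exact: conjP_sym.
exact: conjP_trans Hk.
Qed.

Variable (I : eqType).

Local Notation deq := (fam_equiv pair Q).

Variable g : set A.
Hypothesis Sg : is_subspace g.
Hypothesis Bg : forall x y, g x -> g y -> g (br x y).
Hypothesis g_kt : kernel_transitive g.
Hypothesis g_inv : forall phi psi F, autpair phi psi -> Q phi psi -> tens_map phi psi F ->
  forall x, g x -> g (F x).

(** The conditions under which the centralizer of the torus in [g] is a Cartan subalgebra with
    exactly this toral part. *)
Definition good_family (e : I -> V) (f : I -> W) := [/\
  forall i j, pair (e i) (f j) = (i == j)%:R,
  forall i, exists t, [/\ g t, torus e f t & tc e f t i != 0],
  forall i j, i != j -> exists t, [/\ g t, torus e f t & tc e f t i != tc e f t j],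
  forall d y, torus e f d -> null_part e f y -> g (d + y) -> g d
  & forall y1 y2 y3, g y1 -> g y2 -> g y3 ->
    null_part e f y1 -> null_part e f y2 -> null_part e f y3 ->
    tmul y1 (tmul y2 y3) = 0].

Local Notation cart e f := (centralizer br g (g `&` torus e f)).

Lemma torus_map (e : I -> V) (f : I -> W) (e' : I -> V) (f' : I -> W) phi psi F (p : I -> I) (l m : I -> K) :
  tens_map phi psi F ->
  (forall i, phi (e i) = l i *: e' (p i) /\ psi (f i) = m i *: f' (p i)) ->
  forall x, torus e f x -> torus e' f' (F x).
Proof.
move=> HF H x Hx; apply: (lspan_lin (linear_lin F) (span_on_subspace _ _) _ Hx).
move=> _ [i _ <-]; rewrite HF; have [-> ->] := H i.
rewrite (linZ (tens_linl _ _)) (linZ (tens_linr _ _)).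
by do 2!apply: (subspaceZ (span_on_subspace _ _)); exact: torus_in.
Qed.

Lemma conj_of_deq (e : I -> V) (f : I -> W) (e' : I -> V) (f' : I -> W) : deq e f e' f' -> conjP (cart e f) (cart e' f').
Proof.
move=> [phi [psi [p [l [m [Ha HQ [q pK Kp] H]]]]]].
have [F HF] := tens_map_exists phi psi.
have [b1 b2 _] := Ha.
have [phi' [c1 c2]] := linear_inverse b1; have [psi' [c3 c4]] := linear_inverse b2.
have [F' HF'] := tens_map_exists phi' psi'.
have Ha' := autpair_inv Ha c1 c2 c3 c4; have HQ' := Q_inv HQ c1 c2 c3 c4.
have FK := tmap_cancel HF HF' c1 c3; have F'K := tmap_cancel HF' HF c2 c4.
have T : forall x, torus e f x -> torus e' f' (F x).
  by apply: (torus_map (p := p) (l := l) (m := m) HF) => i; have [_ _ E1 E2] := H i.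
have T' : forall x, torus e' f' x -> torus e f (F' x).
  apply: (torus_map (p := q) (l := fun j => (l (q j))^-1) (m := fun j => (m (q j))^-1) HF').
  move=> j; have [l0 m0 E1 E2] := H (q j); rewrite Kp in E1 E2; split.
    by apply: (can_inj c1); rewrite c2 linearZ/= E1 scalerA mulVf// scale1r.
  by apply: (can_inj c3); rewrite c4 linearZ/= E2 scalerA mulVf// scale1r.
exists phi, psi, F; split=> //.
apply/seteqP; split=> [x [gx Hx]|_ [x [gx Hx] <-]].
  exists (F' x); last by rewrite F'K.
  split; first exact: g_inv Ha' HQ' HF' _ gx.
  move=> z [gz tz]; apply: (can_inj FK); rewrite (tmap_br Ha HF) F'K linear0.
  by apply: Hx; split; [exact: g_inv Ha HQ HF _ gz | exact: T].
split; first exact: g_inv Ha HQ HF _ gx.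
move=> z [gz tz]; apply: (can_inj F'K); rewrite (tmap_br Ha' HF') FK linear0.
by apply: Hx; split; [exact: g_inv Ha' HQ' HF' _ gz | exact: T'].
Qed.

(** A nonzero weight forces [v] into the span of [e]; any [f j] that does not vanish on [v] then
    identifies the weight. *)
Lemma weight_line e f v (chi : A -> K) : good_family e f -> v != 0 ->
  (forall t, g t -> torus e f t -> opV t v = chi t *: v) ->
  (exists t, [/\ g t, torus e f t & chi t != 0]) ->
  exists j, v = pair v (f j) *: e j /\ forall t, g t -> torus e f t -> chi t = tc e f t j.
Proof.
move=> [ef sep1 sep2 _ _] v0 Hv [t [gt tt ct]].
have vS : span_on predT e v.
  apply: (subspaceZ_inv (span_on_subspace _ _) ct); rewrite -Hv//.
  exact: (torus_range v tt).
have [j vj] : exists j, pair v (f j) != 0.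
  apply: contrapT => H; case/eqP: v0; apply: (e_ext ef vS) => i.
  by apply/eqP; apply/negPn/negP => Hi; apply: H; exists i.
have Hc t' : g t' -> torus e f t' -> chi t' = tc e f t' j.
  move=> gt' tt'; have := op_adj t' v (f j).
  rewrite Hv// (torus_f ef)// (bilZl Hb) (bilZr Hb) => /eqP.
  by rewrite -subr_eq0 -mulrBl mulf_eq0 (negbTE vj) orbF subr_eq0 => /eqP.
exists j; split=> //; apply: (weightV ef sep1 sep2) => t' gt' tt'.
by rewrite Hv// Hc.
Qed.

Lemma cart_torus_map e f e' f' phi psi F F' :
  good_family e f -> good_family e' f' ->
  autpair phi psi -> Q phi psi -> tens_map phi psi F ->
  cancel F F' -> cart e' f' = F @` cart e f ->
  forall x, g x -> torus e f x -> g (F x) /\ torus e' f' (F x).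
Proof.
move=> [ef _ _ _ _] [ef' s1 s2 s3 s4] Ha HQ HF FK E x gx tx.
split; first exact: g_inv Ha HQ HF _ gx.
apply: (@diag_h _ _ _ _ _ Hnd _ _ _ ef' g) => //.
  rewrite E; exists x => //; split=> // z [gz tz]; exact: (torus_comm Hnd ef tz tx).
by apply: (tmap_diag Ha HF); exact: torus_diagV tx.
Qed.

(** The diagonalizable elements of the two centralizers are their tori, so a conjugation exchanges
    the tori and hence permutes the weight lines in [V] and in [W]. *)
Lemma deq_of_conj e f e' f' : good_family e f -> good_family e' f' ->
  conjP (cart e f) (cart e' f') -> deq e f e' f'.
Proof.
move=> Hg Hg' [phi [psi [F [Ha HQ HF E]]]].
have [b1 b2 b3] := Ha.
have [phi' [c1 c2]] := linear_inverse b1; have [psi' [c3 c4]] := linear_inverse b2.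
have [F' HF'] := tens_map_exists phi' psi'.
have Ha' := autpair_inv Ha c1 c2 c3 c4; have HQ' := Q_inv HQ c1 c2 c3 c4.
have FK := tmap_cancel HF HF' c1 c3; have F'K := tmap_cancel HF' HF c2 c4.
have E' : cart e f = F' @` cart e' f'.
  rewrite E; apply/seteqP; split=> [x hx|_ [_ [x hx <-] <-]]; last by rewrite FK.
  by exists (F x); [exists x | rewrite FK].
(* Stated for two arbitrary families so that it also applies to the inverse map, which yields the
   surjectivity of the permutation. *)
have step (e1 : I -> V) f1 e2 f2 (phi1 : {linear V -> V}) (psi1 : {linear W -> W}) F1 F2 :
    good_family e1 f1 -> good_family e2 f2 -> autpair phi1 psi1 -> tens_map phi1 psi1 F1 ->
    (forall x, g x -> torus e1 f1 x -> g (F1 x) /\ torus e2 f2 (F1 x)) ->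
    (forall x, g x -> torus e2 f2 x -> g (F2 x) /\ torus e1 f1 (F2 x)) ->
    cancel F1 F2 -> cancel F2 F1 ->
    forall i, exists (j : I) (l m : K), [/\ l != 0, m != 0, phi1 (e1 i) = l *: e2 j
      & psi1 (f1 i) = m *: f2 j].
  move=> Hg1 Hg2 Ha1 HF1 T1 T2 K12 K21 i.
  have [ef1 sep1 sep1' _ _] := Hg1; have [ef2 sep2 sep2' _ _] := Hg2.
  have p1 : pair (phi1 (e1 i)) (psi1 (f1 i)) = 1 by case: Ha1 => _ _ ->; rewrite ef1 eqxx.
  have n1 : phi1 (e1 i) != 0.
    by apply: contraTneq (oner_neq0 K) => H; rewrite -p1 H (bil0l Hb) eqxx.
  have n2 : psi1 (f1 i) != 0.
    by apply: contraTneq (oner_neq0 K) => H; rewrite -p1 H (bil0r Hb) eqxx.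
  have [j [vE chiE]] : exists j, phi1 (e1 i) = pair (phi1 (e1 i)) (f2 j) *: e2 j /\
      forall t, g t -> torus e2 f2 t -> tc e1 f1 (F2 t) i = tc e2 f2 t j.
    apply: (weight_line (chi := fun t => tc e1 f1 (F2 t) i) Hg2) => //.
      move=> t gt tt; have [gt' tt'] := T2 _ gt tt.
      by rewrite -{1}(K21 t) (tmap_opV Ha1 HF1) (torus_e ef1)// linearZ.
    have [t [gt tt ti]] := sep1 i; have [gt' tt'] := T1 _ gt tt.
    by exists (F1 t); rewrite K12.
  have wE : psi1 (f1 i) = pair (e2 j) (psi1 (f1 i)) *: f2 j.
    apply: (weightW ef2 sep2 sep2') => t gt tt; have [gt' tt'] := T2 _ gt tt.
    by rewrite -{1}(K21 t) (tmap_opW Ha1 HF1) (torus_f ef1)// linearZ /= chiE.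
  exists j, (pair (phi1 (e1 i)) (f2 j)), (pair (e2 j) (psi1 (f1 i))); split=> //.
    by apply: contraNneq n1 => H; rewrite vE H scale0r.
  by apply: contraNneq n2 => H; rewrite wE H scale0r.
have T1 := cart_torus_map Hg Hg' Ha HQ HF FK E.
have T2 := cart_torus_map Hg' Hg Ha' HQ' HF' F'K E'.
have /choice[p Hp] := step _ _ _ _ _ _ _ _ Hg Hg' Ha HF T1 T2 FK F'K.
have Hq := step _ _ _ _ _ _ _ _ Hg' Hg Ha' HF' T2 T1 F'K FK.
have /choice[l Hl] := Hp; have /choice[m Hm] := Hl.
have [ef _ _ _ _] := Hg; have [ef' _ _ _ _] := Hg'.
exists phi, psi, p, l, m; split=> //.
apply: inj_surj_bij.
  move=> i j pij; have [li _ Ei _] := Hm i; have [_ mj _ Ej] := Hm j.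
  have := b3 (e i) (f j); rewrite Ei Ej pij (bilZl Hb) (bilZr Hb) ef' eqxx mulr1 ef.
  case: eqP => // _ /eqP; by rewrite mulf_eq0 (negbTE li) (negbTE mj).
move=> j; have [i [l' [m' [l0 m0 E1 E2]]]] := Hq j.
exists i; have [li _ Ei _] := Hm i.
have := c2 (e' j); rewrite E1 linearZ/= Ei => /(congr1 (fun u => pair u (f' j))).
rewrite !(bilZl Hb) !ef' eqxx; case: eqP => // _ /eqP.
by rewrite !mulr0 eq_sym oner_eq0.
Qed.

End Conjugation.

(** * Dual and hyperbolic bases *)

Lemma enum_pred (I : countType) (D : pred I) : infinite_set [set i | D i] ->
  exists (r : I -> nat) (q : nat -> I),
    [/\ forall n, D (q n), forall n, r (q n) = n & forall i, D i -> q (r i) = i].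
Proof.
move=> /infiniteP Di.
have : [set i | D i] #= [set: nat].
  by rewrite card_eq_le Di andbT; exact: countableP.
move=> /card_set_bijP[r [_ rinj rsurj]].
have /choice[q Hq] : forall n, exists i, D i /\ r i = n.
  by move=> n; have [i Di' <-] := rsurj n Logic.I; exists i.
exists r, q; split=> [n|n|i Di']; first by case: (Hq n).
  by case: (Hq n).
by apply: rinj; rewrite ?inE //=; case: (Hq (r i)).
Qed.

Lemma infinite_of_inj (I : Type) (D : set I) (q : nat -> I) :
  injective q -> (forall n, D (q n)) -> infinite_set D.
Proof.
move=> qi Dq; apply/infiniteP.
have /card_esym : q @` [set: nat] #= [set: nat] by apply: inj_card_eq => i j _ _; exact: qi.
rewrite card_eq_le => /andP[H _]; apply: card_le_trans H _.
by apply: subset_card_le => _ [n _ <-].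
Qed.

(** Common skeleton of the constructions of dual and of hyperbolic bases: [P] is the invariant of
    the finite stages and [Q j] the j-th task. Every stage must also grow, since the limit has to be
    an infinite sequence. *)
Lemma chain_limit (X : Type) (x0 : X) (P : seq X -> Prop) (Q : nat -> seq X -> Prop) :
  P [::] -> (forall s t, P (s ++ t) -> P s) -> (forall j s t, Q j s -> Q j (s ++ t)) ->
  (forall j s, P s -> exists t, [/\ P (s ++ t), Q j (s ++ t) & (j < size (s ++ t))%N]) ->
  exists x : nat -> X, (forall n, P (mkseq x n)) /\ forall j, exists n, Q j (mkseq x n).
Proof.
move=> P0 Pp Qm step.
have /choice[st Hst] : forall js : nat * seq X, exists t, P js.2 ->
    [/\ P (js.2 ++ t), Q js.1 (js.2 ++ t) & (js.1 < size (js.2 ++ t))%N].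
  move=> [j s]; have [Ps|nPs] := pselect (P s); last by exists [::].
  by have [t Ht] := step j s Ps; exists t.
pose sg := fix sg j := if j is j'.+1 then sg j' ++ st (j', sg j') else [::].
have Psg j : P (sg j) by elim: j => //= j IHj; case: (Hst (j, sg j)).
have Qsg j : Q j (sg j.+1) by have [] := Hst (j, sg j) (Psg j).
have Ssg j : (j <= size (sg j))%N by case: j => // j; have [] := Hst (j, sg j) (Psg j).
have pre i j : (i <= j)%N -> exists t, sg j = sg i ++ t.
  move=> /subnK <-; elim: (j - i)%N => [|m [t Ht]]; first by exists [::]; rewrite cats0.
  by rewrite addSn /= Ht; eexists; rewrite -catA.
(* Stage n + 1 has length at least n + 1, so the default [x0] is never returned. *)
pose x n := nth x0 (sg n.+1) n.
have xE m n : (n <= m)%N -> mkseq x n = take n (sg m).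
  move=> nm; have nS : (n <= size (sg m))%N by exact: leq_trans (Ssg m).
  apply: (@eq_from_nth _ x0); rewrite size_mkseq ?size_takel//.
  move=> i im; rewrite nth_mkseq// nth_take// /x.
  have [t ->] := pre i.+1 m (leq_trans im nm).
  by rewrite nth_cat Ssg.
exists x; split=> [n|j].
  by rewrite (xE n n)//; apply: (Pp _ (drop n (sg n))); rewrite cat_take_drop.
exists (size (sg j.+1)); rewrite (xE _ _ (leqnn _)).
have [t ->] := pre j.+1 (size (sg j.+1)) (Ssg _).
by rewrite take_size_cat//; exact: Qsg.
Qed.

Section SpanMono.
Variables (K : fieldType) (V : lmodType K) (I : eqType).

Lemma span_on_mono (D E : pred I) (a : I -> V) : {subset D <= E} -> span_on D a `<=` span_on E a.
Proof. by move=> DE; apply: lspan_mono => _ [i Di <-]; exists i => //; exact: DE. Qed.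

Lemma infdim_notin (s : seq I) (a : I -> V) : infdim V -> exists v, ~ span_on (mem s) a v.
Proof.
move=> Hinf; apply: contrapT => H; apply: Hinf.
apply: (findim_sub _ (findim_seq a s)) => v _.
by apply: contrapT => nv; apply: H; exists v.
Qed.

Lemma extend_size (P : seq I -> Prop) (a : I -> V) : infdim V ->
  (forall s v, P s -> exists t, P (s ++ t) /\ span_on (mem (s ++ t)) a v) ->
  forall n s, P s -> exists t, P (s ++ t) /\ (n <= size (s ++ t))%N.
Proof.
move=> Hinf step; elim=> [|n IHn] s Ps; first by exists [::]; rewrite cats0.
have [t [Pt nt]] := IHn s Ps; have [v nv] := infdim_notin (s ++ t) a Hinf.
have [t' [Pt' vt']] := step _ v Pt; exists (t ++ t'); rewrite catA; split=> //.
case: t' Pt' vt' => [|p t'] _; first by rewrite cats0.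
by move=> _; rewrite size_cat /= addnS ltnS (leq_trans nt) ?leq_addr.
Qed.
End SpanMono.

Section Mackey.
Variables (K : fieldType) (V W : lmodType K) (pair : V -> W -> K).
Hypothesis Hb : bil pair.
Hypothesis Hnd : nondegenerate_pairing pair.
Hypothesis Vinf : infdim V.
Implicit Types s t : seq (V * W).

Let dual s := forall i j, (i < size s)%N -> (j < size s)%N ->
  pair (nth 0 s i).1 (nth 0 s j).2 = (i == j)%:R.

Lemma dual_rcons s v w : dual s -> pair v w = 1 ->
  (forall p, p \in s -> pair v p.2 = 0) -> (forall p, p \in s -> pair p.1 w = 0) ->
  dual (rcons s (v, w)).
Proof.
move=> ds vw Hv Hw i j; rewrite size_rcons !ltnS !nth_rcons => ii jj.
case: (ltngtP i (size s)) ii => // [ii|->] _.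
  case: (ltngtP j (size s)) jj => // [jj|->] _; first exact: ds.
  by rewrite Hw ?mem_nth// ltn_eqF.
by case: (ltngtP j (size s)) jj => // jj _; rewrite Hv ?mem_nth.
Qed.

Let proj1 s v := v - \sum_(i < size s) pair v (nth 0 s i).2 *: (nth 0 s i).1.
Let proj2 s w := w - \sum_(i < size s) pair (nth 0 s i).1 w *: (nth 0 s i).2.

Lemma proj1_orth s v p : dual s -> p \in s -> pair (proj1 s v) p.2 = 0.
Proof.
move=> ds /(nthP 0)[i si <-]; rewrite (bilBl Hb) (bil_suml Hb).
rewrite (bigD1 (Ordinal si))//= (bilZl Hb) ds// eqxx mulr1 big1 ?addr0 ?subrr// => j /negbTE ji.
by rewrite (bilZl Hb) ds// -[_ == i]/(j == Ordinal si) ji mulr0.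
Qed.

Lemma proj2_orth s w p : dual s -> p \in s -> pair p.1 (proj2 s w) = 0.
Proof.
move=> ds /(nthP 0)[i si <-]; rewrite (bilBr Hb) (bil_sumr Hb).
rewrite (bigD1 (Ordinal si))//= (bilZr Hb) ds// eqxx mulr1 big1 ?addr0 ?subrr// => j /negbTE ji.
by rewrite (bilZr Hb) ds// eq_sym -[_ == i]/(j == Ordinal si) ji mulr0.
Qed.

Lemma pair_proj2 s v w : (forall p, p \in s -> pair v p.2 = 0) -> pair v (proj2 s w) = pair v w.
Proof.
move=> Hv; rewrite (bilBr Hb) (bil_sumr Hb) big1 ?subr0// => i _.
by rewrite (bilZr Hb) Hv ?mulr0// mem_nth.
Qed.

Lemma pair_proj1 s v w : (forall p, p \in s -> pair p.1 w = 0) -> pair (proj1 s v) w = pair v w.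
Proof.
move=> Hw; rewrite (bilBl Hb) (bil_suml Hb) big1 ?subr0// => i _.
by rewrite (bilZl Hb) Hw ?mulr0// mem_nth.
Qed.

Lemma dual_extV s v : dual s -> exists t, dual (s ++ t) /\ span_on (mem (s ++ t)) fst v.
Proof.
move=> ds; have S1 t := span_on_subspace (mem (s ++ t)) (fst : V * W -> V).
have sums t : span_on (mem (s ++ t)) fst (\sum_(i < size s) pair v (nth 0 s i).2 *: (nth 0 s i).1).
  apply: (subspace_sum (S1 t)) => i _; apply: (subspaceZ (S1 t)).
  by apply: (@span_on_in _ _ _ (mem (s ++ t)) fst); rewrite /= mem_cat mem_nth.
have vE : v = proj1 s v + \sum_(i < size s) pair v (nth 0 s i).2 *: (nth 0 s i).1.
  by rewrite subrK.
have [v0|v0] := eqVneq (proj1 s v) 0.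
  exists [::]; rewrite cats0; split=> //; rewrite vE v0 add0r.
  by have := sums [::]; rewrite cats0.
have [w vw] : exists w, pair (proj1 s v) w != 0.
  apply: contrapT => H; case/eqP: v0; apply: Hnd.1 => w.
  by apply/eqP; apply/negPn/negP => Hw; apply: H; exists w.
have ov p : p \in s -> pair (proj1 s v) p.2 = 0 by exact: proj1_orth.
pose p := (proj1 s v, (pair (proj1 s v) w)^-1 *: proj2 s w).
exists [:: p]; split.
  rewrite cats1; apply: dual_rcons => //.
    by rewrite (bilZr Hb) pair_proj2// mulVf.
  by move=> q qs; rewrite (bilZr Hb) proj2_orth// mulr0.
rewrite vE; apply: (subspaceD (S1 [:: p])); last exact: sums.
apply: (@span_on_in _ _ _ (mem (s ++ [:: p])) fst p).
by rewrite /= mem_cat inE eqxx orbT.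
Qed.

Lemma dual_extW s w : dual s -> exists t, dual (s ++ t) /\ span_on (mem (s ++ t)) snd w.
Proof.
move=> ds; have S1 t := span_on_subspace (mem (s ++ t)) (snd : V * W -> W).
have sums t : span_on (mem (s ++ t)) snd (\sum_(i < size s) pair (nth 0 s i).1 w *: (nth 0 s i).2).
  apply: (subspace_sum (S1 t)) => i _; apply: (subspaceZ (S1 t)).
  by apply: (@span_on_in _ _ _ (mem (s ++ t)) snd); rewrite /= mem_cat mem_nth.
have wE : w = proj2 s w + \sum_(i < size s) pair (nth 0 s i).1 w *: (nth 0 s i).2.
  by rewrite subrK.
have [w0|w0] := eqVneq (proj2 s w) 0.
  exists [::]; rewrite cats0; split=> //; rewrite wE w0 add0r.
  by have := sums [::]; rewrite cats0.
have [v vw] : exists v, pair v (proj2 s w) != 0.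
  apply: contrapT => H; case/eqP: w0; apply: Hnd.2 => v.
  by apply/eqP; apply/negPn/negP => Hv; apply: H; exists v.
have ow p : p \in s -> pair p.1 (proj2 s w) = 0 by exact: proj2_orth.
pose p := ((pair v (proj2 s w))^-1 *: proj1 s v, proj2 s w).
exists [:: p]; split.
  rewrite cats1; apply: dual_rcons => //.
    by rewrite (bilZl Hb) pair_proj1// mulVf.
  by move=> q qs; rewrite (bilZl Hb) proj1_orth// mulr0.
rewrite wE; apply: (subspaceD (S1 [:: p])); last exact: sums.
apply: (@span_on_in _ _ _ (mem (s ++ [:: p])) snd p).
by rewrite /= mem_cat inE eqxx orbT.
Qed.

(** Back and forth: each stage brings the next vector of both given bases into the spans. A vector
    outside is projected off the current system and normalized against a projected partner. *)
Lemma mackey (e : nat -> V) (f : nat -> W) :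
  (forall v, span_on predT e v) -> (forall w, span_on predT f w) ->
  exists (v : nat -> V) (w : nat -> W), [/\ forall i j, pair (v i) (w j) = (i == j)%:R,
    forall u, span_on predT v u & forall u, span_on predT w u].
Proof.
move=> eV fW.
pose Q j s := span_on (mem s) fst (e j) /\ span_on (mem s) snd (f j).
have sub s t : {subset s <= s ++ t} by move=> p; rewrite mem_cat => ->.
have Qmono j s t : Q j s -> Q j (s ++ t).
  move=> [H1 H2]; split; [apply: (span_on_mono _ H1)|apply: (span_on_mono _ H2)]; exact: sub.
have Pp s t : dual (s ++ t) -> dual s.
  move=> d i j ii jj; have := d i j; rewrite !nth_cat ii jj size_cat.
  by apply; rewrite ltn_addr.
have [|j s ds|x [Px Qx]] := @chain_limit _ (0, 0) dual Q _ Pp Qmono.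
- by [].
- have [t1 [d1 e1]] := dual_extV (e j) ds.
  have [t2 [d2 f2]] := dual_extW (f j) d1.
  (* The two previous extensions may be empty; this one supplies the length required by
     [chain_limit]. *)
  have [t3 [d3 n3]] := extend_size Vinf
    (fun s v Hs => dual_extV v Hs) j.+1 d2.
  exists (t1 ++ (t2 ++ t3)); rewrite !catA; split=> //.
  apply: Qmono; split=> //; exact: (span_on_mono (sub (s ++ t1) t2) e1).
have xin (U : lmodType K) (pr : V * W -> U) n u :
    span_on (mem (mkseq x n)) pr u -> span_on predT (pr \o x) u.
  apply: lspan_mono => _ [p /mapP[i _ ->] <-]; by exists i.
exists (fst \o x), (snd \o x); split.
- move=> i j; have := Px (maxn i j).+1 i j; rewrite size_mkseq !ltnS leq_maxl leq_maxr.
  rewrite !nth_mkseq ?ltnS ?leq_maxl ?leq_maxr//; exact.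
- move=> u; apply: (lspan_min (span_on_subspace _ _) _ (eV u)) => _ [j _ <-].
  by have [n [H _]] := Qx j; exact: xin H.
- move=> u; apply: (lspan_min (span_on_subspace _ _) _ (fW u)) => _ [j _ <-].
  by have [n [_ H]] := Qx j; exact: xin H.
Qed.

End Mackey.

Section Hyperbolic.
Variables (K : numClosedFieldType) (V : lmodType K) (form : V -> V -> K) (eta : K).
Hypothesis Hb : bil form.
Hypothesis Hnd : nondegenerate_pairing form.
Hypothesis form_sym : forall u v, form u v = eta * form v u.
Hypothesis eta2 : eta = 1 \/ eta = -1.
Hypothesis Vinf : infdim V.
Implicit Types s t : seq (V * V).

Let hyp s := forall i j, (i < size s)%N -> (j < size s)%N ->
  [/\ form (nth 0 s i).1 (nth 0 s j).1 = 0, form (nth 0 s i).2 (nth 0 s j).2 = 0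
    & form (nth 0 s i).1 (nth 0 s j).2 = (i == j)%:R].

Let orth s u := forall p, p \in s -> form u p.1 = 0 /\ form u p.2 = 0.
Let sp2 s : set V := lspan [set u | exists2 p, p \in s & u = p.1 \/ u = p.2].

Let eta_sq : eta * eta = 1.
Proof. by case: eta2 => ->; rewrite ?mulrNN mulr1. Qed.

Lemma form_sym0 u v : form u v = 0 -> form v u = 0.
Proof. by move=> H; rewrite form_sym H mulr0. Qed.

Lemma hyp_rcons s a b : hyp s -> orth s a -> orth s b -> form a a = 0 -> form b b = 0 ->
  form a b = 1 -> hyp (rcons s (a, b)).
Proof.
move=> hs oa ob aa bb ab i j; rewrite size_rcons !ltnS !nth_rcons => ii jj.
case: (ltngtP i (size s)) ii => // [ii|->] _.
  have [a1 a2] := oa _ (mem_nth 0 ii); have [b1 b2] := ob _ (mem_nth 0 ii).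
  case: (ltngtP j (size s)) jj => // [jj|->] _; first exact: hs.
  by split; [exact: form_sym0 | exact: form_sym0 | rewrite (form_sym0 b1) ltn_eqF].
case: (ltngtP j (size s)) jj => // jj _.
have [a1 a2] := oa _ (mem_nth 0 jj); have [b1 b2] := ob _ (mem_nth 0 jj).
by split.
Qed.

Lemma sp2_subspace s : is_subspace (sp2 s). Proof. exact: lspan_subspace. Qed.

Lemma orth_subspace s : is_subspace (orth s).
Proof.
split=> [p _|a u v Hu Hv p ps]; first by rewrite !(bil0l Hb).
by have [u1 u2] := Hu p ps; have [v1 v2] := Hv p ps; rewrite !Hb.1 u1 u2 v1 v2 mulr0 addr0.
Qed.

Lemma orth_sp2 s u v : orth s u -> sp2 s v -> form u v = 0.
Proof.
move=> Hu Hv; apply: (lspan_lin (bil_linr Hb u) (set0_subspace _) _ Hv).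
by move=> _ [p /Hu[H1 H2] [->|->]].
Qed.

Lemma orth_proj s u : hyp s -> exists2 u', orth s u' & sp2 s (u - u').
Proof.
move=> hs.
pose z := \sum_(i < size s) (form u (nth 0 s i).2 *: (nth 0 s i).1 +
    (eta * form u (nth 0 s i).1) *: (nth 0 s i).2).
exists (u - z); last first.
  rewrite subKr; apply: (subspace_sum (sp2_subspace s)) => i _.
  apply: (subspaceD (sp2_subspace s)); apply: (subspaceZ (sp2_subspace s)); apply: sub_lspan.
    by exists (nth 0 s i); [exact: mem_nth | left].
  by exists (nth 0 s i); [exact: mem_nth | right].
move=> _ /(nthP 0)[j sj <-]; rewrite !(bilBl Hb) !(bil_suml Hb).
have E i : (i < size s)%N -> form (nth 0 s i).2 (nth 0 s j).1 = eta * (i == j)%:R.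
  by move=> si; rewrite form_sym; have [_ _ ->] := hs j i sj si; rewrite eq_sym.
split.
  rewrite (bigD1 (Ordinal sj))//= (bilDl Hb) !(bilZl Hb) E// eqxx.
  have [-> _ _] := hs j j sj sj; rewrite mulr0 add0r mulr1 mulrAC eta_sq mul1r big1 ?addr0 ?subrr//.
  move=> i /negbTE ij; rewrite (bilDl Hb) !(bilZl Hb) E//; have [-> _ _] := hs i j (ltn_ord i) sj.
  by rewrite -[_ == j]/(i == Ordinal sj) ij !mulr0 addr0.
rewrite (bigD1 (Ordinal sj))//= (bilDl Hb) !(bilZl Hb).
have [_ -> ->] := hs j j sj sj; rewrite eqxx mulr0 addr0 mulr1 big1 ?addr0 ?subrr//.
move=> i /negbTE ij; rewrite (bilDl Hb) !(bilZl Hb); have [_ -> ->] := hs i j (ltn_ord i) sj.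
by rewrite -[_ == j]/(i == Ordinal sj) ij !mulr0 addr0.
Qed.

Lemma orth_partner s v : hyp s -> orth s v -> v != 0 -> exists2 u, orth s u & form v u != 0.
Proof.
move=> hs ov v0; have [w vw] : exists w, form v w != 0.
  apply: contrapT => H; case/eqP: v0; apply: Hnd.1 => w.
  by apply/eqP; apply/negPn/negP => Hw; apply: H; exists w.
have [u ou uw] := orth_proj w hs; exists u => //.
by have := orth_sp2 ov uw; rewrite (bilBr Hb) => /eqP; rewrite subr_eq0 => /eqP <-.
Qed.

Lemma sp2_findim s : findim (sp2 s).
Proof.
apply: (findim_sub _ (findim_seq id (map fst s ++ map snd s))).
apply: lspan_min; first exact: span_on_subspace.
move=> u [p ps [->|->]].
  apply: (@span_on_in _ _ _ (mem (map fst s ++ map snd s)) id).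
  by rewrite /= mem_cat map_f.
apply: (@span_on_in _ _ _ (mem (map fst s ++ map snd s)) id).
by rewrite /= mem_cat map_f ?orbT.
Qed.

(* When [v] is anisotropic, a vector [u] orthogonal to [v] and to [s] with
   [form u u = - form v v] makes [v + u] isotropic. *)
Lemma isotropic_partner s v : hyp s -> orth s v -> v != 0 ->
  exists a, [/\ orth s a, form a a = 0 & form v a = 1] \/ (form v v = 0 /\ orth s a /\ form v a = 1).
Proof.
move=> hs ov v0; have Sorth := orth_subspace s.
have [q0|q0] := eqVneq (form v v) 0.
  have [u ou vu] := orth_partner hs ov v0; exists ((form v u)^-1 *: u); right.
  split=> //; split; first exact: (subspaceZ Sorth).
  by rewrite (bilZr Hb) mulVf.
have eta1 : eta = 1.
  case: eta2 => // e1; have := form_sym v v; rewrite e1 mulN1r => /eqP.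
  by rewrite -addr_eq0 -mulr2n mulrn_eq0 (negbTE q0).
have sym u w : form u w = form w u by rewrite form_sym eta1 mul1r.
pose D u := orth s u /\ form v u = 0.
have projD w : exists2 w', orth s w' & exists2 u, D u & w' = u + (form v w' / form v v) *: v /\ sp2 s (w - w').
  have [w' ow' Hw'] := orth_proj w hs; exists w' => //.
  exists (w' - (form v w' / form v v) *: v); last by rewrite subrK.
  split; first by apply: (subspaceB Sorth) => //; exact: (subspaceZ Sorth).
  by rewrite (bilBr Hb) (bilZr Hb) mulfVK// subrr.
have [u [ou vu] uu] : exists2 u, D u & form u u != 0.
  (* Otherwise polarization makes the form vanish on all of [D], nondegeneracy gives D = 0, and [V]
     is spanned by [v] and the finitely many vectors of [s]. *)
  apply: contrapT => Hno.
  have {}Hno u : D u -> form u u = 0.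
    by move=> Du; apply/eqP; apply/negPn/negP => Hu; apply: Hno; exists u.
  have Hno2 u w : D u -> D w -> form u w = 0.
    move=> [ou vu] [ow vw]; have : D (u + w).
      by split; [exact: (subspaceD Sorth) | rewrite (bilDr Hb) vu vw addr0].
    move=> /Hno; rewrite (bilDl Hb) !(bilDr Hb) !Hno// add0r addr0 (sym w u) => /eqP.
    by rewrite -mulr2n mulrn_eq0 => /eqP.
  have Du0 u : D u -> u = 0.
    move=> Du; apply: Hnd.1 => w; have [w' ow' [y Dy [w'E Hw']]] := projD w.
    have := orth_sp2 Du.1 Hw'; rewrite (bilBr Hb) => /eqP; rewrite subr_eq0 => /eqP ->.
    by rewrite w'E (bilDr Hb) (bilZr Hb) Hno2// (sym u v) Du.2 mulr0 addr0.
  apply: Vinf; apply: (findim_sub _ (sp2_findim (rcons s (v, v)))) => w _.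
  have [w' ow' [y /Du0 -> [w'E Hw']]] := projD w.
  have S2 := sp2_subspace (rcons s (v, v)).
  rewrite -(subrK w' w); apply: (subspaceD S2).
    apply: lspan_mono Hw' => z [p ps Hp]; exists p => //.
    by rewrite mem_rcons inE ps orbT.
  rewrite w'E add0r; apply: (subspaceZ S2); apply: sub_lspan; exists (v, v).
    by rewrite mem_rcons inE eqxx.
  by left.
pose c := sqrtC (- form v v / form u u).
have cc : c * c * form u u = - form v v by rewrite -expr2 sqrtCK mulfVK.
exists ((form v v)^-1 *: (v + c *: u)); left; split.
- apply: (subspaceZ Sorth); apply: (subspaceD Sorth) => //; exact: (subspaceZ Sorth).
- rewrite (bilZl Hb) (bilZr Hb) (bilDl Hb) !(bilDr Hb) !(bilZl Hb) !(bilZr Hb).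
  by rewrite (sym u v) vu !mulr0 addr0 add0r [c * (c * _)]mulrA cc subrr !mulr0.
- by rewrite (bilZr Hb) (bilDr Hb) (bilZr Hb) vu mulr0 addr0 mulVf.
Qed.

(** Given an isotropic vector and a second one pairing to 1 with it, subtracting half the norm of
    the second along the first makes it isotropic as well; [v] is one of the two or their
    combination. *)
Lemma hyp_plane s v : hyp s -> orth s v -> v != 0 -> exists a b x y,
  [/\ orth s a, orth s b, form a a = 0, form b b = 0 & form a b = 1 /\ v = x *: a + y *: b].
Proof.
move=> hs ov v0; have Sorth := orth_subspace s.
have two0 : (2%:R : K) != 0 by rewrite pnatr_eq0.
have [a [[oa aa va]|[vv [oa va]]]] := isotropic_partner hs ov v0.
- pose c := form v v / 2%:R.
  have av : form a v = eta by rewrite form_sym va mulr1.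
  have Hc : eta * form v v = form v v by rewrite -form_sym.
  exists a, (eta *: (v - (eta * c) *: a)), (eta * c), eta; split=> //.
  + by apply: (subspaceZ Sorth); apply: (subspaceB Sorth) => //; exact: (subspaceZ Sorth).
  + rewrite (bilZl Hb) (bilZr Hb) (bilBl Hb) !(bilBr Hb) !(bilZl Hb) !(bilZr Hb) aa va av.
    have Hec : eta * c = c by rewrite /c mulrA Hc.
    have vvE : form v v = c + c by rewrite -mulr2n -mulr_natr /c divfK.
    have Hce : c * eta = c by rewrite mulrC.
    by rewrite vvE Hec Hce !mulr0 subr0 mulr1 addrK subrr !mulr0.
  + split; first by rewrite (bilZr Hb) (bilBr Hb) (bilZr Hb) aa mulr0 subr0 av eta_sq.
    by rewrite scalerA eta_sq scale1r addrC subrK.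
- pose c := form a a / 2%:R.
  have av : form a v = eta by rewrite form_sym va mulr1.
  have Hc : eta * form a a = form a a by rewrite -form_sym.
  exists v, (a - c *: v), 1, 0; split=> //.
  + by apply: (subspaceB Sorth) => //; exact: (subspaceZ Sorth).
  + rewrite (bilBl Hb) !(bilBr Hb) !(bilZl Hb) !(bilZr Hb) va av vv.
    have Hec : eta * c = c by rewrite /c mulrA Hc.
    have aaE : form a a = c + c by rewrite -mulr2n -mulr_natr /c divfK.
    have Hce : c * eta = c by rewrite mulrC.
    by rewrite aaE Hce !mulr0 subr0 mulr1 addrK subrr.
  + split; first by rewrite (bilBr Hb) (bilZr Hb) vv mulr0 subr0 va.
    by rewrite scale1r scale0r addr0.
Qed.

Lemma sp2_mono s t : sp2 s `<=` sp2 (s ++ t).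
Proof.
by apply: lspan_mono => u [p ps Hp]; exists p => //; rewrite mem_cat ps.
Qed.

Lemma hyp_ext s v : hyp s -> exists t, hyp (s ++ t) /\ sp2 (s ++ t) v.
Proof.
move=> hs; have [u ou vu] := orth_proj v hs.
have [u0|u0] := eqVneq u 0.
  by exists [::]; rewrite cats0; split=> //; rewrite -(subr0 v) -u0.
have [a [b [x [y [oa ob aa bb [ab uE]]]]]] := hyp_plane hs ou u0.
exists [:: (a, b)]; have S2 := sp2_subspace (s ++ [:: (a, b)]); split.
  by rewrite cats1; exact: hyp_rcons.
rewrite -(subrK u v); apply: (subspaceD S2); first exact: sp2_mono.
have pin : (a, b) \in s ++ [:: (a, b)] by rewrite mem_cat inE eqxx orbT.
rewrite uE; apply: (subspaceD S2); apply: (subspaceZ S2); apply: sub_lspan; exists (a, b) => //.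
  by left.
by right.
Qed.

Lemma hyp_size n s : hyp s -> exists t, hyp (s ++ t) /\ (n <= size (s ++ t))%N.
Proof.
elim: n s => [|n IHn] s hs; first by exists [::]; rewrite cats0.
have [t [ht nt]] := IHn s hs.
have [v nv] : exists v, ~ sp2 (s ++ t) v.
  apply: contrapT => H; apply: Vinf; apply: (findim_sub _ (sp2_findim (s ++ t))) => v _.
  by apply: contrapT => nv; apply: H; exists v.
have [t' [ht' vt']] := hyp_ext v ht; exists (t ++ t'); rewrite catA; split=> //.
case: t' ht' vt' => [|p t'] _; first by rewrite cats0.
by move=> _; rewrite size_cat /= addnS ltnS (leq_trans nt) ?leq_addr.
Qed.

Lemma hyperbolic_basis (e : nat -> V) : (forall v, span_on predT e v) ->
  exists x : nat -> V * V, (forall i j, [/\ form (x i).1 (x j).1 = 0, form (x i).2 (x j).2 = 0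
      & form (x i).1 (x j).2 = (i == j)%:R])
    /\ forall u, span_on predT (fun p : nat * bool => if p.2 then (x p.1).2 else (x p.1).1) u.
Proof.
move=> eV.
have Pp s t : hyp (s ++ t) -> hyp s.
  move=> d i j ii jj; have := d i j; rewrite !nth_cat ii jj size_cat.
  by apply; rewrite ltn_addr.
have Qmono j s t : sp2 s (e j) -> sp2 (s ++ t) (e j) by exact: sp2_mono.
have [|j s ds|x [Px Qx]] := @chain_limit _ (0, 0) hyp (fun j s => sp2 s (e j)) _ Pp Qmono.
- by [].
- have [t1 [d1 e1]] := hyp_ext (e j) ds.
  have [t2 [d2 n2]] := hyp_size j.+1 d1.
  by exists (t1 ++ t2); rewrite catA; split=> //; exact: Qmono.
exists x; split.
  move=> i j; have := Px (maxn i j).+1 i j; rewrite size_mkseq !ltnS leq_maxl leq_maxr.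
  rewrite !nth_mkseq ?ltnS ?leq_maxl ?leq_maxr//; exact.
move=> u; apply: (lspan_min (span_on_subspace _ _) _ (eV u)) => _ [j _ <-].
have [n Hn] := Qx j; apply: (lspan_min (span_on_subspace _ _) _ Hn) => _ [p /mapP[i _ ->] [->|->]].
  exact: (@span_on_in _ _ _ predT (fun p : nat * bool => if p.2 then (x p.1).2 else (x p.1).1) (i, false)).
exact: (@span_on_in _ _ _ predT (fun p : nat * bool => if p.2 then (x p.1).2 else (x p.1).1) (i, true)).
Qed.

End Hyperbolic.

Section BasisMaps.
Variables (K : fieldType) (V : lmodType K).

Lemma basis_bijective (I : eqType) (D : pred I) (a a' : I -> V) (phi : {linear V -> V}) :
  basis_on D a -> basis_on D a' -> (forall i, D i -> phi (a i) = a' i) -> bijective phi.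
Proof.
move=> Ba Ba' H; have [psi Hpsi] := basis_ext a Ba'.
have eqid (f : V -> V) (b : I -> V) : basis_on D b -> lin f ->
    (forall i, D i -> f (b i) = b i) -> f =1 id.
  move=> [_ Sb] Hf fb v; apply/eqP; rewrite -subr_eq0; apply/eqP.
  have HL : lin (fun v => f v - v).
    by move=> k x y; rewrite Hf scalerBr opprD addrACA.
  apply: (lspan_lin HL (set0_subspace _) _ (Sb v)).
  by move=> _ [i Di <-] /=; rewrite fb// subrr.
exists psi.
  apply: (eqid _ a Ba) => [k x y|i Di]; first by rewrite !linearP.
  by rewrite H// Hpsi.
apply: (eqid _ a' Ba') => [k x y|i Di]; first by rewrite !linearP.
by rewrite Hpsi// H.
Qed.

Lemma bijective_basis (I : eqType) (D : pred I) (a : I -> V) (phi : {linear V -> V}) :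
  bijective phi -> basis_on D a -> basis_on D (phi \o a).
Proof.
move=> [g gK Kg] [Fa Sa]; split.
  move=> s c us sD E i si; apply: (Fa s c us sD _ i si); apply: (can_inj gK).
  by rewrite linear0 linear_sum -[RHS]E; apply: eq_bigr => j _; rewrite linearZ.
move=> v; rewrite -(Kg v); apply: (lspan_lin (linear_lin phi) (span_on_subspace _ _) _ (Sa (g v))).
by move=> _ [i Di <-]; exact: (@span_on_in _ _ _ D (phi \o a) i).
Qed.

Lemma reindex_basis (I : eqType) (D : pred I) (e : nat -> V) (r : I -> nat) (q : nat -> I) :
  (forall n, D (q n)) -> (forall n, r (q n) = n) -> (forall i, D i -> q (r i) = i) ->
  basis_on predT e -> basis_on D (e \o r).
Proof.
move=> Dq rq qr [Fe Se]; split.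
  move=> s c us sD E i si.
  have rinj : {in s &, injective r} by move=> x y /sD Dx /sD Dy /(congr1 q); rewrite !qr.
  have := Fe (map r s) (c \o q); rewrite map_inj_in_uniq// us big_map => /(_ isT).
  have -> : \sum_(j <- s) (c \o q) (r j) *: e (r j) = 0.
    by rewrite -[RHS]E; apply: eq_big_seq => j /sD Dj; rewrite /= qr.
  move=> /(_ (fun _ _ => isT) erefl (r i) (map_f r si)).
  by rewrite /= qr//; exact: sD.
move=> v; apply: (lspan_min (span_on_subspace _ _) _ (Se v)) => _ [n _ <-].
by rewrite -(rq n); exact: (@span_on_in _ _ _ D (e \o r) (q n)).
Qed.

Lemma has_dim_basis : has_dim [set: V] Aleph0 -> exists e : nat -> V, basis_on predT e.
Proof.
move=> /dim_quotP[e [_ Hs Hf]]; exists e; split.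
  by move=> s c us _; exact: Hf.
move=> v; have [s [c [_ _ /eqP]]] := Hs v Logic.I.
by rewrite subr_eq0 => /eqP ->; exact: span_on_sum.
Qed.

Lemma basis_infdim (e : nat -> V) : basis_on predT e -> infdim V.
Proof.
move=> [Fe _] [n [b Hb]].
suff : (n.+1 <= n)%N by rewrite ltnn.
apply: (@free_le _ _ _ _ e b); last by move=> i _; exact: Hb.
by move=> s c us _; exact: Fe.
Qed.

End BasisMaps.

Lemma dual_free (K : fieldType) (V W : lmodType K) (pair : V -> W -> K) (I : eqType)
  (v : I -> V) (w : I -> W) : bil pair ->
  (forall i j, pair (v i) (w j) = (i == j)%:R) -> free_on predT v.
Proof.
move=> Hb vw s c us _ E i si; have := congr1 (fun u => pair u (w i)) E.
rewrite /= (bil0l Hb) (bil_suml Hb) (bigD1_seq i)//= (bilZl Hb) vw eqxx mulr1 big1 ?addr0//.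
by move=> j /negbTE ji; rewrite (bilZl Hb) vw ji mulr0.
Qed.

Lemma gram_pair (K : fieldType) (V W V' W' : lmodType K) (pair : V -> W -> K) (pair' : V' -> W' -> K)
  (I J : eqType) (D : pred I) (E : pred J) (a : I -> V) (b : J -> W)
  (phi : {linear V -> V'}) (psi : {linear W -> W'}) :
  bil pair -> bil pair' -> basis_on D a -> basis_on E b ->
  (forall i j, D i -> E j -> pair' (phi (a i)) (psi (b j)) = pair (a i) (b j)) ->
  forall v w, pair' (phi v) (psi w) = pair v w.
Proof.
move=> Hb Hb' [_ Sa] [_ Sb] H v w; apply/eqP; rewrite -subr_eq0; apply/eqP.
have L1 : lin (fun v => pair' (phi v) (psi w) - pair v w : K^o).
  by move=> k x y; rewrite linearP Hb'.1 Hb.1 scalerBr opprD addrACA.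
apply: (lspan_lin L1 (set0_subspace _) _ (Sa v)) => _ [i Di <-] /=.
have L2 : lin (fun w => pair' (phi (a i)) (psi w) - pair (a i) w : K^o).
  by move=> k x y; rewrite linearP Hb'.2 Hb.2 scalerBr opprD addrACA.
apply: (lspan_lin L2 (set0_subspace _) _ (Sb w)) => _ [j Ej <-] /=.
by rewrite H// subrr.
Qed.

Section GramForm.
Variables (K : fieldType) (V W : lmodType K) (I J : eqType) (D : pred I) (E : pred J).
Variables (a : I -> V) (b : J -> W) (B : I -> J -> K).
Hypothesis Ba : basis_on D a.
Hypothesis Bb : basis_on E b.

Lemma gram_form : exists pB : V -> W -> K, bil pB /\
  forall i j, D i -> E j -> pB (a i) (b j) = B i j.
Proof.
have /choice[L HL] : forall j, exists F : {linear V -> K^o}, forall i, D i -> F (a i) = B i j.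
  by move=> j; exact: (basis_ext (fun i => B i j : K^o) Ba).
have /choice[M HM] : forall v, exists F : {linear W -> K^o}, forall j, E j -> F (b j) = L j v.
  by move=> v; exact: (basis_ext (fun j => L j v) Bb).
exists (fun v w => M v w); split; last by move=> i j Di Ej; rewrite HM// HL.
split=> [w k u v|v k w w']; last by rewrite linearP.
apply/eqP; rewrite -subr_eq0; apply/eqP.
have HF : lin (fun w => M (k *: u + v) w - (k * M u w + M v w) : K^o).
  move=> c x y; rewrite !linearP /GRing.scale /=.
  by ring.
case: Bb => _ Sb.
apply: (lspan_lin HF (set0_subspace _) _ (Sb w)) => _ [j Ej <-] /=.
by rewrite !HM// linearP /= subrr.
Qed.

Lemma gram_nondegenerate pB : bil pB -> (forall i j, D i -> E j -> pB (a i) (b j) = B i j) ->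
  (forall s c, uniq s -> {subset s <= D} ->
    (forall j, E j -> \sum_(i <- s) c i * B i j = 0) -> forall i, i \in s -> c i = 0) ->
  (forall s c, uniq s -> {subset s <= E} ->
    (forall i, D i -> \sum_(j <- s) c j * B i j = 0) -> forall j, j \in s -> c j = 0) ->
  nondegenerate_pairing pB.
Proof.
move=> Hb HB N1 N2; split.
  move=> v Hv; have [s [c [us sD _ vE]]] := span_rep (Ba.2 v).
  rewrite vE big1_seq// => i /andP[_ si]; rewrite (N1 s c us sD _ i si) ?scale0r// => j Ej.
  rewrite -[RHS](Hv (b j)) vE (bil_suml Hb); apply: eq_big_seq => k /sD Dk.
  by rewrite (bilZl Hb) HB.
move=> w Hw; have [s [c [us sE _ wE]]] := span_rep (Bb.2 w).
rewrite wE big1_seq// => i /andP[_ si]; rewrite (N2 s c us sE _ i si) ?scale0r// => j Dj.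
rewrite -[RHS](Hw (a j)) wE (bil_sumr Hb); apply: eq_big_seq => k /sE Ek.
by rewrite (bilZr Hb) HB.
Qed.

End GramForm.

(** * Realization of prescribed Gram matrices *)

Section Realize.
Variables (K : numClosedFieldType) (V : lmodType K).
Hypothesis V_dim : has_dim [set: V] Aleph0.

Lemma basis_reindexed (I : countType) (D : pred I) : infinite_set [set i | D i] ->
  exists a : I -> V, basis_on D a.
Proof.
move=> /enum_pred[r [q [Dq rq qr]]]; have [e He] := has_dim_basis V_dim.
by exists (e \o r); exact: (reindex_basis Dq rq qr).
Qed.

(** A second pairing with Gram matrix [B] is put on the same spaces. Both pairings have dual bases,
    and the maps matching these bases carry the second pairing to the given one. *)
Lemma realize_pair (W : lmodType K) (pair : V -> W -> K) (I J : countType)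
    (D : pred I) (E : pred J) (B : I -> J -> K) :
  has_dim [set: W] Aleph0 -> bil pair -> nondegenerate_pairing pair ->
  infinite_set [set i | D i] -> infinite_set [set j | E j] ->
  (forall s c, uniq s -> {subset s <= D} ->
    (forall j, E j -> \sum_(i <- s) c i * B i j = 0) -> forall i, i \in s -> c i = 0) ->
  (forall s c, uniq s -> {subset s <= E} ->
    (forall i, D i -> \sum_(j <- s) c j * B i j = 0) -> forall j, j \in s -> c j = 0) ->
  exists (a : I -> V) (b : J -> W), [/\ basis_on D a, basis_on E b
    & forall i j, D i -> E j -> pair (a i) (b j) = B i j].
Proof.
move=> W_dim Hb Hnd Di Ei N1 N2.
have [a Ba] := basis_reindexed Di.
have [b Bb] : exists b : J -> W, basis_on E b.
  move: Ei => /enum_pred[r [q [Dq rq qr]]]; have [e He] := has_dim_basis W_dim.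
  by exists (e \o r); exact: (reindex_basis Dq rq qr).
have [pB [HpB pBE]] := gram_form B Ba Bb.
have pBnd := gram_nondegenerate Ba Bb HpB pBE N1 N2.
have [e He] := has_dim_basis V_dim; have [f Hf] := has_dim_basis W_dim.
have Vinf := basis_infdim He.
have [v [w [vw Sv Sw]]] := mackey Hb Hnd Vinf He.2 Hf.2.
have [v' [w' [vw' Sv' Sw']]] := mackey HpB pBnd Vinf He.2 Hf.2.
have Bv : basis_on predT v by split=> //; exact: dual_free Hb vw.
have Bv' : basis_on predT v' by split=> //; exact: dual_free HpB vw'.
have Bw : basis_on predT w.
  by split=> //; apply: (dual_free (bil_swap Hb) (w := v)) => i j; rewrite vw eq_sym.
have Bw' : basis_on predT w'.
  by split=> //; apply: (dual_free (bil_swap HpB) (w := v')) => i j; rewrite vw' eq_sym.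
have [phi Hphi] := basis_ext v Bv'; have [psi Hpsi] := basis_ext w Bw'.
have pE : forall x y, pair (phi x) (psi y) = pB x y.
  by apply: (gram_pair HpB Hb Bv' Bw') => i j _ _; rewrite Hphi// Hpsi// vw vw'.
exists (phi \o a), (psi \o b); split.
- exact: bijective_basis (basis_bijective Bv' Bv Hphi) Ba.
- exact: bijective_basis (basis_bijective Bw' Bw Hpsi) Bb.
- by move=> i j Di' Ej; rewrite /= pE pBE.
Qed.

Lemma hyperbolic_basis_on (form : V -> V -> K) eta : bil form -> nondegenerate_pairing form ->
  (forall u v, form u v = eta * form v u) -> eta = 1 \/ eta = -1 ->
  exists x : nat * bool -> V, basis_on predT x /\
    forall p q, form (x p) (x q) = if (p.1 == q.1) && (p.2 != q.2) then (if p.2 then eta else 1) else 0.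
Proof.
move=> Hb Hnd Hs He; have [e Be] := has_dim_basis V_dim.
have Vinf := basis_infdim Be.
have [x [Hx Sx]] := hyperbolic_basis Hb Hnd Hs He Vinf Be.2.
pose y (p : nat * bool) := if p.2 then (x p.1).2 else (x p.1).1.
have yE p q : form (y p) (y q) =
    if (p.1 == q.1) && (p.2 != q.2) then (if p.2 then eta else 1) else 0.
  case: p q => i [] [j []]; rewrite /y /= ?andbF ?andbT.
  - by case: (Hx i j).
  - rewrite Hs; have [_ _ ->] := Hx j i; rewrite eq_sym.
    by case: eqP; rewrite ?mulr1 ?mulr0.
  - by have [_ _ ->] := Hx i j; case: eqP.
  - by case: (Hx i j).
exists y; split=> //; split=> //.
pose w (p : nat * bool) := (if p.2 then eta else 1) *: y (p.1, ~~ p.2).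
have ee : eta * eta = 1 by case: He => ->; rewrite ?mulrNN mulr1.
apply: (dual_free Hb (w := w)) => -[i bi] [j bj]; rewrite /w (bilZr Hb) yE /= xpair_eqE.
case: eqP => _; last by rewrite mulr0.
by case: bi bj => -[] /=; rewrite ?mulr0 ?mulr1.
Qed.

(** The form with Gram matrix [B] has the same sign [eta] as the given one, so hyperbolic bases of
    the two forms have equal Gram matrices and can be matched. *)
Lemma realize_form (form : V -> V -> K) eta (I : countType) (D : pred I) (B : I -> I -> K) :
  bil form -> nondegenerate_pairing form ->
  (forall u v, form u v = eta * form v u) -> eta = 1 \/ eta = -1 ->
  infinite_set [set i | D i] ->
  (forall i j, D i -> D j -> B i j = eta * B j i) ->
  (forall s c, uniq s -> {subset s <= D} ->
    (forall j, D j -> \sum_(i <- s) c i * B i j = 0) -> forall i, i \in s -> c i = 0) ->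
  exists a : I -> V, basis_on D a /\ forall i j, D i -> D j -> form (a i) (a j) = B i j.
Proof.
move=> Hb Hnd Hs He Di Bs N1.
have [a Ba] := basis_reindexed Di.
have [pB [HpB pBE]] := gram_form B Ba Ba.
have ee : eta * eta = 1 by case: He => ->; rewrite ?mulrNN mulr1.
have pBs u v : pB u v = eta * pB v u.
  apply: (gram_pair (pair := fun u v => eta * pB v u) (phi := idfun) (psi := idfun) _ HpB Ba Ba).
    by split=> *; rewrite (HpB.1, HpB.2) mulrDr mulrCA.
  by move=> i j Di' Dj; rewrite /= !pBE// Bs.
have pBnd : nondegenerate_pairing pB.
  apply: (gram_nondegenerate Ba Ba HpB pBE N1) => s c us sD H.
  apply: (N1 s c us sD) => j Dj.
  have E0 : eta * (\sum_(i <- s) c i * B j i) = 0 by rewrite H// mulr0.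
  rewrite -[RHS]E0 mulr_sumr.
  by apply: eq_big_seq => i /sD Di'; rewrite Bs// mulrCA.
have [x [Bx xE]] := hyperbolic_basis_on Hb Hnd Hs He.
have [x' [Bx' xE']] := hyperbolic_basis_on HpB pBnd pBs He.
have [phi Hphi] := basis_ext x Bx'.
have pE : forall u v, form (phi u) (phi v) = pB u v.
  by apply: (gram_pair HpB Hb Bx' Bx') => i j _ _; rewrite !Hphi// xE xE'.
exists (phi \o a); split; last by move=> i j Di' Dj; rewrite /= pE pBE.
exact: bijective_basis (basis_bijective Bx' Bx Hphi) Ba.
Qed.

End Realize.

(** * Dual families and their asymptotics *)

(** Cofinitely many (almost everywhere) and infinitely many (infinitely often) indices; finite
    exceptional sets are given by lists. *)
Definition ae (I : eqType) (P : I -> Prop) := exists s : seq I, forall i, i \notin s -> P i.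
Definition io (I : eqType) (P : I -> Prop) := forall s : seq I, exists i, i \notin s /\ P i.

Section AlmostEverywhere.
Variable I : eqType.
Implicit Types P Q : I -> Prop.

Lemma ae_and P Q : ae P -> ae Q -> ae (fun i => P i /\ Q i).
Proof.
move=> [s Hs] [t Ht]; exists (s ++ t) => i; rewrite mem_cat negb_or => /andP[/Hs ? /Ht ?].
by split.
Qed.

Lemma ae_sub P Q : (forall i, P i -> Q i) -> ae P -> ae Q.
Proof. by move=> PQ [s Hs]; exists s => i /Hs /PQ. Qed.

Lemma io_sub P Q : (forall i, P i -> Q i) -> io P -> io Q.
Proof. by move=> PQ Hs s; have [i [si /PQ ?]] := Hs s; exists i. Qed.

Lemma io_ae P Q : io P -> ae Q -> exists i, P i /\ Q i.
Proof. by move=> HP [s Hs]; have [i [/Hs Qi Pi]] := HP s; exists i. Qed.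

Lemma io_and_ae P Q : io P -> ae Q -> io (fun i => P i /\ Q i).
Proof.
move=> HP [s Hs] t; have [i [it Pi]] := HP (s ++ t); exists i.
move: it; rewrite mem_cat negb_or => /andP[/Hs Qi ->]; by split.
Qed.

Lemma not_ae P : ~ ae (fun i => ~ P i) -> io P.
Proof.
move=> H s; apply: contrapT => n; apply: H; exists s => i si Pi; apply: n.
by exists i.
Qed.

Lemma ae_bij P (p : I -> I) : bijective p -> ae (fun i => P (p i)) -> ae P.
Proof.
move=> [q pK Kp] [s Hs]; exists (map p s) => i; rewrite -{1}(Kp i) (mem_map (can_inj pK)).
by move=> /Hs; rewrite Kp.
Qed.

Lemma io_bij P (p : I -> I) : bijective p -> io (fun i => P (p i)) -> io P.
Proof.
move=> [q pK Kp] H s; have [i [si Pi]] := H (map q s); exists (p i); split=> //.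
by rewrite -(mem_map (can_inj Kp)) pK.
Qed.

End AlmostEverywhere.

Definition dle (d c : dimension) := forall k, below d k -> below c k.

(* Indexes a basis of V adapted to the subspaces S and X = T^perp: [inl (inl i)] for S,
   [inl (inr k)] for X and [inr k] for a complement of their sum. *)
Notation ext I := ((I + nat) + nat)%type.

Definition cat3 (I T : Type) (e : I -> T) (x p : nat -> T) (i : ext I) : T :=
  match i with inl (inl i) => e i | inl (inr k) => x k | inr k => p k end.

Definition dom3 (I : Type) (d c : dimension) : pred (ext I) := fun i =>
  match i with inl (inl _) => true | inl (inr k) => below d k | inr k => below c k end.

Section Ext.
Variable I : eqType.
Implicit Types s : seq (ext I).

Definition getS (i : ext I) := if i is inl (inl j) then Some j else None.
Definition getX (i : ext I) := if i is inl (inr j) then Some j else None.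
Definition getP (i : ext I) := if i is inr j then Some j else None.

Lemma sum_ext (M : nmodType) s (F : ext I -> M) : \sum_(i <- s) F i =
  \sum_(i <- pmap getS s) F (inl (inl i)) + \sum_(k <- pmap getX s) F (inl (inr k))
  + \sum_(k <- pmap getP s) F (inr k).
Proof.
elim: s => [|[[i|k]|k] s IHs]; rewrite /= ?big_nil ?addr0// !big_cons IHs.
- by rewrite !addrA.
- by rewrite !addrA; congr (_ + _ + _); rewrite addrC.
- by rewrite [RHS]addrCA.
Qed.

Lemma getS_uniq s : uniq s -> uniq (pmap getS s).
Proof. by apply: (@pmap_uniq _ _ getS (fun i => inl (inl i))) => -[[]|]. Qed.
Lemma getX_uniq s : uniq s -> uniq (pmap getX s).
Proof. by apply: (@pmap_uniq _ _ getX (fun i => inl (inr i))) => -[[]|]. Qed.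
Lemma getP_uniq s : uniq s -> uniq (pmap getP s).
Proof. by apply: (@pmap_uniq _ _ getP (fun i => inr i)) => -[[]|]. Qed.

Lemma mem_getS s i : (i \in pmap getS s) = (inl (inl i) \in s).
Proof. by rewrite mem_pmap; elim: s => [|[[j|k]|k] s IHs] //=; rewrite !inE IHs. Qed.
Lemma mem_getX s i : (i \in pmap getX s) = (inl (inr i) \in s).
Proof. by rewrite mem_pmap; elim: s => [|[[j|k]|k] s IHs] //=; rewrite !inE IHs. Qed.
Lemma mem_getP s i : (i \in pmap getP s) = (inr i \in s).
Proof. by rewrite mem_pmap; elim: s => [|[[j|k]|k] s IHs] //=; rewrite !inE IHs. Qed.

Variables (K : fieldType) (V : lmodType K).

Lemma ext_basis (e : I -> V) (X : set V) d c : is_subspace X -> free_on predT e ->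
  (forall v, X v -> span_on predT e v -> v = 0) ->
  has_dim X d -> has_codim (sum_space X (span_on predT e)) c ->
  exists x p : nat -> V, [/\ basis_on (@dom3 I d c) (cat3 e x p),
    forall k, below d k -> X (x k), forall v, X v -> span_on (below d) x v,
    forall k, below c k -> ~ sum_space X (span_on predT e) (p k)
    & forall v, exists (s : seq nat) (cc : nat -> K), [/\ uniq s, {subset s <= below c}
        & sum_space X (span_on predT e) (v - \sum_(k <- s) cc k *: p k)]].
Proof.
move=> SX Fe XS /dim_quotP[x [Xx spx fx]] /dim_quotP[p [_ spp fp]].
have Xspan v : X v -> span_on (below d) x v.
  move=> /spx[s [cc [us sd /eqP]]]; rewrite subr_eq0 => /eqP ->.
  exact: span_on_sum.
have Ss := span_on_subspace predT e.
have SXS := sum_space_subspace SX Ss.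
exists x, p; split=> //; first last.
- by move=> v; exact: spp.
- move=> k kc Hk; have := fp [:: k] (fun _ => 1) isT; rewrite big_seq1 scale1r.
  have sk : {subset [:: k] <= below c} by move=> j; rewrite inE => /eqP ->.
  by move=> /(_ sk Hk k (mem_head _ _))/eqP; rewrite oner_eq0.
split.
  move=> s cc us sD; rewrite sum_ext /= => E.
  have Pz k : k \in pmap getP s -> cc (inr k) = 0.
    apply: (fp _ (fun k => cc (inr k)) (getP_uniq us)).
      by move=> j; rewrite mem_getP => /sD.
    move/eqP: E; rewrite addrC addr_eq0 => /eqP ->; apply: (subspaceN SXS).
    rewrite addrC.
    eexists; [|eexists; [|reflexivity]]; last by apply: span_on_sum.
    rewrite big_seq; apply: (subspace_sum SX) => j; rewrite mem_getX => /sD Dj.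
    by apply: (subspaceZ SX); exact: Xx.
  have P0 : \sum_(k <- pmap getP s) cc (inr k) *: p k = 0.
    by apply: big1_seq => k /andP[_ /Pz ->]; rewrite scale0r.
  rewrite P0 addr0 in E.
  have XE : X (\sum_(k <- pmap getX s) cc (inl (inr k)) *: x k).
    rewrite big_seq; apply: (subspace_sum SX) => j; rewrite mem_getX => /sD Dj.
    by apply: (subspaceZ SX); exact: Xx.
  have X0 : \sum_(k <- pmap getX s) cc (inl (inr k)) *: x k = 0.
    apply: XS => //; move/eqP: E; rewrite addrC addr_eq0 => /eqP ->.
    by apply: (subspaceN Ss); exact: span_on_sum.
  rewrite X0 addr0 in E.
  move=> [[i|k]|k] si.
  - by apply: (Fe _ (fun i => cc (inl (inl i))) (getS_uniq us) _ E); rewrite ?mem_getS.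
  - apply: (fx _ (fun k => cc (inl (inr k))) (getX_uniq us) _ X0); rewrite ?mem_getX//.
    by move=> j; rewrite mem_getX => /sD.
  - by apply: Pz; rewrite mem_getP.
move=> v; have [s [cc [us sc [x' Xx' [s' Ss' E]]]]] := spp v Logic.I.
have SB := span_on_subspace (@dom3 I d c) (cat3 e x p).
have -> : v = x' + s' + \sum_(k <- s) cc k *: p k by rewrite E subrK.
apply: (subspaceD SB); first apply: (subspaceD SB).
- apply: (lspan_min SB _ (Xspan _ Xx')) => _ [k kd <-].
  exact: (@span_on_in _ _ _ (@dom3 I d c) (cat3 e x p) (inl (inr k))).
- apply: (lspan_min SB _ Ss') => _ [k kd <-].
  exact: (@span_on_in _ _ _ (@dom3 I d c) (cat3 e x p) (inl (inl k))).
- rewrite big_seq; apply: (subspace_sum SB) => k /sc ck; apply: (subspaceZ SB).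
  exact: (@span_on_in _ _ _ (@dom3 I d c) (cat3 e x p) (inr k)).
Qed.

Lemma basis_dims (e : I -> V) (x p : nat -> V) (X : set V) d c :
  basis_on (@dom3 I d c) (cat3 e x p) -> (forall v, X v <-> span_on (below d) x v) ->
  has_dim X d /\ has_codim (sum_space X (span_on predT e)) c.
Proof.
move=> /basis_coord[cf [sp [cf_lin cf_rep cf_delta]]] HX.
have cfl i : lin (cf i : V -> K^o) by move=> k u v; rewrite cf_lin.
split; apply/dim_quotP.
  exists x; split.
  - by move=> k kd; apply/HX; exact: span_on_in.
  - move=> v /HX/span_rep[s [cc [us sd _ ->]]]; exists s, cc; split=> //.
    by rewrite subrr.
  - move=> s cc us sd E k ks; have := congr1 (cf (inl (inr k))) E.
    rewrite (lin_sum (cfl _)) (lin0 (cfl _)) (bigD1_seq k)//= big1_seq.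
      rewrite addr0 (linZ (cfl _)) (cf_delta _ (inl (inr k))) ?eqxx; last exact: sd.
      by move=> <-; symmetry; exact: mulr1.
    move=> j /andP[/negbTE jk js]; rewrite (linZ (cfl _)) (cf_delta _ (inl (inr j))); last exact: sd.
    by rewrite eq_sym /eq_op /= /eq_op /= jk; exact: mulr0.
exists p; split=> //.
- move=> v _; exists (pmap getP (sp v)), (fun k => cf (inr k) v).
  have [us sD _ vE] := cf_rep v.
  split; [exact: getP_uniq | by move=> j; rewrite mem_getP => /sD |].
  rewrite {1}vE sum_ext /= addrK addrC.
  eexists; [|eexists; [|reflexivity]]; last exact: span_on_sum.
  by apply/HX; apply: span_on_sum => j; rewrite mem_getX => /sD.
- move=> s cc us sc [x' /HX Hx' [s' Hs' E]] k ks.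
  have cfX : cf (inr k) x' = 0.
    apply: (lspan_lin (cfl _) (set0_subspace _) _ Hx') => _ [j jd <-] /=.
    by rewrite (cf_delta _ (inl (inr j))).
  have cfS : cf (inr k) s' = 0.
    apply: (lspan_lin (cfl _) (set0_subspace _) _ Hs') => _ [j jd <-] /=.
    by rewrite (cf_delta _ (inl (inl j))).
  have := congr1 (cf (inr k)) E; rewrite (linD (cfl _)) cfX cfS addr0.
  rewrite (lin_sum (cfl _)) (bigD1_seq k)//= big1_seq.
    rewrite addr0 (linZ (cfl _)) (cf_delta _ (inr k)) ?eqxx; last exact: sc.
    by move=> H; have := esym H; rewrite /GRing.scale /= mulr1.
  move=> j /andP[/negbTE jk js]; rewrite (linZ (cfl _)) (cf_delta _ (inr j)); last exact: sc.
  by rewrite eq_sym /eq_op /= jk; exact: mulr0.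
Qed.

End Ext.

(** Linear independence in the quotient of all sequences by the finitely supported ones. *)
Definition indep_at_inf (K : fieldType) (I : eqType) c (pf : nat -> I -> K) :=
  forall (s : seq nat) (cc : nat -> K), uniq s -> {subset s <= below c} ->
  ae (fun i => \sum_(k <- s) cc k * pf k i = 0) -> forall k, k \in s -> cc k = 0.

Section GLFamilies.
Variables (K : numClosedFieldType) (V W : lmodType K) (pair : V -> W -> K).
Hypothesis Hb : bil pair.
Hypothesis Hnd : nondegenerate_pairing pair.

Definition annV (T : set W) : set V := [set v | forall w, T w -> pair v w = 0].
Definition annW (S : set V) : set W := [set w | forall v, S v -> pair v w = 0].

Lemma annV_subspace T : is_subspace (annV T).
Proof.
split=> [w _|a u v Hu Hv w Tw]; first exact: bil0l.
by rewrite Hb.1 Hu// Hv// mulr0 addr0.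
Qed.

Lemma annV_span (J : eqType) (f : J -> W) v :
  annV (span_on predT f) v <-> forall j, pair v (f j) = 0.
Proof.
split=> [H j|H w Hw]; first by apply: H; exact: span_on_in.
apply: (lspan_lin (bil_linr Hb v) (set0_subspace _) _ Hw) => _ [j _ <-].
exact: H.
Qed.

Lemma annW_span (J : eqType) (e : J -> V) w :
  annW (span_on predT e) w <-> forall j, pair (e j) w = 0.
Proof.
split=> [H j|H v Hv]; first by apply: H; exact: span_on_in.
apply: (lspan_lin (bil_linl Hb w) (set0_subspace _) _ Hv) => _ [j _ <-].
exact: H.
Qed.

(** The rank invariant does not appear: it is forced to be 0, and the second clause expresses
    this. *)
Definition gl_family (I : eqType) (e : I -> V) (f : I -> W) d1 d2 c1 c2 :=
  let S := span_on predT e in let T := span_on predT f in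
  [/\ forall i j, pair (e i) (f j) = (i == j)%:R,
      forall v w, annV T v -> annW S w -> pair v w = 0,
      has_dim (annV T) d1 /\ has_dim (annW S) d2,
      has_codim (sum_space (annV T) S) c1
    & has_codim (sum_space (annW S) T) c2].

(* [pf k] is the sequence of pairings of the [k]-th vector spanning
   [V / (T^perp + S)] with the basis of [T]. *)
Definition gram (pf qf : nat -> nat -> K) (i j : ext nat) : K :=
  match i, j with
  | inl (inl i), inl (inl j) => (i == j)%:R
  | inl (inl i), inr l => qf l i
  | inr k, inl (inl j) => pf k j
  | inl (inr k), inr l | inr k, inl (inr l) => (k == l)%:R
  | _, _ => 0
  end.

Lemma gramC pf qf i j : gram pf qf i j = gram qf pf j i.
Proof. by case: i j => [[i|i]|i] [[j|j]|j] //=; rewrite eq_sym. Qed.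

Lemma big_delta (I : eqType) (s : seq I) (F : I -> K) j : uniq s ->
  \sum_(i <- s) F i * (i == j)%:R = if j \in s then F j else 0.
Proof.
move=> us; case: ifP => js.
  rewrite (bigD1_seq j)//= eqxx mulr1 big1 ?addr0// => i /negbTE ->.
  by rewrite mulr0.
apply: big1_seq => i /andP[_ si]; case: eqP => [ij|]; last by rewrite mulr0.
by rewrite -ij si in js.
Qed.

(** The columns of [gram] that belong to the family [f], for an arbitrary index type so that forms
    are covered too. *)
Definition ext_pairing (I : eqType) (pf : nat -> I -> K) (i : ext I) (j : I) : K :=
  match i with inl (inl i) => (i == j)%:R | inl (inr _) => 0 | inr k => pf k j end.

(** The part along the p_k equals a finitely supported sequence, so independence modulo finite
    sequences kills its coefficients; what is left along the family then vanishes coordinate by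
    coordinate. *)
Lemma ext_row (I : eqType) (pf : nat -> I -> K) d1 c1 s (c : ext I -> K) : indep_at_inf c1 pf ->
  uniq s -> {subset s <= @dom3 I d1 c1} ->
  (forall j, \sum_(i <- s) c i * ext_pairing pf i j = 0) ->
  (forall k, inr k \in s -> c (inr k) = 0) /\ (forall i, inl (inl i) \in s -> c (inl (inl i)) = 0).
Proof.
move=> Hp us sD H.
have E j : (if j \in pmap (@getS I) s then c (inl (inl j)) else 0) +
    \sum_(k <- pmap (@getP I) s) c (inr k) * pf k j = 0.
  rewrite -[RHS](H j) sum_ext /= [X in _ + X + _]big1 ?addr0; last by move=> *; rewrite mulr0.
  by rewrite big_delta// getS_uniq.
have P0 k : inr k \in s -> c (inr k) = 0.
  rewrite -mem_getP; apply: (Hp _ (fun k => c (inr k)) (getP_uniq us)).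
    by move=> j; rewrite mem_getP => /sD.
  by exists (pmap (@getS I) s) => j /negbTE js; have := E j; rewrite js add0r.
split=> // i si; have := E i; rewrite mem_getS si big1_seq ?addr0//.
by move=> k; rewrite mem_getP => /andP[_ /P0 ->]; rewrite mul0r.
Qed.

Lemma ext_annV (I : eqType) (pf : nat -> I -> K) d1 c1 (a : ext I -> V) (f : I -> W) v :
  indep_at_inf c1 pf -> basis_on (@dom3 I d1 c1) a ->
  (forall i j, @dom3 I d1 c1 i -> pair (a i) (f j) = ext_pairing pf i j) ->
  annV (span_on predT f) v <-> span_on (below d1) (fun k => a (inl (inr k))) v.
Proof.
move=> Hp Ba Hab; split.
  move=> /annV_span Hv; have [s [c [us sD _ vE]]] := span_rep (Ba.2 v).
  have [|P0 S0] := ext_row (c := c) Hp us sD.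
    move=> j; rewrite -[RHS](Hv j) vE (bil_suml Hb); apply: eq_big_seq => i /sD Di.
    by rewrite (bilZl Hb) Hab.
  rewrite vE sum_ext /= big1_seq; last first.
    by move=> i; rewrite mem_getS => /andP[_ /S0 ->]; rewrite scale0r.
  rewrite add0r [X in _ + X]big1_seq ?addr0; last first.
    by move=> i; rewrite mem_getP => /andP[_ /P0 ->]; rewrite scale0r.
  by apply: (span_on_sum (a := fun k => a (inl (inr k)))) => k; rewrite mem_getX => /sD.
move=> Hv; apply: (lspan_min (annV_subspace _) _ Hv) => _ [k kd <-].
by apply/annV_span => j; rewrite Hab.
Qed.

(** After [ext_row] only the coefficients along T^perp remain. Each is detected by the complementary
    vector of the same number on the other side, which exists because of [dle d1 c2]. *)
Lemma gram_nondeg pf qf d1 d2 c1 c2 s (c : ext nat -> K) : indep_at_inf c1 pf -> dle d1 c2 ->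
  uniq s -> {subset s <= @dom3 nat d1 c1} ->
  (forall j, @dom3 nat d2 c2 j -> \sum_(i <- s) c i * gram pf qf i j = 0) ->
  forall i, i \in s -> c i = 0.
Proof.
move=> Hp dc us sD H.
have [|P0 S0] := ext_row (c := c) Hp us sD.
  by move=> j; rewrite -[RHS](H (inl (inl j)) isT); apply: eq_bigr => -[[]|].
move=> [[i|l]|k] si; [exact: S0 | | exact: P0].
have cl : below c2 l by apply: dc; exact: (sD _ si).
have := H (inr l) cl; rewrite sum_ext /= big1_seq ?add0r; last first.
  by move=> i; rewrite mem_getS => /andP[_ /S0 ->]; rewrite mul0r.
rewrite [X in _ + X]big1 ?addr0; last by move=> *; rewrite mulr0.
rewrite (big_delta (fun k => c (inl (inr k)))); last exact: getX_uniq.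
by rewrite mem_getX si.
Qed.

Lemma dom3_infinite d c : infinite_set [set i | @dom3 nat d c i].
Proof. by apply: (infinite_of_inj (q := fun n => inl (inl n))) => // m n []. Qed.

Lemma model_annV pf qf d1 d2 c1 c2 (a : ext nat -> V) (b : ext nat -> W) v : indep_at_inf c1 pf ->
  basis_on (@dom3 nat d1 c1) a ->
  (forall i j, @dom3 nat d1 c1 i -> @dom3 nat d2 c2 j -> pair (a i) (b j) = gram pf qf i j) ->
  annV (span_on predT (fun i => b (inl (inl i)))) v <->
  span_on (below d1) (fun k => a (inl (inr k))) v.
Proof.
move=> Hp Ba Hab; apply: (ext_annV v Hp Ba) => i j Di.
by rewrite Hab//; case: i Di => [[]|].
Qed.

End GLFamilies.

Section GLModels.
Variables (K : numClosedFieldType).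

Lemma gl_family_swap (V W : lmodType K) (pair : V -> W -> K) (I : eqType)
    (e : I -> V) (f : I -> W) d1 d2 c1 c2 :
  gl_family pair e f d1 d2 c1 c2 -> gl_family (fun w v => pair v w) f e d2 d1 c2 c1.
Proof.
move=> [ef null [D1 D2] C1 C2]; split=> //; first by move=> i j; rewrite ef eq_sym.
by move=> w v Hw Hv; apply: null.
Qed.

Definition complement_to (V : lmodType K) (U : set V) c (p : nat -> V) :=
  forall v, exists (s : seq nat) (cc : nat -> K),
    [/\ uniq s, {subset s <= below c} & U (v - \sum_(k <- s) cc k *: p k)].

Lemma basis_complement (V : lmodType K) (I : eqType) (e : I -> V) (x p : nat -> V) (X : set V) d c :
  basis_on (@dom3 I d c) (cat3 e x p) -> (forall v, span_on (below d) x v -> X v) ->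
  complement_to (sum_space X (span_on predT e)) c p.
Proof.
move=> [_ Sb] HX v; have [s [cc [us sD _ vE]]] := span_rep (Sb v).
exists (pmap (@getP I) s), (fun k => cc (inr k)); split; first exact: getP_uniq.
  by move=> j; rewrite mem_getP => /sD.
rewrite vE sum_ext /= addrK addrC.
eexists; [|eexists; [|reflexivity]]; last exact: span_on_sum.
by apply: HX; apply: span_on_sum => j; rewrite mem_getX => /sD.
Qed.

(** The two inequalities provide partners for T^perp and S^perp in the opposite complements;
    [gl_family_feasible] is the converse. *)
Lemma gl_model (V W : lmodType K) (pair : V -> W -> K) (pf qf : nat -> nat -> K) d1 d2 c1 c2 :
  has_dim [set: V] Aleph0 -> has_dim [set: W] Aleph0 ->
  bil pair -> nondegenerate_pairing pair -> dle d1 c2 -> dle d2 c1 ->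
  indep_at_inf c1 pf -> indep_at_inf c2 qf ->
  exists (e : nat -> V) (f : nat -> W) (p : nat -> V) (q : nat -> W),
  [/\ gl_family pair e f d1 d2 c1 c2,
      forall k i, below c1 k -> pair (p k) (f i) = pf k i,
      forall k i, below c2 k -> pair (e i) (q k) = qf k i,
      complement_to (sum_space (annV pair (span_on predT f)) (span_on predT e)) c1 p
    & complement_to (sum_space (annW pair (span_on predT e)) (span_on predT f)) c2 q].
Proof.
move=> Vd Wd Hb Hnd dc dc' Hp Hq.
have [||a [b [Ba Bb ab]]] := realize_pair (B := gram pf qf) Vd Wd Hb Hnd
  (@dom3_infinite d1 c1) (@dom3_infinite d2 c2).
- by move=> s c us sD H; exact: (gram_nondeg Hp dc us sD H).
- move=> s c us sD H; apply: (gram_nondeg (qf := pf) (d2 := d1) (c2 := c1) Hq dc' us sD) => j Dj.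
  by rewrite -[RHS](H j Dj); apply: eq_bigr => i _; rewrite gramC.
pose e i := a (inl (inl i)); pose f i := b (inl (inl i)).
pose x k := a (inl (inr k)); pose y k := b (inl (inr k)).
pose p k := a (inr k); pose q k := b (inr k).
have aE i : cat3 e x p i = a i by case: i => [[]|].
have bE i : cat3 f y q i = b i by case: i => [[]|].
have Ba' : basis_on (@dom3 nat d1 c1) (cat3 e x p) by rewrite (_ : cat3 e x p = a)//; apply/funext.
have Bb' : basis_on (@dom3 nat d2 c2) (cat3 f y q) by rewrite (_ : cat3 f y q = b)//; apply/funext.
have XE v : annV pair (span_on predT f) v <-> span_on (below d1) x v.
  exact: (model_annV (pf := pf) (qf := qf) (d2 := d2) (c2 := c2) Hb v Hp Ba ab).
have ba : forall j i, @dom3 nat d2 c2 j -> @dom3 nat d1 c1 i -> pair (a i) (b j) = gram qf pf j i.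
  by move=> j i Dj Di; rewrite ab// gramC.
have YE w : annW pair (span_on predT e) w <-> span_on (below d2) y w.
  exact: (model_annV (pf := qf) (qf := pf) (d2 := d1) (c2 := c1) (bil_swap Hb) w Hq Bb ba).
have [D1 C1] := basis_dims Ba' XE; have [D2 C2] := basis_dims Bb' YE.
exists e, f, p, q; split.
- split=> //; first by move=> i j; rewrite ab.
  move=> v w /XE Hv /YE Hw.
  apply: (lspan_lin (bil_linl Hb w) (set0_subspace _) _ Hv) => _ [k kd <-] /=.
  apply: (lspan_lin (bil_linr Hb (x k)) (set0_subspace _) _ Hw) => _ [l ld <-] /=.
  by rewrite ab.
- by move=> k i kc; rewrite ab.
- by move=> k i kc; rewrite ab.
- by apply: (basis_complement Ba') => v; apply (XE v).2.
- by apply: (basis_complement Bb') => v; apply (YE v).2.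
Qed.

Section Asymptotics.
Variables (V W : lmodType K) (pair : V -> W -> K) (I : eqType) (e : I -> V) (f : I -> W).
Hypothesis Hb : bil pair.
Hypothesis ef : forall i j, pair (e i) (f j) = (i == j)%:R.

Lemma span_ae0 u : span_on predT e u -> ae (fun i => pair u (f i) = 0).
Proof.
move=> /span_rep[s [c [us _ _ ->]]]; exists s => i si; rewrite (bil_suml Hb).
apply: big1_seq => j /andP[_ sj]; rewrite (bilZl Hb) ef; case: eqP => [ji|]; last by rewrite mulr0.
by rewrite -ji sj in si.
Qed.

Lemma small_ae0 u : sum_space (annV pair (span_on predT f)) (span_on predT e) u ->
  ae (fun i => pair u (f i) = 0).
Proof.
move=> [x Hx [s Hs <-]]; apply: ae_sub (span_ae0 Hs) => i si.
by rewrite (bilDl Hb) si addr0; move/(annV_span Hb): Hx; apply.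
Qed.

Lemma ae0_small u : ae (fun i => pair u (f i) = 0) ->
  sum_space (annV pair (span_on predT f)) (span_on predT e) u.
Proof.
move=> [s Hs]; pose z := \sum_(i <- undup s) pair u (f i) *: e i.
exists (u - z); last by exists z; [exact: span_on_sum | rewrite subrK].
apply/(annV_span Hb) => j; rewrite (bilBl Hb) (bil_suml Hb).
case: (boolP (j \in s)) => js; last first.
  rewrite Hs// big1_seq ?subrr// => i /andP[_]; rewrite mem_undup => si.
  rewrite (bilZl Hb) ef; case: eqP => [ij|]; last by rewrite mulr0.
  by rewrite -ij si in js.
rewrite (bigD1_seq j)//= ?undup_uniq ?mem_undup// (bilZl Hb) ef eqxx mulr1 big1 ?addr0 ?subrr//.
by move=> i /negbTE ij; rewrite (bilZl Hb) ef ij mulr0.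
Qed.

Lemma complement_ae (p : nat -> V) (pf : nat -> I -> K) c :
  complement_to (sum_space (annV pair (span_on predT f)) (span_on predT e)) c p ->
  (forall k i, below c k -> pair (p k) (f i) = pf k i) ->
  forall v, exists s cc, [/\ uniq s, {subset s <= below c} &
    ae (fun i => pair v (f i) = \sum_(k <- s) cc k * pf k i)].
Proof.
move=> Hc Hp v; have [s [cc [us sc /small_ae0 H]]] := Hc v.
exists s, cc; split=> //; apply: ae_sub H => i; rewrite (bilBl Hb) (bil_suml Hb) => /eqP.
rewrite subr_eq0 => /eqP ->; apply: eq_big_seq => k /sc ck.
by rewrite (bilZl Hb) Hp.
Qed.

End Asymptotics.

(** T^perp is orthogonal to S^perp and to T, so it pairs faithfully with a complement of their sum,
    whose dimension therefore bounds dim T^perp. For finite [c2] the rows of pairings with such a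
    complement are independent. *)
Lemma gl_family_feasible (V W : lmodType K) (pair : V -> W -> K) (I : eqType)
    (e : I -> V) (f : I -> W) d1 d2 c1 c2 : bil pair -> nondegenerate_pairing pair ->
  gl_family pair e f d1 d2 c1 c2 -> dle d1 c2.
Proof.
move=> Hb Hnd [ef null [D1 _] _ C2] k kd; apply: contrapT => nkc.
case: c2 C2 nkc => // n C2 nkc; have {nkc} nk : (n <= k)%N by rewrite leqNgt; apply/negP.
have [x [Xx _ fx]] := (dim_quotP _ _ _).1 D1.
have [q [_ sq _]] := (dim_quotP _ _ _).1 C2.
have below_le j : (j <= k)%N -> below d1 j.
  by case: (d1) kd => //= m km jk; exact: leq_ltn_trans jk km.
pose row i : 'rV[K]_n := \row_j pair (x i) (q j).
pose b i : 'rV[K]_n := \row_j (i == nat_of_ord j)%:R.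
have : (k.+1 <= n)%N; last by rewrite ltnNge nk.
apply: (@free_le _ _ _ _ row b); last first.
  move=> i _; have -> : row i = \sum_(j <- iota 0 n) (oapp (row i 0) 0 (insub j)) *: b j.
    apply/rowP => j; rewrite summxE (bigD1_seq (val j))//= ?mem_iota ?iota_uniq//= ?ltn_ord//.
    rewrite !mxE valK /= eqxx mulr1 mxE big1 ?addr0// => l /negbTE lj.
    by rewrite !mxE lj mulr0.
  by apply: span_on_sum => j; rewrite mem_iota.
move=> s c us sk E.
have X0 : \sum_(i <- s) c i *: x i = 0.
  have Hx w : annW pair (span_on predT e) w -> pair (\sum_(i <- s) c i *: x i) w = 0.
    move=> Hw; rewrite (bil_suml Hb); apply: big1_seq => i /andP[_ /sk ik].
    by rewrite (bilZl Hb) null ?mulr0//; apply: Xx; exact: below_le.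
  have Ht w : span_on predT f w -> pair (\sum_(i <- s) c i *: x i) w = 0.
    move=> Hw; rewrite (bil_suml Hb); apply: big1_seq => i /andP[_ /sk ik].
    by rewrite (bilZl Hb) (Xx i) ?mulr0//; exact: below_le.
  apply: Hnd.1 => w; have [t [cc [ut tn [y Hy [z Hz yz]]]]] := sq w Logic.I.
  have -> : w = y + z + \sum_(j <- t) cc j *: q j by rewrite yz subrK.
  rewrite !(bilDr Hb) Hx// Ht// !add0r (bil_sumr Hb).
  apply: big1_seq => j /andP[_ /tn jn]; rewrite (bilZr Hb).
  have := congr1 (fun r : 'rV_n => r 0 (Ordinal jn)) E; rewrite summxE mxE => Ej.
  rewrite (bil_suml Hb) (eq_bigr (fun i => (c i *: row i) 0 (Ordinal jn))) ?Ej ?mulr0// => i _.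
  by rewrite (bilZl Hb) !mxE.
have sd : {subset s <= below d1} by move=> i /sk; exact: below_le.
exact: (fx s c us sd X0).
Qed.

Section PolynomialSequences.

Lemma poly_io0 (p : {poly K}) : io (fun i : nat => p.[i%:R] = 0) -> p = 0.
Proof.
move=> H; apply/eqP; apply/negPn/negP => p0.
have long n : exists s : seq nat, [/\ uniq s, size s = n & {in s, forall i, p.[i%:R] = 0}].
  elim: n => [|n [s [us ss ps]]]; first by exists [::].
  have [i [si pi]] := H s; exists (i :: s); split; rewrite /= ?si ?ss//.
  by move=> j; rewrite inE => /orP[/eqP ->|/ps].
have [s [us ss ps]] := long (size p).
have := @max_poly_roots _ p (map (fun i => i%:R) s) p0; rewrite size_map ss ltnn => Hf.
suff : false by [].
apply: Hf.
  by apply/allP => _ /mapP[i si ->]; apply/eqP; exact: ps.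
rewrite map_inj_uniq// => i j /eqP; rewrite eqr_nat => /eqP //.
Qed.

Definition seq_poly (s : seq nat) (c : nat -> K) : {poly K} := \sum_(k <- s) c k *: 'X^k.

Lemma seq_polyE s c x : (seq_poly s c).[x] = \sum_(k <- s) c k * x ^+ k.
Proof.
by rewrite horner_sum; apply: eq_bigr => k _; rewrite hornerZ hornerXn.
Qed.

Lemma seq_poly_eq0 s c : uniq s -> seq_poly s c = 0 -> forall k, k \in s -> c k = 0.
Proof.
move=> us E k ks; have := congr1 (fun p : {poly K} => p`_k) E.
rewrite coef0 coef_sum (bigD1_seq k)//= coefZ coefXn eqxx mulr1 big1 ?addr0// => j /negbTE jk.
by rewrite coefZ coefXn eq_sym jk mulr0.
Qed.

(** A polynomial vanishing at almost all natural numbers is zero. These sequences fill any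
    codimension on the side that carries no invariant. *)
Lemma indep_poly c : indep_at_inf c (fun k i : nat => (i%:R : K) ^+ k).
Proof.
move=> s cc us sc [t Ht]; apply: (seq_poly_eq0 us); apply: poly_io0 => u.
exists (\max_(i <- t ++ u) i).+1; set N := \max_(i <- t ++ u) i.
have N1 : N.+1 \notin t ++ u.
  by apply/negP => H; have := @leq_bigmax_seq _ (t ++ u) predT id N.+1 H isT; rewrite /= -/N ltnn.
move: N1; rewrite mem_cat negb_or => /andP[Nt ->]; split=> //.
by rewrite seq_polyE; exact: Ht.
Qed.

End PolynomialSequences.
End GLModels.

(** * Cross ratios *)

Section CrossRatio.
Variable K : numClosedFieldType.
Implicit Types z x y : K.

(** The binary quartic with zeros (1, 0), (0, 1), (1, 1) and (1, z) on the projective line, whose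
    cross ratio is z in a suitable order. *)
Definition quartic z x y := x * y * (x - y) * (y - z * x).

(** Of the six values z, 1 - z, 1/z, 1/(1 - z), z/(z - 1), (z - 1)/z of an unordered cross ratio,
    only z lies in this interval. *)
Definition param z := (0 < z) && (z < 2^-1).

Lemma param_facts z z' : param z -> param z' ->
  [/\ z != 0, z != 1, z * z' != 1 & z' - (1 - z) != 0].
Proof.
move=> /andP[z0 z2] /andP[z0' z2'].
have h1 : (2^-1 : K) < 1 by rewrite invf_lt1 ?ltr0n// ltr1n.
have z1 := lt_trans z2 h1; have z1' := lt_trans z2' h1.
have hh : (2^-1 : K) + 2^-1 = 1.
  by rewrite -[RHS](@divff _ (2 : K)) ?pnatr_eq0// -[2%:R as X in X / _]/(1 + 1) mulrDl mul1r.
split; first by rewrite gt_eqF.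
- by rewrite lt_eqF.
- by rewrite lt_eqF// mulr_ilt1// ltW.
- by rewrite opprB addrA subr_eq0 addrC lt_eqF// -hh ltrD.
Qed.

(** Here t rescales {1, z'} into {1, z} and the value 1 is attained. If t = 1 then z' = z; the other
    possibilities give z = 1 or z z' = 1, which the interval excludes. *)
Lemma two_values t z z' : param z -> param z' ->
  (t = 1 \/ t = z) -> (t * z' = 1 \/ t * z' = z) -> (t = 1 \/ t * z' = 1) -> z = z'.
Proof.
move=> Hz Hz' E0 E1 E2.
have [z0 z1 zz _] := param_facts Hz Hz'; have [z0' z1' _ _] := param_facts Hz' Hz.
case: E0 => [t1|tz].
  by case: E1; rewrite t1 mul1r => // E; move: z1'; rewrite E eqxx.
case: E1 => E1; first by move: zz; rewrite -tz E1 eqxx.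
by case: E2 => E2; move: z1; [rewrite -tz E2 eqxx | rewrite -E1 E2 eqxx].
Qed.

Lemma param_factors z z' : param z -> param z' ->
  [/\ (1 - z) * z' - 1 != 0, (z - 1) * z' - z != 0 & z * z' - z + 1 != 0].
Proof.
move=> /andP[z0 z2] /andP[z0' z2'].
have h1 : (2^-1 : K) < 1 by rewrite invf_lt1 ?ltr0n// ltr1n.
have z1 := lt_trans z2 h1; have z1' := lt_trans z2' h1.
have zz0 : 0 < z * z' by exact: mulr_gt0.
split.
- rewrite lt_eqF// subr_lt0 mulrBl mul1r ltrBlDr.
  by apply: lt_trans z1' _; rewrite ltrDl.
- rewrite lt_eqF// subr_lt0 mulrBl mul1r ltrBlDr.
  by apply: (@lt_trans _ _ z); [rewrite gtr_pMr | rewrite ltrDl].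
- by rewrite gt_eqF// -addrA addr_gt0// addrC subr_gt0.
Qed.

(** The difference of the two sides is 27 times six factors, one for each of the six values of the
    cross ratio, and the interval excludes all of them but z' = z. *)
Lemma j_invariant z z' : param z -> param z' ->
  (z' ^+ 2 - z' + 1) ^+ 3 * ((1 + z) * (2%:R * z ^+ 2 - 5%:R * z + 2%:R)) ^+ 2 =
  (z ^+ 2 - z + 1) ^+ 3 * ((1 + z') * (2%:R * z' ^+ 2 - 5%:R * z' + 2%:R)) ^+ 2 ->
  z = z'.
Proof.
move=> Hz Hz' E.
have [_ _ f1 f2] := param_facts Hz Hz'; have [f3 f4 f5] := param_factors Hz Hz'.
have : 27%:R * ((z' - z) * (z' - (1 - z)) * (z * z' - 1) * ((1 - z) * z' - 1)
   * ((z - 1) * z' - z) * (z * z' - z + 1)) = 0.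
  move/eqP: E; rewrite -subr_eq0 => /eqP <-; ring.
move/eqP; rewrite !mulf_eq0 pnatr_eq0 /= (negbTE f2) (negbTE f3) (negbTE f4) (negbTE f5).
by rewrite !orbF subr_eq0 subr_eq0 (negbTE f1) orbF => /eqP.
Qed.

(* The quartic in [s, t] obtained by substituting [a s + b t, c s + d t]
   vanishes at [(1, 0), (0, 1), (1, 1), (1, z')], hence is a multiple of
   [s t (s - t) (t - z' s)]; its invariants [I] and [J], of weights 4 and 6,
   then determine the j-invariant of [z] in terms of that of [z']. *)
Lemma cross_ratio z z' (a b c d : K) : param z -> param z' -> a * d - b * c != 0 ->
  quartic z a c = 0 -> quartic z b d = 0 -> quartic z (a + b) (c + d) = 0 ->
  quartic z (a + z' * b) (c + z' * d) = 0 -> z = z'.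
Proof.
move=> Hz Hz' D0 q1 q2 q3 q4.
have [z0 z1 zz _] := param_facts Hz Hz'; have [z0' z1' _ _] := param_facts Hz' Hz.
set D := a * d - b * c in D0.
(* The coefficients of s^3 t, s^2 t^2 and s t^3 after the substitution; those of s^4 and t^4 are
   [quartic z a c] and [quartic z b d]. *)
pose a1 := - z * (a ^+ 3 * d + 3%:R * a ^+ 2 * b * c) + (1 + z) * (2%:R * a * c * (a * d + b * c))
  - (3%:R * a * c ^+ 2 * d + b * c ^+ 3).
pose a2 := - z * (3%:R * a ^+ 2 * b * d + 3%:R * a * b ^+ 2 * c)
  + (1 + z) * ((a * d + b * c) ^+ 2 + 2%:R * a * b * c * d) - (3%:R * a * c * d ^+ 2 + 3%:R * b * c ^+ 2 * d).
pose a3 := - z * (3%:R * a * b ^+ 2 * d + b ^+ 3 * c) + (1 + z) * (2%:R * b * d * (a * d + b * c))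
  - (a * d ^+ 3 + 3%:R * b * c * d ^+ 2).
have E3 : a1 + a2 + a3 = 0.
  have -> : a1 + a2 + a3 = quartic z (a + b) (c + d) - quartic z a c - quartic z b d.
    by rewrite /a1 /a2 /a3 /quartic; ring.
  by rewrite q1 q2 q3 !subr0.
have E4 : a1 + a2 * z' + a3 * z' ^+ 2 = 0.
  apply: (mulfI z0'); rewrite mulr0.
  have -> : z' * (a1 + a2 * z' + a3 * z' ^+ 2) = quartic z (a + z' * b) (c + z' * d)
      - quartic z a c - z' ^+ 4 * quartic z b d.
    by rewrite /a1 /a2 /a3 /quartic; ring.
  by rewrite q1 q2 q4 mulr0 !subr0.
have a2E : a2 = - (1 + z') * a3.
  have z1z : 1 - z' != 0 by rewrite subr_eq0 eq_sym.
  apply: (mulfI z1z); apply/eqP; rewrite -subr_eq0; apply/eqP.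
  rewrite -[RHS](subrr 0) -{1}E3 -E4; ring.
have a1E : a1 = z' * a3.
  by apply/eqP; rewrite -subr_eq0 -E3 a2E; apply/eqP; ring.
(* For a quartic with coefficients A, B, C, D, E these are I = 12 A E - 3 B D + C^2 and J = 72 A C E
   + 9 B C D - 27 A D^2 - 27 E B^2 - 2 C^3. The terms with the end coefficients are split off and
   vanish. *)
have EI : - 3%:R * a1 * a3 + a2 ^+ 2 = D ^+ 4 * (z ^+ 2 - z + 1).
  have -> : - 3%:R * a1 * a3 + a2 ^+ 2 =
      D ^+ 4 * (z ^+ 2 - z + 1) - 12%:R * quartic z a c * quartic z b d.
    by rewrite /a1 /a2 /a3 /D /quartic; ring.
  by rewrite q1 mulr0 mul0r subr0.
have EJ : 9%:R * a1 * a2 * a3 - 2%:R * a2 ^+ 3 =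
    - D ^+ 6 * ((1 + z) * (2%:R * z ^+ 2 - 5%:R * z + 2%:R)).
  have -> : 9%:R * a1 * a2 * a3 - 2%:R * a2 ^+ 3 =
      - D ^+ 6 * ((1 + z) * (2%:R * z ^+ 2 - 5%:R * z + 2%:R))
      - 72%:R * quartic z a c * a2 * quartic z b d + 27%:R * quartic z a c * a3 ^+ 2
      + 27%:R * quartic z b d * a1 ^+ 2.
    by rewrite /a1 /a2 /a3 /D /quartic; ring.
  by rewrite q1 q2 !mulr0 !mul0r subr0 !addr0.
have {}EI : a3 ^+ 2 * (z' ^+ 2 - z' + 1) = D ^+ 4 * (z ^+ 2 - z + 1).
  by rewrite -EI a2E a1E; ring.
have {}EJ : a3 ^+ 3 * ((1 + z') * (2%:R * z' ^+ 2 - 5%:R * z' + 2%:R)) =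
    - D ^+ 6 * ((1 + z) * (2%:R * z ^+ 2 - 5%:R * z + 2%:R)).
  by rewrite -EJ a2E a1E; ring.
have I0 : z ^+ 2 - z + 1 != 0.
  by have [_ _ H] := param_factors Hz Hz; rewrite expr2.
have a30 : a3 != 0.
  apply: contraTneq isT => H; move/eqP: EI; rewrite H expr0n mul0r eq_sym mulf_eq0.
  by rewrite (negbTE I0) orbF expf_eq0 (negbTE D0) andbF.
apply: j_invariant => //.
have n0 : a3 ^+ 6 * D ^+ 12 != 0 by rewrite mulf_neq0 ?expf_neq0.
apply: (mulfI n0).
transitivity ((a3 ^+ 2 * (z' ^+ 2 - z' + 1)) ^+ 3 *
    (- D ^+ 6 * ((1 + z) * (2%:R * z ^+ 2 - 5%:R * z + 2%:R))) ^+ 2); first by ring.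
by rewrite EI -EJ; ring.
Qed.

End CrossRatio.

(** * Equivalence of dual families *)

Definition any_pair (V W : Type) (phi : V -> V) (psi : W -> W) := True.

Section GLInvariants.
Variables (K : numClosedFieldType) (V W : lmodType K) (pair : V -> W -> K).
Hypothesis Hb : bil pair.
Hypothesis Hnd : nondegenerate_pairing pair.
Local Notation deq := (fam_equiv pair (@any_pair V W)).

Lemma deq_swap (I : eqType) (e : I -> V) (f : I -> W) e' f' : deq e f e' f' ->
  fam_equiv (fun w v => pair v w) (@any_pair W V) f e f' e'.
Proof.
move=> [phi [psi [p [l [m [[b1 b2 b3] _ bp H]]]]]].
exists psi, phi, p, m, l; split=> //.
by move=> i; have [l0 m0 E1 E2] := H i; split.
Qed.

(** All that an equivalence does to sequences of pairings is to permute the indices and to rescale,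
    by mutually inverse factors on the two sides. *)
Lemma deq_transport (Q : (V -> V) -> (W -> W) -> Prop) (I : eqType) (e : I -> V) (f : I -> W) e' f' :
  (forall i j, pair (e i) (f j) = (i == j)%:R) ->
  (forall i j, pair (e' i) (f' j) = (i == j)%:R) ->
  fam_equiv pair Q e f e' f' -> exists (phi : V -> V) (psi : W -> W) (p : I -> I) (l m : I -> K),
  [/\ bijective p, Q phi psi, forall i, l i * m i = 1,
      forall i v, pair (phi v) (f' (p i)) = l i * pair v (f i)
    & forall i w, pair (e' (p i)) (psi w) = m i * pair (e i) w].
Proof.
move=> ef ef' [phi [psi [p [l [m [[_ _ b3] HQ bp H]]]]]].
have lm i : l i * m i = 1.
  have [_ _ E1 E2] := H i; have := b3 (e i) (f i).
  by rewrite E1 E2 (bilZl Hb) (bilZr Hb) ef ef' !eqxx mulr1.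
exists phi, psi, p, l, m; split=> // i v; have [l0 m0 E1 E2] := H i.
  by rewrite -(b3 v) E2 (bilZr Hb) mulrA lm mul1r.
by rewrite -(b3 _ v) E1 (bilZl Hb) mulrA [m i * _]mulrC lm mul1r.
Qed.

(** The first clause is homogeneous, hence insensitive to rescaling. The second says that the values
    of (v1, v2) do not almost all lie on the union of two lines, which excludes degenerate choices
    of [v1] and [v2]. *)
Definition quartic_inv (I : eqType) (f : I -> W) z := exists v1 v2 : V,
  ae (fun i => quartic z (pair v1 (f i)) (pair v2 (f i)) = 0) /\
  forall a b c d, (a, b) != (0, 0) -> (c, d) != (0, 0) ->
    io (fun i => (a * pair v1 (f i) + b * pair v2 (f i)) *
                 (c * pair v1 (f i) + d * pair v2 (f i)) != 0).

Lemma quartic_inv_deq (I : eqType) (e : I -> V) (f : I -> W) e' f' z :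
  (forall i j, pair (e i) (f j) = (i == j)%:R) ->
  (forall i j, pair (e' i) (f' j) = (i == j)%:R) ->
  deq e f e' f' -> quartic_inv f z -> quartic_inv f' z.
Proof.
move=> ef ef' /(deq_transport ef ef')[phi [psi [p [l [m [bp _ lm H1 H2]]]]]] [v1 [v2 [A O]]].
exists (phi v1), (phi v2); split.
  apply: (ae_bij bp); apply: ae_sub A => i; rewrite !H1 /quartic => A.
  by rewrite -[RHS](mulr0 (l i ^+ 4)) -A; ring.
move=> a b c d ab cd; apply: (io_bij bp); apply: io_sub (O a b c d ab cd) => i; rewrite !H1.
apply: contra_neq => E.
have li : l i != 0 by apply: contraTneq isT => l0; have := lm i; rewrite l0 mul0r => /esym/eqP; rewrite oner_eq0.
apply: (mulfI (expf_neq0 2 li)); rewrite mulr0 -[RHS]E; ring.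
Qed.

(** The rescaling factors on the two sides are inverse to each other and cancel in these
    products. *)
Definition product_inv (I : eqType) (e : I -> V) (f : I -> W) z := exists v w,
  [/\ ae (fun i => pair v (f i) * pair (e i) w = 1 \/ pair v (f i) * pair (e i) w = z),
      io (fun i => pair v (f i) * pair (e i) w = 1)
    & io (fun i => pair v (f i) * pair (e i) w = z)].

Lemma product_inv_deq (I : eqType) (e : I -> V) (f : I -> W) e' f' z :
  (forall i j, pair (e i) (f j) = (i == j)%:R) ->
  (forall i j, pair (e' i) (f' j) = (i == j)%:R) ->
  deq e f e' f' -> product_inv e f z -> product_inv e' f' z.
Proof.
move=> ef ef' /(deq_transport ef ef')[phi [psi [p [l [m [bp _ lm H1 H2]]]]]] [v [w [A O1 O2]]].
have E i : pair (phi v) (f' (p i)) * pair (e' (p i)) (psi w) = pair v (f i) * pair (e i) w.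
  by rewrite H1 H2 mulrACA lm mul1r.
exists (phi v), (psi w); split.
- by apply: (ae_bij bp); apply: ae_sub A => i; rewrite !E.
- by apply: (io_bij bp); apply: io_sub O1 => i; rewrite !E.
- by apply: (io_bij bp); apply: io_sub O2 => i; rewrite !E.
Qed.

Definition zero_inv (I : eqType) (f : I -> W) := exists v : V,
  io (fun i => pair v (f i) = 0) /\ io (fun i => pair v (f i) != 0).

Lemma zero_inv_deq (I : eqType) (e : I -> V) (f : I -> W) e' f' :
  (forall i j, pair (e i) (f j) = (i == j)%:R) ->
  (forall i j, pair (e' i) (f' j) = (i == j)%:R) ->
  deq e f e' f' -> zero_inv f -> zero_inv f'.
Proof.
move=> ef ef' /(deq_transport ef ef')[phi [psi [p [l [m [bp _ lm H1 H2]]]]]] [v [O1 O2]].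
exists (phi v); split.
- by apply: (io_bij bp); apply: io_sub O1 => i; rewrite H1 => ->; rewrite mulr0.
- apply: (io_bij bp); apply: io_sub O2 => i; rewrite H1 => n0; rewrite mulf_neq0//.
  by apply: contraTneq isT => l0; have := lm i; rewrite l0 mul0r => /esym/eqP; rewrite oner_eq0.
Qed.

End GLInvariants.

Section GLSequences.
Variable K : numClosedFieldType.

(* Modulo 5, the classes 0, 1, 2, 3 place the first two sequences at the points
   [(1, 0), (0, 1), (1, 1), (1, z)]; the remaining sequences live on the class 4. *)
Definition pfz (z : K) (k i : nat) : K :=
  match k with
  | 0 => nth 0 [:: 1; 0; 1; 1; 0] (i %% 5)
  | 1 => nth 0 [:: 0; 1; 1; z; 0] (i %% 5)
  | _ => if (i %% 5 == 4)%N then i%:R ^+ k else 0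
  end.

Lemma io_mod (n b : nat) : (b < n)%N -> io (fun i : nat => i %% n = b)%N.
Proof.
move=> bn s; exists ((\max_(i <- s) i).+1 * n + b)%N; split; last by rewrite modnMDl modn_small.
apply/negP => H; have := @leq_bigmax_seq _ s predT id _ H isT.
rewrite /= leqNgt => /negP[]; apply: leq_trans (leq_addr _ _).
by rewrite leq_pmulr// (leq_ltn_trans _ bn).
Qed.

(** Coefficients outside the support list are arbitrary, so they are cut off before a fixed
    coefficient is inspected. *)
Definition part (s : seq nat) (cc : nat -> K) k := if k \in s then cc k else 0.

Lemma pfz_sum z s cc i : uniq s -> \sum_(k <- s) cc k * pfz z k i =
  part s cc 0 * pfz z 0 i + part s cc 1 * pfz z 1 i +
  (if (i %% 5 == 4)%N then (seq_poly [seq k <- s | (2 <= k)%N] cc).[i%:R] else 0).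
Proof.
move=> us; rewrite (bigID (fun k => 2 <= k)%N)/= addrC; congr (_ + _); last first.
  rewrite seq_polyE big_filter.
  case: ifP => i5.
    by apply: eq_bigr => -[|[|k]] //= _; rewrite i5.
  by apply: big1 => -[|[|k]] //= _; rewrite i5 mulr0.
rewrite -big_filter.
have -> : \sum_(k <- [seq k <- s | ~~ (1 < k)%N]) cc k * pfz z k i =
    \sum_(k <- [:: 0; 1]%N) part s cc k * pfz z k i.
  rewrite (eq_big_seq (fun k => part s cc k * pfz z k i)); last first.
    by move=> k; rewrite mem_filter /part => /andP[_ ->].
  apply: sum_widen => //; first exact: filter_uniq.
    by move=> [|[|k]]; rewrite mem_filter.
  move=> k k2; rewrite mem_filter /part => H.
  have k1 : ~~ (1 < k)%N by case: k k2 {H} => [|[|k]].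
  by move: H; rewrite k1 /= => /negbTE ->; rewrite mul0r.
by rewrite big_cons big_seq1.
Qed.

Lemma io_poly_mod (n b : nat) (p : {poly K}) : (b < n)%N ->
  ae (fun i : nat => (i %% n = b)%N -> p.[i%:R] = 0) -> p = 0.
Proof.
move=> bn Hp; apply: poly_io0.
apply: io_sub (io_and_ae (io_mod bn) Hp) => i [ib]; exact.
Qed.

(** Classes 0 and 1 isolate the coefficients of the first two sequences; class 4 then leaves a
    polynomial with infinitely many roots. *)
Lemma indep_pfz z c : indep_at_inf c (pfz z).
Proof.
move=> s cc us sc H.
have at_b b : (b < 5)%N -> exists i, (i %% 5 = b)%N /\ \sum_(k <- s) cc k * pfz z k i = 0.
  by move=> b5; have [i [ib Hi]] := io_ae (io_mod b5) H; exists i.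
have c0 : part s cc 0 = 0.
  have [i [ib]] := at_b 0%N isT; rewrite pfz_sum// /pfz ib /=.
  by rewrite mulr1 mulr0 !addr0.
have c1 : part s cc 1 = 0.
  have [i [ib]] := at_b 1%N isT; rewrite pfz_sum// /pfz ib /=.
  by rewrite mulr1 mulr0 addr0 add0r.
have Q0 : seq_poly [seq k <- s | (2 <= k)%N] cc = 0.
  apply: (@io_poly_mod 5 4) => //; apply: ae_sub H => i; rewrite pfz_sum// c0 c1 => + ib.
  by rewrite ib /= !mul0r !add0r.
move=> [|[|k]] ks; [by move: c0; rewrite /part ks | by move: c1; rewrite /part ks |].
by apply: (seq_poly_eq0 _ Q0); [exact: filter_uniq | rewrite mem_filter ks].
Qed.

End GLSequences.

Section GLFamiliesClasses.
Variables (K : numClosedFieldType) (V W : lmodType K) (pair : V -> W -> K).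
Hypothesis Hb : bil pair.
Hypothesis Hnd : nondegenerate_pairing pair.
Hypothesis Vd : has_dim [set: V] Aleph0.
Hypothesis Wd : has_dim [set: W] Aleph0.
Local Notation deq := (fam_equiv pair (@any_pair V W)).
Local Notation fam := (@gl_family K V W pair nat).

Lemma quartic_model z (e : nat -> V) (f : nat -> W) (p : nat -> V) c :
  (forall i j, pair (e i) (f j) = (i == j)%:R) -> below c 1 ->
  (forall k i, below c k -> pair (p k) (f i) = pfz z k i) -> quartic_inv pair f z.
Proof.
move=> ef c1 Hp; have c0 : below c 0 by case: (c) c1 => //= n /ltnW.
exists (p 0%N), (p 1%N); split.
  exists [::] => i _; rewrite !Hp// /pfz.
  have := ltn_pmod i (isT : 0 < 5)%N.
  case: (i %% 5)%N => [|[|[|[|[|n]]]]] //= _; rewrite /quartic; ring.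
move=> a b c' d ab cd.
(* Two lines through the origin cannot contain all of (1, 0), (0, 1) and (1, 1), so one of the
   classes 0, 1, 2 always succeeds. *)
have fin j : (j < 5)%N -> (a * pfz z 0 j + b * pfz z 1 j) * (c' * pfz z 0 j + d * pfz z 1 j) != 0 ->
    io (fun i => (a * pair (p 0%N) (f i) + b * pair (p 1%N) (f i)) *
      (c' * pair (p 0%N) (f i) + d * pair (p 1%N) (f i)) != 0).
  move=> j5 H; apply: io_sub (io_mod j5) => i ij; rewrite !Hp//.
  by move: H; rewrite /pfz ij modn_small.
case: (boolP (a * c' == 0)) => [ac|ac]; last first.
  by apply: (fin 0%N) => //=; rewrite /pfz /= !mulr1 !mulr0 !addr0.
case: (boolP (b * d == 0)) => [bd|bd]; last first.
  by apply: (fin 1%N) => //=; rewrite /pfz /= !mulr1 !mulr0 !add0r.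
apply: (fin 2%N) => //=; rewrite /pfz /= !mulr1.
move: ac bd ab cd; rewrite !mulf_eq0 !xpair_eqE !negb_and.
move=> /orP[/eqP ->|/eqP ->] /orP[/eqP ->|/eqP ->]; rewrite ?eqxx ?addr0 ?add0r //= ?orbF => ab cd.
  by rewrite negb_or ab cd.
by rewrite negb_or ab cd.
Qed.

Lemma quartic_model_eq z z' (e : nat -> V) (f : nat -> W) (p : nat -> V) c :
  (forall i j, pair (e i) (f j) = (i == j)%:R) -> param z -> param z' ->
  (forall k i, below c k -> pair (p k) (f i) = pfz z' k i) ->
  complement_to (sum_space (annV pair (span_on predT f)) (span_on predT e)) c p ->
  quartic_inv pair f z -> z = z'.
Proof.
move=> ef Hz Hz' Hp Hc [v1 [v2 [A O]]].
have [s1 [cc1 [us1 _ A1]]] := complement_ae Hb ef Hc Hp v1.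
have [s2 [cc2 [us2 _ A2]]] := complement_ae Hb ef Hc Hp v2.
pose a := part s1 cc1 0; pose b := part s1 cc1 1.
pose c' := part s2 cc2 0; pose d := part s2 cc2 1.
pose q1 := seq_poly [seq k <- s1 | (2 <= k)%N] cc1.
pose q2 := seq_poly [seq k <- s2 | (2 <= k)%N] cc2.
have A3 : ae (fun i => [/\ quartic z (pair v1 (f i)) (pair v2 (f i)) = 0,
    pair v1 (f i) = a * pfz z' 0 i + b * pfz z' 1 i + (if (i %% 5 == 4)%N then q1.[i%:R] else 0)
    & pair v2 (f i) = c' * pfz z' 0 i + d * pfz z' 1 i + (if (i %% 5 == 4)%N then q2.[i%:R] else 0)]).
  apply: ae_sub (ae_and A (ae_and A1 A2)) => i [H1 [H2 H3]].
  by split=> //; [rewrite H2 pfz_sum | rewrite H3 pfz_sum].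
(* The sequences beyond the first two vanish on the classes 0 to 3, so [v1] and [v2] take there the
   values of a linear substitution at the four points of parameter [z']. *)
have at_b j : (j < 4)%N -> quartic z (a * pfz z' 0 j + b * pfz z' 1 j) (c' * pfz z' 0 j + d * pfz z' 1 j) = 0.
  move=> j4; have [i [ij [H1 H2 H3]]] := io_ae (io_mod (leqW j4)) A3.
  by move: H1; rewrite H2 H3 ij ltn_eqF// !addr0 /pfz ij modn_small// leqW.
have B0 := at_b 0%N isT; have B1 := at_b 1%N isT; have B2 := at_b 2%N isT; have B3 := at_b 3%N isT.
rewrite /pfz /= ?mulr1 ?mulr0 ?addr0 ?add0r in B0 B1 B2 B3.
(* On class 4 the quartic becomes a polynomial in i with infinitely many roots, so one of its four
   linear factors vanishes identically. *)
have q0 : q1 * q2 * (q1 - q2) * (q2 - z *: q1) = 0.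
  apply: (@io_poly_mod _ 5 4) => //; apply: ae_sub A3 => i [H1 H2 H3] i4.
  move: H1; rewrite H2 H3 i4 /pfz i4 /= !mulr0 !add0r => H1.
  by rewrite !hornerM !hornerD !hornerN hornerZ.
(* a line through the origin containing all the values taken on the class 4 *)
have [g [h [gh Hgh]]] : exists g h, (g, h) != (0, 0) :> K * K /\ g *: q1 + h *: q2 = 0.
  have one : (1 : K) != 0 by exact: oner_neq0.
  move/eqP: q0; rewrite !mulf_eq0 -!orbA => /or4P[] /eqP E.
  - exists 1, 0; rewrite xpair_eqE negb_and one; split=> //.
    by rewrite E scaler0 scale0r addr0.
  - exists 0, 1; rewrite xpair_eqE negb_and one orbT; split=> //.
    by rewrite E scaler0 scale0r addr0.
  - exists 1, (-1); rewrite xpair_eqE negb_and one; split=> //.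
    by rewrite scale1r scaleN1r.
  - exists (- z), 1; rewrite xpair_eqE negb_and one orbT; split=> //.
    by rewrite scale1r scaleNr addrC.
apply: (cross_ratio (a := a) (b := b) (c := c') (d := d)) => //; last by rewrite ![z' * _]mulrC.
(* If the substitution is singular, the values on the classes 0 to 3 lie on one line; with the line
   found for class 4 this contradicts the second clause of [quartic_inv]. *)
apply/eqP => det.
have [x [y [xy Hx Hy]]] : exists x y, [/\ (x, y) != (0, 0) :> K * K, x * a + y * c' = 0 & x * b + y * d = 0].
  case: (boolP ((a == 0) && (c' == 0))) => [/andP[/eqP a0 /eqP c0]|ac].
    case: (boolP ((b == 0) && (d == 0))) => [/andP[/eqP b0 /eqP d0]|bd].
      exists 1, 0; rewrite a0 b0 c0 d0 !mulr0 !addr0; split=> //.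
      by rewrite xpair_eqE negb_and oner_neq0.
    exists d, (- b); rewrite a0 c0 !mulr0 addr0; split=> //; last by rewrite mulNr mulrC subrr.
    by rewrite xpair_eqE oppr_eq0 andbC.
  exists c', (- a); rewrite xpair_eqE oppr_eq0 andbC; split=> //.
    by rewrite mulNr mulrC subrr.
  by apply/eqP; rewrite mulNr -[_ == _]/(c' * b - a * d == 0) -opprB oppr_eq0 [c' * b]mulrC; apply/eqP.
have [i [Hi [_ H2 H3]]] := io_ae (O x y g h xy gh) A3.
move/eqP: Hi; apply; rewrite H2 H3.
case: ifP => i4; last first.
  rewrite !addr0 (_ : x * _ + y * _ = (x * a + y * c') * pfz z' 0 i + (x * b + y * d) * pfz z' 1 i); last by ring.
  by rewrite Hx Hy !mul0r add0r mul0r.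
rewrite /pfz (eqP i4) /= !mulr0 !add0r.
have := congr1 (fun p : {poly K} => p.[i%:R]) Hgh; rewrite /= hornerD !hornerZ horner0 => ->.
by rewrite mulr0.
Qed.

Lemma gl_many_quartic d1 d2 c1 c2 : below c1 1 -> dle d1 c2 -> dle d2 c1 ->
  exists (E : K -> nat -> V) (F : K -> nat -> W),
  (forall z, fam (E z) (F z) d1 d2 c1 c2) /\
  forall z z', param z -> param z' -> deq (E z) (F z) (E z') (F z') -> z = z'.
Proof.
move=> c11 D1 D2.
have /choice[M HM] : forall z : K, exists M : (nat -> V) * (nat -> W) * (nat -> V),
  [/\ fam M.1.1 M.1.2 d1 d2 c1 c2, forall k i, below c1 k -> pair (M.2 k) (M.1.2 i) = pfz z k i
   & complement_to (sum_space (annV pair (span_on predT M.1.2)) (span_on predT M.1.1)) c1 M.2].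
  move=> z; have [e [f [p [q [H1 H2 H3 H4 _]]]]] :=
    gl_model Vd Wd Hb Hnd D1 D2 (@indep_pfz K z c1) (@indep_poly K c2).
  by exists ((e, f), p).
exists (fun z => (M z).1.1), (fun z => (M z).1.2); split=> [z|z z' Hz Hz' H]; first by case: (HM z).
have [F1 P1 _] := HM z; have [F2 P2 C2] := HM z'.
have [ef1 _ _ _ _] := F1; have [ef2 _ _ _ _] := F2.
apply: (quartic_model_eq ef2 Hz Hz' P2 C2).
exact: (quartic_inv_deq Hb ef1 ef2 H (quartic_model ef1 c11 P1)).
Qed.

Lemma below1_sum (c : dimension) s cc (pf : nat -> nat -> K) i : c = Fin 1 -> uniq s ->
  {subset s <= below c} -> \sum_(k <- s) cc k * pf k i = part s cc 0 * pf 0%N i.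
Proof.
move=> -> us sc; rewrite (eq_big_seq (fun k => part s cc k * pf k i)); last first.
  by move=> k ks; rewrite /part ks.
rewrite (@sum_widen _ _ s [:: 0%N]) ?big_seq1// => [k /sc|k _ /negbTE ks].
  by rewrite inE /in_mem /= ltnS leqn0.
by rewrite /part ks mul0r.
Qed.

Lemma gl_many_product d1 d2 : dle d1 (Fin 1) -> dle d2 (Fin 1) ->
  exists (E : K -> nat -> V) (F : K -> nat -> W),
  (forall z, fam (E z) (F z) d1 d2 (Fin 1) (Fin 1)) /\
  forall z z', param z -> param z' -> deq (E z) (F z) (E z') (F z') -> z = z'.
Proof.
move=> D1 D2.
(* The products of the two sequences are 1 at even and z at odd indices. *)
pose pf (k i : nat) : K := 1; pose qf z (k i : nat) : K := if (i %% 2 == 0)%N then 1 else z.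
have ind (g : nat -> nat -> K) : (forall i, (i %% 2 = 0)%N -> g 0%N i = 1) -> indep_at_inf (Fin 1) g.
  move=> g1 s cc us sc H; have [i [i2]] := io_ae (io_mod (isT : 0 < 2)%N) H.
  rewrite (below1_sum cc g i erefl us sc) g1// mulr1 /part => E k ks.
  have k0 : k = 0%N by have := sc k ks; rewrite /in_mem /= ltnS leqn0 => /eqP.
  by rewrite k0 in ks *; rewrite ks in E.
have /choice[M HM] : forall z : K, exists M : (nat -> V) * (nat -> W) * ((nat -> V) * (nat -> W)),
  [/\ fam M.1.1 M.1.2 d1 d2 (Fin 1) (Fin 1),
   (forall k i, below (Fin 1) k -> pair (M.2.1 k) (M.1.2 i) = pf k i),
   (forall k i, below (Fin 1) k -> pair (M.1.1 i) (M.2.2 k) = qf z k i),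
   complement_to (sum_space (annV pair (span_on predT M.1.2)) (span_on predT M.1.1)) (Fin 1) M.2.1
   & complement_to (sum_space (annW pair (span_on predT M.1.1)) (span_on predT M.1.2)) (Fin 1) M.2.2].
  move=> z.
  have i1 : indep_at_inf (Fin 1) pf by exact: ind.
  have i2 : indep_at_inf (Fin 1) (qf z) by apply: ind => i; rewrite /qf => ->.
  have [e [f [p [q [H1 H2 H3 H4 H5]]]]] := gl_model Vd Wd Hb Hnd D1 D2 i1 i2.
  by exists ((e, f), (p, q)).
exists (fun z => (M z).1.1), (fun z => (M z).1.2); split=> [z|z z' Hz Hz' H]; first by case: (HM z).
have [F1 P1 Q1 _ _] := HM z; have [F2 P2 Q2 C2 C2'] := HM z'.
have [ef1 _ _ _ _] := F1; have [ef2 _ _ _ _] := F2.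
have P : product_inv pair (M z).1.1 (M z).1.2 z.
  exists ((M z).2.1 0%N), ((M z).2.2 0%N); split.
  - exists [::] => i _; rewrite P1// Q1// /pf /qf mul1r; case: ifP; by [left|right].
  - by apply: io_sub (io_mod (isT : 0 < 2)%N) => i i2; rewrite P1// Q1// /pf /qf i2 mul1r.
  - by apply: io_sub (io_mod (isT : 1 < 2)%N) => i i2; rewrite P1// Q1// /pf /qf i2 mul1r.
have [v [w [A O1 O2]]] := product_inv_deq Hb ef1 ef2 H P.
have [s1 [cc1 [us1 sc1 A1]]] := complement_ae Hb ef2 C2 P2 v.
have fe2 : forall i j, pair ((M z').1.1 j) ((M z').1.2 i) = (i == j)%:R by move=> i j; rewrite ef2 eq_sym.
have [s2 [cc2 [us2 sc2 A2]]] := complement_ae (bil_swap Hb) fe2 C2' Q2 w.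
(* Each complement has dimension 1, so [v] and [w] are almost everywhere scalar multiples of the
   model sequences; [t] is the product of the two scalars. *)
pose t := part s1 cc1 0 * part s2 cc2 0.
have B : ae (fun i => pair v ((M z').1.2 i) * pair ((M z').1.1 i) w = t * qf z' 0%N i).
  apply: ae_sub (ae_and A1 A2) => i [-> ->].
  by rewrite !(below1_sum _ _ _ erefl)// /pf mulr1 /t mulrA.
have E0 : t = 1 \/ t = z.
  have [i [i2 [Hi]]] := io_ae (io_mod (isT : 0 < 2)%N) (ae_and B A).
  by rewrite Hi /qf i2 /= mulr1.
have E1 : t * z' = 1 \/ t * z' = z.
  have [i [i2 [Hi]]] := io_ae (io_mod (isT : 1 < 2)%N) (ae_and B A).
  by rewrite Hi /qf i2.
have E2 : t = 1 \/ t * z' = 1.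
  have [i [Hi]] := io_ae O1 B; rewrite Hi /qf; case: ifP => _; rewrite ?mulr1.
    by left.
  by right.
exact: (two_values Hz Hz' E0 E1 E2).
Qed.

End GLFamiliesClasses.

Lemma io_infinite (I : eqType) (P : I -> Prop) : io P -> infinite_set [set i | P i].
Proof.
move=> H /finite_seqP[s Hs]; have [i [/negP si Pi]] := H s; apply: si.
by have : [set i | P i] i by []; rewrite Hs.
Qed.

Section GLFewClasses.
Variables (K : numClosedFieldType) (V W : lmodType K) (pair : V -> W -> K).
Hypothesis Hb : bil pair.
Hypothesis Hnd : nondegenerate_pairing pair.
Local Notation deq := (fam_equiv pair (@any_pair V W)).
Local Notation fam := (@gl_family K V W pair nat).

Lemma span_ann0 (I : eqType) (e : I -> V) (f : I -> W) v :
  (forall i j, pair (e i) (f j) = (i == j)%:R) ->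
  annV pair (span_on predT f) v -> span_on predT e v -> v = 0.
Proof.
move=> ef /(annV_span Hb) Hv /span_rep[s [c [us _ _ vE]]]; rewrite vE.
apply: big1_seq => i /andP[_ si]; have := Hv i; rewrite vE (bil_suml Hb) (bigD1_seq i)//=.
rewrite (bilZl Hb) ef eqxx mulr1 big1 ?addr0 => [->|j /negbTE ji]; first by rewrite scale0r.
by rewrite (bilZl Hb) ef ji mulr0.
Qed.

(** Injectivity comes from nondegeneracy: a vector killed by one map would be orthogonal to
    everything. *)
Lemma surjective_pair_aut (phi : {linear V -> V}) (psi : {linear W -> W}) :
  (forall v w, pair (phi v) (psi w) = pair v w) ->
  (forall v, exists u, phi u = v) -> (forall w, exists u, psi u = w) -> pair_aut pair phi psi.
Proof.
move=> H s1 s2; split=> //; apply: inj_surj_bij => // u v E.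
  apply/eqP; rewrite -subr_eq0; apply/eqP; apply: Hnd.1 => w.
  by rewrite (bilBl Hb) -(H u) -(H v) E subrr.
apply/eqP; rewrite -subr_eq0; apply/eqP; apply: Hnd.2 => w.
by rewrite (bilBr Hb) -(H w u) -(H w v) E subrr.
Qed.

Lemma surjective_on_basis (U : lmodType K) (I : eqType) (D : pred I) (a : I -> U) (phi : {linear U -> U}) :
  basis_on D a -> (forall i, D i -> exists u, phi u = a i) -> forall v, exists u, phi u = v.
Proof.
move=> [_ Sa] H v; apply: (@lspan_min _ _ _ [set v | exists u, phi u = v] _ _ _ (Sa v)).
  split; first by exists 0; rewrite linear0.
  by move=> k _ _ [u <-] [u' <-]; exists (k *: u + u'); rewrite linearP.
by move=> _ [i Di <-]; exact: H.
Qed.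

End GLFewClasses.

Section GLBases.
Variables (K : numClosedFieldType) (V W : lmodType K) (pair : V -> W -> K).
Hypothesis Hb : bil pair.

Lemma gl_family_basis (I : eqType) (e : I -> V) (f : I -> W) d1 d2 c1 c2 :
  gl_family pair e f d1 d2 c1 c2 -> exists x p : nat -> V,
  [/\ basis_on (@dom3 I d1 c1) (cat3 e x p),
      forall k, below d1 k -> annV pair (span_on predT f) (x k),
      forall k, below c1 k -> ~ ae (fun i => pair (p k) (f i) = 0)
    & complement_to (sum_space (annV pair (span_on predT f)) (span_on predT e)) c1 p].
Proof.
move=> [ef _ [D1 _] C1 _].
have [x [p [B1 B2 _ B4 B5]]] := ext_basis (annV_subspace Hb _) (dual_free Hb ef)
  (fun v => span_ann0 Hb ef) D1 C1.
exists x, p; split=> // k kc /(ae0_small Hb ef); exact: B4.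
Qed.
End GLBases.

Section GLOneClass.
Variables (K : numClosedFieldType) (V W : lmodType K) (pair : V -> W -> K).
Hypothesis Hb : bil pair.
Hypothesis Hnd : nondegenerate_pairing pair.
Local Notation deq := (fam_equiv pair (@any_pair V W)).
Local Notation fam := (@gl_family K V W pair nat).

Lemma gl_equiv_zero e f e' f' : fam e f (Fin 0) (Fin 0) (Fin 0) (Fin 0) ->
  fam e' f' (Fin 0) (Fin 0) (Fin 0) (Fin 0) -> deq e f e' f'.
Proof.
move=> F F'; have [ef _ _ _ _] := F; have [ef' _ _ _ _] := F'.
have [x [p [Ba _ _ _]]] := gl_family_basis Hb F.
have [x' [p' [Ba' _ _ _]]] := gl_family_basis Hb F'.
have [y [q [Bb _ _ _]]] := gl_family_basis (bil_swap Hb) (gl_family_swap F).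
have [y' [q' [Bb' _ _ _]]] := gl_family_basis (bil_swap Hb) (gl_family_swap F').
have [phi Hphi] := basis_ext (cat3 e' (fun=> 0) (fun=> 0)) Ba.
have [psi Hpsi] := basis_ext (cat3 f' (fun=> 0) (fun=> 0)) Bb.
have phiE i : phi (e i) = e' i by exact: (Hphi (inl (inl i)) isT).
have psiE i : psi (f i) = f' i by exact: (Hpsi (inl (inl i)) isT).
exists phi, psi, id, (fun=> 1), (fun=> 1); split=> //; last first.
- by move=> i; rewrite oner_neq0 !scale1r phiE psiE.
- by exists id.
apply: surjective_pair_aut => //.
- apply: (gram_pair Hb Hb Ba Bb) => -[[i|//]|//] [[j|//]|//] _ _ /=.
  by rewrite phiE psiE ef ef'.
- by apply: (surjective_on_basis Ba') => -[[i|//]|//] _ /=; exists (e i).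
- by apply: (surjective_on_basis Bb') => -[[i|//]|//] _ /=; exists (f i).
Qed.

Section Line.
Variable d : dimension.
Hypothesis d1 : forall k, below d k -> k = 0%N.

(** [y 0] is orthogonal to every [e i], and [V] is spanned by the [e i] and [p 0], so nondegeneracy
    leaves only [p 0] to detect it. *)
Lemma line_pairing e f x p y q :
  fam e f (Fin 0) d (Fin 1) (Fin 0) ->
  basis_on (@dom3 nat (Fin 0) (Fin 1)) (cat3 e x p) ->
  basis_on (@dom3 nat d (Fin 0)) (cat3 f y q) ->
  (forall k, below d k -> annW pair (span_on predT e) (y k)) ->
  below d 0 -> pair (p 0%N) (y 0%N) != 0.
Proof.
move=> [ef _ _ _ _] Ba Bb Hy d0; apply/eqP => E.
have y0 : y 0%N = 0.
  apply: Hnd.2 => v; apply: (lspan_lin (bil_linl Hb (y 0%N)) (set0_subspace _) _ (Ba.2 v)).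
  move=> _ [[[i|//]|k] Hi <-] /=; first by move/(annW_span Hb): (Hy 0%N d0); exact.
  by move: Hi; rewrite /= ltnS leqn0 => /eqP ->.
have := Bb.1 [:: inl (inr 0%N)] (fun=> 1) isT; rewrite big_seq1 /= y0 scaler0.
have sD : {subset [:: inl (inr 0%N)] <= @dom3 nat d (Fin 0)} by move=> i; rewrite inE => /eqP ->.
by move=> /(_ sD erefl _ (mem_head _ _))/eqP; rewrite oner_eq0.
Qed.

(** Inverse rescalings of [e i] and [f i] adjust each nonzero value of a single sequence at will, so
    only the zero pattern has to be matched, after the permutation [pi] and the finite modification
    [sg] of [p']. *)
Lemma gl_equiv_line e f e' f' x p y q x' p' y' q' (pi : nat -> nat) sg :
  fam e f (Fin 0) d (Fin 1) (Fin 0) -> fam e' f' (Fin 0) d (Fin 1) (Fin 0) ->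
  basis_on (@dom3 nat (Fin 0) (Fin 1)) (cat3 e x p) ->
  basis_on (@dom3 nat d (Fin 0)) (cat3 f y q) ->
  (forall k, below d k -> annW pair (span_on predT e) (y k)) ->
  basis_on (@dom3 nat (Fin 0) (Fin 1)) (cat3 e' x' p') ->
  basis_on (@dom3 nat d (Fin 0)) (cat3 f' y' q') ->
  (forall k, below d k -> annW pair (span_on predT e') (y' k)) ->
  bijective pi -> span_on predT e' sg ->
  (forall i, (pair (p 0%N) (f i) == 0) = (pair (p' 0%N + sg) (f' (pi i)) == 0)) ->
  deq e f e' f'.
Proof.
move=> F F' Ba Bb Hy Ba' Bb' Hy' [ip piK Kpi] Hsg Hz.
have [ef _ _ _ _] := F; have [ef' _ _ _ _] := F'.
pose a i := pair (p 0%N) (f i); pose a' i := pair (p' 0%N + sg) (f' (pi i)).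
(* Where the value is 0 any nonzero factor serves; elsewhere the ratio of the two values is
   forced. *)
pose l i := if a i == 0 then 1 else a' i / a i.
have l0 i : l i != 0.
  rewrite /l; case: ifPn => [_|ai]; first exact: oner_neq0.
  by rewrite mulf_neq0 ?invr_eq0// /a' -Hz.
have la i : (l i)^-1 * a' i = a i.
  rewrite /l; case: ifPn => [/eqP ai|ai].
    by rewrite invr1 mul1r ai; apply/eqP; rewrite -Hz -/(a i) ai eqxx.
  have a'i : a' i != 0 by rewrite /a' -Hz.
  by rewrite invfM invrK mulrAC mulVf// mul1r.
have ysg : below d 0 -> pair sg (y' 0%N) = 0 by move=> d0; exact: (Hy' _ d0).
have yn (d0 : below d 0) : pair (p 0%N) (y 0%N) != 0 := line_pairing F Ba Bb Hy d0.
have yn' (d0 : below d 0) : pair (p' 0%N) (y' 0%N) != 0 := line_pairing F' Ba' Bb' Hy' d0.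
(* Normalizes the pairing of the complement with S^perp, when S^perp is a line. *)
pose mu := pair (p 0%N) (y 0%N) / pair (p' 0%N) (y' 0%N).
have [phi Hphi] := basis_ext (cat3 (fun i => l i *: e' (pi i)) (fun=> 0) (fun=> p' 0%N + sg)) Ba.
have [psi Hpsi] := basis_ext (cat3 (fun i => (l i)^-1 *: f' (pi i)) (fun k => mu *: y' k) (fun=> 0)) Bb.
have phiE i : phi (e i) = l i *: e' (pi i) by exact: (Hphi (inl (inl i)) isT).
have psiE i : psi (f i) = (l i)^-1 *: f' (pi i) by exact: (Hpsi (inl (inl i)) isT).
have phip : phi (p 0%N) = p' 0%N + sg by exact: (Hphi (inr 0%N) isT).
have psiy (d0 : below d 0) : psi (y 0%N) = mu *: y' 0%N by exact: (Hpsi (inl (inr 0%N)) d0).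
have pinj : injective pi := can_inj piK.
exists phi, psi, pi, l, (fun i => (l i)^-1); split=> //; last first.
- by move=> i; rewrite invr_eq0 l0.
- by exists ip.
have phi_e' j : exists u, phi u = e' j.
  exists ((l (ip j))^-1 *: e (ip j)).
  by rewrite linearZ/= phiE scalerA mulVf// scale1r Kpi.
apply: surjective_pair_aut => //.
- apply: (gram_pair Hb Hb Ba Bb) => -[[i|//]|k] [[j|l']|//] Di Dj /=.
  + rewrite phiE psiE (bilZl Hb) (bilZr Hb) ef ef' (inj_eq pinj).
    by case: eqP => [->|_]; rewrite ?mulr0// mulr1 mulfV.
  + have l'0 := d1 Dj; rewrite {l'}l'0 in Dj *; rewrite phiE psiy// (bilZl Hb) (bilZr Hb).
    move/(annW_span Hb): (Hy _ Dj) => ->.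
    by move/(annW_span Hb): (Hy' _ Dj) => ->; rewrite !mulr0.
  + by move: Di; rewrite /= ltnS leqn0 => /eqP ->; rewrite phip psiE (bilZr Hb) -/(a' j) la.
  + have l'0 := d1 Dj; rewrite {l'}l'0 in Dj *.
    move: Di; rewrite /= ltnS leqn0 => /eqP ->; rewrite phip psiy// (bilZr Hb) (bilDl Hb) ysg// addr0.
    by rewrite /mu divfK// yn'.
- apply: (surjective_on_basis Ba') => -[[j|//]|k] Di /=; first exact: phi_e'.
  move: Di; rewrite /= ltnS leqn0 => /eqP ->.
  have [u Hu] : exists u, phi u = sg.
    apply: (@lspan_min _ _ _ [set v | exists u, phi u = v] _ _ _ Hsg).
      split; first by exists 0; rewrite linear0.
      by move=> c _ _ [u <-] [u' <-]; exists (c *: u + u'); rewrite linearP.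
    by move=> _ [j _ <-]; exact: phi_e'.
  by exists (p 0%N - u); rewrite linearB/= phip Hu addrK.
- apply: (surjective_on_basis Bb') => -[[j|k]|//] Di /=.
    exists (l (ip j) *: f (ip j)); rewrite linearZ/= psiE scalerA mulfV// scale1r Kpi.
    by [].
  have k0 := d1 Di; rewrite {k}k0 in Di *.
  exists (mu^-1 *: y 0%N); rewrite linearZ/= psiy// scalerA mulVf ?scale1r//.
  by rewrite mulf_neq0 ?invr_eq0// ?yn ?yn'.
Qed.

Lemma zero_inv_line e f x p : fam e f (Fin 0) d (Fin 1) (Fin 0) ->
  (forall k, below (Fin 1) k -> ~ ae (fun i => pair (p k) (f i) = 0)) ->
  complement_to (sum_space (annV pair (span_on predT f)) (span_on predT e)) (Fin 1) p ->
  basis_on (@dom3 nat (Fin 0) (Fin 1)) (cat3 e x p) ->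
  io (fun i => pair (p 0%N) (f i) != 0) /\
  (zero_inv pair f <-> io (fun i => pair (p 0%N) (f i) = 0)).
Proof.
move=> [ef _ _ _ _] Hp Hc _.
have n0 : io (fun i => pair (p 0%N) (f i) != 0).
  apply: not_ae => H; apply: (Hp 0%N isT); apply: ae_sub H => i /negP.
  by rewrite negbK => /eqP.
split=> //; split; last by move=> H; exists (p 0%N).
move=> [v [O1 O2]].
have [s [cc [us sc A]]] := complement_ae Hb ef Hc (pf := fun k i => pair (p k) (f i)) (fun _ _ _ => erefl) v.
have {}A : ae (fun i => pair v (f i) = part s cc 0 * pair (p 0%N) (f i)).
  apply: ae_sub A => i ->.
  exact: (below1_sum cc (fun k i => pair (p k) (f i)) i erefl us sc).
have [i [vi Ei]] := io_ae O2 A.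
have c0 : part s cc 0 != 0 by apply: contraNneq vi => c0; rewrite Ei c0 mul0r.
apply: io_sub (io_and_ae O1 A) => j [Hj].
by move=> /esym/eqP; rewrite Hj mulf_eq0 (negbTE c0) => /eqP.
Qed.

Lemma gl_equiv_line_iff e f e' f' : fam e f (Fin 0) d (Fin 1) (Fin 0) ->
  fam e' f' (Fin 0) d (Fin 1) (Fin 0) -> (zero_inv pair f <-> zero_inv pair f') -> deq e f e' f'.
Proof.
move=> F F' E; have [ef _ _ _ _] := F; have [ef' _ _ _ _] := F'.
have [x [p [Ba _ Hp Hc]]] := gl_family_basis Hb F.
have [x' [p' [Ba' _ Hp' Hc']]] := gl_family_basis Hb F'.
have [y [q [Bb Hy _ _]]] := gl_family_basis (bil_swap Hb) (gl_family_swap F).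
have [y' [q' [Bb' Hy' _ _]]] := gl_family_basis (bil_swap Hb) (gl_family_swap F').
have [O1 Z1] := zero_inv_line F Hp Hc Ba; have [O1' Z1'] := zero_inv_line F' Hp' Hc' Ba'.
have Se := span_on_subspace predT e'.
have [zi|nz] := pselect (io (fun i => pair (p 0%N) (f i) = 0)).
  have zi' : io (fun i => pair (p' 0%N) (f' i) = 0) by apply/Z1'/E/Z1.
  pose P i := pair (p 0%N) (f i) == 0; pose P' i := pair (p' 0%N) (f' i) == 0.
  have inf1 : infinite_set [set i | P i] by apply: io_infinite; apply: io_sub zi => i Ei; rewrite /P Ei eqxx.
  have inf2 : infinite_set [set i | ~~ P i] by apply: io_infinite.
  have inf1' : infinite_set [set i | P' i] by apply: io_infinite; apply: io_sub zi' => i Ei; rewrite /P' Ei eqxx.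
  have inf2' : infinite_set [set i | ~~ P' i] by apply: io_infinite.
  have [r1 [q1 [a1 b1 g1]]] := enum_pred inf1; have [r2 [q2 [a2 b2 g2]]] := enum_pred inf2.
  have [r1' [q1' [a1' b1' g1']]] := enum_pred inf1'; have [r2' [q2' [a2' b2' g2']]] := enum_pred inf2'.
  (* Zeros go to zeros and nonzeros to nonzeros; all four index sets are infinite here. *)
  pose pi i := if P i then q1' (r1 i) else q2' (r2 i).
  pose ip i := if P' i then q1 (r1' i) else q2 (r2' i).
  have Ppi i : P' (pi i) = P i.
    by rewrite /pi; case: ifP => _; [exact: a1'|apply: negbTE; exact: a2'].
  have Pip i : P (ip i) = P' i.
    by rewrite /ip; case: ifP => _; [exact: a1|apply: negbTE; exact: a2].
  have piK : cancel pi ip.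
    move=> i; rewrite /ip Ppi /pi; case: (boolP (P i)) => Pi; [by rewrite b1' g1|by rewrite b2' g2].
  have Kpi : cancel ip pi.
    move=> i; rewrite /pi Pip /ip; case: (boolP (P' i)) => Pi; [by rewrite b1 g1'|by rewrite b2 g2'].
  apply: (gl_equiv_line (pi := pi) (sg := 0) F F' Ba Bb Hy Ba' Bb' Hy') => //.
  - by exists ip.
  - exact: (subspace0 Se).
  - by move=> j; rewrite addr0 -[RHS]/(P' (pi j)) Ppi.
have nz' : ~ io (fun i => pair (p' 0%N) (f' i) = 0) by move=> /Z1'/E/Z1.
have [s Hs] : ae (fun i => pair (p 0%N) (f i) <> 0).
  by apply: contrapT => H; apply: nz; exact: not_ae.
have [s' Hs'] : ae (fun i => pair (p' 0%N) (f' i) <> 0).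
  by apply: contrapT => H; apply: nz'; exact: not_ae.
pose t := undup (s ++ s').
(* On the finite set [t] the modified sequence of [p'] takes the values of that of [p]; outside [t]
   neither sequence vanishes. *)
pose sg := \sum_(i <- t) (pair (p 0%N) (f i) - pair (p' 0%N) (f' i)) *: e' i.
apply: (gl_equiv_line (pi := id) (sg := sg) F F' Ba Bb Hy Ba' Bb' Hy') => //.
- by exists id.
- exact: span_on_sum.
- move=> i; rewrite (bilDl Hb) (bil_suml Hb); case: (boolP (i \in t)) => it.
    rewrite (bigD1_seq i)//= ?undup_uniq// (bilZl Hb) ef' eqxx mulr1 big1 ?addr0.
      by rewrite addrC subrK.
    by move=> j /negbTE ji; rewrite (bilZl Hb) ef' ji mulr0.
  rewrite big1_seq ?addr0; last first.
    move=> j /andP[_ jt]; rewrite (bilZl Hb) ef'; case: eqP => [ji|]; last by rewrite mulr0.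
    by rewrite -ji jt in it.
  move: it; rewrite mem_undup mem_cat negb_or => /andP[/Hs/eqP/negbTE -> /Hs'/eqP/negbTE ->].
  by [].
Qed.

Lemma gl_two_models : has_dim [set: V] Aleph0 -> has_dim [set: W] Aleph0 ->
  exists e1 f1 e2 f2, [/\ fam e1 f1 (Fin 0) d (Fin 1) (Fin 0), fam e2 f2 (Fin 0) d (Fin 1) (Fin 0),
    ~ zero_inv pair f1 & zero_inv pair f2].
Proof.
move=> Vd Wd.
have dd : dle d (Fin 1) by move=> k /d1 ->.
have d0 : dle (Fin 0) (Fin 0) by [].
have ind (g : nat -> nat -> K) : (forall i, (i %% 2 = 0)%N -> g 0%N i = 1) -> indep_at_inf (Fin 1) g.
  move=> g1 s cc us sc H; have [i [i2]] := io_ae (io_mod (isT : 0 < 2)%N) H.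
  rewrite (below1_sum cc g i erefl us sc) g1// mulr1 /part => E k ks.
  have k0 : k = 0%N by have := sc k ks; rewrite /in_mem /= ltnS leqn0 => /eqP.
  by rewrite k0 in ks *; rewrite ks in E.
(* Representatives of the two classes: no zeros, and infinitely many zeros. *)
pose g1 (k i : nat) : K := 1; pose g2 (k i : nat) : K := (i %% 2 == 0)%N%:R.
have i1 : indep_at_inf (Fin 1) g1 by exact: ind.
have i2 : indep_at_inf (Fin 1) g2 by apply: ind => i; rewrite /g2 => ->.
have i0 : indep_at_inf (Fin 0) (fun k i : nat => 0 : K) by move=> s cc us sc _ k /sc.
have [e1 [f1 [p1 [q1 [F1 P1 _ C1 _]]]]] := gl_model Vd Wd Hb Hnd d0 dd i1 i0.
have [e2 [f2 [p2 [q2 [F2 P2 _ C2 _]]]]] := gl_model Vd Wd Hb Hnd d0 dd i2 i0.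
exists e1, f1, e2, f2; split=> //.
- move=> [v [O1 O2]]; have [ef _ _ _ _] := F1.
  have [s [cc [us sc A]]] := complement_ae Hb ef C1 P1 v.
  have {}A : ae (fun i => pair v (f1 i) = part s cc 0).
    apply: ae_sub A => i ->.
    by rewrite (below1_sum cc g1 i erefl us sc) /g1 mulr1.
  have [i [/eqP vi Ei]] := io_ae O2 A; have [j [vj Ej]] := io_ae O1 A.
  by apply: vi; rewrite Ei -Ej.
- exists (p2 0%N); split.
    by apply: io_sub (io_mod (isT : 1 < 2)%N) => i H; rewrite P2// /g2 H.
  by apply: io_sub (io_mod (isT : 0 < 2)%N) => i H; rewrite P2// /g2 H eqxx oner_neq0.
Qed.

End Line.
End GLOneClass.

(** * Self-dual families *)

Definition hflip (x : nat * bool) := (x.1, ~~ x.2).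

Lemma hflipK : involutive hflip.
Proof. by case=> i b; rewrite /hflip /= negbK. Qed.

Lemma ae_fiber (P : nat * bool -> Prop) b : ae P -> ae (fun i => P (i, b)).
Proof.
move=> [s H]; exists (map fst s) => i si; apply: H; apply: contra si => si.
by apply/mapP; exists (i, b).
Qed.

Lemma io_fiber (P : nat * bool -> Prop) b : io (fun i => P (i, b)) -> io P.
Proof.
move=> H s; have [i [si Pi]] := H (map fst s); exists (i, b); split=> //.
by apply: contra si => si; apply/mapP; exists (i, b).
Qed.

Lemma has_dim_uniq (K : fieldType) (V : lmodType K) (X : set V) d n :
  has_dim X d -> has_dim X (Fin n) -> d = Fin n.
Proof.
move=> /dim_quotP[e [e1 e2 e3]] /dim_quotP[u [u1 u2 u3]].
have se v : X v -> span_on (below d) e v.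
  move=> /e2[s [c [us sD /eqP]]]; rewrite subr_eq0 => /eqP ->; exact: span_on_sum.
have su v : X v -> span_on (below (Fin n)) u v.
  move=> /u2[s [c [us sD /eqP]]]; rewrite subr_eq0 => /eqP ->; exact: span_on_sum.
have fu : free_on (upto n) u by move=> s c us sD E; exact: (u3 s c us sD).
have fe : free_on (below d) e by move=> s c us sD E; exact: (e3 s c us sD).
case: d e1 e2 e3 se fe => [m|] e1 e2 e3 se fe; last first.
  have fe' : free_on (upto n.+1) e by move=> s c us _; exact: fe.
  have := free_le fe' (e := u) (n := n) (fun i _ => su _ (e1 i isT)).
  by rewrite ltnn.
congr Fin; apply/eqP; rewrite eqn_leq (free_le fe (fun i Hi => su _ (e1 i Hi))).
exact: (free_le fu (fun i Hi => se _ (u1 i Hi))).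
Qed.

Section SelfFamilies.
Variables (K : numClosedFieldType) (V : lmodType K) (form : V -> V -> K) (eta : K).
Hypothesis Hb : bil form.
Hypothesis Hnd : nondegenerate_pairing form.
Hypothesis form_sym : forall u v, form u v = eta * form v u.
Hypothesis eta2 : eta = 1 \/ eta = -1.

Definition sg (b : bool) := if b then eta else 1.

Lemma eta_sq : eta * eta = 1.
Proof. by case: eta2 => ->; rewrite ?mulr1 ?mulrN1 ?opprK. Qed.

Lemma sg_sq b : sg b * sg b = 1.
Proof. by case: b; rewrite /sg ?mulr1 ?eta_sq. Qed.

Lemma sg_flip b : sg (~~ b) = eta * sg b.
Proof. by case: b; rewrite /sg /= ?mulr1 ?eta_sq. Qed.

Definition hyperbolic (E : nat * bool -> V) := forall p q,
  form (E p) (E q) = if (p.1 == q.1) && (p.2 != q.2) then sg p.2 else 0.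

(** Pairing [E] with this family turns a hyperbolic system into a dual family on [V] and itself, to
    which the results on pairings apply. *)
Definition hyp_dual (E : nat * bool -> V) x := sg x.2 *: E (hflip x).

Lemma hyp_dualK E x : E x = sg (~~ x.2) *: hyp_dual E (hflip x).
Proof. by rewrite /hyp_dual scalerA sg_sq scale1r hflipK. Qed.

Lemma hyp_dualE E : hyperbolic E -> forall x y, form (E x) (hyp_dual E y) = (x == y)%:R.
Proof.
move=> HE [i b] [j b']; rewrite (bilZr Hb) HE /= xpair_eqE negb_eqb addbN negb_add.
case: eqP => _ /=; last by rewrite mulr0.
by case: eqP => [->|]; rewrite ?sg_sq ?mulr0.
Qed.

Lemma span_hyp_dual E : span_on predT (hyp_dual E) = span_on predT E.
Proof.
rewrite eqEsubset; split; apply: lspan_min; try exact: span_on_subspace.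
  move=> _ [x _ <-]; apply: (subspaceZ (span_on_subspace _ _)); exact: span_on_in.
move=> _ [x _ <-]; rewrite hyp_dualK; apply: (subspaceZ (span_on_subspace _ _)); exact: span_on_in.
Qed.

Lemma annWV S : annW form S = annV form S.
Proof. by apply/seteqP; split=> u Hu v Sv; rewrite form_sym Hu ?mulr0. Qed.

Definition self_family (E : nat * bool -> V) r d c :=
  let X := annV form (span_on predT E) in
  [/\ hyperbolic E, dim_quot X (annV form X) r, has_dim X d
    & has_codim (sum_space X (span_on predT E)) c].

Lemma self_family_basis E r d c : self_family E r d c -> exists x p : nat -> V,
  [/\ basis_on (@dom3 (nat * bool) d c) (cat3 E x p),
    forall k, below d k -> annV form (span_on predT E) (x k)
    & forall v, annV form (span_on predT E) v -> span_on (below d) x v].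
Proof.
move=> [HE _ D1 C1]; have ef := hyp_dualE HE.
have Hv v : annV form (span_on predT E) v -> span_on predT E v -> v = 0.
  by rewrite -{1}span_hyp_dual; exact: (span_ann0 Hb ef).
have [x [p [B1 B2 B3 _ _]]] := ext_basis (annV_subspace Hb _) (dual_free Hb ef) Hv D1 C1.
by exists x, p.
Qed.

(* Changing the pairings of [p] with [E] in the Gram matrix of a basis [E, x, p]
   preserves both the nondegeneracy and the form induced on [E^perp]. *)
Lemma self_remodel E r d c (pf : nat -> nat * bool -> K) : has_dim [set: V] Aleph0 ->
  self_family E r d c -> indep_at_inf c pf ->
  exists (E' : nat * bool -> V) (p : nat -> V), [/\ self_family E' r d c,
    forall k x, below c k -> form (p k) (hyp_dual E' x) = pf k x
    & complement_to (sum_space (annV form (span_on predT E')) (span_on predT E')) c p].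
Proof.
move=> Vd F Hp; have [x [p [Ba Hx xX]]] := self_family_basis F; have [HE HR HD HC] := F.
set X := annV form _ in HR HD HC Hx.
pose a := cat3 E x p; pose D := @dom3 (nat * bool) d c.
(* The prescribed values are pairings with [hyp_dual]; [pe] converts them into pairings with the
   hyperbolic system itself. *)
pose pe k (y : nat * bool) := sg (~~ y.2) * pf k (hflip y).
pose B (i j : ext (nat * bool)) : K := match i, j with
  | inr k, inl (inl y) => pe k y
  | inl (inl y), inr k => eta * pe k y
  | _, _ => form (a i) (a j) end.
have xE k y : below d k -> form (x k) (E y) = 0.
  by move=> kd; move/(annV_span Hb): (Hx k kd); apply.
have B_sym i j : D i -> D j -> B i j = eta * B j i.
  by case: i => [[i|i]|i]; case: j => [[j|j]|j] _ _ //=; rewrite ?mulrA ?eta_sq ?mul1r.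
have BF i y : D i -> sg y.2 * B i (inl (inl (hflip y))) = ext_pairing pf i y.
  case: i => [[i|i]|i] Di /=.
  - by rewrite -(hyp_dualE HE) (bilZr Hb).
  - by rewrite xE// mulr0.
  - by rewrite /pe /= negbK mulrA sg_sq mul1r hflipK.
have row s (cc : ext (nat * bool) -> K) : uniq s -> {subset s <= D} ->
    (forall y, \sum_(i <- s) cc i * B i (inl (inl y)) = 0) ->
    (forall k, inr k \in s -> cc (inr k) = 0) /\
    (forall i, inl (inl i) \in s -> cc (inl (inl i)) = 0).
  move=> us sD H; apply: (ext_row (c := cc) Hp us sD) => y.
  have /(congr1 (fun t => sg y.2 * t)) := H (hflip y); rewrite mulr0 mulr_sumr => E0; apply: etrans E0.
  by apply: eq_big_seq => i /sD Di; rewrite -BF// mulrCA.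
have nd s (cc : ext (nat * bool) -> K) : uniq s -> {subset s <= D} ->
    (forall j, D j -> \sum_(i <- s) cc i * B i j = 0) -> forall i, i \in s -> cc i = 0.
  move=> us sD H; have [P0 S0] := row s cc us sD (fun y => H (inl (inl y)) isT).
  have xa k j : below d k -> form (x k) (a j) = B (inl (inr k)) j by case: j => [[]|].
  pose u := \sum_(k <- pmap (@getX _) s) cc (inl (inr k)) *: x k.
  have u0 : u = 0.
    apply: Hnd.1 => v; apply: (lspan_lin (bil_linr Hb u) (set0_subspace _) _ (Ba.2 v)).
    move=> _ [j Dj <-]; apply: etrans _ (H j Dj); rewrite sum_ext /= big1_seq ?add0r; last first.
      by move=> i; rewrite mem_getS => /andP[_ /S0 ->]; rewrite mul0r.
    rewrite [X in _ = _ + X]big1_seq ?addr0; last first.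
      by move=> i; rewrite mem_getP => /andP[_ /P0 ->]; rewrite mul0r.
    rewrite /u (bil_suml Hb); apply: eq_big_seq => k; rewrite mem_getX => /sD kd.
    by rewrite (bilZl Hb) xa.
  move=> [[i|k]|k] si; [exact: S0 | | exact: P0].
  have fx : free_on (below d) x.
    have [fa _] := Ba; move=> t b ut tD E0 l lt.
    have um : uniq (map (fun k => inl (inr k) : ext (nat * bool)) t).
      by rewrite map_inj_uniq// => ? ? [].
    have := fa _ (fun i => if getX i is Some k then b k else 0) um.
    rewrite big_map /= => /(_ _ E0 (inl (inr l))); apply; last exact: map_f.
    by move=> _ /mapP[k' /tD Hk' ->].
  apply: (fx (pmap (@getX _) s) (fun k => cc (inl (inr k)))) => //.
  - exact: getX_uniq.
  - by move=> l; rewrite mem_getX => /sD.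
  - by rewrite mem_getX.
have Dinf : infinite_set [set i | D i].
  by apply: (infinite_of_inj (q := fun n => inl (inl (n, false)))) => // m n [].
have [a' [Ba' a'B]] := realize_form Vd Hb Hnd form_sym eta2 Dinf B_sym nd.
pose E' y := a' (inl (inl y)); pose x' k := a' (inl (inr k)); pose p' k := a' (inr k).
have a'E : cat3 E' x' p' = a' by apply/funext => -[[]|].
have HE' : hyperbolic E' by move=> y z; rewrite a'B//= HE.
have a'F i y : D i -> form (a' i) (hyp_dual E' y) = ext_pairing pf i y.
  by move=> Di; rewrite (bilZr Hb) a'B// BF.
have XE v : annV form (span_on predT E') v <-> span_on (below d) x' v.
  by rewrite -span_hyp_dual; exact: (ext_annV Hb v Hp Ba').
have Ba'' : basis_on D (cat3 E' x' p') by rewrite a'E.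
have [D' C'] := basis_dims Ba'' XE.
exists E', p'; split; last 2 first.
- by move=> k y kc; rewrite a'F.
- by apply: (basis_complement Ba'') => v; apply (XE v).2.
split=> //.
(* [phi] maps the old basis to the new one and is isometric on [X], where the Gram matrix was kept;
   it transports the radical of [X] and with it the rank. *)
have [phi Hphi] := basis_ext a' Ba.
have SX : is_subspace X by exact: annV_subspace.
have SX' := annV_subspace Hb (span_on predT E').
have phix k : below d k -> phi (x k) = x' k by move=> kd; exact: (Hphi (inl (inr k)) kd).
have phiX u : X u -> annV form (span_on predT E') (phi u).
  move=> /xX; apply: (lspan_lin (linear_lin phi) SX') => _ [k kd <-]; rewrite phix//.
  by apply/XE; exact: span_on_in.
have onX v : annV form (span_on predT E') v -> exists2 u, X u & phi u = v.
  move=> /XE; apply: (@lspan_min _ _ _ [set v | exists2 u, X u & phi u = v]) => [|_ [k kd <-]].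
    split; first by exists 0; [exact: subspace0 SX | rewrite linear0].
    move=> t _ _ [u Xu <-] [u' Xu' <-]; exists (t *: u + u'); last by rewrite linearP.
    by apply SX.2.
  by exists (x k); [exact: Hx | exact: phix].
have phiB u v : X u -> X v -> form (phi u) (phi v) = form u v.
  move=> /xX Hu /xX; move: v; apply: (@lspan_min _ _ _ [set v | form (phi u) (phi v) = form u v]) => [|_ [l ld <-]].
    split=> [|t v w /= Ev Ew]; first by rewrite /= linear0 !(bil0r Hb).
    by rewrite linearP !(bilDr Hb) !(bilZr Hb) Ev Ew.
  move: u Hu; apply: (@lspan_min _ _ _ [set u | form (phi u) (phi (x l)) = form u (x l)]) => [|_ [k kd <-]].
    split=> [|t v w /= Ev Ew]; first by rewrite /= linear0 !(bil0l Hb).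
    by rewrite linearP !(bilDl Hb) !(bilZl Hb) Ev Ew.
  by rewrite /= !phix// a'B.
have radE u : X u -> annV form X u <-> annV form (annV form (span_on predT E')) (phi u).
  move=> Xu; split=> [H _ /onX[v Xv <-]|H v Xv]; first by rewrite phiB// H.
  by rewrite -phiB//; apply: H; exact: phiX.
have [e [e1 e2 e3]] := HR.
have esum N (t : nat -> K) : X (\sum_(i < N | below r i) t i *: e i).
  by apply: (subspace_sum SX) => // i ri; apply: (subspaceZ SX); exact: e1.
have phisum N (t : nat -> K) : phi (\sum_(i < N | below r i) t i *: e i) =
    \sum_(i < N | below r i) t i *: phi (e i).
  by rewrite linear_sum; apply: eq_bigr => i _; rewrite linearZ.
exists (phi \o e); split=> [i ri|v /onX[u Xu <-]|N t].
- by apply: phiX; exact: e1.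
- have [N [t Ht]] := e2 u Xu; exists N, t; rewrite -phisum -linearB.
  have Xw : X (u - \sum_(i < N | below r i) t i *: e i) by apply: (subspaceB SX).
  by apply (radE _ Xw).1.
- by rewrite -phisum => /radE-/(_ (esum N t)); exact: e3.
Qed.

(* On the classes 0 and 1 modulo 3 only the first sequence is nonzero, and there the
   products of its values at [(i, false)] and [(i, true)] are 1 and z; on the class 2
   all these products vanish. *)
Definition pfs (z : K) (k : nat) (x : nat * bool) : K :=
  if (x.1 %% 3 == 2)%N then (if x.2 then 0 else x.1%:R ^+ k)
  else if k is 0 then (if (x.1 %% 3 == 1)%N && x.2 then z else 1) else 0.

Lemma indep_pfs z c : indep_at_inf c (pfs z).
Proof.
move=> s cc us sc /(ae_fiber false) H.
apply: (seq_poly_eq0 us); apply: (@io_poly_mod _ 3 2) => //.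
by apply: ae_sub H => i H i2; rewrite seq_polyE -[RHS]H; apply: eq_bigr => k _; rewrite /pfs /= i2.
Qed.

(** The products at (i, false) and (i, true) agree up to the sign [eta], which the square removes.
    The value 0 is allowed because the class reserved for the remaining sequences contributes it. *)
Definition square_inv (E F : nat * bool -> V) z := exists v,
  let T x := (form v (F x) * form (E x) v) ^+ 2 in
  [/\ ae (fun x => T x = 0 \/ T x = 1 \/ T x = z), io (fun x => T x = 1) & io (fun x => T x = z)].

Definition same_pair (phi psi : V -> V) := phi =1 psi.

Lemma square_inv_deq E F E' F' z : (forall i j, form (E i) (F j) = (i == j)%:R) ->
  (forall i j, form (E' i) (F' j) = (i == j)%:R) ->
  fam_equiv form same_pair E F E' F' -> square_inv E F z -> square_inv E' F' z.
Proof.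
move=> ef ef' /(deq_transport Hb ef ef')[phi [psi [p [l [m [bp sp lm H1 H2]]]]]] [v [A O1 O2]].
have E0 i : form (phi v) (F' (p i)) * form (E' (p i)) (phi v) = form v (F i) * form (E i) v.
  by rewrite H1 {1}sp H2 mulrACA lm mul1r.
exists (phi v); split.
- by apply: (ae_bij bp); apply: ae_sub A => i; rewrite !E0.
- by apply: (io_bij bp); apply: io_sub O1 => i; rewrite !E0.
- by apply: (io_bij bp); apply: io_sub O2 => i; rewrite !E0.
Qed.

Lemma square_product E v i b :
  (form v (hyp_dual E (i, b)) * form (E (i, b)) v) ^+ 2 =
  (form v (hyp_dual E (i, false)) * form v (hyp_dual E (i, true))) ^+ 2.
Proof.
have e2 : eta ^+ 2 = 1 by rewrite expr2 eta_sq.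
have s2 b' : sg b' ^+ 2 = 1 by rewrite expr2 sg_sq.
have -> : form (E (i, b)) v = eta * (sg (~~ b) * form v (hyp_dual E (i, ~~ b))).
  by rewrite form_sym {1}hyp_dualK (bilZr Hb).
rewrite !exprMn e2 s2 !mul1r; case: b => //=; exact: mulrC.
Qed.

Lemma self_square_model E z p r d c : self_family E r d c -> below c 0 ->
  (forall k x, below c k -> form (p k) (hyp_dual E x) = pfs z k x) ->
  square_inv E (hyp_dual E) (z ^+ 2).
Proof.
move=> F c0 Hp; exists (p 0%N).
have T i b : (form (p 0%N) (hyp_dual E (i, b)) * form (E (i, b)) (p 0%N)) ^+ 2 =
    if (i %% 3 == 2)%N then 0 else if (i %% 3 == 1)%N then z ^+ 2 else 1.
  rewrite square_product !Hp// /pfs /=; case: ifP => _; first by rewrite mulr0 expr0n.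
  by rewrite andbF andbT; case: ifP => _; rewrite ?mul1r ?mulr1 ?expr1n.
split.
- exists [::] => -[i b] _; rewrite T; case: ifP => _; first by left.
  by case: ifP => _; [right; right | right; left].
- apply: (@io_fiber _ false); apply: io_sub (io_mod (isT : 0 < 3)%N) => i i3.
  by rewrite T i3.
- apply: (@io_fiber _ false); apply: io_sub (io_mod (isT : 1 < 3)%N) => i i3.
  by rewrite T i3.
Qed.

Lemma self_square_model_eq E z z' p r d c : self_family E r d c -> param (z ^+ 2) -> param (z' ^+ 2) ->
  (forall k x, below c k -> form (p k) (hyp_dual E x) = pfs z' k x) ->
  complement_to (sum_space (annV form (span_on predT E)) (span_on predT E)) c p ->
  square_inv E (hyp_dual E) (z ^+ 2) -> z ^+ 2 = z' ^+ 2.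
Proof.
move=> [HE _ _ _] Hz Hz' Hp Hc [v [A O1 O2]].
have ef := hyp_dualE HE; rewrite -{1}span_hyp_dual in Hc.
have [s [cc [us sc A1]]] := complement_ae Hb ef Hc Hp v.
(* Off class 2 the vector [v] pairs like [c0] times the first sequence, and the invariant is the
   square of a product of two such values: hence the exponent 4. *)
pose c0 := part s cc 0; pose t := c0 ^+ 4.
have A2 : ae (fun i => forall b, (form v (hyp_dual E (i, b)) * form (E (i, b)) v) ^+ 2 =
    if (i %% 3 == 2)%N then 0 else if (i %% 3 == 1)%N then t * z' ^+ 2 else t).
  have val i b : (i %% 3 == 2)%N = false -> \sum_(k <- s) cc k * pfs z' k (i, b) =
      c0 * pfs z' 0 (i, b).
    move=> i2; rewrite (eq_big_seq (fun k => part s cc k * pfs z' k (i, b))); last first.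
      by move=> k ks; rewrite /part ks.
    rewrite (@sum_widen _ _ s (undup (0%N :: s))) ?undup_uniq//; first last.
    - by move=> k _ /negbTE ks; rewrite /part ks mul0r.
    - by move=> k ks; rewrite mem_undup inE ks orbT.
    rewrite (bigD1_seq 0%N) ?undup_uniq ?mem_undup ?mem_head//= big1 ?addr0//.
    by case=> // k _; rewrite /pfs /= i2 mulr0.
  apply: ae_sub (ae_and (ae_fiber false A1) (ae_fiber true A1)) => i [V0 V1] b.
  rewrite square_product V0 V1; case: ifP => i2.
    rewrite [X in _ * X]big1 ?mulr0 ?expr0n// => k _.
    by rewrite /pfs /= i2 mulr0.
  rewrite !val// /pfs /= i2 andbF andbT mulr1 mulrA -expr2 exprMn -exprM.
  by case: ifP => _; rewrite ?expr1n ?mulr1.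
have A' := ae_fiber false A.
have E0 : t = 0 \/ t = 1 \/ t = z ^+ 2.
  by have [i [i2 [Hi]]] := io_ae (io_mod (isT : 0 < 3)%N) (ae_and A2 A'); rewrite Hi i2.
have E1 : t * z' ^+ 2 = 0 \/ t * z' ^+ 2 = 1 \/ t * z' ^+ 2 = z ^+ 2.
  by have [i [i2 [Hi]]] := io_ae (io_mod (isT : 1 < 3)%N) (ae_and A2 A'); rewrite Hi i2.
have E2 : t = 1 \/ t * z' ^+ 2 = 1.
  have [sA HA] := A2.
  have [[i b] [si Ti]] := O1 [seq (i, b) | i <- sA, b <- [:: false; true]].
  have si' : i \notin sA.
    by apply: contra si => si; apply: (allpairs_f _ si); case: (b).
  move: Ti; rewrite (HA i si' b); case: ifP => _; first by move/eqP; rewrite eq_sym oner_eq0.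
  by case: ifP => _ ->; [right | left].
have [z'0 _ _ _] := param_facts Hz' Hz.
have t0 : t != 0.
  by apply/eqP => t0; case: E2; rewrite t0 ?mul0r => /eqP; rewrite eq_sym oner_eq0.
apply: (@two_values _ t _ _ Hz Hz') => //; first by case: E0 => // t00; rewrite t00 eqxx in t0.
case: E1 => // /eqP; by rewrite mulf_eq0 (negbTE t0) (negbTE z'0).
Qed.

Lemma self_many E r d c : has_dim [set: V] Aleph0 -> self_family E r d c -> below c 0 ->
  exists M : K -> nat * bool -> V, (forall z, self_family (M z) r d c) /\
  forall z z', param z -> param z' ->
    fam_equiv form same_pair (M z) (hyp_dual (M z)) (M z') (hyp_dual (M z')) -> z = z'.
Proof.
move=> Vd F c0.
have /choice[M HM] : forall z : K, exists M : (nat * bool -> V) * (nat -> V),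
  [/\ self_family M.1 r d c, forall k x, below c k -> form (M.2 k) (hyp_dual M.1 x) = pfs z k x
   & complement_to (sum_space (annV form (span_on predT M.1)) (span_on predT M.1)) c M.2].
  move=> z; have [E' [p [H1 H2 H3]]] := self_remodel Vd F (@indep_pfs z c).
  by exists (E', p).
exists (fun z => (M z).1); split=> [z|z z' Hz Hz' H]; first by case: (HM z).
(* The models realize the value z^2, so the parameter interval must be stable under squaring; the
   square determines z because z is positive. *)
have sq (y : K) : param y -> param (y ^+ 2).
  move=> /andP[y0 y2]; rewrite /param exprn_gt0//= (lt_trans _ y2)//.
  rewrite expr2 gtr_pMr// (lt_trans y2)// invf_lt1 ?ltr0n// ltr1n//.
have [F1 P1 _] := HM z; have [F2 P2 C2] := HM z'.
have [HE1 _ _ _] := F1; have [HE2 _ _ _] := F2.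
have Ez : z ^+ 2 = z' ^+ 2.
  apply: (self_square_model_eq F2 (sq z Hz) (sq z' Hz') P2 C2).
  exact: (square_inv_deq (hyp_dualE HE1) (hyp_dualE HE2) H (self_square_model F1 c0 P1)).
move: Hz Hz' => /andP[z0 _] /andP[z0' _].
by move/eqP: Ez; rewrite eqrXn2 ?ltW// => /eqP.
Qed.

Lemma self_equiv E E' r d : (forall k, below d k -> k = 0%N) ->
  self_family E r d (Fin 0) -> self_family E' r d (Fin 0) ->
  fam_equiv form same_pair E (hyp_dual E) E' (hyp_dual E').
Proof.
move=> d1 F F'; have [x [p [Ba Hx _]]] := self_family_basis F.
have [x' [p' [Ba' Hx' _]]] := self_family_basis F'.
have [HE _ _ _] := F; have [HE' _ _ _] := F'.
have nz (E0 : nat * bool -> V) x0 p0 : basis_on (@dom3 (nat * bool) d (Fin 0)) (cat3 E0 x0 p0) ->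
    (forall k, below d k -> annV form (span_on predT E0) (x0 k)) -> below d 0 -> form (x0 0%N) (x0 0%N) != 0.
  move=> B H d0; apply/eqP => E1; have x00 : x0 0%N = 0.
    apply: Hnd.1 => v; apply: (lspan_lin (bil_linr Hb (x0 0%N)) (set0_subspace _) _ (B.2 v)).
    move=> _ [[[i|k]|//] Hi <-] /=; first by move/(annV_span Hb): (H 0%N d0); exact.
    by rewrite (d1 _ Hi).
  have sD : {subset [:: inl (inr 0%N)] <= @dom3 (nat * bool) d (Fin 0)} by move=> i; rewrite inE => /eqP ->.
  have := B.1 [:: inl (inr 0%N)] (fun=> 1) isT; rewrite big_seq1 /= x00 scaler0.
  by move=> /(_ sD erefl _ (mem_head _ _))/eqP; rewrite oner_eq0.
(* The norms of the two vectors spanning [X] are nonzero by [nz], and a square root matches them. *)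
pose mu := sqrtC (form (x 0%N) (x 0%N) / form (x' 0%N) (x' 0%N)).
have [phi Hphi] := basis_ext (cat3 E' (fun k => mu *: x' k) (fun=> 0)) Ba.
have phiE i : phi (E i) = E' i by exact: (Hphi (inl (inl i)) isT).
have phix k : below d k -> phi (x k) = mu *: x' k by move=> kd; exact: (Hphi (inl (inr k)) kd).
exists phi, phi, id, (fun=> 1), (fun=> 1); split=> //; last first.
- by move=> i; rewrite oner_neq0 !scale1r /hyp_dual linearZ/= !phiE.
- by exists id.
have sur v : exists u, phi u = v.
  apply: (surjective_on_basis Ba') => -[[i|k]|//] Di /=; first by exists (E i).
  exists (mu^-1 *: x k); have k0 := d1 _ Di; rewrite {k}k0 in Di *.
  rewrite linearZ/= phix// scalerA mulVf ?scale1r// sqrtC_eq0.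
  by rewrite mulf_neq0// ?invr_eq0 (nz E x p, nz E' x' p').
apply: (surjective_pair_aut Hb Hnd) => //.
apply: (gram_pair Hb Hb Ba Ba) => -[[i|k]|//] [[j|l]|//] Di Dj /=.
- by rewrite !phiE HE HE'.
- rewrite phiE phix// (bilZr Hb) (form_sym (E i)) (form_sym (E' i)).
  by move/(annV_span Hb): (Hx l Dj) => ->; move/(annV_span Hb): (Hx' l Dj) => ->; rewrite !mulr0.
- rewrite phiE phix// (bilZl Hb).
  by move/(annV_span Hb): (Hx k Di) => ->; move/(annV_span Hb): (Hx' k Di) => ->; rewrite !mulr0.
- have k0 := d1 _ Di; have l0 := d1 _ Dj; rewrite {k}k0 {l}l0 in Di Dj *.
  rewrite phix// (bilZr Hb) (bilZl Hb) mulrA -expr2 sqrtCK divfK//.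
  exact: (nz E' x' p').
Qed.

(** Here [V] is the sum of [X] and the span of [E], so a vector of [X] orthogonal to [X] is
    orthogonal to everything. The form is thus nondegenerate on [X], where rank and dimension
    agree. *)
Lemma self_family_codim0 E r d : self_family E r d (Fin 0) -> r = Fin 0 \/ r = Fin 1 -> d = r.
Proof.
move=> F Hr; have [x [p [Ba Hx xX]]] := self_family_basis F; have [HE HR HD HC] := F.
set X := annV form _ in HR HD HC Hx xX.
have X0 u : X u -> annV form X u -> u = 0.
  move=> Xu Au; apply: Hnd.1 => v.
  apply: (lspan_lin (bil_linr Hb u) (set0_subspace _) _ (Ba.2 v)) => _ [[[i|k]|//] Di <-] /=.
    by move/(annV_span Hb): Xu; exact.
  by apply: Au; exact: Hx.
have SX : is_subspace X by exact: annV_subspace.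
have Xr : has_dim X r.
  have [e [e1 e2 e3]] := HR; exists e.
  have esum N (t : nat -> K) : X (\sum_(i < N | below r i) t i *: e i).
    by apply: (subspace_sum SX) => // i ri; apply: (subspaceZ SX); exact: e1.
  split=> // [v Xv|N t E0].
    have [N [t Ht]] := e2 v Xv; exists N, t; apply: X0 => //; exact: (subspaceB SX).
  by apply: e3; rewrite E0; exact: subspace0 (annV_subspace Hb _).
by case: Hr => rE; rewrite rE in Xr *; exact: has_dim_uniq HD Xr.
Qed.

Lemma self_family_zero : has_dim [set: V] Aleph0 ->
  exists E, self_family E (Fin 0) (Fin 0) (Fin 0).
Proof.
move=> Vd; have [E [BE HE]] := hyperbolic_basis_on Vd Hb Hnd form_sym eta2.
have X0 v : annV form (span_on predT E) v -> v = 0.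
  by move=> Hv; apply: Hnd.1 => w; apply: Hv; exact: BE.2.
exists E; split=> //.
- exists (fun=> 0); split=> // v /X0 ->; exists 0%N, (fun=> 0).
  by rewrite big_ord0 subr0; exact: subspace0 (annV_subspace Hb _).
- exists (fun=> 0); split=> // v /X0 ->; exists 0%N, (fun=> 0).
  by rewrite big_ord0 subr0.
- exists (fun=> 0); split=> // v _; exists 0%N, (fun=> 0).
  rewrite big_ord0 subr0; exists 0; first exact: subspace0 (annV_subspace Hb _).
  by exists v; [exact: BE.2 | rewrite add0r].
Qed.

Lemma self_family_one : has_dim [set: V] Aleph0 -> eta = 1 ->
  exists E, self_family E (Fin 1) (Fin 1) (Fin 0).
Proof.
move=> Vd eta1; pose D := @dom3 (nat * bool) (Fin 1) (Fin 0).
(* Hyperbolic pairs and one further vector of norm 1: for [Fin 1] only k = l = 0 lies in the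
   domain. *)
pose B (i j : ext (nat * bool)) : K := match i, j with
  | inl (inl i), inl (inl j) => if (i.1 == j.1) && (i.2 != j.2) then 1 else 0
  | inl (inr k), inl (inr l) => 1
  | _, _ => 0 end.
have Bdual s (cc : ext (nat * bool) -> K) : uniq s -> {subset s <= D} ->
    (forall j, D j -> \sum_(i <- s) cc i * B i j = 0) -> forall i, i \in s -> cc i = 0.
  move=> us sD H i si; have [j [Dj Bj]] : exists j, D j /\ forall i', D i' -> B i' j = (i' == i)%:R.
    have := sD _ si; case: i {si} => [[[n b]|[|//]]|//] _.
      exists (inl (inl (n, ~~ b))); split=> // -[[[m b']|k]|//] _ //=.
      rewrite -[inl _ == _]/((m, b') == (n, b)) xpair_eqE negb_eqb addbN negb_add.
      by case: (_ && _).
    by exists (inl (inr 0%N)); split=> // -[[i|[|//]]|//] _.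
  have := H j Dj; rewrite (eq_big_seq (fun i' => cc i' * (i' == i)%:R)); last first.
    by move=> i' /sD Di'; rewrite Bj.
  by rewrite big_delta// si.
have Bsym i j : D i -> D j -> B i j = eta * B j i.
  rewrite eta1 mul1r; case: i => [[i|k]|k]; case: j => [[j|l]|l] _ _ //=.
  by rewrite [i.1 == _]eq_sym [i.2 == _]eq_sym.
have Dinf : infinite_set [set i | D i].
  by apply: (infinite_of_inj (q := fun n => inl (inl (n, false)))) => // m n [].
have [a [Ba aB]] := realize_form Vd Hb Hnd form_sym eta2 Dinf Bsym Bdual.
pose E y := a (inl (inl y)); pose x k := a (inl (inr k)); pose p k := a (inr k).
have aE : cat3 E x p = a by apply/funext => -[[]|].
have HE : hyperbolic E.
  by move=> y z; rewrite aB//= /sg eta1; case: ifP => // _; case: ifP.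
have Ba' : basis_on D (cat3 E x p) by rewrite aE.
have aF i y : D i -> form (a i) (hyp_dual E y) = ext_pairing (fun _ _ => 0) i y.
  move=> Di; case: i Di => [[i|k]|//] Di; first by rewrite (hyp_dualE HE).
  by rewrite (bilZr Hb) aB//= mulr0.
have ind : indep_at_inf (Fin 0) (fun k (i : nat * bool) => 0 : K) by move=> s cc us sc _ k /sc.
have XE v : annV form (span_on predT E) v <-> span_on (below (Fin 1)) x v.
  by rewrite -span_hyp_dual; exact: (ext_annV Hb v ind Ba).
have [D1 C1] := basis_dims Ba' XE.
have X0 : annV form (span_on predT E) (x 0%N) by apply/XE; exact: span_on_in.
exists E; split=> //; exists x; split=> [i|v /XE/span_upto[c ->]|N c H i iN].
- by rewrite /= ltnS leqn0 => /eqP ->.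
- exists 1%N, c; rewrite [X in _ - X](eq_bigl xpredT); last by move=> i; exact: ltn_ord.
  by rewrite subrr; exact: subspace0 (annV_subspace Hb _).
- rewrite /= ltnS leqn0 => /eqP i0; rewrite i0 in iN *.
  have := H _ X0; rewrite (bil_suml Hb) (bigD1 (Ordinal iN))//= big1 ?addr0; last first.
    by move=> j /andP[]; rewrite /= ltnS leqn0 -val_eqE /= => ->.
  by rewrite (bilZl Hb) aB// mulr1.
Qed.

End SelfFamilies.

(** * The algebras gl and sl *)

Section KernelVectors.
Variables (K : numClosedFieldType) (V W : lmodType K).
Variable pair : {bilinear V -> W -> K | *%R & *%R}.
Variable A : tensor_alg pair.
Hypothesis Hnd : nondegenerate_pairing pair.
Hypothesis Vd : has_dim [set: V] Aleph0.
Let Hb : bil pair := bilinear_bil pair.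

Lemma orthogonal_vector n (b : 'I_n -> W) :
  exists2 u, u != 0 & forall i, pair u (b i) = 0.
Proof.
have [e [fe _]] := has_dim_basis Vd.
pose M : 'M[K]_(n.+1, n) := \matrix_(i, j) pair (e i) (b j).
have : kermx M != 0.
  by rewrite kermx_eq0 /row_free neq_ltn ltnS rank_leq_col.
move=> /matrix0Pn[i [j kij]]; pose c := row i (kermx M).
have cM : c *m M = 0 by apply/sub_kermxP; exact: row_sub.
exists (\sum_(l < n.+1) c 0 l *: e l).
  apply: contra kij => /eqP E; have -> : kermx M i j = c 0 j by rewrite /c [RHS]mxE.
  pose s := map val (enum 'I_n.+1); pose c' k := c 0 (inord k).
  have us : uniq s by rewrite map_inj_uniq ?enum_uniq//; exact: val_inj.
  have := fe s c' us; rewrite big_map big_enum_cond /=.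
  rewrite (eq_bigr (fun l => c 0 l *: e l)); last by move=> l _; rewrite /c' inord_val.
  move=> /(_ (fun _ _ => isT) E (val j)); rewrite /c' inord_val => -> //.
  by apply: map_f; rewrite mem_enum.
move=> l; rewrite (bil_suml Hb); have := congr1 (fun X : 'rV_n => X 0 l) cM.
rewrite !mxE => E; apply: etrans E; apply: eq_bigr => k _.
by rewrite (bilZl Hb) !mxE.
Qed.

(** [x] has finite rank, so finitely many linear conditions are imposed. The extra one against [w]
    ensures that a correcting term added later does not move [u]. *)
Lemma kernel_vector (x : A) w : exists u, [/\ u != 0, opV x u = 0 & pair u w = 0].
Proof.
have [n [a [b ->]]] := tens_rep x.
have [u u0 Hu] := orthogonal_vector (fun i : 'I_n.+1 => if unlift ord0 i is Some j then b j else w).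
exists u; split=> //; last by have := Hu ord0; rewrite unlift_none.
rewrite opV_sum big1// => i _; have := Hu (lift ord0 i); rewrite liftK => ->.
by rewrite scale0r.
Qed.

Lemma dual_vector u : u != 0 -> exists w, pair u w = 1.
Proof.
move=> u0; have [w Hw] : exists w, pair u w != 0.
  apply: contrapT => H; case/eqP: u0; apply: Hnd.1 => w; apply: contrapT => /eqP Hw.
  by apply: H; exists w.
by exists ((pair u w)^-1 *: w); rewrite (bilZr Hb) mulVf.
Qed.

End KernelVectors.

Section Trace.
Variables (K : numClosedFieldType) (V W : lmodType K).
Variable pair : {bilinear V -> W -> K | *%R & *%R}.
Variable A : tensor_alg pair.
Hypothesis Hnd : nondegenerate_pairing pair.
Local Notation tens := (tens A).
Let Hb : bil pair := bilinear_bil pair.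

Lemma trace_exists : exists tr : {linear A -> K^o}, forall v w, tr (tens v w) = pair v w.
Proof.
by apply: (@lift_tens _ _ _ _ A K^o pair) => [w|v]; [exact: bil_linl | exact: bil_linr].
Qed.

Variable tr : {linear A -> K^o}.
Hypothesis trE : forall v w, tr (tens v w) = pair v w.

Lemma trace_bracket x y : tr (bracket A x y) = 0.
Proof.
rewrite /bracket linearB/=; apply/eqP; rewrite subr_eq0; apply/eqP.
move: y; apply: (lin_eq_tens (U := K^o)) => [k u v|k u v|a b].
- by rewrite (tmul_linr x) linearP.
- by rewrite (tmul_linl x) linearP.
- by rewrite /= (tmul_tensr Hnd) (tmul_tensl Hnd) !trE op_adj.
Qed.

(** The bracket of v (x) w0 and u0 (x) w is v (x) w - <v, w> u0 (x) w0, so modulo brackets every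
    element is its trace times u0 (x) w0. *)
Lemma sl_trace u0 w0 : pair u0 w0 = 1 -> forall x, sl A x <-> tr x = 0.
Proof.
move=> uw x; split.
  apply: (@lspan_min _ _ _ [set x | tr x = 0]) => [|_ [y _ [z _ <-]]]; last exact: trace_bracket.
  by split=> [|k y z /= y0 z0]; rewrite /= ?linear0// linearP y0 z0 scaler0 addr0.
move=> tx; suff : sl A (x - tr x *: tens u0 w0) by rewrite tx scale0r subr0.
have Ssl : is_subspace (sl A) by exact: lspan_subspace.
move: x {tx}; apply: (tens_ind (P := [set x | sl A (x - tr x *: tens u0 w0)])) => [|v w] /=.
  split=> [|k x y /= Hx Hy]; first by rewrite /= linear0 scale0r subr0; exact: subspace0.
  rewrite linearP/= scalerDl opprD addrACA -scalerA -scalerBr.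
  by apply Ssl.2.
apply: sub_lspan; exists (tens v w0) => //; exists (tens u0 w) => //.
by rewrite /bracket !tmulE trE uw scale1r.
Qed.

Lemma trace_null (I : eqType) (e : I -> V) (f : I -> W) y :
  (forall u w, annV pair (span_on predT f) u -> annW pair (span_on predT e) w -> pair u w = 0) ->
  null_part e f y -> tr y = 0.
Proof.
move=> H0 [Ny Nf]; have [n [a [b [yE fa fb]]]] := tens_free_rep y.
rewrite yE linear_sum big1// => i _; rewrite trE; apply: H0.
  apply/(annV_span Hb) => j; apply: (fb (fun i => pair (a i) (f j))).
  by have := Nf j; rewrite yE opW_sum.
apply/(annW_span Hb) => j; apply: (fa (fun i => pair (e j) (b i))).
by have := Ny j; rewrite yE opV_sum.
Qed.

Lemma tens_map_trace phi psi F : pair_aut pair phi psi -> tens_map phi psi F ->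
  forall x, tr (F x) = tr x.
Proof.
move=> [_ _ H] HF; apply: (lin_eq_tens (U := K^o)) => [k u v|k u v|a b].
- by rewrite !linearP.
- by rewrite linearP.
- by rewrite HF !trE H.
Qed.

Variables (v : nat -> V) (w : nat -> W).
Hypothesis vw : forall i j, pair (v i) (w j) = (i == j)%:R.
Hypothesis v_span : forall u, span_on predT v u.
Hypothesis w_span : forall u, span_on predT w u.

Lemma star_exists (x : A) : exists y : A,
  (forall i j, cf v w y i j = (cf v w x j i)^*) /\ tr y = (tr x : K)^*.
Proof.
pose P : set A := [set x | exists y : A,
  (forall i j, cf v w y i j = (cf v w x j i)^*) /\ tr y = (tr x : K)^*].
have SP : is_subspace P.
  split=> [|k x1 x2 [y1 [E1 T1]] [y2 [E2 T2]]].
    exists 0; split=> [i j|]; last by rewrite linear0 rmorph0.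
    by rewrite /cf !(lin0 (opV_linl _)) !(bil0l Hb) rmorph0.
  exists (k^* *: y1 + y2); split=> [i j|]; last by rewrite !linearP/= T1 T2 rmorphD rmorphM.
  by rewrite !cf_lin E1 E2 rmorphD rmorphM.
move: x; apply: (tens_ind SP) => a b.
apply: (lspan_lin (tens_linl A b) SP _ (v_span a)) => _ [i _ <-].
apply: (lspan_lin (tens_linr A (v i)) SP _ (w_span b)) => _ [j _ <-].
exists (tens (v j) (w i)); split=> [k l|]; last by rewrite !trE !vw rmorph_nat eq_sym.
by rewrite !cf_tens !vw rmorphM !rmorph_nat mulrC [l == i]eq_sym [k == j]eq_sym.
Qed.

End Trace.

(** Used for operators of rank at most two: [a] and [b] are eigenvectors and the remainder lies in
    the kernel. *)
Lemma lspan3 (K : fieldType) (U : lmodType K) (E : set U) (a b v : U) (s t : K) :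
  E a -> E b -> E (v - s *: a - t *: b) -> lspan E v.
Proof.
move=> Ea Eb Ev; have S := lspan_subspace E.
rewrite -[v](subrK (s *: a)) -[v - _](subrK (t *: b)).
apply: (subspaceD S); last by apply: (subspaceZ S); exact: sub_lspan.
apply: (subspaceD S); [exact: sub_lspan | by apply: (subspaceZ S); exact: sub_lspan].
Qed.

Section NullParts.
Variables (K : numClosedFieldType) (V W : lmodType K).
Variable pair : {bilinear V -> W -> K | *%R & *%R}.
Variable A : tensor_alg pair.
Variables (I : eqType) (e : I -> V) (f : I -> W).
Let Hb : bil pair := bilinear_bil pair.
Local Notation X := (annV pair (span_on predT f)).
Local Notation Y := (annW pair (span_on predT e)).

Lemma null_part_annV (y : A) v : null_part e f y -> X (opV y v).
Proof. by move=> [_ H]; apply/(annV_span Hb) => i; rewrite op_adj H (bil0r Hb). Qed.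

Lemma null_part_annW (y : A) w : null_part e f y -> Y (opW y w).
Proof. by move=> [H _]; apply/(annW_span Hb) => i; rewrite -op_adj H (bil0l Hb). Qed.

Lemma torus_annV (t : A) x : torus e f t -> X x -> opV t x = 0.
Proof.
move=> Ht /(annV_span Hb) Hx; move: t Ht; apply: lspan_min => [|_ [i _ <-]].
  split=> [|k y z /= y0 z0]; first by rewrite /= (lin0 (opV_linl x)).
  by rewrite (opV_linl x) y0 z0 scaler0 addr0.
by rewrite /= opV_tens Hx scale0r.
Qed.

End NullParts.

Section GLSL.
Variables (K : numClosedFieldType) (V W : lmodType K).
Variable pair : {bilinear V -> W -> K | *%R & *%R}.
Variable A : tensor_alg pair.
Hypothesis Hnd : nondegenerate_pairing pair.
Hypothesis Vd : has_dim [set: V] Aleph0.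
Hypothesis Wd : has_dim [set: W] Aleph0.
Variable g : set A.
Hypothesis gE : g = gl A \/ g = sl A.
Local Notation tens := (tens A).
Local Notation br := (bracket A).
Let Hb : bil pair := bilinear_bil pair.

Lemma unit_pair : exists u w, pair u w = 1.
Proof.
have [u [u0 _ _]] := kernel_vector (A := A) Vd 0 0.
by have [w uw] := dual_vector Hnd u0; exists u, w.
Qed.

Lemma glsl_subspace : is_subspace g.
Proof. by case: gE => ->; [split | exact: lspan_subspace]. Qed.

Lemma glsl_bracket x y : g x -> g y -> g (br x y).
Proof. by case: gE => -> // _ _; apply: sub_lspan; exists x => //; exists y. Qed.

Lemma glsl_trace0 (tr : {linear A -> K^o}) x : (forall v w, tr (tens v w) = pair v w) ->
  tr x = 0 -> g x.
Proof.
move=> trE tx; case: gE => -> //; have [u [w uw]] := unit_pair.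
by apply (sl_trace Hnd trE uw x).2.
Qed.

(** The tensor v (x) w sends u to v. Its trace is removed by a multiple of u0 (x) w0, which kills u
    because u is chosen orthogonal to w0. *)
Lemma glsl_kernel_transitive : kernel_transitive g.
Proof.
move=> x v; have [tr trE] := trace_exists A; have [u0 [w0 uw]] := unit_pair.
have [u [un ux uw0]] := kernel_vector Vd x w0; have [w Hw] := dual_vector Hnd un.
exists (tens v w - pair v w *: tens u0 w0), u; split=> //.
  by apply: (glsl_trace0 trE); rewrite linearB linearZ/= !trE uw /GRing.scale/= mulr1 subrr.
rewrite (linB (opV_linl u)) (linZ (opV_linl u)) !opV_tens Hw uw0.
by rewrite scale1r scale0r scaler0 subr0.
Qed.

Lemma glsl_star (v : nat -> V) (w : nat -> W) :
  (forall i j, pair (v i) (w j) = (i == j)%:R) ->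
  (forall u, span_on predT v u) -> (forall u, span_on predT w u) -> star_closed v w g.
Proof.
move=> vw Sv Sw x gx; have [tr trE] := trace_exists A.
have [y [Ey Ty]] := star_exists trE vw Sv Sw x; exists y => //.
case: gE gx => -> // sx; have [u [w' uw]] := unit_pair.
apply (sl_trace Hnd trE uw y).2; rewrite Ty; have -> : tr x = 0 by apply (sl_trace Hnd trE uw x).1.
exact: rmorph0.
Qed.

Lemma glsl_jordan x : g x -> diagonalizable (opV x) -> diagonalizable (opW x) -> jordan br g x x 0.
Proof.
have [e Be] := has_dim_basis Vd; have [f [_ Sf]] := has_dim_basis Wd.
have [v [w [vw Sv Sw]]] := mackey Hb Hnd (basis_infdim Be) Be.2 Sf.
exact: (jordan_intro Hnd vw Sv Sw glsl_subspace glsl_bracket (glsl_star vw Sv Sw)).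
Qed.

Lemma glsl_inv phi psi F : pair_aut pair phi psi -> any_pair phi psi -> tens_map phi psi F ->
  forall x, g x -> g (F x).
Proof.
move=> H _ HF x; case: gE => -> //; have [tr trE] := trace_exists A; have [u [w uw]] := unit_pair.
move=> /(sl_trace Hnd trE uw x) tx; apply (sl_trace Hnd trE uw _).2.
by rewrite (tens_map_trace trE H HF).
Qed.

Section Family.
Variables (e : nat -> V) (f : nat -> W).
Hypothesis ef : forall i j, pair (e i) (f j) = (i == j)%:R.
Local Notation X := (annV pair (span_on predT f)).
Local Notation Y := (annW pair (span_on predT e)).

Lemma glsl_good : (forall v w, X v -> Y w -> pair v w = 0) -> good_family g e f.
Proof.
move=> H0; have [tr trE] := trace_exists A.
(* A single e_i (x) f_i has trace 1. Subtracting the one at a third index [k] restores trace 0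
   without changing the weights at i and j. *)
have t i j : i != j -> exists t, [/\ g t, torus e f t, tc e f t i = 1 & tc e f t j = 0].
  move=> ij; pose k := (i + j).+1.
  have [ki kj] : k != i /\ k != j by rewrite /k; split; apply/eqP; lia.
  exists (tens (e i) (f i) - tens (e k) (f k)); split.
  - by apply: (glsl_trace0 trE); rewrite linearB/= !trE !ef !eqxx subrr.
  - by apply: (subspaceB (torus_subspace _ _ _)); exact: torus_in.
  - by rewrite addrC -scaleN1r tc_lin !tc_tens// eqxx (negbTE ki) mulr0 add0r.
  - by rewrite addrC -scaleN1r tc_lin !tc_tens// (negbTE ij) (negbTE kj) mulr0 add0r.
split=> //.
- move=> i; have /t[x [gx tx x1 _]] : i != i.+1 by rewrite neq_ltn ltnSn.
  by exists x; rewrite x1 oner_neq0.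
- by move=> i j /t[x [gx tx x1 x0]]; exists x; rewrite x1 x0 oner_neq0.
- move=> d y _ ny; case: gE => -> //; have [u [w uw]] := unit_pair.
  move=> /(sl_trace Hnd trE uw _); rewrite linearD/= (trace_null trE H0 ny) addr0 => td.
  by apply (sl_trace Hnd trE uw _).2.
- move=> y1 y2 y3 _ _ _ n1 n2 n3; apply: (opV_eq0 Hnd) => v; apply: Hnd.1 => w.
  rewrite opV_mul op_adj; apply: H0; last exact: (null_part_annW _ n1).
  by rewrite opV_mul; exact: (null_part_annV _ n2).
Qed.

(** If x in T^perp and y in S^perp paired to 1, then x (x) y, corrected by e_0 (x) f_0 in sl, would
    be diagonalizable and centralize the torus, hence lie in it; but the torus kills T^perp while
    this element fixes x. *)
Lemma cartan_null h : is_cartan br g h -> ss_parts br g h = g `&` torus e f ->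
  forall v w, X v -> Y w -> pair v w = 0.
Proof.
move=> Ch Sh v y Xv Yy; apply: contrapT => /eqP vy.
have [x [Xx xy]] : exists x, X x /\ pair x y = 1.
  exists ((pair v y)^-1 *: v); split; last by rewrite (bilZl Hb) mulVf.
  exact: (subspaceZ (annV_subspace Hb _)).
have [c [z [zE gz]]] : exists c z, z = tens x y - c *: tens (e 0%N) (f 0%N) /\ g z.
  case: gE => gE'; [exists 0 | exists 1]; eexists; (split; [by []|]); first by rewrite gE'.
  have [tr trE] := trace_exists A.
  by apply: (glsl_trace0 trE); rewrite scale1r linearB/= !trE xy ef eqxx subrr.
have xf i : pair x (f i) = 0 by move/(annV_span Hb): Xx; exact.
have ey i : pair (e i) y = 0 by move/(annW_span Hb): Yy; exact.
have zV u : opV z u = pair u y *: x - (c * pair u (f 0%N)) *: e 0%N.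
  by rewrite zE (linB (opV_linl u)) (linZ (opV_linl u)) !opV_tens [X in _ - X]scalerA.
have zW u : opW z u = pair x u *: y - (c * pair (e 0%N) u) *: f 0%N.
  by rewrite zE (linB (opW_linl u)) (linZ (opW_linl u)) !opW_tens [X in _ - X]scalerA.
have zx : opV z x = x by rewrite zV xy xf mulr0 scale0r subr0 scale1r.
have tz : torus e f z.
  apply: (diag_in_torus glsl_jordan Ch Sh).
  - split=> // t [_ tt]; rewrite zE (linB (br_linr t)) (linZ (br_linr t)).
    have t0 : torus e f (tens (e 0%N) (f 0%N)) by exact: torus_in.
    rewrite (torus_comm Hnd ef tt t0) scaler0 subr0.
    apply: (torus_null_br Hnd tt); split=> i; first by rewrite opV_tens ey scale0r.
    by rewrite opW_tens xf scale0r.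
  - move=> u; apply: (@lspan3 _ _ _ x (e 0%N) u (pair u y) (pair u (f 0%N))).
    + by exists 1; rewrite scale1r.
    + exists (- c); rewrite zV ey ef eqxx mulr1 scale0r sub0r.
      by rewrite scaleNr.
    + exists 0; rewrite scale0r zV !(bilBl Hb) !(bilZl Hb) xy ey ef eqxx xf !mulr0 !mulr1 !subr0 !subrr.
      by rewrite mulr0 !scale0r subr0.
  - move=> u; apply: (@lspan3 _ _ _ y (f 0%N) u (pair x u) (pair (e 0%N) u)).
    + by exists 1; rewrite scale1r zW xy ey mulr0 scale0r subr0 scale1r.
    + exists (- c); rewrite zW xf ef eqxx mulr1 scale0r sub0r.
      by rewrite scaleNr.
    + exists 0; rewrite scale0r zW !(bilBr Hb) !(bilZr Hb) xy ey ef eqxx xf !mulr0 !mulr1 !subr0 !subrr.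
      by rewrite mulr0 !scale0r subr0.
by move/eqP: xy; rewrite -zx (torus_annV tz Xx) (bil0l Hb) eq_sym oner_eq0.
Qed.

End Family.
End GLSL.

Section Lines.
Variables (K : fieldType) (V : lmodType K).

Definition scalars (v : V) : set V := [set a *: v | a in [set: K]].

Lemma lspan_scalars (J I : choiceType) (D : set J) (P : pred I) (L : J -> set V) (e : I -> V) :
  (forall j, D j -> exists2 i, P i & L j = scalars (e i)) ->
  (forall i, P i -> exists2 j, D j & L j = scalars (e i)) ->
  lspan (\bigcup_(j in D) L j) = span_on P e.
Proof.
move=> H1 H2; apply/seteqP; split; apply: lspan_min; try exact: lspan_subspace.
  move=> v [j Dj]; have [i Pi ->] := H1 j Dj => -[a _ <-].
  by apply: (subspaceZ (span_on_subspace _ _)); exact: span_on_in.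
move=> _ [i Pi <-]; apply: sub_lspan; have [j Dj Lj] := H2 i Pi; exists j => //.
by rewrite Lj; exists 1 => //; rewrite scale1r.
Qed.

Lemma line_scalars v : v != 0 -> line (scalars v).
Proof. by move=> v0; exists v. Qed.

Lemma choice_lines (L : nat -> set V) : (forall i, line (L i)) ->
  exists e, forall i, L i = scalars (e i).
Proof.
move=> H; have /choice[e He] : forall i, exists v, L i = scalars v.
  by move=> i; have [v _ ->] := H i; exists v.
by exists e.
Qed.

Lemma scalars_scale v a : a != 0 -> scalars (a *: v) = scalars v.
Proof.
move=> a0; apply/seteqP; split=> _ [b _ <-].
  by exists (b * a) => //; rewrite scalerA.
by exists (b / a) => //; rewrite scalerA divfK.
Qed.

Lemma dim_quot_sub (A B : set V) r : is_subspace B -> A `<=` B -> dim_quot A B r <-> r = Fin 0.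
Proof.
move=> SB AB; split=> [[e [e1 _ e3]]|->].
  have r0 : ~~ below r 0.
    apply/negP => r0; have /eqP : (1 : K) = 0; last by rewrite oner_eq0.
    apply: (e3 1%N (fun=> 1) _ 0%N (leqnn _) r0).
    by apply: (subspace_sum SB) => i ri; apply: (subspaceZ SB); apply: AB; exact: e1.
  by case: r r0 {e1 e3} => [[]|].
exists (fun=> 0); split=> // v Av; exists 0%N, (fun=> 0); rewrite big_ord0 subr0; exact: AB.
Qed.

Lemma dim_quot0 (A B : set V) : dim_quot A B (Fin 0) -> A `<=` B.
Proof. by move=> [e [_ H _]] v /H[N [c]]; rewrite big1 ?subr0// => i. Qed.

End Lines.

Lemma bilinear_image (K : fieldType) (V W : lmodType K) (pair : V -> W -> K) v w : bil pair ->
  [set pair x y | x in scalars v & y in scalars w] =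
  if pair v w == 0 then [set 0] else [set: K].
Proof.
move=> Hb; apply/seteqP; split=> [_ [_ [a _ <-] [_ [b _ <-] <-]]|k].
  by rewrite (bilZl Hb) (bilZr Hb); case: eqP => // ->; rewrite !mulr0.
case: eqP => [vw /= ->|/eqP vw _].
  exists (0 *: v); first by exists 0.
  by exists (0 *: w); [exists 0 | rewrite !scale0r (bil0l Hb)].
exists ((k / pair v w) *: v); first by exists (k / pair v w).
exists (1 *: w); first by exists 1.
by rewrite scale1r (bilZl Hb) divfK.
Qed.

Lemma setT_neq0 (K : fieldType) : [set: K] <> [set 0].
Proof.
move=> /seteqP[H _]; have /eqP : (1 : K) = 0 by exact: H.
by rewrite oner_eq0.
Qed.

(** * From Cartan subalgebras to equivalence classes of families *)

Section CartanClasses.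
Variables (K : numClosedFieldType) (V W : lmodType K).
Variable pair : {bilinear V -> W -> K | *%R & *%R}.
Variable A : tensor_alg pair.
Hypothesis Hnd : nondegenerate_pairing pair.
Variable Q : (V -> V) -> (W -> W) -> Prop.
Hypothesis Q_id : Q id id.
Hypothesis Q_inv : forall (phi : {linear V -> V}) (psi : {linear W -> W})
    (phi' : {linear V -> V}) (psi' : {linear W -> W}), Q phi psi ->
  cancel phi phi' -> cancel phi' phi -> cancel psi psi' -> cancel psi' psi -> Q phi' psi'.
Hypothesis Q_comp : forall (phi : {linear V -> V}) (psi : {linear W -> W})
    (phi' : {linear V -> V}) (psi' : {linear W -> W}), Q phi psi -> Q phi' psi' ->
  Q (phi' \o phi) (psi' \o psi).
Variable G : set {linear V -> V}.
Hypothesis GP : forall h h', conjugate_under (A := A) G h h' <-> conjP Q h h'.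
Variable g : set A.
Hypothesis Sg : is_subspace g.
Hypothesis Bg : forall x y, g x -> g y -> g (bracket A x y).
Hypothesis g_kt : kernel_transitive g.
Hypothesis g_ji : forall x, g x -> diagonalizable (opV x) -> diagonalizable (opW x) ->
  jordan (bracket A) g x x 0.
Hypothesis g_inv : forall phi psi F, pair_aut pair phi psi -> Q phi psi -> tens_map phi psi F ->
  forall x, g x -> g (F x).
Variable I : eqType.

Definition cart (e : I -> V) (f : I -> W) := centralizer (bracket A) g (g `&` torus e f).

Lemma good_cartan e f : good_family g e f ->
  is_cartan (bracket A) g (cart e f) /\ ss_parts (bracket A) g (cart e f) = g `&` torus e f.
Proof.
move=> [ef s1 s2 sp nil].
split; first exact: (h_cartan Hnd ef Sg Bg g_kt g_ji s1 s2 sp nil).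
exact: (ss_parts_h Hnd ef Sg g_kt g_ji s1 s2 sp nil).
Qed.

Lemma cartan_cart e f h : is_cartan (bracket A) g h ->
  ss_parts (bracket A) g h = g `&` torus e f -> h = cart e f.
Proof. by move=> [_ _ _ hE] sE; rewrite /cart -sE. Qed.

Lemma cart_class e f e' f' : good_family g e f -> good_family g e' f' ->
  conj_class G (cart e f) = conj_class G (cart e' f') <-> fam_equiv pair Q e f e' f'.
Proof.
move=> H H'; have CP := conj_classP Q_id Q_inv Q_comp GP.
split=> [/CP|D]; first exact: (deq_of_conj Hnd Q_inv Sg g_inv H H').
by apply/CP; exact: (conj_of_deq Hnd Q_inv g_inv D).
Qed.

End CartanClasses.

Section GLClasses.
Variables (K : numClosedFieldType) (V W : lmodType K).
Variable pair : {bilinear V -> W -> K | *%R & *%R}.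
Variable A : tensor_alg pair.
Hypothesis Hnd : nondegenerate_pairing pair.
Hypothesis Vd : has_dim [set: V] Aleph0.
Hypothesis Wd : has_dim [set: W] Aleph0.
Variable g : set A.
Hypothesis gE : g = gl A \/ g = sl A.
Let Hb : bil pair := bilinear_bil pair.

Lemma GL_conjP (h h' : set A) : conjugate_under (GL pair) h h' <-> conjP (@any_pair V W) h h'.
Proof.
split=> [[f [F [Gf If ->]]]|[f [psi [F [H1 _ H2 ->]]]]].
  by have [psi [H1 H2]] := GL_autpair Hnd Gf If; exists f, psi, F.
by exists f, F; have [H3 H4] := autpair_GL H1 H2.
Qed.

Lemma dual_system_family L L' : dual_system pair L L' -> exists (e : nat -> V) (f : nat -> W),
  [/\ forall i j, pair (e i) (f j) = (i == j)%:R, forall i, L i = scalars (e i)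
    & forall i, L' i = scalars (f i)].
Proof.
move=> [H1 H2 H3].
have [e He] := choice_lines H1; have [f Hf] := choice_lines H2.
have pe i j : (pair (e i) (f j) != 0) = (i == j).
  have := H3 i j; rewrite He Hf (bilinear_image _ _ Hb).
  case: eqP => /= _; case: eqP => //= _ H; first by case: (@setT_neq0 K).
  by case: (@setT_neq0 K).
exists e, (fun i => (pair (e i) (f i))^-1 *: f i); split=> [i j|//|i]; last first.
  by rewrite Hf scalars_scale// invr_eq0 pe.
rewrite (bilZr Hb); case: eqP => [<-|/eqP ij]; first by rewrite mulVf// pe.
by move: ij; rewrite -pe negbK => /eqP ->; rewrite mulr0.
Qed.

Lemma family_dual_system (e : nat -> V) (f : nat -> W) :
  (forall i j, pair (e i) (f j) = (i == j)%:R) ->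
  dual_system pair (fun i => scalars (e i)) (fun i => scalars (f i)).
Proof.
move=> ef; have nz i : pair (e i) (f i) <> 0 by rewrite ef eqxx; apply/eqP; exact: oner_neq0.
split=> [i|i|i j].
- by apply: line_scalars; apply/eqP => E; apply: (nz i); rewrite E (bil0l Hb).
- by apply: line_scalars; apply/eqP => E; apply: (nz i); rewrite E (bil0r Hb).
- rewrite (bilinear_image _ _ Hb) ef.
  by case: (i == j); rewrite ?oner_eq0 ?eqxx.
Qed.

Lemma span_lines (U : lmodType K) (L : nat -> set U) (e : nat -> U) :
  (forall i, L i = scalars (e i)) -> lspan (\bigcup_i L i) = span_on predT e.
Proof. by move=> H; apply: lspan_scalars => i _; exists i. Qed.

Lemma span_torus L L' (e : nat -> V) (f : nat -> W) :
  (forall i, L i = scalars (e i)) -> (forall i, L' i = scalars (f i)) ->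
  lspan (\bigcup_i [set tens A v w | v in L i & w in L' i]) = torus (A := A) e f.
Proof.
move=> HL HL'; apply: span_lines => i; rewrite HL HL'; apply/seteqP; split.
  move=> _ [_ [a _ <-] [_ [b _ <-] <-]]; exists (a * b) => //.
  by rewrite (linZ (tens_linl A _)) (linZ (tens_linr A _)) scalerA.
move=> _ [a _ <-]; exists (a *: e i); first by exists a.
exists (1 *: f i); first by exists 1.
by rewrite scale1r (linZ (tens_linl A _)).
Qed.

Lemma gl_classesE r d1 d2 c1 c2 C : gl_classes g (r, d1, d2, c1, c2) C <->
  r = Fin 0 /\ exists (e : nat -> V) (f : nat -> W), gl_family pair e f d1 d2 c1 c2 /\ conj_class (GL pair) (cart g e f) = C.
Proof.
have Sg := glsl_subspace gE; have Bg := glsl_bracket gE.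
have kt := glsl_kernel_transitive Hnd Vd gE; have ji := glsl_jordan Hnd Vd Wd gE.
split.
  move=> [h [Ch [L [L' [[LL ssE] [HR D1 D2 C1 C2]]]]] <-].
  have [e [f [ef Le Lf]]] := dual_system_family LL.
  rewrite (span_torus Le Lf) in ssE; rewrite (span_lines Le) (span_lines Lf) in HR D1 D2 C1 C2.
  have H0 := cartan_null Hnd Vd Wd gE ef Ch ssE.
  split.
    apply: (dim_quot_sub r (annV_subspace Hb _) _).1 HR => v Hv w Hw; exact: H0.
  by exists e, f; split=> //; rewrite (cartan_cart Ch ssE).
move=> [-> [e [f [F <-]]]]; have [ef H0 [D1 D2] C1 C2] := F.
have [Ch ssE] := good_cartan Hnd Sg Bg kt ji (glsl_good Hnd Vd gE ef H0).
exists (cart g e f) => //; split=> //.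
exists (fun i => scalars (e i)), (fun i => scalars (f i)); split.
  by split; [exact: family_dual_system | rewrite (@span_torus _ _ e f)].
rewrite (@span_lines _ _ e)// (@span_lines _ _ f)//; split=> //.
by apply: (dim_quot_sub _ (annV_subspace Hb _) _).2 => // v Hv w Hw; exact: H0.
Qed.

Lemma gl_class_eq (e : nat -> V) (f : nat -> W) e' f' d1 d2 c1 c2 d1' d2' c1' c2' :
  gl_family pair e f d1 d2 c1 c2 -> gl_family pair e' f' d1' d2' c1' c2' ->
  conj_class (GL pair) (cart g e f) = conj_class (GL pair) (cart g e' f') <->
  fam_equiv pair (@any_pair V W) e f e' f'.
Proof.
move=> [ef H _ _ _] [ef' H' _ _ _]; apply: (cart_class Hnd) => //.
- exact: GL_conjP.
- exact: (glsl_subspace gE).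
- move=> phi psi F; exact: (glsl_inv Hnd Vd gE).
- exact: (glsl_good Hnd Vd gE ef H).
- exact: (glsl_good Hnd Vd gE ef' H').
Qed.

End GLClasses.

(** * The algebras so and sp *)

(* [(n, false)] and [(n, true)] stand for the indices n + 1 and - (n + 1) of the
   self-dual systems. *)
Definition pos_int (x : nat * bool) : int := if x.2 then - (x.1.+1)%:Z else x.1.+1.

Definition int_pos (i : int) : nat * bool :=
  match i with Posz n => (n.-1, false) | Negz n => (n, true) end.

Lemma int_posK i : i != 0 -> pos_int (int_pos i) = i.
Proof. by case: i => [[|n]|n] // _; rewrite /pos_int /= NegzE. Qed.

Lemma pos_intK : cancel pos_int int_pos.
Proof. by case=> n []; rewrite /pos_int //= -NegzE. Qed.

Lemma pos_int_neq0 x : pos_int x != 0.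
Proof. by case: x => n []; rewrite /pos_int //= oppr_eq0. Qed.

Lemma pos_intN x : pos_int (hflip x) = - pos_int x.
Proof. by case: x => n []; rewrite /pos_int /= ?opprK. Qed.

Section SkewAlgebra.
Variables (K : numClosedFieldType) (V : lmodType K).
Variable form : {bilinear V -> V -> K | *%R & *%R}.
Variable A : tensor_alg form.
Variable eta : K.
Hypothesis Hnd : nondegenerate_pairing form.
Hypothesis form_sym : forall u v, form u v = eta * form v u.
Hypothesis eta2 : eta = 1 \/ eta = -1.
Hypothesis Vd : has_dim [set: V] Aleph0.
Variable op : V -> V -> A.
Hypothesis opE : forall a b, op a b = tens A a b - eta *: tens A b a.
Implicit Types (E : nat * bool -> V).
Local Notation br := (bracket A).
Local Notation dual := (hyp_dual eta).
Let Hb : bil form := bilinear_bil form.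

(** This is so for [eta] equal to 1 and sp for [eta] equal to -1, described by skew-adjointness;
    [skew_lspan] identifies it with the span of the [op a b]. *)
Definition skew : set A := [set x : A | forall u v, form (opV x u) v = - form u (opV x v)].

Lemma opV_op a b u : opV (op a b) u = form u b *: a - (eta * form u a) *: b.
Proof.
by rewrite opE (linB (opV_linl u)) (linZ (opV_linl u)) !opV_tens [X in _ - X]scalerA.
Qed.

Lemma skew_op a b : skew (op a b).
Proof.
move=> u v; rewrite !opV_op !(bilBl Hb) !(bilBr Hb) !(bilZl Hb) !(bilZr Hb).
rewrite (form_sym a v) (form_sym b v).
have -> : form v b * form u a = eta * eta * (form v b * form u a) by rewrite eta_sq// mul1r.
by ring.
Qed.

Lemma skew_subspace : is_subspace skew.
Proof.
split=> [u v|k x y Hx Hy u v]; first by rewrite !(lin0 (opV_linl _)) (bil0l Hb) (bil0r Hb) oppr0.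
by rewrite !(opV_linl _) (bilDl Hb) (bilDr Hb) (bilZl Hb) (bilZr Hb) Hx Hy opprD mulrN.
Qed.

Lemma skew_br (x y : A) : skew x -> skew y -> skew (br x y).
Proof.
move=> Hx Hy u v; rewrite !opV_br (bilBl Hb) (bilBr Hb) (Hx (opV y u)) (Hy u) opprK.
by rewrite (Hy (opV x u)) (Hx u) opprK opprB.
Qed.

Lemma skew_opW (x : A) w : skew x -> opW x w = - opV x w.
Proof.
move=> Hx; apply/eqP; rewrite -subr_eq0 opprK; apply/eqP; apply: Hnd.2 => u.
by rewrite (bilDr Hb) -op_adj Hx addNr.
Qed.

(** If a skew element is the sum of the a_i (x) b_i, skew-adjointness also writes it as the sum of
    the - eta b_i (x) a_i; the average of the two is half the sum of the [op (a i) (b i)]. *)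
Lemma skew_lspan : skew = lspan [set op a b | a in [set: V] & b in [set: V]].
Proof.
apply/seteqP; split; last first.
  by apply: lspan_min; [exact: skew_subspace | move=> _ [a _ [b _ <-]]; exact: skew_op].
move=> x Hx; have [n [a [b xE]]] := tens_rep x.
have -> : x = 2^-1 *: \sum_i op (a i) (b i).
  apply: (opV_inj Hnd) => u; rewrite (linZ (opV_linl u)) (lin_sum (opV_linl u)).
  have H1 : opV x u = \sum_i form u (b i) *: a i by rewrite xE opV_sum.
  have H2 : opV x u = - \sum_i (eta * form u (a i)) *: b i.
    apply/eqP; rewrite -subr_eq0 opprK; apply/eqP; apply: Hnd.1 => v.
    rewrite (bilDl Hb) Hx {1}xE opV_sum (bil_sumr Hb) (bil_suml Hb) addrC; apply/eqP; rewrite subr_eq0; apply/eqP.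
    apply: eq_bigr => i _; rewrite (bilZl Hb) (bilZr Hb) (form_sym (b i)).
    by rewrite mulrACA eta_sq// mul1r mulrC.
  rewrite (eq_bigr _ (fun i _ => opV_op (a i) (b i) u)) sumrB -H1.
  rewrite -[X in _ + X]H2 -mulr2n -scaler_nat scalerA mulVf ?scale1r//.
  by rewrite pnatr_eq0.
apply: (subspaceZ (lspan_subspace _)); apply: (subspace_sum (lspan_subspace _)) => i _.
by apply: sub_lspan; exists (a i) => //; exists (b i).
Qed.

Lemma skew_kernel_transitive : kernel_transitive skew.
Proof.
move=> x v; have [u [un ux uv]] := kernel_vector Vd x v; have [b Hb1] := dual_vector Hnd un.
exists (op v b), u; split=> //; first exact: skew_op.
by rewrite opV_op Hb1 uv mulr0 scale0r subr0 scale1r.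
Qed.

Lemma skew_basis E (x : A) : (forall u, span_on predT E u) ->
  (forall p q, form (opV x (E p)) (E q) = - form (E p) (opV x (E q))) -> skew x.
Proof.
move=> HE H u v; move: v (HE v); apply: (@lspan_min _ _ _ [set v | form (opV x u) v = - form u (opV x v)]).
  split=> [|k y z /= Hy Hz]; first by rewrite /= (lin0 (opV_linr x)) !(bil0r Hb) oppr0.
  by rewrite (opV_linr x) !(bilDr Hb) !(bilZr Hb) Hy Hz opprD mulrN.
move=> _ [q _ <-]; move: u (HE u).
apply: (@lspan_min _ _ _ [set u | form (opV x u) (E q) = - form u (opV x (E q))]).
  split=> [|k y z /= Hy Hz]; first by rewrite /= (lin0 (opV_linr x)) !(bil0l Hb) oppr0.
  by rewrite (opV_linr x) !(bilDl Hb) !(bilZl Hb) Hy Hz opprD mulrN.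
by move=> _ [p _ <-]; exact: H.
Qed.

Lemma sg_conj b : (sg eta b)^* = sg eta b.
Proof. by case: b; rewrite /sg ?rmorph1//; case: eta2 => ->; rewrite ?rmorphN rmorph1. Qed.

(** In a hyperbolic basis and its dual, skewness is a relation between matrix entries with
    coefficients 1 and -1, which are real, so conjugate transposition preserves it. *)
Lemma skew_star : exists (v w : nat -> V), [/\ forall i j, form (v i) (w j) = (i == j)%:R,
  forall u, span_on predT v u, forall u, span_on predT w u & star_closed v w skew].
Proof.
have [E [BE HE]] := hyperbolic_basis_on Vd Hb Hnd form_sym eta2.
have ef : forall p q, form (E p) (dual E q) = (p == q)%:R := hyp_dualE Hb eta2 HE.
have Iinf : infinite_set [set i : nat * bool | predT i].
  by apply: (infinite_of_inj (q := fun n => (n, false))) => // m n [].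
have [r [q [_ rq qr]]] := enum_pred Iinf.
have SE (a : nat * bool -> V) u : span_on predT a u -> span_on predT (a \o q) u.
  by apply: lspan_mono => _ [i _ <-]; exists (r i) => //=; rewrite qr.
have vw i j : form ((E \o q) i) ((dual E \o q) j) = (i == j)%:R.
  by rewrite ef (inj_eq (can_inj rq)).
have Sv u : span_on predT (E \o q) u by apply: SE; exact: BE.2.
have Sw u : span_on predT (dual E \o q) u by apply: SE; rewrite span_hyp_dual//; exact: BE.2.
exists (E \o q), (dual E \o q); split=> // x Hx.
have [tr trE] := trace_exists A; have [y [Ey _]] := star_exists trE vw Sv Sw x.
exists y => //; pose c (z : A) p p' := form (opV z (E p')) (dual E p).
have cE p p' : c y p p' = (c x p' p)^*.
  by have := Ey (r p) (r p'); rewrite /cf /= !qr.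
have fE z p p' : form (opV z (E p)) (E p') = sg eta (~~ p'.2) * c z (hflip p') p.
  by rewrite (hyp_dualK eta2 E p') (bilZr Hb).
apply: (skew_basis BE.2) => p p'.
rewrite (form_sym (E p)) !fE !cE.
have := Hx (E (hflip p')) (E (hflip p)); rewrite (form_sym (E (hflip p'))) !fE !hflipK /= !negbK.
set c1 := c x p _; set c2 := c x p' _ => H.
have c1E : c1 = - (eta * sg eta p.2 * sg eta p'.2 * c2).
  rewrite -[LHS]mul1r -(sg_sq eta2 p.2) -mulrA H; ring.
rewrite c1E rmorphN !rmorphM/= !sg_conj !sg_flip//.
have -> : eta^* = eta by exact: (sg_conj true).
have -> : eta * sg eta p'.2 * - (eta * sg eta p.2 * sg eta p'.2 * c2^*) =
  - (eta * (eta * sg eta p.2 * c2^*)) * (sg eta p'.2 * sg eta p'.2) by ring.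
by rewrite sg_sq// mulr1.
Qed.

Lemma skew_jordan x : skew x -> diagonalizable (opV x) -> diagonalizable (opW x) ->
  jordan br skew x x 0.
Proof.
have [v [w [vw Sv Sw st]]] := skew_star.
exact: (jordan_intro Hnd vw Sv Sw skew_subspace skew_br st).
Qed.

Lemma skew_inv phi psi F : pair_aut form phi psi -> same_pair phi psi -> tens_map phi psi F ->
  forall x, skew x -> skew (F x).
Proof.
move=> [[phi' K1 K2] b2 H] sp HF x Hx u v.
have b1 : bijective phi by exists phi'.
rewrite -(K2 u) -(K2 v) !(tmap_opV (And3 b1 b2 H) HF).
have phiB a b : form (phi a) (phi b) = form a b by rewrite (sp b) H.
by rewrite !phiB Hx.
Qed.

Definition t_ E n := op (E (n, false)) (E (n, true)).

Section Family.
Variable E : nat * bool -> V.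
Hypothesis HE : hyperbolic form eta E.
Local Notation F := (dual E).
Local Notation X := (annV form (span_on predT E)).
Let ef : forall p q, form (E p) (F q) = (p == q)%:R := hyp_dualE Hb eta2 HE.

Lemma t_torus n : torus E F (t_ E n).
Proof.
have -> : t_ E n = tens A (E (n, false)) (F (n, false)) - tens A (E (n, true)) (F (n, true)).
  rewrite /t_ opE /hyp_dual /hflip /= scale1r; congr (_ - _).
  by rewrite (linZ (tens_linr A _)).
by apply: (subspaceB (torus_subspace _ _ _)); exact: torus_in.
Qed.

Lemma tc_t n i : tc E F (t_ E n) i = (i.1 == n)%:R * (if i.2 then -1 else 1).
Proof.
case: i => m b; rewrite /tc /t_ opV_op !HE /= (bilBl Hb) !(bilZl Hb) !ef !xpair_eqE /=.
rewrite [n == m]eq_sym; case: (m == n) => /=; last by rewrite ?mul0r ?mulr0 ?subrr ?mul0r ?subr0.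
by case: b => /=; rewrite ?mul1r ?mul0r ?mulr0 ?mulr1 ?subr0 ?eta_sq// ?sub0r ?mulr1.
Qed.

Lemma tc_anti (d y : A) i : torus E F d -> null_part E F y -> skew (d + y) ->
  tc E F d (hflip i) = - tc E F d i.
Proof.
move=> td [ny _] Hs; have dE j : opV (d + y) (E j) = tc E F d j *: E j.
  by rewrite (linD (opV_linl _)) (torus_e ef _ td) ny addr0.
have := Hs (E i) (E (hflip i)); rewrite !dE (bilZl Hb) (bilZr Hb) -mulNr.
have nz : form (E i) (E (hflip i)) != 0.
  rewrite HE /= eqxx; case: (i.2) => /=; rewrite ?oner_neq0//.
  by case: eta2 => ->; rewrite /sg ?oppr_eq0 oner_neq0.
by move=> /(mulIf nz) ->; rewrite opprK.
Qed.

(** [t_ E n] has weight 1 at (n, false) and -1 at (n, true). The combination with the weights of [d]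
    at the (n, false) therefore has all the weights of [d], and these determine a torus element. *)
Lemma anti_span (d : A) : torus E F d -> (forall i, tc E F d (hflip i) = - tc E F d i) ->
  span_on predT (t_ E) d.
Proof.
move=> td Ha; have [s us dE] := torus_rep ef td.
have ts : is_subspace (span_on predT (t_ E)) by exact: span_on_subspace.
pose s2 := undup (map fst s); pose d' := \sum_(n <- s2) tc E F d (n, false) *: t_ E n.
have td' : torus E F d'.
  by apply: (subspace_sum (torus_subspace _ _ _)) => n _; apply: (subspaceZ (torus_subspace _ _ _)); exact: t_torus.
have tcs (c : nat -> K) i : tc E F (\sum_(n <- s2) c n *: t_ E n) i =
    \sum_(n <- s2) c n * tc E F (t_ E n) i.
  rewrite /tc (lin_sum (opV_linl _)) (bil_suml Hb); apply: eq_bigr => n _.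
  by rewrite (linZ (opV_linl _)) (bilZl Hb).
have out i : i \notin s -> tc E F d i = 0.
  move=> si; rewrite {1}dE /tc (lin_sum (opV_linl _)) (bil_suml Hb).
  apply: big1_seq => j /andP[_ sj]; rewrite (linZ (opV_linl _)) (bilZl Hb).
  rewrite opV_tens (bilZl Hb) !ef; case: eqP => [ij|]; last by rewrite mul0r mulr0.
  by rewrite ij sj in si.
have E0 i : tc E F d' i = tc E F d i.
  case: i => n b; rewrite tcs.
  have -> : tc E F d (n, b) = tc E F d (n, false) * (if b then -1 else 1).
    by case: b; rewrite ?mulr1// mulrN1 -Ha.
  rewrite (eq_bigr (fun m => tc E F d (m, false) * (m == n)%:R * (if b then -1 else 1))); last first.
    by move=> m _; rewrite tc_t /= eq_sym mulrA.
  rewrite -mulr_suml big_delta ?undup_uniq// mem_undup; case: ifP => // /negbT ns.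
  rewrite out//; apply: contra ns => ns; by apply/mapP; exists (n, false).
suff -> : d = d'.
  by apply: (subspace_sum ts) => n _; apply: (subspaceZ ts); exact: span_on_in.
apply/eqP; rewrite -subr_eq0; apply/eqP.
have td'' : torus E F (d - d') by apply: (subspaceB (torus_subspace _ _ _)).
have [s' _ ->] := torus_rep ef td''; apply: big1_seq => i _.
have -> : tc E F (d - d') i = 0.
  by rewrite -[d - d']addrC -scaleN1r tc_lin// E0 mulN1r addNr.
by rewrite scale0r.
Qed.

Lemma skew_torus : skew `&` torus E F = span_on predT (t_ E).
Proof.
apply/seteqP; split=> [d [sd td]|].
  apply: (anti_span td) => i; apply: (tc_anti (y := 0) i td); last by rewrite addr0.
  by split=> j; [exact: (lin0 (opV_linl _)) | exact: (lin0 (opW_linl _))].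
apply: lspan_min.
  by apply: setI_subspace; [exact: skew_subspace | exact: torus_subspace].
by move=> _ [n _ <-]; split; [exact: skew_op | exact: t_torus].
Qed.

Lemma null_part_X (y : A) v : null_part E F y -> X (opV y v).
Proof. by move=> H; rewrite -(span_hyp_dual eta2); exact: (null_part_annV _ H). Qed.

(** On a line with a symmetric form a skew operator is zero, which is why rank one is tolerated for
    so; an alternating form never has rank one. *)
Definition small_rank r := r = Fin 0 \/ (eta = 1 /\ r = Fin 1).

(** A null skew [y] kills the radical of [X]. Modulo the radical [X] is at most a line, on which
    symmetry of the form and skewness of [y] leave only 0. *)
Lemma null_skew_X r (y : A) u u' : dim_quot X (annV form X) r -> small_rank r ->
  skew y -> null_part E F y -> X u -> X u' -> form (opV y u) u' = 0.
Proof.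
move=> HR + sy ny Xu Xu'; case=> [r0|[e1 r1]].
  by rewrite r0 in HR; apply: (dim_quot0 HR (null_part_X u ny)).
rewrite r1 in HR; have [e [e_X H _]] := HR; have Xe := e_X 0%N isT.
have {}H v : X v -> exists c, annV form X (v - c *: e 0%N).
  move=> /H[[|N] [c]]; first by rewrite big_ord0 => Hv; exists 0; rewrite scale0r.
  rewrite big_mkcond big_ord_recl big1 /= ?addr0 => [Hv|i _ //]; by exists (c 0%N).
have rad0 v : annV form X v -> opV y v = 0.
  by move=> Hv; apply: Hnd.1 => w; rewrite sy Hv ?oppr0//; exact: null_part_X.
have [c Hc] := H u Xu; have [c' Hc'] := H u' Xu'.
rewrite -(subrK (c *: e 0%N) u) -(subrK (c' *: e 0%N) u').
rewrite (linD (opV_linr y)) (rad0 _ Hc) add0r (linZ (opV_linr y)) (bilZl Hb) (bilDr Hb) (bilZr Hb).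
rewrite [form _ (u' - _)]sy (rad0 _ Hc') (bil0r Hb) oppr0 add0r.
have /eqP : form (opV y (e 0%N)) (e 0%N) = - form (opV y (e 0%N)) (e 0%N).
  by rewrite {1}sy form_sym e1 mul1r.
rewrite -subr_eq0 opprK -mulr2n mulrn_eq0 /= => /eqP ->.
by rewrite !mulr0.
Qed.

Lemma skew_good r : dim_quot X (annV form X) r -> small_rank r -> good_family skew E F.
Proof.
move=> HR Hr; have one : (1 : K) != -1.
  by rewrite -subr_eq0 opprK -mulr2n pnatr_eq0.
split=> //.
- move=> [n b]; exists (t_ E n); split; [exact: skew_op | exact: t_torus |].
  by rewrite tc_t /= eqxx mul1r; case: b; rewrite ?oppr_eq0 oner_neq0.
- move=> [n b] [m b'] nm; exists (t_ E n); split; [exact: skew_op | exact: t_torus |].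
  rewrite !tc_t /= eqxx mul1r; move: nm; rewrite xpair_eqE eq_sym.
  case: eqP => _ /=; last by rewrite mul0r; case: b; rewrite ?oppr_eq0 oner_neq0.
  by rewrite mul1r; case: b; case: b' => //= _; rewrite // eq_sym.
- move=> d y td ny /(fun H => anti_span td (fun i => tc_anti i td ny H)).
  by rewrite -skew_torus => -[].
- move=> y1 y2 y3 g1 g2 g3 n1 n2 n3; apply: (opV_eq0 Hnd) => v; apply: Hnd.1 => w.
  rewrite !opV_mul g1 (null_skew_X HR Hr g2 n2) ?oppr0//; exact: null_part_X.
Qed.

(** For a hyperbolic pair a, b in [X] the element [op a b] is diagonalizable with eigenvalues 1, -1
    and 0, and it centralizes the torus. It would then lie in the torus, which kills [X], although
    it fixes a. *)
Lemma cartan_anisotropic h a b : is_cartan br skew h -> ss_parts br skew h = skew `&` torus E F ->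
  X a -> X b -> form a a = 0 -> form b b = 0 -> form a b != 1.
Proof.
move=> Ch Sh Xa Xb aa bb; apply/eqP => ab; pose z := op a b.
have sz : skew z by exact: skew_op.
have ba : form b a = eta by rewrite form_sym ab mulr1.
have za : opV z a = a by rewrite opV_op ab aa mulr0 scale0r subr0 scale1r.
have zb : opV z b = - b by rewrite opV_op bb ba eta_sq// scale0r sub0r scale1r.
have dz : diagonalizable (opV z).
  move=> u; apply: (@lspan3 _ _ _ a b u (form u b) (eta * form u a)).
  - by exists 1; rewrite scale1r.
  - by exists (-1); rewrite zb scaleN1r.
  - exists 0; rewrite scale0r opV_op !(bilBl Hb) !(bilZl Hb) ab aa ba bb !mulr0 !mulr1 !subr0 subrr scale0r.
    by rewrite mulrAC eta_sq// mul1r subrr mulr0 scale0r subr0.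
have tz : torus E F z.
  apply: (diag_in_torus skew_jordan Ch Sh) => //.
    split=> // t [_ tt]; apply: (torus_null_br Hnd tt).
    have Xe c i : X c -> form (E i) c = 0.
      by move=> /(annV_span Hb) Hc; rewrite form_sym Hc mulr0.
    split=> i; first by rewrite opV_op !Xe// mulr0 !scale0r subrr.
    rewrite (skew_opW _ sz) /hyp_dual (linZ (opV_linr z)) opV_op !Xe// mulr0 !scale0r subrr.
    by rewrite scaler0 oppr0.
  move=> u; have := dz u; apply: lspan_mono => v [c vE]; exists (- c).
  by rewrite (skew_opW _ sz) vE scaleNr.
have a0 : a = 0 by rewrite -za; apply: (torus_annV tz); rewrite (span_hyp_dual eta2).
by move/eqP: ab; rewrite a0 (bil0l Hb) eq_sym oner_eq0.
Qed.

Lemma alternating : eta = -1 -> forall u, form u u = 0.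
Proof.
move=> e1 u; apply/eqP; have /eqP := form_sym u u.
by rewrite {1}e1 mulN1r -subr_eq0 opprK -mulr2n mulrn_eq0.
Qed.

Lemma isotropic_combination (a b : V) : exists s t, (s, t) != (0, 0) :> K * K /\
  form (s *: a + t *: b) (s *: a + t *: b) = 0.
Proof.
have [E1|E1] := eqVneq eta (-1).
  exists 1, 0; rewrite xpair_eqE negb_and oner_neq0; split=> //.
  exact: alternating.
have {E1} eta1 : eta = 1 by case: eta2 => // E2; rewrite E2 eqxx in E1.
have [aa|aa] := eqVneq (form a a) 0.
  exists 1, 0; rewrite xpair_eqE negb_and oner_neq0; split=> //.
  by rewrite scale1r scale0r addr0.
(* A root of the discriminant of the form on the plane of [a] and [b]; the coefficients solve the
   quadratic equation for an isotropic vector. *)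
pose D := sqrtC (form a b ^+ 2 - form a a * form b b).
exists (D - form a b), (form a a); rewrite xpair_eqE negb_and aa orbT; split=> //.
rewrite !(bilDl Hb) !(bilDr Hb) !(bilZl Hb) !(bilZr Hb) (form_sym b a) eta1 mul1r.
have -> : (D - form a b) * ((D - form a b) * form a a) + (D - form a b) * (form a a * form a b) +
  (form a a * ((D - form a b) * form a b) + form a a * (form a a * form b b)) =
  form a a * (D ^+ 2 - (form a b ^+ 2 - form a a * form b b)) by ring.
by rewrite sqrtCK subrr mulr0.
Qed.

(** [X] contains no hyperbolic pair, so each of its isotropic vectors is in the radical. Two vectors
    independent modulo the radical would have an isotropic combination outside it. *)
Lemma cartan_small_rank h r : is_cartan br skew h -> ss_parts br skew h = skew `&` torus E F ->
  dim_quot X (annV form X) r -> small_rank r.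
Proof.
move=> Ch Sh HR; have SX : is_subspace X by exact: annV_subspace.
have iso a : X a -> form a a = 0 -> annV form X a.
  move=> Xa aa b Xb; apply: contrapT => /eqP ab.
  have [b1 [Xb1 ab1]] : exists b1, X b1 /\ form a b1 = 1.
    exists ((form a b)^-1 *: b); split; last by rewrite (bilZr Hb) mulVf.
    exact: (subspaceZ SX).
  have [eta1|eta1] := eta2.
    have b1a : form b1 a = 1 by rewrite form_sym ab1 eta1 mulr1.
    (* Subtracting half the norm along the isotropic [a] makes the partner isotropic and keeps its
       pairing with [a]. *)
    have Xb2 : X (b1 - (2^-1 * form b1 b1) *: a).
      by apply: (subspaceB SX) => //; exact: (subspaceZ SX).
    have := cartan_anisotropic Ch Sh Xa Xb2 aa; rewrite !(bilBr Hb) !(bilZr Hb).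
    rewrite aa ab1 mulr0 subr0 eqxx => /(_ _)/negP; apply=> //.
    rewrite !(bilBl Hb) !(bilZl Hb) aa b1a ab1 !mulr0 !mulr1 subr0.
    by field.
  have := cartan_anisotropic Ch Sh Xa Xb1 aa; rewrite ab1 eqxx => /(_ _)/negP; apply=> //.
  exact: alternating.
have [e [e1 _ e3]] := HR.
have [r2|r2] := boolP (below r 1).
  have r0 : below r 0 by case: (r) r2 => //= n; exact: ltnW.
  have [s [t [st H]]] := isotropic_combination (e 0%N) (e 1%N).
  have Xst : X (s *: e 0%N + t *: e 1%N).
    by apply: (subspaceD SX); apply: (subspaceZ SX); exact: e1.
  pose c n : K := if n is 0 then s else t.
  have := e3 2 c; rewrite !big_mkcond /= big_ord_recl big_ord_recl big_ord0 /= r0 r2 addr0.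
  move=> /(_ (iso _ Xst H)) H0; move: st.
  have -> : s = 0 by exact: (H0 0%N isT r0).
  have -> : t = 0 by exact: (H0 1%N isT r2).
  by rewrite eqxx.
have [eta1|eta1] := eta2.
  case: (r) r2 => [[|[|n]]|] //= _; [by left | by right].
left; apply: (dim_quot_sub r (annV_subspace Hb _) _).1 HR => a Xa; apply: iso => //.
exact: alternating.
Qed.

End Family.

Lemma isometries_conjP (h h' : set A) :
  conjugate_under (isometries form) h h' <-> conjP (@same_pair K V) h h'.
Proof.
split=> [[f [F [[Gf If] Jf ->]]]|[f [psi [F [H1 sp H2 ->]]]]].
  have [psi [H1 H2]] := GL_autpair Hnd Gf Jf; exists f, psi, F; split=> // v.
  have [[f' K1 K2] _ H] := H1; apply/eqP; rewrite -subr_eq0; apply/eqP; apply: Hnd.2 => u.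
  by rewrite -(K2 u) (bilBr Hb) If H subrr.
exists f, F; have [H3 H4] := autpair_GL H1 H2; split=> //; split=> // u v.
by have [_ _ H] := H1; rewrite (sp v) H.
Qed.

Lemma self_dual_family L : self_dual_system form L -> exists E : nat * bool -> V,
  hyperbolic form eta E /\ forall x, L (pos_int x) = scalars (E x).
Proof.
move=> [H1 H2]; have /choice[u Hu] : forall x, exists v, L (pos_int x) = scalars v.
  by move=> x; have [v _ ->] := H1 _ (pos_int_neq0 x); exists v.
have pu x y : (form (u x) (u y) != 0) = (x == hflip y).
  have := H2 _ _ (pos_int_neq0 x) (pos_int_neq0 y).
  rewrite !Hu (bilinear_image _ _ Hb) -pos_intN (can_eq pos_intK).
  case: eqP => /= _; case: eqP => //= _ H; first by case: (@setT_neq0 K).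
  by case: (@setT_neq0 K).
pose E x := if x.2 then (form (u (x.1, false)) (u x))^-1 *: u x else u x.
have uu n : form (u (n, false)) (u (n, true)) != 0 by rewrite pu /hflip eqxx.
exists E; split=> [[n b] [m b']|[n b]]; last first.
  by rewrite Hu /E /=; case: b => //; rewrite scalars_scale// invr_eq0.
have z : (n, b) != hflip (m, b') -> form (u (n, b)) (u (m, b')) = 0.
  by rewrite -pu negbK => /eqP.
have [nm|nm] := eqVneq n m; last first.
  rewrite /= ?(negbTE nm) /=; have {}z : form (u (n, b)) (u (m, b')) = 0.
    by apply: z; rewrite xpair_eqE (negbTE nm).
  by rewrite /E /=; case: b z; case: b' => z; rewrite ?(bilZl Hb) ?(bilZr Hb) z ?mulr0.
have {}z : b = b' -> form (u (n, b)) (u (m, b')) = 0.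
  by move=> bb; apply: z; rewrite bb xpair_eqE /=; case: (b'); rewrite andbF.
move: z; rewrite {}nm /= ?eqxx /E /=; case: b; case: b' => /= z.
- by rewrite (bilZl Hb) (bilZr Hb) z ?mulr0.
- by rewrite (bilZl Hb) (form_sym (u (m, true))) mulrCA mulVf// mulr1.
- by rewrite (bilZr Hb) mulVf.
- exact: z erefl.
Qed.

Lemma family_self_dual E : hyperbolic form eta E ->
  self_dual_system form (fun i => scalars (E (int_pos i))).
Proof.
move=> HE.
have sgn0 b : sg eta b != 0 by case: b; rewrite /sg ?oner_neq0//; case: eta2 => ->; rewrite ?oppr_eq0 oner_neq0.
have nz x : form (E x) (E (hflip x)) != 0.
  by have := sgn0 x.2; rewrite HE /= eqxx; case: (x.2).
split=> [i _|i j i0 j0].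
  apply: line_scalars; apply: contraNneq (nz (int_pos i)) => ->.
  by rewrite (bil0l Hb).
rewrite (bilinear_image _ _ Hb) HE.
have -> : (i == - j) = (((int_pos i).1 == (int_pos j).1) && ((int_pos i).2 != (int_pos j).2)).
  rewrite -{1}(int_posK i0) -{1}(int_posK j0) -pos_intN (can_eq pos_intK).
  by case: (int_pos i) (int_pos j) => n b [m b']; rewrite xpair_eqE /=; case: b; case: b'.
by case: (_ && _); rewrite ?(negbTE (sgn0 _)) ?eqxx.
Qed.

Lemma span_self_lines L E : (forall x, L (pos_int x) = scalars (E x)) ->
  lspan (\bigcup_(i in [set i : int | i != 0]) L i) = span_on predT E.
Proof.
move=> HL; apply: lspan_scalars => [i i0|x _].
  by exists (int_pos i); rewrite // -HL int_posK.
by exists (pos_int x); [exact: pos_int_neq0 | exact: HL].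
Qed.

Lemma op_scale a b u v : op (a *: u) (b *: v) = (a * b) *: op u v.
Proof.
rewrite !opE !(linZ (tens_linl A _)) !(linZ (tens_linr A _)) scalerBr !scalerA.
by congr (_ - _ *: _); ring.
Qed.

Lemma span_self_torus L E : (forall x, L (pos_int x) = scalars (E x)) ->
  lspan (\bigcup_(i in [set i : int | 0 < i]) [set op a b | a in L i & b in L (- i)]) =
  span_on predT (t_ E).
Proof.
move=> HL.
have H n : [set op a b | a in L (pos_int (n, false)) & b in L (- pos_int (n, false))] = scalars (t_ E n).
  rewrite -pos_intN !HL; apply/seteqP; split.
    move=> _ [_ [a _ <-] [_ [b _ <-] <-]]; exists (a * b) => //.
    by rewrite op_scale.
  move=> _ [a _ <-]; exists (a *: E (n, false)); first by exists a.
  exists (1 *: E (n, true)); first by exists 1.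
  by rewrite op_scale mulr1.
apply: lspan_scalars => [[[|n]|n] // _|n _]; first by exists n => //; exact: (H n).
by exists (pos_int (n, false)) => //; exact: H.
Qed.

Lemma self_classesE r d c C : self_dual_classes op skew (r, d, c) C <->
  small_rank r /\ exists E, self_family form eta E r d c /\
    conj_class (isometries form) (cart skew E (dual E)) = C.
Proof.
have kt := skew_kernel_transitive; have ji := skew_jordan.
split.
  move=> [h [Ch [L [[LL ssE] [HR D1 C1]]]] <-].
  have [E [HE HL]] := self_dual_family LL.
  rewrite (span_self_torus HL) -(skew_torus HE) in ssE.
  rewrite (span_self_lines HL) in HR D1 C1.
  have AW : perpW form (span_on predT E) = annV form (span_on predT E) := annWV form_sym _.
  rewrite AW in HR D1 C1.
  split; first exact: (cartan_small_rank Ch ssE HR).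
  by exists E; split=> //; rewrite (cartan_cart Ch ssE).
move=> [Hr [E [[HE HR D1 C1] <-]]].
have [Ch ssE] := good_cartan Hnd skew_subspace skew_br kt ji (skew_good HE HR Hr).
exists (cart skew E (dual E)) => //; split=> //.
pose L i := scalars (E (int_pos i)).
have HL x : L (pos_int x) = scalars (E x) by rewrite /L pos_intK.
exists L; split.
  by split; [exact: family_self_dual | rewrite (span_self_torus HL) -(skew_torus HE)].
have AW : perpW form (span_on predT E) = annV form (span_on predT E) := annWV form_sym _.
by rewrite (span_self_lines HL); cbv zeta; rewrite AW.
Qed.

Lemma self_class_eq E E' r d c r' d' c' : small_rank r -> small_rank r' ->
  self_family form eta E r d c -> self_family form eta E' r' d' c' ->
  conj_class (isometries form) (cart skew E (dual E)) =
  conj_class (isometries form) (cart skew E' (dual E')) <->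
  fam_equiv form (@same_pair K V) E (dual E) E' (dual E').
Proof.
move=> Hr Hr' [HE HR _ _] [HE' HR' _ _]; apply: (cart_class Hnd) => //.
- move=> phi psi phi' psi' H K1 _ _ K2 v.
  by rewrite -{1}(K2 v) -H K1.
- by move=> phi psi phi' psi' H H' v /=; rewrite H H'.
- exact: isometries_conjP.
- exact: skew_subspace.
- by move=> phi psi F; exact: skew_inv.
- exact: (skew_good HE HR Hr).
- exact: (skew_good HE' HR' Hr').
Qed.

End SkewAlgebra.

(** * Cardinality of the continuum *)

Section Continuum.
Variable R : realType.

Lemma card_le_inj (T U : Type) (A : set T) (B : set U) (f : T -> U) :
  {in A &, injective f} -> (forall x, A x -> B (f x)) -> A #<= B.
Proof.
move=> fi fB; rewrite -(card_le_eql (inj_card_eq fi)); apply: subset_card_le.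
by move=> _ [x Ax <-]; exact: fB.
Qed.

(** Base 3 with digits 0 and 1 only, which avoids the double expansions of base 2. *)
Definition csum (b : nat -> bool) n : R := \sum_(i < n) (b i)%:R * 3^-1 ^+ i.

Lemma csumS b n : csum b n.+1 = csum b n + (b n)%:R * 3^-1 ^+ n.
Proof. exact: big_ord_recr. Qed.

Lemma csum_tail b n N : (n <= N)%N ->
  csum b n <= csum b N <= csum b n + 3 / 2 * (3^-1 ^+ n - 3^-1 ^+ N).
Proof.
move=> /subnKC <-; elim: (N - n)%N => [|k IH]; first by rewrite addn0 subrr mulr0 addr0 lexx.
rewrite addnS csumS exprS; set t := 3^-1 ^+ (n + k) in IH *.
have t0 : 0 < t by rewrite exprn_gt0// invr_gt0.
by move: IH; case: (b _) => /=; move=> /andP[]; lra.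
Qed.

Definition cantor_real (b : nat -> bool) : R := sup (range (csum b)).

Lemma csum_bound b n : 0 <= csum b n <= 3 / 2.
Proof.
have /andP[] := csum_tail b (leq0n n); rewrite /csum big_ord0 -/(csum b n) expr0.
have : (0 : R) < 3^-1 ^+ n by rewrite exprn_gt0// invr_gt0.
by move=> h1 h2 h3; apply/andP; split; lra.
Qed.

Lemma csum_has_ubound b : has_ubound (range (csum b)).
Proof. by exists (3 / 2) => _ [n _ <-]; have /andP[] := csum_bound b n. Qed.

Lemma cantor_real_bound b : 0 <= cantor_real b <= 3 / 2.
Proof.
apply/andP; split.
  have : csum b 0 <= cantor_real b by apply: (ub_le_sup (csum_has_ubound b)); exists 0%N.
  by rewrite /csum big_ord0.
apply: ge_sup => [|_ [n _ <-]]; first by exists (csum b 0), 0%N.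
by have /andP[] := csum_bound b n.
Qed.

(** At the first difference one sequence gains 3^-n, whereas all later digits of the other
    contribute at most half of that. *)
Lemma cantor_real_lt (b b' : nat -> bool) n : (forall i, (i < n)%N -> b i = b' i) -> b n -> ~~ b' n ->
  cantor_real b' < cantor_real b.
Proof.
move=> E bn b'n; have Es : csum b n = csum b' n.
  by apply: eq_bigr => i _; rewrite E.
have p0 : (0 : R) < 3^-1 ^+ n by rewrite exprn_gt0// invr_gt0.
have h1 : csum b n.+1 <= cantor_real b by apply: (ub_le_sup (csum_has_ubound b)); exists n.+1.
have h2 : cantor_real b' <= csum b' n.+1 + 3 / 2 * (3^-1 ^+ n.+1).
  apply: ge_sup => [|_ [N _ <-]]; first by exists (csum b' 0), 0%N.
  have q0 : (0 : R) < 3^-1 ^+ n.+1 by rewrite exprn_gt0// invr_gt0.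
  have [nN|Nn] := leqP n.+1 N.
    have /andP[_] := csum_tail b' nN.
    have : (0 : R) < 3^-1 ^+ N by rewrite exprn_gt0// invr_gt0.
    by lra.
  by have /andP[] := csum_tail b' (ltnW Nn); lra.
move: h1 h2; rewrite !csumS bn (negbTE b'n) Es mul1r mul0r addr0 exprS; lra.
Qed.

Lemma cantor_real_inj : injective cantor_real.
Proof.
move=> b b' E; apply: contrapT => bb.
have ex : exists n, b n != b' n.
  apply: contrapT => H; apply: bb; apply/funext => n; apply: contrapT => /eqP bn.
  by apply: H; exists n.
case: (ex_minnP ex) => n bn min.
have eqn i : (i < n)%N -> b i = b' i.
  by move=> i_n; apply: contrapT => /eqP /min; rewrite leqNgt i_n.
move: bn; case bn: (b n); case b'n: (b' n) => // _.
  by have := cantor_real_lt eqn bn (negbT b'n); rewrite E ltxx.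
have := @cantor_real_lt b' b n (fun i Hi => esym (eqn i Hi)) b'n (negbT bn).
by rewrite E ltxx.
Qed.

Definition cut (x : R) (q : rat) : bool := ratr q < x.

Lemma cut_inj : injective cut.
Proof.
have lt x y : x < y -> cut x <> cut y.
  move=> /rat_in_itvoo[q]; rewrite in_itv /= => /andP[xq qy] /(congr1 (fun f => f q)).
  by rewrite /cut qy ltNge (ltW xq).
move=> x y E; apply: contrapT => /eqP; rewrite neq_lt => /orP[/lt|/lt]; first exact.
by move=> H; apply: H.
Qed.

Lemma card_le_continuum (T : Type) (C : countType) (f : T -> C -> bool) :
  injective f -> [set: T] #<= [set: R].
Proof.
move=> fi; apply: (card_le_inj (f := fun t => cantor_real
  (fun n => if unpickle n is Some c then f t c else false))) => // t u _ _ /cantor_real_inj E.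
apply: fi; apply/funext => c; have := congr1 (fun g => g (pickle c)) E.
by rewrite pickleK.
Qed.

(** Injects the real line into the parameter interval: Cantor sums lie in [0, 3/2], so the values
    lie in [1/8, 5/16]. *)
Definition spread (x : R) : R := 8^-1 * (1 + cantor_real (fun n =>
  if unpickle n is Some q then cut x q else false)).

Lemma spread_inj : injective spread.
Proof.
move=> x y; rewrite /spread => /mulfI E; have /E/addrI/cantor_real_inj {}E : (8^-1 : R) != 0.
  by rewrite invr_eq0 pnatr_eq0.
apply: cut_inj; apply/funext => q; have := congr1 (fun g => g (pickle q)) E.
by rewrite pickleK.
Qed.

Lemma spread_bound x : 0 < spread x < 2^-1.
Proof.
have := cantor_real_bound (fun n => if unpickle n is Some q then cut x q else false).
by rewrite /spread; move: (cantor_real _) => c /andP[]; lra.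
Qed.

Definition zparam (x : R) : R[i] := (spread x)%:C%C.

Lemma zparam_inj : injective zparam.
Proof. by move=> x y /complexI/spread_inj. Qed.

Lemma zparam_param x : param (zparam x).
Proof.
rewrite /param /zparam; have /andP[h1 h2] := spread_bound x.
rewrite -[0]/(0%:C%C) ltcR h1 /=.
have -> : (2^-1 : R[i]) = (2^-1)%:C%C by rewrite fmorphV rmorph_nat.
by rewrite ltcR.
Qed.

Lemma continuum_le (T : Type) (S : set T) (M : R[i] -> T) : (forall z, S (M z)) ->
  (forall z z', param z -> param z' -> M z = M z' -> z = z') -> [set: R] #<= S.
Proof.
move=> SM Mi; apply: (card_le_inj (f := fun x => M (zparam x))) => // x y _ _ E.
by apply: zparam_inj; apply: Mi E; exact: zparam_param.
Qed.

Definition code_complex (z : R[i]) (c : bool * rat) := cut (if c.1 then complex.Re z else complex.Im z) c.2.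

Lemma code_complex_inj : injective code_complex.
Proof.
move=> [a b] [a' b'] E; congr Complex; apply: cut_inj; apply/funext => q.
  exact: (congr1 (fun f => f (true, q)) E).
exact: (congr1 (fun f => f (false, q)) E).
Qed.

(** A vector is determined by its countably many coordinates, and each of these by the rational cuts
    of its real and imaginary parts. *)
Lemma code_vector (V : lmodType R[i]) : has_dim [set: V] Aleph0 ->
  exists f : V -> nat * (bool * rat) -> bool, injective f.
Proof.
move=> Vd; have [e Be] := has_dim_basis Vd; have [cf [sp [l r _]]] := basis_coord Be.
exists (fun v c => code_complex (cf c.1 v) c.2) => v v' E.
have Ec i : cf i v = cf i v'.
  by apply: code_complex_inj; apply/funext => c; exact: (congr1 (fun f => f (i, c)) E).
apply/eqP; rewrite -subr_eq0; apply/eqP; have [_ _ _ ->] := r (v - v').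
apply: big1 => i _; have -> : cf i (v - v') = 0.
  by rewrite addrC -scaleN1r l mulN1r Ec addNr.
by rewrite scale0r.
Qed.

Lemma card_families (V W : lmodType R[i]) (I J : countType) : has_dim [set: V] Aleph0 ->
  has_dim [set: W] Aleph0 -> [set: (I -> V) * (J -> W)] #<= [set: R].
Proof.
move=> Vd Wd; have [f fi] := code_vector Vd; have [h hi] := code_vector Wd.
pose C := ((I * (nat * (bool * rat))) + (J * (nat * (bool * rat))))%type.
apply: (card_le_continuum (C := C) (f := fun t (c : C) => match c with
  | inl c => f (t.1 c.1) c.2 | inr c => h (t.2 c.1) c.2 end)) => -[a b] [a' b'] E.
congr pair; apply/funext => i; [apply: fi | apply: hi]; apply/funext => c.
  exact: (congr1 (fun g => g (inl (i, c))) E).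
exact: (congr1 (fun g => g (inr (i, c))) E).
Qed.

Lemma card_image_families (V W : lmodType R[i]) (I J : countType) (T : Type)
    (S : set T) (cl : (I -> V) -> (J -> W) -> T) : has_dim [set: V] Aleph0 ->
  has_dim [set: W] Aleph0 -> (forall C, S C -> exists e f, cl e f = C) -> S #<= [set: R].
Proof.
move=> Vd Wd HS; apply: card_le_trans (card_families I J Vd Wd).
apply: card_le_trans (card_image_le (fun ef => cl ef.1 ef.2) _).
by apply: subset_card_le => C /HS[e [f <-]]; exists (e, f).
Qed.

Lemma continuum_infinite (T : Type) (S : set T) n : S #= [set: R] -> ~ (S #= `I_n).
Proof.
move=> SR Sn; have : [set: R] #= `I_n by apply: card_eq_trans Sn; rewrite card_eq_sym.
rewrite card_eq_le => /andP[Rn _].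
have : `I_n.+1 #<= `I_n.
  apply: card_le_trans Rn; apply: (card_le_inj (f := fun i : nat => i%:R)) => // i j _ _ /eqP.
  by rewrite eqr_nat => /eqP.
by rewrite card_le_II ltnn.
Qed.

Lemma card_unique (T : Type) (S : set T) m n : S #= `I_m -> S #= `I_n -> m = n.
Proof. by move=> Sm Sn; apply/card_eq_II; apply: card_eq_trans Sn; rewrite card_eq_sym. Qed.

Lemma card_pair (T : Type) (x y : T) : x <> y -> [set x; y] #= `I_2.
Proof.
move=> xy; have <- : (fun n => if n is 0%N then x else y) @` `I_2 = [set x; y].
  apply/seteqP; split=> [_ [[|[|//]] _ <-]|_ [->|->]]; [by left | by right | by exists 0%N | by exists 1%N].
by apply: inj_card_eq => -[|[|i]] [|[|j]] //=; rewrite ?inE //= => _ _ E; case: xy.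
Qed.

End Continuum.

(** * Counting conjugacy classes *)

Lemma dle0 d : dle d (Fin 0) -> d = Fin 0.
Proof. by case: d => [[|n]|] // H; have := H 0%N isT. Qed.

Lemma dle1 d : dle d (Fin 1) -> d = Fin 0 \/ d = Fin 1.
Proof.
case: d => [[|[|n]]|] H; [by left | by right | |]; by have := H 1%N isT.
Qed.

Lemma not_below0 c : ~~ below c 0 -> c = Fin 0.
Proof. by case: c => [[|n]|]. Qed.

Lemma not_below1 c : ~~ below c 1 -> c = Fin 0 \/ c = Fin 1.
Proof. by case: c => [[|[|n]]|] // _; [left | right]. Qed.

Section GLConfigurations.
Variables (K : numClosedFieldType) (V W : lmodType K) (pair : V -> W -> K).
Hypothesis Hb : bil pair.
Hypothesis Hnd : nondegenerate_pairing pair.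
Hypothesis Vd : has_dim [set: V] Aleph0.
Hypothesis Wd : has_dim [set: W] Aleph0.
Local Notation deq := (fam_equiv pair (@any_pair V W)).
Local Notation fam := (@gl_family K V W pair nat).

Definition many_families d1 d2 c1 c2 := exists (E : K -> nat -> V) (F : K -> nat -> W),
  (forall z, fam (E z) (F z) d1 d2 c1 c2) /\
  forall z z', param z -> param z' -> deq (E z) (F z) (E z') (F z') -> z = z'.

Definition two_families d1 d2 c1 c2 := exists e1 f1 e2 f2,
  [/\ fam e1 f1 d1 d2 c1 c2, fam e2 f2 d1 d2 c1 c2, ~ deq e1 f1 e2 f2
    & forall e f, fam e f d1 d2 c1 c2 -> deq e f e1 f1 \/ deq e f e2 f2].

Lemma gl_two d : dle d (Fin 1) -> two_families (Fin 0) d (Fin 1) (Fin 0).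
Proof.
move=> /dle1 Hd; have d1 k : below d k -> k = 0%N.
  by case: Hd => ->; case: k.
have [e1 [f1 [e2 [f2 [F1 F2 N1 Z2]]]]] := gl_two_models Hb Hnd d1 Vd Wd.
exists e2, f2, e1, f1; split=> // [D|e f F].
  have [ef1 _ _ _ _] := F1; have [ef2 _ _ _ _] := F2.
  by apply: N1; exact: (zero_inv_deq Hb ef2 ef1 D Z2).
have [Z|N] := pselect (zero_inv pair f); [left | right].
  exact: (gl_equiv_line_iff Hb Hnd d1 F F2).
exact: (gl_equiv_line_iff Hb Hnd d1 F F1).
Qed.

Lemma gl_zero : exists e f, fam e f (Fin 0) (Fin 0) (Fin 0) (Fin 0).
Proof.
have i0 : indep_at_inf (Fin 0) (fun k i : nat => 0 : K) by move=> s cc us sc _ k /sc.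
have d0 : dle (Fin 0) (Fin 0) by [].
have [e [f [p [q [F _ _ _ _]]]]] := gl_model Vd Wd Hb Hnd d0 d0 i0 i0.
by exists e, f.
Qed.

End GLConfigurations.

Lemma nondegenerate_swap (K : fieldType) (V W : lmodType K) (pair : V -> W -> K) :
  nondegenerate_pairing pair -> nondegenerate_pairing (fun w v => pair v w).
Proof. by case. Qed.

Lemma many_swap (K : numClosedFieldType) (V W : lmodType K) (pair : V -> W -> K) d1 d2 c1 c2 :
  bil pair -> many_families (fun w v => pair v w) d2 d1 c2 c1 -> many_families pair d1 d2 c1 c2.
Proof.
move=> Hb [E [F [H1 H2]]]; exists F, E; split=> [z|z z' Hz Hz' D].
  exact: (gl_family_swap (H1 z)).
by apply: H2 => //; exact: (deq_swap D).
Qed.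

Lemma two_swap (K : numClosedFieldType) (V W : lmodType K) (pair : V -> W -> K) d1 d2 c1 c2 :
  bil pair -> two_families (fun w v => pair v w) d2 d1 c2 c1 -> two_families pair d1 d2 c1 c2.
Proof.
move=> Hb [e1 [f1 [e2 [f2 [H1 H2 N H]]]]]; exists f1, e1, f2, e2; split.
- exact: (gl_family_swap H1).
- exact: (gl_family_swap H2).
- by move=> D; apply: N; exact: (deq_swap D).
- move=> e f F; have [D|D] := H _ _ (gl_family_swap F); [left | right]; exact: (deq_swap D).
Qed.

Section Counting.
Variable R : realType.

Lemma card_empty (T : Type) (S : set T) : (forall x, ~ S x) -> S #= `I_0.
Proof.
move=> H; have -> : S = set0 by apply/seteqP; split=> // x /H.
by rewrite II0 card_eq00.
Qed.

Section GLCount.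
Variables (V W : lmodType R[i]) (pair : {bilinear V -> W -> R[i] | *%R & *%R}).
Variable A : tensor_alg pair.
Hypothesis Vd : has_dim [set: V] Aleph0.
Hypothesis Wd : has_dim [set: W] Aleph0.
Hypothesis Hnd : nondegenerate_pairing pair.
Variable g : set A.
Hypothesis gE : g = gl A \/ g = sl A.
Let Hb : bil pair := bilinear_bil pair.

(** Families exist exactly for [r = Fin 0] with [dle d1 c2] and [dle d2 c1]. A codimension of at
    least 2 gives quartic invariants on its side and the codimensions 1, 1 give product invariants;
    otherwise their sum is at most 1. *)
Lemma gl_count p :
  let S := gl_classes g p in
  let one := p = (Fin 0, Fin 0, Fin 0, Fin 0, Fin 0) in
  let two := p = (Fin 0, Fin 0, Fin 0, Fin 1, Fin 0) \/ p = (Fin 0, Fin 0, Fin 0, Fin 0, Fin 1) \/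
    p = (Fin 0, Fin 1, Fin 0, Fin 0, Fin 1) \/ p = (Fin 0, Fin 0, Fin 1, Fin 1, Fin 0) in
  [\/ [/\ S #= `I_0, ~ one & ~ two], [/\ S #= `I_1, one & ~ two],
      [/\ S #= `I_2, ~ one & two] | [/\ S #= [set: R], ~ one & ~ two]].
Proof.
case: p => [[[[r d1] d2] c1] c2] S one two.
have SE C := gl_classesE Hnd Vd Wd gE r d1 d2 c1 c2 C; rewrite -/S in SE.
pose cl (e : nat -> V) (f : nat -> W) := conj_class (GL pair) (cart g e f : set A).
have Sle : S #<= [set: R].
  apply: (card_image_families (I := nat) (J := nat) (cl := cl) Vd Wd) => C /SE[_ [e [f [_ H]]]].
  by exists e, f.
have many : r = Fin 0 -> many_families pair d1 d2 c1 c2 -> S #= [set: R].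
  move=> r0 [E [F [H1 H2]]]; rewrite card_eq_le Sle.
  apply: (continuum_le (M := fun z => cl (E z) (F z))) => [z|z z' Hz Hz' Ez].
    by apply/SE; split=> //; exists (E z), (F z).
  apply: H2 => //; have := (gl_class_eq Hnd Vd gE (H1 z) (H1 z')).1; exact.
(* Necessary conditions shared by the listed invariants; each branch with no class or with continuum
   many violates one of them. *)
have onetwo : one \/ two -> [/\ r = Fin 0, dle d1 c2 /\ dle d2 c1, ~~ below c1 1, ~~ below c2 1
    & ~ (c1 = Fin 1 /\ c2 = Fin 1)].
  by move=> [[-> -> -> -> ->]|[|[|[]]] [-> -> -> -> ->]]; split=> //; try (by split); move=> [].
have nope : ~ [/\ r = Fin 0, dle d1 c2 /\ dle d2 c1, ~~ below c1 1, ~~ below c2 1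
    & ~ (c1 = Fin 1 /\ c2 = Fin 1)] -> ~ one /\ ~ two.
  by move=> H; split=> H'; apply: H; apply: onetwo; [left | right].
have [r0|r0] := pselect (r = Fin 0); last first.
  have [n1 n2] : ~ one /\ ~ two by apply: nope => -[].
  by apply: Or41; split=> //; apply: card_empty => C /SE[].
have [[D1 D2]|D] := pselect (dle d1 c2 /\ dle d2 c1); last first.
  have [n1 n2] : ~ one /\ ~ two by apply: nope => -[_ D' _ _ _]; exact: D.
  apply: Or41; split=> //; apply: card_empty => C /SE[_ [e [f [F _]]]]; apply: D; split.
    exact: (gl_family_feasible Hb Hnd F).
  exact: (gl_family_feasible (bil_swap Hb) (nondegenerate_swap Hnd) (gl_family_swap F)).
have [b1|/not_below1 Hc1] := boolP (below c1 1).
  have [n1 n2] : ~ one /\ ~ two by apply: nope => -[_ _]; rewrite b1.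
  apply: Or44; split=> //; apply: many => //; exact: (gl_many_quartic Hb Hnd Vd Wd b1 D1 D2).
have [b2|/not_below1 Hc2] := boolP (below c2 1).
  have [n1 n2] : ~ one /\ ~ two by apply: nope => -[_ _ _]; rewrite b2.
  apply: Or44; split=> //; apply: many => //; apply: (many_swap Hb).
  exact: (gl_many_quartic (bil_swap Hb) (nondegenerate_swap Hnd) Wd Vd b2 D2 D1).
have two_card : two_families pair d1 d2 c1 c2 -> S #= `I_2.
  move=> [e1 [f1 [e2 [f2 [F1 F2 N H]]]]].
  have -> : S = [set cl e1 f1; cl e2 f2].
    apply/seteqP; split=> [C /SE[_ [e [f [F <-]]]]|C [->|->]]; last 2 first.
    - by apply/SE; split=> //; exists e1, f1.
    - by apply/SE; split=> //; exists e2, f2.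
    have [D|D] := H e f F; [left | right].
      by have := (gl_class_eq Hnd Vd gE F F1).2 D.
    by have := (gl_class_eq Hnd Vd gE F F2).2 D.
  by apply: card_pair => E; apply: N; have := (gl_class_eq Hnd Vd gE F1 F2).1 E.
have [c1E|c1E] := Hc1; have [c2E|c2E] := Hc2.
- rewrite c1E in D2; rewrite c2E in D1; have d1E := dle0 D1; have d2E := dle0 D2.
  apply: Or42; split; [|by rewrite /one r0 c1E c2E d1E d2E|].
    have [e [f F]] := gl_zero Hb Hnd Vd Wd.
    have -> : S = [set cl e f].
      apply/seteqP; split=> [C /SE[_ [e' [f' [F' <-]]]]|C ->].
        rewrite d1E d2E c1E c2E in F'.
        by have := (gl_class_eq Hnd Vd gE F' F).2 (gl_equiv_zero Hb Hnd F' F).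
      by apply/SE; split=> //; exists e, f; rewrite d1E d2E c1E c2E.
    exact: card_set1.
  by rewrite /two r0 c1E c2E d1E d2E => -[|[|[]]].
- rewrite c1E in D2; rewrite c2E in D1; have d2E := dle0 D2.
  apply: Or43; split.
  + apply: two_card; rewrite c1E c2E d2E; apply: (two_swap Hb).
    exact: (gl_two (bil_swap Hb) (nondegenerate_swap Hnd) Wd Vd D1).
  + by rewrite /one c2E.
  + rewrite /two r0 c1E c2E d2E; have [->|->] := dle1 D1; first by right; left.
    by right; right; left.
- rewrite c1E in D2; rewrite c2E in D1; have d1E := dle0 D1.
  apply: Or43; split.
  + apply: two_card; rewrite c1E c2E d1E; exact: (gl_two Hb Hnd Vd Wd D2).
  + by rewrite /one c1E.
  + rewrite /two r0 c1E c2E d1E; have [->|->] := dle1 D2; first by left.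
    by right; right; right.
- have [n1 n2] : ~ one /\ ~ two by apply: nope => -[_ _ _ _]; apply.
  apply: Or44; split=> //; apply: many => //; rewrite c1E c2E in D1 D2 *.
  exact: (gl_many_product Hb Hnd Vd Wd D1 D2).
Qed.

End GLCount.

Section SelfCount.
Variables (V : lmodType R[i]) (form : {bilinear V -> V -> R[i] | *%R & *%R}).
Variable A : tensor_alg form.
Variable eta : R[i].
Hypothesis Vd : has_dim [set: V] Aleph0.
Hypothesis Hnd : nondegenerate_pairing form.
Hypothesis form_sym : forall u v, form u v = eta * form v u.
Hypothesis eta2 : eta = 1 \/ eta = -1.
Variable op : V -> V -> A.
Hypothesis opE : forall a b, op a b = tens A a b - eta *: tens A b a.
Let Hb : bil form := bilinear_bil form.

(** For positive [c] a single existing family is remodelled into continuum many. For [c = Fin 0] the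
    dimension equals the rank, which is 0 or, for so only, 1, and the family is unique. *)
Lemma self_count p :
  let S := self_dual_classes op (lspan [set op a b | a in [set: V] & b in [set: V]]) p in
  let one := p = (Fin 0, Fin 0, Fin 0) \/ eta = 1 /\ p = (Fin 1, Fin 1, Fin 0) in
  [\/ S #= `I_0 /\ ~ one, S #= `I_1 /\ one | S #= [set: R] /\ ~ one].
Proof.
case: p => [[r d] c] S one.
have SE C := self_classesE Hnd form_sym eta2 Vd opE r d c C.
rewrite (skew_lspan Hnd form_sym eta2 opE) -/S in SE.
pose cl (E : nat * bool -> V) := conj_class (isometries form) (cart
  (lspan [set op a b | a in [set: V] & b in [set: V]]) E (hyp_dual eta E) : set A).
have Sle : S #<= [set: R].
  apply: (card_image_families (I := (nat * bool)%type) (J := nat)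
    (cl := fun E (_ : nat -> V) => cl E) Vd Vd) => C /SE[_ [E [_ H]]].
  by exists E, (fun=> 0).
have ceq := self_class_eq Hnd form_sym eta2 opE.
rewrite (skew_lspan Hnd form_sym eta2 opE) in ceq.
have oneE : one -> small_rank eta r /\ exists E, self_family form eta E r d c.
  move=> [[-> -> ->]|[e1 [-> -> ->]]]; split.
  - by left.
  - exact: (self_family_zero Hb Hnd form_sym eta2 Vd).
  - by right.
  - exact: (self_family_one Hb Hnd form_sym eta2 Vd e1).
have [Hr|Hr] := pselect (small_rank eta r); last first.
  apply: Or31; split; last by move=> /oneE[].
  by apply: card_empty => C /SE[].
have [[E F]|N] := pselect (exists E, self_family form eta E r d c); last first.
  apply: Or31; split; last by move=> /oneE[].
  by apply: card_empty => C /SE[_ [E [F _]]]; apply: N; exists E.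
have [c0|/not_below0 cE] := boolP (below c 0).
  apply: Or33; split; last first.
    by case=> [[_ _ cE]|[_ [_ _ cE]]]; rewrite cE in c0.
  have [M [H1 H2]] := self_many Hb Hnd form_sym eta2 Vd F c0.
  rewrite card_eq_le Sle; apply: (continuum_le (M := fun z => cl (M z))) => [z|z z' Hz Hz' Ez].
    by apply/SE; split=> //; exists (M z).
  by apply: H2 => //; have := (ceq _ _ _ _ _ _ _ _ Hr Hr (H1 z) (H1 z')).1 Ez.
rewrite cE in F; have dE : d = r.
  by apply: (self_family_codim0 Hb Hnd eta2 F); case: Hr => [->|[_ ->]]; [left | right].
apply: Or32; split; last first.
  rewrite /one cE dE; case: Hr => [->|[e1 ->]]; first by left.
  by right.
have -> : S = [set cl E].
  apply/seteqP; split=> [C /SE[_ [E' [F' <-]]]|C ->]; last first.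
    by apply/SE; split=> //; exists E; rewrite cE.
  rewrite cE in F'; have d1 k : below d k -> k = 0%N.
    by rewrite dE; case: Hr => [->|[_ ->]] //; case: k.
  have D := self_equiv Hb Hnd form_sym eta2 d1 F' F.
  by have := (ceq _ _ _ _ _ _ _ _ Hr Hr F' F).2 D.
exact: card_set1.
Qed.

End SelfCount.

End Counting.

Theorem corollary5p12 (R : realType) :
  (forall (V W : lmodType R[i])
          (pair : {bilinear V -> W -> R[i] | *%R & *%R})
          (A : tensor_alg pair),
     has_dim [set: V] Aleph0 -> has_dim [set: W] Aleph0 -> nondegenerate_pairing pair ->
     forall g : set A, g = gl A \/ g = sl A ->
     forall p : dimension * dimension * dimension * dimension * dimension,
       (gl_classes g p #= `I_0 \/ gl_classes g p #= `I_1 \/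
        gl_classes g p #= `I_2 \/ gl_classes g p #= [set: R]) /\
       (gl_classes g p #= `I_1 <-> p = (Fin 0, Fin 0, Fin 0, Fin 0, Fin 0)) /\
       (gl_classes g p #= `I_2 <->
          p = (Fin 0, Fin 0, Fin 0, Fin 1, Fin 0) \/
          p = (Fin 0, Fin 0, Fin 0, Fin 0, Fin 1) \/
          p = (Fin 0, Fin 1, Fin 0, Fin 0, Fin 1) \/
          p = (Fin 0, Fin 0, Fin 1, Fin 1, Fin 0)))
  /\
  (forall (V : lmodType R[i])
          (form : {bilinear V -> V -> R[i] | *%R & *%R})
          (A : tensor_alg form),
     has_dim [set: V] Aleph0 -> nondegenerate_pairing form ->
     (forall u v, form u v = form v u) ->
     forall p : dimension * dimension * dimension,
       (so_classes A p #= `I_0 \/ so_classes A p #= `I_1 \/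
        so_classes A p #= [set: R]) /\
       (so_classes A p #= `I_1 <->
          p = (Fin 0, Fin 0, Fin 0) \/ p = (Fin 1, Fin 1, Fin 0)))
  /\
  (forall (V : lmodType R[i])
          (form : {bilinear V -> V -> R[i] | *%R & *%R})
          (A : tensor_alg form),
     has_dim [set: V] Aleph0 -> nondegenerate_pairing form ->
     (forall u v, form u v = - form v u) ->
     forall p : dimension * dimension * dimension,
       (sp_classes A p #= `I_0 \/ sp_classes A p #= `I_1 \/
        sp_classes A p #= [set: R]) /\
       (sp_classes A p #= `I_1 <-> p = (Fin 0, Fin 0, Fin 0))).
Proof.
split=> [V W pair A Vd Wd Hnd g gE p|].
  have ne m n (S : set (set (set A))) : S #= `I_m -> S #= `I_n -> m == n.
    by move=> Hm Hn; apply/eqP; exact: (card_unique Hm Hn).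
  case: (gl_count Vd Wd Hnd gE p) => -[Sn H1 H2].
  - split; first by left.
    by split; split=> // H; have := ne _ _ _ Sn H.
  - split; first by right; left.
    by split; split=> // H; have := ne _ _ _ Sn H.
  - split; first by right; right; left.
    by split; split=> // H; have := ne _ _ _ Sn H.
  - split; first by right; right; right.
    by split; split=> // H; case: (continuum_infinite Sn H).
split=> V form A Vd Hnd form_sym p.
  have sym u v : form u v = 1 * form v u by rewrite mul1r form_sym.
  have opE a b : wedge A a b = tens A a b - 1 *: tens A b a by rewrite scale1r.
  case: (self_count Vd Hnd sym (or_introl erefl) opE p) => -[Sn H1].
  - split; first by left.
    split=> [H|H]; first by have /eqP := card_unique Sn H.
    by case: H1; case: H => ->; [left | right].
  - split; first by right; left.
    by split=> // _; case: H1 => [->|[_ ->]]; [left | right].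
  - split; first by right; right.
    split=> [H|H]; first by case: (continuum_infinite Sn H).
    by case: H1; case: H => ->; [left | right].
have sym u v : form u v = -1 * form v u by rewrite mulN1r form_sym.
have opE a b : symp A a b = tens A a b - (-1) *: tens A b a by rewrite scaleN1r opprK.
have no1 : (-1 : R[i]) <> 1.
  by move/eqP; rewrite eq_sym -subr_eq0 opprK -mulr2n pnatr_eq0.
case: (self_count Vd Hnd sym (or_intror erefl) opE p) => -[Sn H1].
- split; first by left.
  split=> [H|H]; first by have /eqP := card_unique Sn H.
  by case: H1; left.
- split; first by right; left.
  by split=> // _; case: H1 => [->|[/no1]].
- split; first by right; right.
  split=> [H|H]; first by case: (continuum_infinite Sn H).
  by case: H1; left.
Qed.
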